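(* Let $\omega\in\mathbb{R}$ and $\gamma>0$, and let $$\phi_{\omega,\gamma}(x)=e^{\frac{\omega+1}{2}}\,e^{-\frac12\left(|x|+\frac{\gamma}{2}\right)^2},\qquad x\in\mathbb{R}.$$ Then the standing wave $e^{i\omega t}\phi_{\omega,\gamma}(x)$ of the equation $i\partial_t u+\partial_x^2u+\gamma\delta(x)u+u\,\mathrm{Log}|u|^2=0$ is orbitally stable in $W(\mathbb{R})$. That is: for every $\epsilon>0$ there exists $\eta>0$ such that if $u_0\in W(\mathbb{R})$ and $\|u_0-\phi_{\omega,\gamma}\|_{W(\mathbb{R})}<\eta$, then the solution $u(t)$ of the equation with $u(0)=u_0$ exists for all $t\in\mathbb{R}$ and satisfies $$\sup_{t\in\mathbb{R}}\ \inf_{\theta\in\mathbb{R}}\ \|u(t)-e^{i\theta}\phi_{\omega,\gamma}\|_{W(\mathbb{R})}<\epsilon .$$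
   Context: All functions of $x\in\mathbb{R}$ are complex-valued, $\mathrm{Log}$ is the natural logarithm, and $0\,\mathrm{Log}\,0=0$. $L^2(\mathbb{R})$ carries the real scalar product $(u,v)=\Re\int_{\mathbb{R}}u\overline{v}\,dx$, and duals are real duals accordingly. The space $W(\mathbb{R})=\{u\in H^1(\mathbb{R}): |u|^2\mathrm{Log}|u|^2\in L^1(\mathbb{R})\}$. Define $A:[0,\infty)\to[0,\infty)$ by $A(s)=-s^2\mathrm{Log}(s^2)$ for $0\le s\le e^{-3}$ and $A(s)=3s^2+4e^{-3}s-e^{-6}$ for $s\ge e^{-3}$. Let $L^A(\mathbb{R})=\{u\in L^1_{loc}(\mathbb{R}): A(|u|)\in L^1(\mathbb{R})\}$ with the Luxemburg norm $\|u\|_{L^A}=\inf\{k>0:\int_{\mathbb{R}}A(k^{-1}|u(x)|)\,dx\le 1\}$. Then $W(\mathbb{R})=H^1(\mathbb{R})\cap L^A(\mathbb{R})$ as a set, and it is a reflexive Banach space with norm $\|u\|_{W(\mathbb{R})}=\|u\|_{H^1}+\|u\|_{L^A}$; $W'(\mathbb{R})$ denotes its dual, with $W(\mathbb{R})\hookrightarrow L^2(\mathbb{R})\hookrightarrow W'(\mathbb{R})$. The expression $\partial_x^2u+\gamma\delta(x)u+u\,\mathrm{Log}|u|^2$, for $u\in W(\mathbb{R})$, is the element of $W'(\mathbb{R})$ given by $h\mapsto -\Re\int u'\overline{h'}\,dx+\gamma\Re[u(0)\overline{h(0)}]+\Re\int u\,\mathrm{Log}|u|^2\,\overline{h}\,dx$.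 A (global) solution of the equation is a function $u\in C(\mathbb{R},W(\mathbb{R}))\cap C^1(\mathbb{R},W'(\mathbb{R}))$ satisfying the equation in $W'(\mathbb{R})$ for all $t\in\mathbb{R}$; for each $u_0\in W(\mathbb{R})$ ''the solution with $u(0)=u_0$'' is the unique such solution. *)

(* Defs.v *)
From HB Require Import structures.
From mathcomp Require Import all_boot all_order all_algebra.
From mathcomp Require Import complex.
From mathcomp Require Import all_classical all_reals all_analysis.

Set Implicit Arguments.
Unset Strict Implicit.
Unset Printing Implicit Defensive.

Import Order.TTheory GRing.Theory Num.Theory.
Import numFieldNormedType.Exports.

Local Open Scope classical_set_scope.
Local Open Scope complex_scope.
Local Open Scope ring_scope.

Definition cmod {R : realType} (z : R[i]) : R := Normc.normc z.

Definition cdot {R : realType} (z w : R[i]) : R := complex.Re (z * conjc w).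

Definition cexp_i {R : realType} (theta : R) : R[i] := cos theta +i* sin theta.

(** ** Sobolev space on the line *)

Definition test_function {R : realType} (f : R -> R) : Prop :=
  (forall (n : nat) (x : R), derivable (derive1n n f) x 1) /\
  (exists M : R, forall x : R, M < `|x| -> f x = 0).

Definition L2 {R : realType} (f : R -> R[i]) : Prop :=
  [/\ measurable_fun setT (fun x => complex.Re (f x)),
      measurable_fun setT (fun x => complex.Im (f x)) &
      (@lebesgue_measure R).-integrable setT (fun x => (cmod (f x) ^+ 2)%:E)].

Definition weak_derivative {R : realType} (u g : R -> R[i]) : Prop :=
  forall f : R -> R, test_function f ->
    (\int[@lebesgue_measure R]_x (complex.Re (u x) * derive1 f x)) =
      - (\int[@lebesgue_measure R]_x (complex.Re (g x) * f x)) /\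
    (\int[@lebesgue_measure R]_x (complex.Im (u x) * derive1 f x)) =
      - (\int[@lebesgue_measure R]_x (complex.Im (g x) * f x)).

(** Every class in the Sobolev space H^1 of the line has exactly one continuous
    representative. An element of H^1 is encoded by that representative, so
    that the point value [u 0] makes sense and Leibniz equality of functions
    is equality in H^1. *)
Definition H1 {R : realType} : set (R -> R[i]) :=
  [set u | [/\ continuous (fun x => complex.Re (u x)),
               continuous (fun x => complex.Im (u x)),
               L2 u &
               exists g, L2 g /\ weak_derivative u g]].

(** Some square integrable weak derivative of [u]; it is unique almost
    everywhere, and it is only used under integrals. *)
Definition dx {R : realType} (u : R -> R[i]) : R -> R[i] :=
  xget (fun=> 0) [set g | L2 g /\ weak_derivative u g].

Definition H1norm {R : realType} (u : R -> R[i]) : R :=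
  Num.sqrt ((\int[@lebesgue_measure R]_x (cmod (u x) ^+ 2)) +
            (\int[@lebesgue_measure R]_x (cmod (dx u x) ^+ 2))).

(** ** The energy space. [ln 0 = 0] in the library, so [0 * ln 0 = 0]. *)

Definition Afun {R : realType} (s : R) : R :=
  if s <= expR (- 3) then - (s ^+ 2 * ln (s ^+ 2))
  else 3 * s ^+ 2 + 4 * expR (- 3) * s - expR (- 6).

Definition LAnorm {R : realType} (u : R -> R[i]) : R :=
  inf [set k : R | 0 < k /\
    ((\int[@lebesgue_measure R]_x (Afun (k^-1 * cmod (u x)))%:E) <= 1)%E].

Definition W {R : realType} : set (R -> R[i]) :=
  [set u | H1 u /\
    (@lebesgue_measure R).-integrable setT
      (fun x => (cmod (u x) ^+ 2 * ln (cmod (u x) ^+ 2))%:E)].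

Definition Wnorm {R : realType} (u : R -> R[i]) : R := H1norm u + LAnorm u.

(** ** The real dual of [W]. Functionals are total functions of which only the
    values on [W] matter. *)

Definition Wdual {R : realType} : set ((R -> R[i]) -> R) :=
  [set F | (forall (a : R) (h k : R -> R[i]), W h -> W k ->
              F (fun x => a%:C * h x + k x) = a * F h + F k) /\
           (exists C : R, forall h, W h -> `|F h| <= C * Wnorm h)].

Definition Wdual_norm {R : realType} (F : (R -> R[i]) -> R) : \bar R :=
  ereal_sup [set (`|F h|)%:E | h in [set h | W h /\ Wnorm h <= 1]].

(** The embedding of [W] into its dual through the real scalar product. *)
Definition dual_of {R : realType} (u : R -> R[i]) : (R -> R[i]) -> R :=
  fun h => (\int[@lebesgue_measure R]_x (cdot (u x) (h x))).

(** Multiplication by i on the dual, extending the one on functions: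
    [dual_of (i u) h = dual_of u (- i h)]. *)
Definition dual_muli {R : realType} (F : (R -> R[i]) -> R) : (R -> R[i]) -> R :=
  fun h => F (fun x => (0 -i* 1) * h x).

(** The functional u'' + gamma delta u + u Log |u|^2. *)
Definition logNLS_op {R : realType} (gamma : R) (u : R -> R[i]) :
    (R -> R[i]) -> R :=
  fun h =>
    - (\int[@lebesgue_measure R]_x (cdot (dx u x) (dx h x)))
    + gamma * cdot (u 0) (h 0)
    + (\int[@lebesgue_measure R]_x
        (cdot (u x * (ln (cmod (u x) ^+ 2))%:C) (h x))).

Definition continuous_in_W {R : realType} (u : R -> R -> R[i]) : Prop :=
  (forall t, W (u t)) /\
  (forall t : R, Wnorm (fun x => u s x - u t x) @[s --> t] --> (0 : R)).

Definition C1_in_Wdual {R : realType} (u : R -> R -> R[i])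
    (du : R -> (R -> R[i]) -> R) : Prop :=
  [/\ forall t, Wdual (du t),
      forall t : R,
        Wdual_norm (fun h => (s - t)^-1 * (dual_of (u s) h - dual_of (u t) h)
                             - du t h) @[s --> t^'] --> 0%E &
      forall t : R, Wdual_norm (fun h => du s h - du t h) @[s --> t] --> 0%E].

Definition global_solution {R : realType} (gamma : R) (u : R -> R -> R[i]) :
    Prop :=
  continuous_in_W u /\
  exists du : R -> (R -> R[i]) -> R,
    C1_in_Wdual u du /\
    (forall (t : R) h, W h -> dual_muli (du t) h + logNLS_op gamma (u t) h = 0).

(** ** Orbital stability *)

Definition orbit_distance {R : realType} (phi v : R -> R[i]) : \bar R :=
  ereal_inf (range (fun theta : R =>
    (Wnorm (fun x => v x - cexp_i theta * phi x))%:E)).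

Definition orbitally_stable {R : realType} (gamma : R) (phi : R -> R[i]) :
    Prop :=
  forall eps : R, 0 < eps -> exists eta : R, 0 < eta /\
    forall u0 : R -> R[i], W u0 -> Wnorm (fun x => u0 x - phi x) < eta ->
      exists u : R -> R -> R[i],
        [/\ global_solution gamma u,
            u 0 = u0,
            (forall v, global_solution gamma v -> v 0 = u0 -> v = u) &
            (ereal_sup (range (fun t : R => orbit_distance phi (u t)))
               < eps%:E)%E].

Definition phi_peak {R : realType} (omega gamma : R) : R -> R[i] :=
  fun x => (expR ((omega + 1) / 2) *
            expR (- (1 / 2) * (`|x| + gamma / 2) ^+ 2))%:C.

(* Main.v *)
(* Stability. For [s y = sqrt (omega + 1 - ln y)], completing the square bounds the action
   [Df u + (omega + 1) Qf u - int |u|^2 ln |u|^2] from below by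
   [int |u' + sgn(x) s(|u|^2) u|^2 + 2 int_0^{|u(0)|^2} s], and the peak annihilates the square.
   After rescaling, a family whose charge and energy tend to those of the peak has a weak limit
   with [|u(0)| = phi(0)] solving [u' = - sgn(x) s(|u|^2) u], so this limit is [e^{i theta} phi];
   convergence of charge and energy makes the convergence strong. Since both are conserved by the
   flow, a sequence of solutions violating stability would contradict this compactness.

   Well-posedness. Explicit Euler steps in finite-dimensional subspaces of [W], with a pointwise
   limit along an ultrafilter, give a weak solution that conserves the charge and does not
   increase the energy. The Cazenave-Haraux inequality gives uniqueness; running time backwards
   then gives energy conservation, and with it strong continuity in [W]. *)

From mathcomp Require Import all_boot all_order all_algebra.
From mathcomp Require Import complex.
From mathcomp Require Import all_classical all_reals all_analysis.
From mathcomp Require Import measurable_realfun.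
From mathcomp Require Import ring lra.
Require Import Defs.

Set Implicit Arguments.
Unset Strict Implicit.
Unset Printing Implicit Defensive.

Import Order.TTheory GRing.Theory Num.Theory.
Import numFieldNormedType.Exports.

Local Open Scope classical_set_scope.
Local Open Scope complex_scope.
Local Open Scope ring_scope.

(** * Complex numbers and real integrals *)

Section complex_plane.
Context {R : realType}.
Implicit Types z w v : R[i].
Implicit Types a b : R.

(** The map [u ln |u|^2] is not Lipschitz at 0, so a contraction argument is out of reach. What
    remains is a modulus of order [d |ln d|] and the splitting [s^2 ln s^2 = Psi s - Afun s], where
    [Psi] is locally Lipschitz in [s^2] and [Afun] is nonnegative and carries the singularity. Weak
    compactness is replaced by bounds in [W] with pointwise convergence; a dyadic criterion of F.
    Riesz recovers the weak derivative of a limit. In the lower bound, the root [s] is real only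
    where [|u|^2 <= e^(omega+1)], a ceiling that [u] may exceed. The bound is therefore applied to
    [u / sqrt p], at the cost of a term [- Q ln p] with [Q = Qf u]. With [a = 2 int_0^{phi(0)^2} s -
    gamma phi(0)^2], which equals [Qf phi], concavity of [ln] gives
    [p a - Q - Q ln p >= Q (1 - Q / a)]. The right side tends to 0 as [Q] tends to [a], so a
    minimizing family can lose nothing: this pins [p] to 1 and the completed square to 0. *)

Definition nsq z : R := complex.Re z ^+ 2 + complex.Im z ^+ 2.

Lemma nsq_ge0 z : 0 <= nsq z. Proof. by rewrite addr_ge0 ?sqr_ge0. Qed.

Lemma cmod_sq z : cmod z ^+ 2 = nsq z.
Proof. by case: z => a b; rewrite /cmod /= sqr_sqrtr // addr_ge0 ?sqr_ge0. Qed.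

Lemma cmod_ge0 z : 0 <= cmod z.
Proof. by case: z => a b; rewrite /cmod /= sqrtr_ge0. Qed.

Lemma cmod_sqrt z : cmod z = Num.sqrt (nsq z). Proof. by case: z. Qed.

Lemma cdotE z w : cdot z w = complex.Re z * complex.Re w + complex.Im z * complex.Im w.
Proof. by case: z w => a b [c d]; rewrite /cdot /= mulrN opprK. Qed.

Lemma cdotC z w : cdot z w = cdot w z. Proof. by rewrite !cdotE; ring. Qed.

Lemma cdotDl z w v : cdot (z + w) v = cdot z v + cdot w v.
Proof. by case: z w v => a b [c d] [e f]; rewrite !cdotE /=; ring. Qed.

Lemma cdotDr z w v : cdot v (z + w) = cdot v z + cdot v w.
Proof. by rewrite cdotC cdotDl !(cdotC v). Qed.

Lemma cdotNl z w : cdot (- z) w = - cdot z w.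
Proof. by case: z w => a b [c d]; rewrite !cdotE /=; ring. Qed.

Lemma cdotNr z w : cdot w (- z) = - cdot w z.
Proof. by rewrite cdotC cdotNl cdotC. Qed.

Lemma cdotBl z w v : cdot (z - w) v = cdot z v - cdot w v.
Proof. by rewrite cdotDl cdotNl. Qed.

Lemma ReZ a z : complex.Re (a%:C * z) = a * complex.Re z.
Proof. by case: z => x y /=; ring. Qed.

Lemma ImZ a z : complex.Im (a%:C * z) = a * complex.Im z.
Proof. by case: z => x y /=; ring. Qed.

Lemma ReD z w : complex.Re (z + w) = complex.Re z + complex.Re w.
Proof. by case: z w => ? ? []. Qed.

Lemma ImD z w : complex.Im (z + w) = complex.Im z + complex.Im w.
Proof. by case: z w => ? ? []. Qed.

Lemma ReB z w : complex.Re (z - w) = complex.Re z - complex.Re w.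
Proof. by case: z w => ? ? []. Qed.

Lemma ImB z w : complex.Im (z - w) = complex.Im z - complex.Im w.
Proof. by case: z w => ? ? []. Qed.

Lemma cdotZl a z w : cdot (a%:C * z) w = a * cdot z w.
Proof. by rewrite !cdotE ReZ ImZ; ring. Qed.

Lemma cdotZr a z w : cdot w (a%:C * z) = a * cdot w z.
Proof. by rewrite cdotC cdotZl cdotC. Qed.

Lemma cdot0l z : cdot 0 z = 0. Proof. by rewrite cdotE /=; ring. Qed.
Lemma cdotzz z : cdot z z = nsq z. Proof. by rewrite cdotE /nsq; ring. Qed.

Lemma cdot_mulil z w : cdot (- 'i * z) w = - cdot z (- 'i * w).
Proof. by case: z w => a b [c d]; rewrite !cdotE /=; ring. Qed.

Lemma cdot_rot z : cdot z (- 'i * z) = 0.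
Proof. by case: z => a b; rewrite !cdotE /=; ring. Qed.

Lemma nsqD z w : nsq (z + w) = nsq z + 2 * cdot z w + nsq w.
Proof. by rewrite /nsq !cdotE ReD ImD; ring. Qed.

Lemma nsqN z : nsq (- z) = nsq z.
Proof. by case: z => a b; rewrite /nsq /=; ring. Qed.

Lemma nsqB z w : nsq (z - w) = nsq z - 2 * cdot z w + nsq w.
Proof. by rewrite nsqD cdotNr nsqN; ring. Qed.

Lemma nsqZ a z : nsq (a%:C * z) = a ^+ 2 * nsq z.
Proof. by rewrite /nsq ReZ ImZ; ring. Qed.

Lemma nsqM z w : nsq (z * w) = nsq z * nsq w.
Proof. by case: z w => a b [c d]; rewrite /nsq /=; ring. Qed.

Lemma nsq_i z : nsq (- 'i * z) = nsq z.
Proof. by rewrite nsqM; rewrite {1}/nsq /=; ring. Qed.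

Lemma cmodM z w : cmod (z * w) = cmod z * cmod w.
Proof. by rewrite !cmod_sqrt nsqM sqrtrM ?nsq_ge0. Qed.

Lemma cmodZ a z : cmod (a%:C * z) = `|a| * cmod z.
Proof. by rewrite !cmod_sqrt nsqZ sqrtrM ?sqr_ge0 // sqrtr_sqr. Qed.

Lemma cmodN z : cmod (- z) = cmod z.
Proof. by rewrite !cmod_sqrt nsqN. Qed.

Lemma cmod_i z : cmod (- 'i * z) = cmod z.
Proof. by rewrite !cmod_sqrt nsq_i. Qed.

Lemma cmodB z w : cmod (z - w) = cmod (w - z).
Proof. by rewrite -cmodN opprB. Qed.

Lemma cmod0 : cmod (0 : R[i]) = 0.
Proof. by rewrite cmod_sqrt /nsq /= expr0n /= addr0 sqrtr0. Qed.

Lemma nsq0 : nsq (0 : R[i]) = 0.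
Proof. by rewrite /nsq /= expr0n /= addr0. Qed.

Lemma nsq_eq0 z : nsq z = 0 -> z = 0.
Proof.
case: z => a b; rewrite /nsq /= => /eqP; rewrite paddr_eq0 ?sqr_ge0 //.
by rewrite !sqrf_eq0 => /andP[/eqP -> /eqP ->].
Qed.

Lemma cmod_eq0 z : cmod z = 0 -> z = 0.
Proof. by move=> h; apply: nsq_eq0; rewrite -cmod_sq h expr0n. Qed.

Lemma cdot_sq_le z w : cdot z w ^+ 2 <= nsq z * nsq w.
Proof.
rewrite cdotE /nsq -subr_ge0.
rewrite [leRHS](_ : _ = (complex.Re z * complex.Im w - complex.Im z * complex.Re w) ^+ 2); last by ring.
exact: sqr_ge0.
Qed.

Lemma cdot_le z w : `|cdot z w| <= cmod z * cmod w.
Proof.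
rewrite -(@ler_pXn2r _ 2) ?nnegrE ?mulr_ge0 ?cmod_ge0 //.
by rewrite -normrX ger0_norm ?sqr_ge0 // exprMn !cmod_sq cdot_sq_le.
Qed.

Lemma cmodD_le z w : cmod (z + w) <= cmod z + cmod w.
Proof.
rewrite -(@ler_pXn2r _ 2) ?nnegrE ?addr_ge0 ?cmod_ge0 //.
rewrite cmod_sq nsqD sqrrD !cmod_sq -mulr_natl.
have := cdot_le z w; rewrite ler_norml => /andP[_]; lra.
Qed.

Lemma cmodB_le z w : cmod (z - w) <= cmod z + cmod w.
Proof. by rewrite -(cmodN w) cmodD_le. Qed.

Lemma cmod_dist z w : `|cmod z - cmod w| <= cmod (z - w).
Proof.
rewrite ler_norml; apply/andP; split.
  have := cmodD_le z (w - z); rewrite addrC subrK cmodB; lra.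
have := cmodD_le w (z - w); rewrite addrC subrK; lra.
Qed.

Lemma Re_le z : `|complex.Re z| <= cmod z.
Proof.
rewrite -(@ler_pXn2r _ 2) ?nnegrE ?cmod_ge0 //.
by rewrite -normrX ger0_norm ?sqr_ge0 // cmod_sq lerDl sqr_ge0.
Qed.

Lemma Im_le z : `|complex.Im z| <= cmod z.
Proof.
rewrite -(@ler_pXn2r _ 2) ?nnegrE ?cmod_ge0 //.
by rewrite -normrX ger0_norm ?sqr_ge0 // cmod_sq lerDr sqr_ge0.
Qed.

Lemma cmod_le z : cmod z <= `|complex.Re z| + `|complex.Im z|.
Proof.
rewrite -(@ler_pXn2r _ 2) ?nnegrE ?addr_ge0 ?cmod_ge0 // cmod_sq sqrrD.
rewrite !real_normK ?num_real // -addrA lerD2l lerDr.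
by rewrite mulrn_wge0 // mulr_ge0.
Qed.

Lemma nsqB_le z w : nsq (z - w) <= 2 * nsq z + 2 * nsq w.
Proof. by have := nsq_ge0 (z + w); rewrite nsqB nsqD; lra. Qed.

Lemma nsq_sub_le z w : `|nsq z - nsq w| <= cmod (z - w) * (cmod z + cmod w).
Proof.
rewrite -!cmod_sq subr_sqr normrM (ger0_norm (addr_ge0 (cmod_ge0 z) (cmod_ge0 w))).
by rewrite ler_wpM2r ?addr_ge0 ?cmod_ge0 ?cmod_dist.
Qed.

End complex_plane.

(** * Lebesgue integrals of real functions on subsets of the line *)

Section integration.
Context {R : realType}.
Local Notation mu := (@lebesgue_measure R).
Implicit Types (D E : set R) (f g : R -> R).

Definition intg D f : Prop := mu.-integrable D (EFin \o f).
Definition Int D f : R := \int[mu]_(x in D) f x.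

Lemma intg_meas D f : intg D f -> measurable_fun D f.
Proof. by move=> /measurable_int/measurable_EFinP. Qed.

Lemma intg_dom D f g : measurable D -> measurable_fun D f ->
  (forall x, D x -> `|f x| <= g x) -> intg D g -> intg D f.
Proof.
move=> mD mf fg; apply: le_integrable => //; first exact/measurable_EFinP.
by move=> x Dx /=; rewrite lee_fin (le_trans (fg _ Dx)) // ler_norm.
Qed.

Lemma intg_ext D f g : (forall x, f x = g x) -> intg D f -> intg D g.
Proof. by move=> fg; rewrite (_ : f = g) //; apply/funext. Qed.

Lemma intgD D f g : measurable D -> intg D f -> intg D g -> intg D (fun x => f x + g x).
Proof. by move=> mD hf hg; exact: (@integrableD _ _ _ mu D mD _ _ hf hg). Qed.

Lemma intgZ D f (a : R) : measurable D -> intg D f -> intg D (fun x => a * f x).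
Proof. by move=> mD hf; exact: (@integrableZl _ _ _ mu D mD a _ hf). Qed.

Lemma intgN D f : measurable D -> intg D f -> intg D (fun x => - f x).
Proof.
by move=> mD hf; apply: (intg_ext (f := fun x => (- 1) * f x));
  [move=> x; rewrite mulN1r|exact: intgZ].
Qed.

Lemma intgB D f g : measurable D -> intg D f -> intg D g -> intg D (fun x => f x - g x).
Proof. by move=> mD hf hg; apply: intgD => //; apply: intgN. Qed.

Lemma intg_abs D f : measurable D -> intg D f -> intg D (fun x => `|f x|).
Proof. by move=> mD hf; exact: integrable_abse hf. Qed.

Lemma intgS D E f : measurable E -> measurable D -> D `<=` E -> intg E f -> intg D f.
Proof. by move=> mE mD DE hf; exact: (@integrableS _ _ _ mu E D _ mE mD DE hf). Qed.

Lemma intg_sub D f : measurable D -> intg setT f -> intg D f.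
Proof. by move=> mD; exact: intgS. Qed.

Lemma intg0 D : measurable D -> intg D (fun=> 0).
Proof. by move=> mD; exact: (@integrable0 _ _ _ mu D). Qed.

Lemma IntD D f g : measurable D -> intg D f -> intg D g ->
  Int D (fun x => f x + g x) = Int D f + Int D g.
Proof. by move=> mD hf hg; exact: (@RintegralD _ _ _ mu D _ _ mD hf hg). Qed.

Lemma IntB D f g : measurable D -> intg D f -> intg D g ->
  Int D (fun x => f x - g x) = Int D f - Int D g.
Proof. by move=> mD hf hg; exact: (@RintegralB _ _ _ mu D _ _ mD hf hg). Qed.

Lemma IntZ D f (a : R) : measurable D -> intg D f ->
  Int D (fun x => a * f x) = a * Int D f.
Proof. by move=> mD hf; exact: (@RintegralZl _ _ _ mu D _ a mD hf). Qed.

Lemma Int_ext D f g : (forall x, D x -> f x = g x) -> Int D f = Int D g.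
Proof. by move=> fg; apply: eq_Rintegral => x; rewrite inE => /fg. Qed.

Lemma IntN D f : measurable D -> intg D f -> Int D (fun x => - f x) = - Int D f.
Proof.
move=> mD hf; rewrite -mulN1r -IntZ //.
by apply: Int_ext => x _; rewrite mulN1r.
Qed.

Lemma Int_le D f g : measurable D -> intg D f -> intg D g ->
  (forall x, D x -> f x <= g x) -> Int D f <= Int D g.
Proof. by move=> mD hf hg; exact: (@le_Rintegral _ _ _ mu D _ _ mD hf hg). Qed.

Lemma Int_ge0 D f : (forall x, D x -> 0 <= f x) -> 0 <= Int D f.
Proof. by move=> f0; exact: (@Rintegral_ge0 _ _ _ mu D f f0). Qed.

Lemma Int0 D : Int D (fun=> 0) = 0.
Proof. by rewrite /Int /Rintegral /= integral0. Qed.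

Lemma Int_norm D f : measurable D -> intg D f -> `|Int D f| <= Int D (fun x => `|f x|).
Proof. by move=> mD hf; exact: (@le_normr_Rintegral _ _ _ mu D _ mD hf). Qed.

Lemma Int_norm_le D f g : measurable D -> measurable_fun D f -> intg D g ->
  (forall x, D x -> `|f x| <= g x) -> `|Int D f| <= Int D g.
Proof.
move=> mD mf hg fg; have hf : intg D f by exact: intg_dom fg hg.
by rewrite (le_trans (Int_norm mD hf)) // Int_le //; exact: intg_abs.
Qed.

Lemma intg_EFin D f : measurable D -> intg D f ->
  (\int[mu]_(x in D) (f x)%:E)%E = (Int D f)%:E.
Proof. by move=> mD hf; rewrite /Int /Rintegral fineK //; exact: integrable_fin_num. Qed.

Lemma Int_subset D E f : measurable D -> measurable E -> D `<=` E -> intg E f ->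
  (forall x, E x -> 0 <= f x) -> Int D f <= Int E f.
Proof.
move=> mD mE DE hf f0; have hD := intgS mE mD DE hf.
rewrite -lee_fin -!intg_EFin //; apply: ge0_subset_integral => //.
exact: measurable_int hf.
Qed.

Lemma Int_setU D E f : measurable D -> measurable E -> intg (D `|` E) f ->
  D `&` E = set0 -> Int (D `|` E) f = Int D f + Int E f.
Proof. by move=> mD mE hf DE; apply: Rintegral_setU => //; exact/disj_set2P. Qed.

Lemma Int_itv_split (a b c : R) f : a <= b -> b <= c -> intg `[a, c] f ->
  Int `[a, c] f = Int `[a, b] f + Int `[b, c] f.
Proof.
move=> ab bc hf.
rewrite /Int (_ : (\int[mu]_(x in `[a, c]) f x) =
  \int[mu]_(x in `[a, b]) f x + \int[mu]_(x in `]b, c]) f x); last first.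
  by rewrite -(@Rintegral_itvB _ f (BLeft a) (BRight c) b) //;
    [ring|rewrite bnd_simp..].
by rewrite Rintegral_itv_obnd_cbnd //;
  apply: (intgS _ _ _ hf) => // x /=; rewrite !in_itv /= => /andP[h1 h2];
  rewrite h2 andbT (le_trans ab) // ltW.
Qed.

Lemma Int_itv1 (a : R) f : Int `[a, a] f = 0.
Proof. by rewrite /Int set_itv1 Rintegral_set1. Qed.

Lemma Int_cst (a b r : R) : a <= b -> Int `[a, b] (fun=> r) = r * (b - a).
Proof.
move=> ab; rewrite /Int Rintegral_cst //= lebesgue_measure_itv /= lte_fin.
by move: ab; rewrite le_eqVlt => /predU1P[->|->//]; rewrite ltxx subrr /= mulr0.
Qed.

Lemma continuous_meas f : continuous f -> measurable_fun setT f.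
Proof. exact: continuous_measurable_fun. Qed.

Lemma continuous_measD D f : measurable D -> continuous f -> measurable_fun D f.
Proof. by move=> mD cf; apply: measurable_funS (continuous_meas cf). Qed.

Lemma continuous_intg (a b : R) f : continuous f -> intg `[a, b] f.
Proof.
move=> cf; apply: continuous_compact_integrable; first exact: segment_compact.
exact/continuous_subspaceT.
Qed.

Lemma cst_intg (a b r : R) : intg `[a, b] (fun=> r).
Proof. by apply: continuous_intg => x; exact: cvg_cst. Qed.

Definition co (r : R) : set R := ~` `[- r, r].

Lemma measurable_co r : measurable (co r).
Proof. exact: measurableC. Qed.

Lemma Int_co (r : R) f : intg setT f ->
  Int setT f = Int `[- r, r] f + Int (co r) f.
Proof.
move=> hf; rewrite -Int_setU ?setUv ?setICr //.
exact: measurable_co.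
Qed.

Lemma itv_nat_cup : \bigcup_n `[- (n%:R : R), n%:R]%classic = setT.
Proof.
rewrite -subTset => x _; exists (Num.truncn `|x|).+1 => //=.
by rewrite in_itv /= -ler_norml ltW // truncnS_gt.
Qed.

(** Monotone convergence along the intervals [[-n, n]]. It is the standard way here to get
    integrability on the line from bounds on bounded intervals. *)
Lemma ge0_intg_sup f (C : R) : (forall x, 0 <= f x) -> measurable_fun setT f ->
  (forall n : nat, Int `[- (n%:R : R), n%:R] f <= C) ->
  (forall n : nat, intg `[- (n%:R : R), n%:R] f) ->
  intg setT f /\ Int setT f <= C.
Proof.
move=> f0 mf hC hf.
pose In (n : nat) : set R := `[- (n%:R : R), n%:R]%classic.
have sIn m n : (m <= n)%N -> In m `<=` In n.
  move=> mn x; rewrite /In /= !in_itv /= => /andP[h1 h2].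
  by rewrite (le_trans _ h1) ?lerN2 ?(le_trans h2) // ler_nat.
have h : (\int[mu]_x (f x)%:E <= C%:E)%E.
  have cv : (\int[mu]_(x in In n) (f x)%:E)%E @[n --> \oo] --> (\int[mu]_x (f x)%:E)%E.
    rewrite -itv_nat_cup; apply: ge0_nondecreasing_set_cvg_integral => //.
    - by move=> m n mn; apply/subsetPset; exact: sIn.
    - by move=> i; exact: measurable_itv.
    - by move=> i; apply/measurable_EFinP; apply: (measurable_funS _ _ mf).
    - by move=> i x _; rewrite lee_fin.
  rewrite -(cvg_lim _ cv) //; apply: lime_le; first by apply/cvg_ex; eexists; exact: cv.
  by apply: nearW => n; have := hC n; rewrite -lee_fin -intg_EFin.
have hi : intg setT f.
  apply/integrableP; split; first exact/measurable_EFinP.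
  under eq_integral do rewrite /= ger0_norm //.
  exact: le_lt_trans h (ltry _).
by split=> //; rewrite -lee_fin -intg_EFin.
Qed.

(** If every tail were at least [e], the integrals over [[-n, n]] would all stay below the full
    integral minus [e], and monotone convergence would bound the full integral by less than
    itself. *)
Lemma Int_tail f (e : R) : intg setT f -> (forall x, 0 <= f x) -> 0 < e ->
  exists n : nat, Int (co n%:R) f < e.
Proof.
move=> hf f0 e0; apply/not_existsP => H.
have hI (n : nat) : Int `[- (n%:R : R), n%:R] f <= Int setT f - e.
  have := Int_co n%:R hf; have /negP := H n; rewrite -leNgt; lra.
have [|_] := @ge0_intg_sup f (Int setT f - e) f0 (intg_meas hf) hI.
  by move=> n; exact: intg_sub.
lra.
Qed.

Lemma Int_co_le (r s : R) f : r <= s -> intg setT f -> (forall x, 0 <= f x) ->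
  Int (co s) f <= Int (co r) f.
Proof.
move=> rs hf f0; apply: Int_subset => //; try exact: measurable_co.
  move=> x; apply: contra_not => /=; rewrite !in_itv /= => /andP[h1 h2].
  by rewrite (le_trans _ h1) ?lerN2 // (le_trans h2).
by apply: intg_sub => //; exact: measurable_co.
Qed.

Lemma CS_intg D f g : measurable D -> measurable_fun D f -> measurable_fun D g ->
  intg D (fun x => f x ^+ 2) -> intg D (fun x => g x ^+ 2) ->
  intg D (fun x => f x * g x).
Proof.
move=> mD mf mg hf hg.
apply: (@intg_dom _ _ (fun x => f x ^+ 2 + g x ^+ 2)) => //; last exact: intgD.
  exact: measurable_funM.
move=> x _; rewrite ler_norml.
have h1 : 0 <= (f x + g x) ^+ 2 by exact: sqr_ge0.
have h2 : 0 <= (f x - g x) ^+ 2 by exact: sqr_ge0.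
have h3 : 0 <= f x ^+ 2 by exact: sqr_ge0.
have h4 : 0 <= g x ^+ 2 by exact: sqr_ge0.
by apply/andP; split; lra.
Qed.

(** Discriminant criterion behind every Cauchy-Schwarz inequality below. The sign of [c] is not
    assumed, so the degenerate cases are ruled out by explicit values of [t]. *)
Lemma discr_le (a b c : R) : 0 <= a -> (forall t, 0 <= a + 2 * t * b + t ^+ 2 * c) ->
  b ^+ 2 <= a * c.
Proof.
move=> a0 H; have [c0|c0|c0] := ltgtP c 0.
- exfalso; have hN t : 0 <= 2 * a + 2 * (t ^+ 2 * c).
    by have := H t; have := H (- t); rewrite sqrrN; lra.
  (* For [c < 0] the even part [a + t^2 c] must be nonnegative; this [t] makes [t^2 c] at most
     [- 2 (a + 1)]. *)
  have := hN (1 - (a + 1) / c); have -> : (1 - (a + 1) / c) ^+ 2 * c =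
    c - 2 * (a + 1) + (a + 1) ^+ 2 / c by field; rewrite lt_eqF.
  have : (a + 1) ^+ 2 / c <= 0 by rewrite mulr_ge0_le0 ?sqr_ge0 // invr_le0 ltW.
  by lra.
- have := H (- (b / c)); have cV : c * c^-1 = 1 by rewrite divff // gt_eqF.
  have -> : a + 2 * - (b / c) * b + (- (b / c)) ^+ 2 * c = (a * c - b ^+ 2) / c.
    by field; rewrite gt_eqF.
  by rewrite pmulr_lge0 ?invr_gt0 // subr_ge0.
- rewrite c0 mulr0; have [->|b0] := eqVneq b 0; first by rewrite expr0n.
  exfalso; have := H (- (a + 1) / b); rewrite c0 mulr0 addr0.
  have -> : 2 * (- (a + 1) / b) * b = - 2 * (a + 1) by field.
  lra.
Qed.

Lemma CS_Int D f g : measurable D -> measurable_fun D f -> measurable_fun D g ->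
  intg D (fun x => f x ^+ 2) -> intg D (fun x => g x ^+ 2) ->
  Int D (fun x => f x * g x) ^+ 2 <= Int D (fun x => f x ^+ 2) * Int D (fun x => g x ^+ 2).
Proof.
move=> mD mf mg hf hg; have hfg := CS_intg mD mf mg hf hg.
apply: discr_le => [|t]; first by apply: Int_ge0 => x _; exact: sqr_ge0.
have -> : Int D (fun x => f x ^+ 2) + 2 * t * Int D (fun x => f x * g x) +
    t ^+ 2 * Int D (fun x => g x ^+ 2) = Int D (fun x => (f x + t * g x) ^+ 2).
  rewrite -!IntZ // -!IntD //; try exact: intgZ; try (apply: intgD => //; exact: intgZ).
  by apply: Int_ext => x _; ring.
by apply: Int_ge0 => x _; exact: sqr_ge0.
Qed.

Lemma Int_dct D (fn : nat -> R -> R) f g : measurable D ->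
  (forall n, measurable_fun D (fn n)) -> measurable_fun D f -> intg D g ->
  (forall n x, D x -> `|fn n x| <= g x) ->
  (forall x, D x -> fn n x @[n --> \oo] --> f x) ->
  Int D (fn n) @[n --> \oo] --> Int D f.
Proof.
move=> mD mfn mf hg dom cv.
have [] := @dominated_convergence _ _ _ mu D mD (fun n => EFin \o fn n) (EFin \o f) (EFin \o g).
- by move=> n; apply/measurable_EFinP; exact: mfn.
- exact/measurable_EFinP.
- by apply/aeW => x Dx; apply/fine_cvgP; split; [exact: nearW|exact: cv].
- exact: hg.
- by apply/aeW => x n Dx; rewrite /= lee_fin; exact: dom.
move=> hf _ hc; have /fine_cvgP[] : (\int[mu]_(x in D) (fn n x)%:E)%E @[n --> \oo] --> (Int D f)%:E.
  by rewrite -intg_EFin.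
by [].
Qed.

Lemma ae_eq_Int D f g : measurable D -> measurable_fun D f -> measurable_fun D g ->
  ae_eq mu D f g -> Int D f = Int D g.
Proof.
move=> mD mf mg h; rewrite /Int /Rintegral; congr fine.
apply: ae_eq_integral => //; try exact/measurable_EFinP.
by apply: filterS h => x /= h' /h' ->.
Qed.

End integration.

#[export] Hint Resolve measurable_co : core.

(** * Absolute continuity and weak derivatives *)

Section absolutely_continuous.
Context {R : realType}.
Local Notation mu := (@lebesgue_measure R).
Implicit Types (f g h p : R -> R).

Lemma continuousEP f : continuous f ->
  forall (x e : R), 0 < e -> exists2 d : R, 0 < d & forall y, `|y - x| <= d -> `|f y - f x| <= e.
Proof.
move=> cf x e e0; have /cvgrPdist_le /(_ _ e0) /nbhs_ballP [d /= d0 hd] := cf x.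
exists (d / 2); first by rewrite divr_gt0.
move=> y hy; rewrite distrC; apply: hd; rewrite /ball /= distrC (le_lt_trans hy) //.
by rewrite ltr_pdivrMr // mulr_natr mulr2n ltrDl.
Qed.

Lemma continuousEI f :
  (forall (x e : R), 0 < e -> exists2 d : R, 0 < d & forall y, `|y - x| <= d -> `|f y - f x| <= e) ->
  continuous f.
Proof.
move=> H x; apply/cvgrPdist_le => e e0; have [d d0 hd] := H x e e0.
apply/nbhs_ballP; exists d => //= y; rewrite /ball /= distrC => /ltW /hd.
by rewrite distrC.
Qed.

(** Only [x] is confined to the compact interval, while [y] may leave it. This spares boundary cases
    when the estimate is used near an end point. *)
Lemma continuous_unif f (a b e : R) : continuous f -> 0 < e ->
  exists2 d : R, 0 < d & forall x y : R, a <= x <= b -> `|y - x| <= d -> `|f y - f x| <= e.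
Proof.
move=> cf e0.
have cA : compact (`[a, b]%classic : set R) by exact: segment_compact.
have /compact_near_coveringP hc := cA.
have := hc R (0^'+) (fun d x => forall y, `|y - x| <= d -> `|f y - f x| <= e) _.
case.
- move=> x _; have [r r0 hr] := continuousEP cf x (divr_gt0 e0 (ltr0n _ 2)).
  exists (ball x (r / 2), [set d | 0 < d < r / 2]) => /=.
    split; first by apply: nbhsx_ballx; rewrite divr_gt0.
    by exists (r / 2); rewrite /= ?divr_gt0 // => y; rewrite /ball_ /= sub0r normrN => h y0; rewrite y0 (le_lt_trans (ler_norm y)).
  move=> [x' d] /= [hx' /andP[d0 dr]] y hy.
  have h1 : `|x' - x| <= r by move: hx'; rewrite /ball /= distrC; lra.
  have h2 : `|y - x| <= r.
    have -> : y - x = (y - x') + (x' - x) by ring.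
    by rewrite (le_trans (ler_normD _ _)) //; move: hx'; rewrite /ball /= (distrC x x'); lra.
  have -> : f y - f x' = (f y - f x) - (f x' - f x) by ring.
  by rewrite (le_trans (ler_normB _ _)) //; have := hr _ h1; have := hr _ h2; lra.
- move=> d /= d0 H; exists (d / 2); first by rewrite divr_gt0.
  move=> x y xab; apply: H => //=; last by rewrite divr_gt0.
  by rewrite sub0r normrN gtr0_norm ?divr_gt0 //; lra.
Qed.

Lemma continuous_bounded f (a b : R) : continuous f ->
  exists2 M : R, 0 < M & forall x, a <= x <= b -> `|f x| <= M.
Proof.
move=> cf; have [ab|ba] := leP a b; last first.
  by exists 1 => // x /andP[h1 h2]; have := le_trans h1 h2; rewrite leNgt ba.
have cn : {within `[a, b], continuous (fun x => `|f x|)}.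
  by apply: continuous_subspaceT => x; apply: cvg_norm; exact: cf.
have [c _ hc] := EVT_max ab cn; exists (`|f c| + 1); first by rewrite ltr_wpDl.
by move=> x xab; rewrite (le_trans (hc x _)) ?lerDl // in_itv.
Qed.

Lemma intg_contM p g (a b : R) : continuous p -> intg `[a, b] g ->
  intg `[a, b] (fun x => p x * g x).
Proof.
move=> cp hg; have [M M0 hM] := continuous_bounded a b cp.
apply: (@intg_dom _ _ _ (fun x => M * `|g x|)) => //.
- by apply: measurable_funM; [exact: continuous_measD|exact: intg_meas].
- move=> x /=; rewrite in_itv /= => xab.
  by rewrite normrM ler_wpM2r // hM.
- by apply: intgZ => //; exact: intg_abs.
Qed.

(** Absolute continuity with derivative [g], stated as [f] being a primitive of [g]. All calculus
    with weak derivatives goes through this form. *)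
Definition ac f g : Prop :=
  forall a b, a <= b -> intg `[a, b] g /\ f b - f a = Int `[a, b] g.

(** Chain rule for [h = H (f1, f2)] with partial derivatives [p1] and [p2] along the path. The
    hypothesis is a first-order expansion with an error proportional to the increments of [f1] and
    [f2]; the proof is a Riemann sum argument and does not differentiate at points. *)
Lemma ac_chain f1 f2 g1 g2 h p1 p2 (a b : R) : a <= b ->
  ac f1 g1 -> ac f2 g2 -> continuous p1 -> continuous p2 ->
  (forall e : R, 0 < e -> exists2 d : R, 0 < d & forall x y : R, a <= x <= b -> a <= y <= b ->
     `|y - x| <= d ->
     `|h y - h x - p1 x * (f1 y - f1 x) - p2 x * (f2 y - f2 x)| <=
       e * (`|f1 y - f1 x| + `|f2 y - f2 x|)) ->
  h b - h a = Int `[a, b] (fun x => p1 x * g1 x + p2 x * g2 x).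
Proof.
move=> ab ac1 ac2 cp1 cp2 Hh.
pose k x := p1 x * g1 x + p2 x * g2 x.
have ik x y : x <= y -> intg `[x, y] k.
  by move=> xy; have [i1 _] := ac1 _ _ xy; have [i2 _] := ac2 _ _ xy;
    apply: intgD => //; exact: intg_contM.
pose n x := `|g1 x| + `|g2 x|.
have inn x y : x <= y -> intg `[x, y] n.
  by move=> xy; have [i1 _] := ac1 _ _ xy; have [i2 _] := ac2 _ _ xy;
    apply: intgD => //; exact: intg_abs.
have n0 x : 0 <= n x by rewrite addr_ge0.
(* The error of each short piece is at most [2 e] times the integral of [|g1| + |g2|] over it, so
   the errors add up to a bound that vanishes with [e]. *)
suff E e : 0 < e -> `|h b - h a - Int `[a, b] k| <= 2 * e * Int `[a, b] n.
  apply/eqP; rewrite -subr_eq0 -normr_eq0 eq_le normr_ge0 andbT.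
  apply/ler_addgt0Pl => e e0; rewrite addr0.
  have I0 : 0 <= Int `[a, b] n by apply: Int_ge0.
  have e1 : 0 < e / (2 * (Int `[a, b] n + 1)) by rewrite divr_gt0 // mulr_gt0 // ltr_wpDl.
  apply: (le_trans (E _ e1)).
  rewrite [leLHS](_ : _ = e * (Int `[a, b] n / (Int `[a, b] n + 1))); last first.
    by field; rewrite gt_eqF // ltr_wpDl.
  by rewrite ler_piMr ?ltW // ltr_pdivrMr ?ltr_wpDl // mul1r ltrDl.
move=> e0.
have [d1 d10 H1] := Hh _ e0.
have [d2 d20 H2] := continuous_unif a b cp1 e0.
have [d3 d30 H3] := continuous_unif a b cp2 e0.
pose d := Num.min d1 (Num.min d2 d3).
have d0 : 0 < d by rewrite !lt_min d10 d20.
have small x y : a <= x -> x <= y -> y <= b -> y - x <= d ->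
    `|h y - h x - Int `[x, y] k| <= 2 * e * Int `[x, y] n.
  move=> ax xy yb; rewrite !le_min => /and3P[hd1 hd2 hd3].
  have [i1 F1] := ac1 _ _ xy; have [i2 F2] := ac2 _ _ xy.
  have hn := inn _ _ xy.
  have h1 : `|h y - h x - p1 x * (f1 y - f1 x) - p2 x * (f2 y - f2 x)| <= e * Int `[x, y] n.
    have yxd : `|y - x| <= d1 by rewrite ger0_norm // subr_ge0.
    apply: (le_trans (H1 x y _ _ yxd)).
    - by rewrite ax (le_trans xy).
    - by rewrite yb (le_trans ax).
    - rewrite ler_pM2l // F1 F2 IntD //; try exact: intg_abs.
      by apply: lerD; apply: le_trans (Int_norm _ _) => //; rewrite ?ler_norm.
  have c1 : intg `[x, y] (fun z => p1 x * g1 z) by exact: intgZ.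
  have c2 : intg `[x, y] (fun z => p2 x * g2 z) by exact: intgZ.
  have ikxy := ik _ _ xy.
  have h2 : `|p1 x * (f1 y - f1 x) + p2 x * (f2 y - f2 x) - Int `[x, y] k| <= e * Int `[x, y] n.
    have c12 : intg `[x, y] (fun z => p1 x * g1 z + p2 x * g2 z) by exact: intgD.
    rewrite F1 F2 -!IntZ // -IntD // -IntB //.
    apply: Int_norm_le => //; [by apply: intg_meas; exact: intgB|exact: intgZ|].
    move=> z /=; rewrite in_itv /= => /andP[xz zy].
    rewrite [X in `|X|](_ : _ = - ((p1 z - p1 x) * g1 z + (p2 z - p2 x) * g2 z)); last first.
      by rewrite /k; ring.
    rewrite normrN (le_trans (ler_normD _ _)) // !normrM mulrDr.
    have axb : a <= x <= b by rewrite ax (le_trans xy).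
    have zxd : `|z - x| <= y - x by rewrite ger0_norm ?subr_ge0 // lerD2r.
    by apply: lerD; rewrite ler_wpM2r //; [apply: H2|apply: H3] => //; exact: le_trans zxd _.
  rewrite [X in `|X|](_ : _ = (h y - h x - p1 x * (f1 y - f1 x) - p2 x * (f2 y - f2 x)) +
    (p1 x * (f1 y - f1 x) + p2 x * (f2 y - f2 x) - Int `[x, y] k)); last by ring.
  by rewrite (le_trans (ler_normD _ _)) //; lra.
(* Induction on the number of pieces of length [d] that cover the interval. *)
suff iter m x y : a <= x -> x <= y -> y <= b -> y - x <= m%:R * d ->
    `|h y - h x - Int `[x, y] k| <= 2 * e * Int `[x, y] n.
  apply: (iter (Num.truncn ((b - a) / d)).+1) => //.
  by rewrite -ler_pdivrMr // ltW // truncnS_gt.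
elim: m x y => [|m IH] x y ax xy yb.
  by rewrite mul0r => hd; apply: small => //; rewrite (le_trans hd) // ltW.
rewrite mulrSr mulrDl mul1r => hd.
have [hs|hs] := leP (y - x) d; first exact: small.
pose z := x + d.
have xz : x <= z by rewrite lerDl ltW.
have zy : z <= y by rewrite /z; lra.
have E1 : `|h z - h x - Int `[x, z] k| <= 2 * e * Int `[x, z] n.
  by apply: small => //; [exact: le_trans zy _|rewrite /z; lra].
have E2 : `|h y - h z - Int `[z, y] k| <= 2 * e * Int `[z, y] n.
  by apply: IH => //; [exact: le_trans xz|rewrite /z; lra].
rewrite !(Int_itv_split xz zy); [|exact: inn|exact: ik].
rewrite [X in `|X|](_ : _ = (h z - h x - Int `[x, z] k) + (h y - h z - Int `[z, y] k)); last by ring.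
by rewrite (le_trans (ler_normD _ _)) //; lra.
Qed.

Lemma ac_mul f1 f2 g1 g2 : continuous f1 -> continuous f2 -> ac f1 g1 -> ac f2 g2 ->
  ac (fun x => f1 x * f2 x) (fun x => f2 x * g1 x + f1 x * g2 x).
Proof.
move=> c1 c2 a1 a2 a b ab; split.
  by have [i1 _] := a1 _ _ ab; have [i2 _] := a2 _ _ ab; apply: intgD => //; exact: intg_contM.
apply: (ac_chain (h := fun x => f1 x * f2 x) ab a1 a2 c2 c1) => e e0.
have [d d0 H] := continuous_unif a b c2 e0; exists d => // x y xab _ yx.
rewrite [X in `|X|](_ : _ = (f2 y - f2 x) * (f1 y - f1 x)); last by ring.
by rewrite normrM ler_pM // ?lerDl //; exact: H.
Qed.

Lemma ac_C1 f : (forall x, derivable f x 1) -> continuous (derive1 f) -> ac f (derive1 f).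
Proof.
move=> df cf a b ab; split; first exact: continuous_intg.
move: ab; rewrite le_eqVlt => /predU1P[->|ab]; first by rewrite subrr Int_itv1.
have cF x : {for x, continuous f} by apply/differentiable_continuous/derivable1_diffP.
have cw : {within `[a, b], continuous (derive1 f)} by exact: continuous_subspaceT.
have dF : derivable_oo_LRcontinuous f a b.
  split; first by move=> x _; exact: df.
    by apply: cvg_at_right_filter; exact: cF.
  by apply: cvg_at_left_filter; exact: cF.
have h := continuous_FTC2 ab cw dF (fun x _ => erefl).
by rewrite /Int /Rintegral h.
Qed.

Lemma ac_lin f1 f2 g1 g2 (c : R) : ac f1 g1 -> ac f2 g2 ->
  ac (fun x => c * f1 x + f2 x) (fun x => c * g1 x + g2 x).
Proof.
move=> a1 a2 a b ab; have [i1 e1] := a1 _ _ ab; have [i2 e2] := a2 _ _ ab.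
split; first by apply: intgD => //; exact: intgZ.
by rewrite IntD // ?IntZ // -?e1 -?e2; [ring|exact: intgZ].
Qed.

(* Differentiating the primitive recovers [g] almost everywhere, so a constant
   function only has the null derivative. *)
Lemma ac_uniq f g1 g2 : intg setT g1 \/ measurable_fun setT g1 ->
  intg setT g2 \/ measurable_fun setT g2 -> ac f g1 -> ac f g2 ->
  ae_eq mu setT g1 g2.
Proof.
move=> m1 m2 a1 a2.
have mg1 : measurable_fun setT g1 by case: m1 => // /intg_meas.
have mg2 : measurable_fun setT g2 by case: m2 => // /intg_meas.
pose g x := g1 x - g2 x.
have mg : measurable_fun setT g by exact: measurable_funB.
have ig a b : intg `[a, b] g /\ Int `[a, b] g = 0.
  have [ab|ba] := leP a b; last first.
    rewrite set_itv_ge ?bnd_simp -?ltNge //; split; last by rewrite /Int Rintegral_set0.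
    exact/integrable_set0.
  have [i1 e1] := a1 _ _ ab; have [i2 e2] := a2 _ _ ab; split; first exact: intgB.
  by rewrite IntB // -e1 -e2 subrr.
have lg : locally_integrable [set: R] g.
  split => //; first exact: openT.
  move=> K _ cK.
  have [M [_ hM]] := compact_bounded cK.
  have KM : K `<=` `[- (M + 1), M + 1]%classic.
    by move=> x Kx /=; rewrite in_itv /= -ler_norml; apply: hM => //; rewrite ltrDl.
  have : intg K g by apply: (intgS _ _ KM (ig _ _).1) => //; exact: compact_measurable.
  by move=> /integrableP[].
have main (n : nat) : {ae mu, forall x, - (n%:R : R) < x -> g x = 0}.
  have h := @FTC1 _ g (BLeft (- (n%:R : R))) (fun y => (ig _ y).1) lg.
  apply: (@filterS _ _ (ae_filter_ringOfSetsType mu) _ _ _ h) => x /= {}h nx; have [|_ <-] := h; first by rewrite lte_fin.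
  rewrite derive1E.
  rewrite (_ : (fun x0 => _) = cst 0) ?derive_cst //.
  by apply/funext => y; have [_] := ig (- n%:R) y.
have /ae_foralln H := main.
apply: (@filterS _ _ (ae_filter_ringOfSetsType mu) _ _ _ H) => x /= {}H _; have := H (Num.truncn `|x|).+1.
rewrite /g => /(_ _) /eqP; rewrite subr_eq0 => h; apply/eqP/h.
rewrite ltrNl; apply: (le_lt_trans _ (truncnS_gt `|x|)).
by rewrite -normrN ler_norm.
Qed.

Lemma derive1_zero_out f (M x : R) : (forall x, M < `|x| -> f x = 0) -> M < `|x| ->
  derive1 f x = 0.
Proof.
move=> f0 Mx; rewrite derive1E.
have hn : \forall y \near x, f y = cst 0 y.
  have : \forall y \near x, M < `|y|.
    have cn : (fun y : R => `|y|) y @[y --> x] --> `|x| by apply: cvg_norm; exact: cvg_id.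
    exact: (cvgr_gt _ cn).
  by apply: filterS => y /f0.
by rewrite (near_eq_derive _ hn) ?derive_cst // oner_eq0.
Qed.

Lemma Int_support f (r : R) : (forall x, r < `|x| -> f x = 0) -> intg `[- r, r] f ->
  measurable_fun setT f -> intg setT f /\ Int setT f = Int `[- r, r] f.
Proof.
move=> f0 hf mf.
have hz x : co r x -> f x = 0.
  by move=> /negP; rewrite in_itv /= -ler_norml -ltNge; exact: f0.
have i2 : intg (co r) f.
  apply: (@intg_dom _ _ _ (fun=> 0)) => //; last exact: intg0.
    exact: measurable_funS mf.
  by move=> x /hz ->; rewrite normr0.
have iT : intg setT f.
  have -> : setT = `[- r, r]%classic `|` co r :> set R by rewrite setUv.
  apply/integrableP; split; first by apply/measurable_EFinP; rewrite setUv.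
  rewrite ge0_integral_setU //=; try exact: measurable_co; last 2 first.
  - by apply/measurable_EFinP; rewrite setUv; exact: measurableT_comp.
  - by apply/disj_set2P; rewrite setICr.
  by apply: lte_add_pinfty; [have /integrableP[] := hf|have /integrableP[] := i2].
by split => //; rewrite (Int_co r iT) (Int_ext hz) Int0 addr0.
Qed.

(** Integration by parts: [f k] is a primitive of [k g + f k'] and vanishes at both ends of an
    interval that contains the support of [k]. *)
Lemma ac_weak f g (k : R -> R) : continuous f -> ac f g -> measurable_fun setT g ->
  test_function k ->
  Int setT (fun x => f x * derive1 k x) = - Int setT (fun x => g x * k x).
Proof.
move=> cf af mg [dk [M0 hM0]].
(* The bound [M0] on the support may be negative, hence the absolute value; the interval used is
   [[-(M+1), M+1]], so that [k] vanishes at its ends. *)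
pose M : R := `|M0|; have Mge0 : 0 <= M by exact: normr_ge0.
have hM x : M < `|x| -> k x = 0 by move=> h; apply: hM0; rewrite (le_lt_trans _ h) // ler_norm.
have d0 x : derivable k x 1 by exact: (dk 0%N x).
have d1 x : derivable (derive1 k) x 1 by exact: (dk 1%N x).
have cont (h : R -> R) : (forall x, derivable h x 1) -> continuous h.
  by move=> hh x; apply/differentiable_continuous/derivable1_diffP.
have ck := cont _ d0; have ck1 := cont _ d1.
have MM : - (M + 1) <= M + 1 by lra.
have [] := ac_mul cf ck af (ac_C1 d0 ck1) MM => _.
have z (x : R) : `|x| = M + 1 -> k x = 0 by move=> h; apply: hM; rewrite h ltrDl.
have M1 : 0 <= M + 1 by rewrite addr_ge0.
rewrite (z (M + 1)) ?ger0_norm // (z (- (M + 1))) ?normrN ?ger0_norm // !mulr0 subrr.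
have i1 : intg `[- (M + 1), M + 1] (fun x => k x * g x) by apply: intg_contM ck (af _ _ MM).1.
have i2 : intg `[- (M + 1), M + 1] (fun x => f x * derive1 k x).
  by apply: intg_contM => //; exact: continuous_intg.
rewrite IntD // => /esym/eqP; rewrite addrC addr_eq0 => /eqP h.
have [||_ ->] := @Int_support (fun x => f x * derive1 k x) (M + 1) _ i2.
- by move=> x hx; rewrite (@derive1_zero_out _ M) ?mulr0 // (lt_trans _ hx) // ltrDl.
- by apply: measurable_funM; exact: continuous_meas.
rewrite h; congr (- _).
have e : (fun x => g x * k x) = (fun x => k x * g x) by apply/funext => x; rewrite mulrC.
rewrite e; have [||_ ->] := @Int_support (fun x => k x * g x) (M + 1) _ i1 => //.
- by move=> x hx; rewrite hM ?mul0r // (lt_trans _ hx) // ltrDl.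
- by apply: measurable_funM => //; exact: continuous_meas.
Qed.

End absolutely_continuous.

(** * Smooth bumps, and the passage from weak derivatives to primitives *)

Section test_functions.
Context {R : realType}.
Local Notation mu := (@lebesgue_measure R).
Implicit Types (f g : R -> R).

Lemma intg_patch (D : set R) f : measurable D -> intg D f -> intg setT (f \_ D).
Proof.
move=> mD hf; rewrite /intg -restrict_EFin.
exact: (proj1 (@integrable_mkcond _ _ _ mu D (EFin \o f) mD) hf).
Qed.

Lemma expR_ge_pow (n : nat) (x : R) : 0 <= x -> x ^+ n <= n%:R ^+ n * expR x.
Proof.
move=> x0; case: n => [|n]; first by rewrite !expr0 mul1r -expR0 ler_expR.
have n0 : (0 : R) < n.+1%:R by rewrite ltr0n.
have h : x / n.+1%:R <= expR (x / n.+1%:R).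
  by apply: le_trans (expR_ge1Dx _); rewrite lerDr.
have -> : expR x = expR (x / n.+1%:R) ^+ n.+1.
  by rewrite -expRM_natl mulr_natl -mulr_natr mulfVK // gt_eqF.
rewrite -exprMn lerXn2r // ?nnegrE ?mulr_ge0 ?expR_ge0 //.
by move: h; rewrite ler_pdivrMr // mulrC.
Qed.

(** Handles the points where the formula for a bump is glued to 0: quadratic vanishing gives
    derivative 0 there. *)
Lemma quad_derive f (x C : R) : (forall y, `|f y| <= C * (y - x) ^+ 2) ->
  is_derive x 1 f 0.
Proof.
move=> H; have fx : f x = 0.
  by apply/eqP; rewrite -normr_le0 (le_trans (H x)) // subrr expr0n mulr0.
have cv : h^-1 *: (f (h *: 1 + x) - f x) @[h --> 0^'] --> (0 : R).
  apply/cvgrPdist_le => e e0.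
  have C0 : 0 < `|C| + 1 by rewrite ltr_wpDl.
  exists (e / (`|C| + 1)) => /=; first by rewrite divr_gt0.
  move=> h; rewrite /ball_ /= sub0r normrN => he h0.
  rewrite sub0r normrN fx subr0 /GRing.scale /= mulr1 normrM normfV.
  rewrite ler_pdivrMl ?normr_gt0 // (le_trans (H _)) //.
  have -> : h + x - x = h by ring.
  rewrite -normr_eq0 in h0.
  have hp : 0 < `|h| by rewrite lt_def h0 normr_ge0.
  rewrite -(real_normK (num_real h)) expr2 mulrCA ler_pM2l //.
  rewrite (le_trans (ler_wpM2r _ (ler_norm C))) // (le_trans (ler_wpM2l _ (ltW he))) //.
  rewrite mulrCA -[leRHS]mulr1 ler_pM2l // ltW // ltr_pdivrMr // mul1r ltrDl.
  exact: ltr01.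
apply: DeriveDef; first by apply/cvg_ex; exists 0.
exact: cvg_lim cv.
Qed.

Definition bq (x : R) : R := (x * (1 - x))^-1.

(** With [q = 1 / (x (1 - x))] these are the functions [x^i q^j e^(-q)] on the unit interval. Two
    exponents are carried because [q' = (2 x - 1) q^2], so the derivative of a member is again a
    combination of members; smoothness of [bump 0 0] follows from this closure. *)
Definition bump (i j : nat) (x : R) : R :=
  if (0 < x) && (x < 1) then x ^+ i * bq x ^+ j * expR (- bq x) else 0.

(** The exponential beats every power: [q^j e^(-q)] is at most a constant times
    [q^(-2) = (y (1 - y))^2], and [y (1 - y)] is at most the distance from [y] to any point outside
    the unit interval. *)
Lemma bump_quad i j (x : R) : ~~ ((0 < x) && (x < 1)) ->
  forall y, `|bump i j y| <= (j.+2)%:R ^+ j.+2 * (y - x) ^+ 2.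
Proof.
move=> hx y; rewrite /bump; case: ifP => [/andP[y0 y1]|_]; last first.
  by rewrite normr0 mulr_ge0 ?sqr_ge0 // exprn_ge0.
have z0 : 0 < y * (1 - y) by rewrite mulr_gt0 // subr_gt0.
have q0 : 0 < bq y by rewrite invr_gt0.
have e0 : 0 <= y ^+ i * bq y ^+ j * expR (- bq y).
  by rewrite !mulr_ge0 ?exprn_ge0 ?expR_ge0 // ltW.
rewrite (ger0_norm e0).
have h1 : y ^+ i * bq y ^+ j * expR (- bq y) <= bq y ^+ j * expR (- bq y).
  rewrite ler_wpM2r ?expR_ge0 // ler_piMl ?exprn_ge0 // ?(ltW q0) //.
  by apply: exprn_ile1; exact: ltW.
apply: (le_trans h1).
have h2 : bq y ^+ j * expR (- bq y) <= j.+2%:R ^+ j.+2 * (bq y)^-1 ^+ 2.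
  have := expR_ge_pow j.+2 (ltW q0).
  rewrite expRN ler_pdivrMr ?expR_gt0 // => h.
  rewrite mulrAC exprVn ler_pdivlMr ?exprn_gt0 // -exprD addn2.
  exact: h.
apply: (le_trans h2); rewrite ler_pM2l ?exprn_gt0 ?ltr0n //.
rewrite /bq invrK -(real_normK (num_real (y - x))) lerXn2r ?nnegrE ?(ltW z0) //.
move: hx; rewrite negb_and -!leNgt => /orP[x0|x1].
- rewrite ger0_norm; last by rewrite subr_ge0 ltW // (le_lt_trans x0).
  have : y * (1 - y) <= y by nra.
  by lra.
- rewrite ler0_norm; last by rewrite subr_le0 ltW // (lt_le_trans y1).
  have : y * (1 - y) <= 1 - y by nra.
  by lra.
Qed.

Definition bumpD (i j : nat) (x : R) : R :=
  i%:R * bump i.-1 j x + (j%:R * (2 * bump i.+1 j.+1 x - bump i j.+1 x) -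
   (2 * bump i.+1 j.+2 x - bump i j.+2 x)).

Lemma bump_out i j x : ~~ ((0 < x) && (x < 1)) -> bump i j x = 0.
Proof. by rewrite /bump => /negbTE ->. Qed.

Lemma bump_derive i j (x : R) : is_derive x 1 (bump i j) (bumpD i j x).
Proof.
have [hx|hx] := boolP ((0 < x) && (x < 1)); last first.
  rewrite /bumpD !bump_out // !mulr0 !subr0 mulr0 addr0.
  exact: quad_derive (bump_quad i j hx).
have /andP[x0 x1] := hx.
have z0 : x * (1 - x) != 0 by rewrite mulf_neq0 // ?subr_eq0 ?gt_eqF.
have dq : is_derive x 1 bq ((2 * x - 1) * bq x ^+ 2).
  have d1 : is_derive x (1 : R) (fun x : R => x * (1 - x)) (1 - 2 * x).
    by apply: is_derive_eq; rewrite /GRing.scale /= ; ring.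
  have := @is_deriveV _ (fun x : R => x * (1 - x)) _ _ _ z0 d1.
  by move=> h; apply: (is_derive_eq h); rewrite /GRing.scale /= /bq exprVn; ring.
have de : is_derive x 1 (fun x => expR (- bq x)) (- ((2 * x - 1) * bq x ^+ 2) * expR (- bq x)).
  have := @is_derive1_comp _ expR (- bq) _ _ _ (is_derive_expR (- bq x)) (is_deriveN dq).
  by move=> h; apply: (is_derive_eq h); rewrite mulrC.
have dp : is_derive x 1 (fun x => x ^+ i * bq x ^+ j * expR (- bq x)) (bumpD i j x).
  have dx : is_derive x (1 : R) (fun x : R => x ^+ i) (i%:R * x ^+ i.-1).
    have := is_deriveX i (is_derive_id x (1 : R)).
    rewrite (_ : id ^+ i = (fun y : R => y ^+ i)); last by apply/funext => y; rewrite exprfctE.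
    by move=> h; apply: (is_derive_eq h); rewrite /GRing.scale /=; ring.
  have dqj : is_derive x 1 (fun x => bq x ^+ j) (j%:R * bq x ^+ j.-1 * ((2 * x - 1) * bq x ^+ 2)).
    have := is_deriveX j dq.
    rewrite (_ : bq ^+ j = (fun y : R => bq y ^+ j)); last by apply/funext => y; rewrite exprfctE.
    by move=> h; apply: (is_derive_eq h); rewrite /GRing.scale /=; ring.
  have := is_deriveM (is_deriveM dx dqj) de.
  move=> h; apply: (is_derive_eq h); rewrite /GRing.scale /= !fctE /bumpD /bump hx !exprS.
  case: j {dqj h} => [|j]; rewrite /= ?exprS; ring.
apply: near_eq_is_derive dp.
near=> y; rewrite /bump (_ : (0 < y) && (y < 1) = true) //.
by apply/andP; split; near: y; [exact: lt_nbhsr|exact: lt_nbhsl].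
Unshelve. all: by end_near. Qed.

(** The linear span of the bumps as a predicate, stable under differentiation, so that derivatives
    of all orders can be chosen inside it one after the other. *)
Inductive bump_span : (R -> R) -> Prop :=
| bump_span_bump i j : bump_span (bump i j)
| bump_span_lin (c : R) f g : bump_span f -> bump_span g ->
    bump_span (fun x => c * f x + g x).

Lemma bump_span_derive f : bump_span f ->
  exists2 f', bump_span f' & forall x : R, is_derive x 1 f (f' x).
Proof.
elim=> [i j|c {}f g _ [f' sf' df] _ [g' sg' dg]]; last first.
  exists (fun x => c * f' x + g' x); first exact: bump_span_lin.
  by move=> x; have := is_deriveD (is_deriveZ c (df x)) (dg x).
exists (bumpD i j); last exact: bump_derive.
rewrite /bumpD.
have b k l : bump_span (bump k l) by exact: bump_span_bump.
pose F1 x := (-2) * bump i.+1 j.+2 x + bump i j.+2 x.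
pose F2 x := (- j%:R) * bump i j.+1 x + F1 x.
pose F3 x := (2 * j%:R) * bump i.+1 j.+1 x + F2 x.
have -> : (fun x => i%:R * bump i.-1 j x + (j%:R * (2 * bump i.+1 j.+1 x - bump i j.+1 x) -
   (2 * bump i.+1 j.+2 x - bump i j.+2 x))) = (fun x => i%:R * bump i.-1 j x + F3 x).
  by apply/funext => x; rewrite /F3 /F2 /F1; ring.
by do 4 ! (apply: bump_span_lin => //).
Qed.

Definition derivs (F : nat -> R -> R) : Prop :=
  forall (n : nat) (x : R), is_derive x 1 (F n) (F n.+1 x).

Lemma bump_derivs : exists2 F, derivs F & F 0%N = bump 0 0.
Proof.
have [f|d hd] := @choice _ _ (fun f f' => bump_span f -> bump_span f' /\
    forall x : R, is_derive x 1 f (f' x)).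
  have [/bump_span_derive[f' h1 h2]|h] := pselect (bump_span f); first by exists f'.
  by exists f.
pose F n := iter n d (bump 0 0).
have hF n : bump_span (F n).
  by elim: n => [|n IH]; [exact: bump_span_bump|exact: (hd _ IH).1].
exists F => // n x; exact: (hd _ (hF n)).2.
Qed.

Lemma derivs_derive1n F : derivs F -> forall n, derive1n n (F 0%N) = F n.
Proof.
move=> hF; elim=> [//|n IH]; rewrite derive1nS IH; apply/funext => x.
by rewrite derive1E; apply: derive_val.
Qed.

Lemma derivs_smooth F : derivs F -> forall n (x : R), derivable (derive1n n (F 0%N)) x 1.
Proof. by move=> hF n x; rewrite derivs_derive1n //; have [] := hF n x. Qed.

Lemma is_derive_cont f f' : (forall x : R, is_derive x 1 f (f' x)) -> continuous f.
Proof. by move=> H x; apply/differentiable_continuous/derivable1_diffP; have [] := H x. Qed.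

Definition beta : R -> R := bump 0 0.

Lemma beta_cont : continuous beta.
Proof. exact: is_derive_cont (bump_derive 0 0). Qed.

Lemma beta_ge0 x : 0 <= beta x.
Proof. by rewrite /beta /bump; case: ifP => // _; rewrite !expr0 !mul1r expR_ge0. Qed.

Lemma beta_out x : x <= 0 \/ 1 <= x -> beta x = 0.
Proof.
by move=> h; apply: bump_out; rewrite negb_and -!leNgt; apply/orP; case: h; [left|right].
Qed.

(** A smooth transition from 0 to the height [step 1], which is left unnormalised. The base point -1
    only has to lie to the left of the support of [beta]. *)
Definition step (x : R) : R := Int `[-1, x] beta.

Lemma step_le0 x : x <= 0 -> step x = 0.
Proof.
move=> x0; rewrite /step (@Int_ext _ _ _ (fun=> 0)) ?Int0 // => y /=.
by rewrite in_itv /= => /andP[_ yx]; apply: beta_out; left; exact: le_trans x0.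
Qed.

Lemma step_ge1 x : 1 <= x -> step x = step 1.
Proof.
move=> x1; have h : (-1 : R) <= 1 by lra.
rewrite /step (Int_itv_split h x1); last exact: continuous_intg beta_cont.
rewrite (@Int_ext _ `[1, x] _ (fun=> 0)) ?Int0 ?addr0 // => y /=.
by rewrite in_itv /= => /andP[yx _]; apply: beta_out; right.
Qed.

Lemma step_derive (x : R) : is_derive x 1 step (beta x).
Proof.
have [x0|x0] := ltP x 0; last first.
  have [] := @continuous_FTC1_closed _ beta (-1) x (x + 1).
  - by rewrite ltrDl.
  - exact: continuous_intg beta_cont.
  - by apply: lt_le_trans x0; rewrite ltrN10.
  - exact: beta_cont.
  by move=> d1 d2; apply: DeriveDef; [exact: d1|rewrite -derive1E; exact: d2].
rewrite beta_out; last by left; exact: ltW.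
have hc : is_derive x (1 : R) (cst (0 : R)) 0 by exact: is_derive_cst.
apply: near_eq_is_derive hc.
near=> y; rewrite step_le0 //.
by near: y; exact: lt_le_nbhsl.
Unshelve. all: by end_near. Qed.

Lemma step_ac : ac step beta.
Proof.
have -> : beta = derive1 step.
  by apply/funext => x; rewrite derive1E; apply/esym/(@derive_val _ _ _ _ _ _ _ (step_derive x)).
apply: ac_C1 => [x|]; first by have [] := step_derive x.
have -> : derive1 step = beta.
  by apply/funext => x; rewrite derive1E; apply/(@derive_val _ _ _ _ _ _ _ (step_derive x)).
exact: beta_cont.
Qed.

Lemma step_bnd x : 0 <= step x <= step 1.
Proof.
apply/andP; split; first by apply: Int_ge0 => y _; exact: beta_ge0.
have [x1|x1] := leP x 1; last by rewrite step_ge1 // ltW.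
have [_ h] := step_ac x1; rewrite -subr_ge0 h.
by apply: Int_ge0 => y _; exact: beta_ge0.
Qed.

Lemma step1_gt0 : 0 < step 1.
Proof.
rewrite lt_def (proj1 (andP (step_bnd 1))) andbT; apply/eqP => s0.
have s1 x : step x = 0.
  by apply/eqP; rewrite eq_le; have := step_bnd x; rewrite s0 andbC.
have := @derive_val _ _ _ _ _ _ _ (step_derive 2^-1).
have -> : step = cst 0 by apply/funext.
rewrite derive_cst => /esym; rewrite /beta /bump.
have -> : ((0 : R) < 2^-1) && ((2^-1 : R) < 1) by apply/andP; split; lra.
by rewrite !expr0 !mul1r => /eqP; rewrite gt_eqF // expR_gt0.
Qed.

(** It rises on [[a - 1/n, a]], equals [step 1] on [[a, b]] and falls on [[b, b + 1/n]]: a smooth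
    multiple of the indicator function of [[a, b]] in the limit. *)
Definition plateau (n a b x : R) : R := step (n * (x - a) + 1) - step (n * (x - b)).

Lemma affine_derive f (f' : R -> R) (n p x : R) : (forall x : R, is_derive x 1 f (f' x)) ->
  is_derive x 1 (fun x => f (n * x + p)) (n * f' (n * x + p)).
Proof.
move=> H; have da : is_derive x (1 : R) (fun x : R => n * x + p) n.
  by apply: is_derive_eq; rewrite /GRing.scale /=; ring.
have := @is_derive1_comp _ f (fun x => n * x + p) _ _ _ (H (n * x + p)) da.
by move=> h; apply: (is_derive_eq h); rewrite mulrC.
Qed.

Lemma plateau_derive (n a b x : R) : is_derive x 1 (plateau n a b)
  (n * (beta (n * (x - a) + 1) - beta (n * (x - b)))).
Proof.
have := is_deriveB (affine_derive n (1 - n * a) x step_derive)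
   (affine_derive n (- (n * b)) x step_derive).
have -> : (fun x => step (n * x + (1 - n * a))) - (fun x => step (n * x - n * b)) =
   plateau n a b.
  by apply/funext => y; rewrite /plateau /= !fctE; congr (step _ - step _); ring.
move=> h; apply: (is_derive_eq h); rewrite mulrBr.
by congr (n * beta _ - n * beta _); ring.
Qed.

Lemma plateau_out (n a b x : R) : 1 <= n -> a <= b -> x <= a - 1 \/ b + 1 <= x -> plateau n a b x = 0.
Proof.
move=> n1 ab [h|h]; rewrite /plateau.
  by rewrite !step_le0 ?subrr //; nra.
by rewrite !step_ge1 ?subrr //; nra.
Qed.

Lemma plateau_test (n a b : R) : 1 <= n -> a <= b -> test_function (plateau n a b).
Proof.
move=> n1 ab; have [F hF F0] := bump_derivs.
pose G (m : nat) (x : R) := if m is m'.+1 then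
  n ^+ m * (F m' (n * (x - a) + 1) - F m' (n * (x - b))) else plateau n a b x.
have dG : derivs G.
  move=> m x; case: m => [|m] /=.
    by rewrite F0 expr1; exact: plateau_derive.
  have := is_deriveZ (n ^+ m.+1) (is_deriveB (affine_derive n (1 - n * a) x (hF m))
     (affine_derive n (- (n * b)) x (hF m))).
  have -> : n ^+ m.+1 \*: ((fun x => F m (n * x + (1 - n * a))) - (fun x => F m (n * x - n * b))) =
    (fun x => n ^+ m.+1 * (F m (n * (x - a) + 1) - F m (n * (x - b)))).
    apply/funext => y; rewrite /= !fctE; congr (_ * (F m _ - F m _)); ring.
  move=> h; apply: (is_derive_eq h); rewrite /GRing.scale /= [in RHS]exprSr -mulrA; congr (_ * _).
  by rewrite mulrBr; congr (n * F _ _ - n * F _ _); ring.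
split; first exact: (derivs_smooth dG).
exists (`|a| + `|b| + 1) => x hx; apply: plateau_out => //.
have ha : `|a| >= a /\ `|a| >= - a by rewrite ler_norm -normrN ler_norm.
have hb : `|b| >= b /\ `|b| >= - b by rewrite ler_norm -normrN ler_norm.
have [x0|x0] := leP 0 x; move: hx; [rewrite (ger0_norm x0)|rewrite (ltr0_norm x0)] => hx.
  by right; lra.
by left; lra.
Qed.

Lemma plateau_cvg (a b : R) x : a <= b ->
  plateau n.+1%:R a b x @[n --> \oo] --> (if (a <= x) && (x <= b) then step 1 else 0).
Proof.
move=> ab; apply: cvg_near_cst.
have arch (d : R) : 0 < d -> \forall n \near \oo, 1 <= n.+1%:R * d.
  move=> d0; exists (Num.truncn d^-1) => // n /= hn.
  rewrite -ler_pdivrMr // mul1r ltW // (lt_le_trans (truncnS_gt _)) //.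
  by rewrite ler_nat ltnS.
case: ifP => [/andP[ax xb]|h].
  apply: nearW => n; rewrite /plateau step_ge1; last first.
    by rewrite lerDr mulr_ge0 // subr_ge0.
  by rewrite [X in _ - X]step_le0 ?subr0 // mulr_ge0_le0 // subr_le0.
have [xa|ax] := ltP x a.
  have := arch (a - x); rewrite subr_gt0 => /(_ xa); apply: filterS => n hn.
  rewrite /plateau !step_le0 ?subrr //; last by lra.
  have n0 : 0 < (n.+1%:R : R) by [].
  by nra.
have xb : b < x by move: h; rewrite ax /= => /negbT; rewrite -ltNge.
have := arch (x - b); rewrite subr_gt0 => /(_ xb); apply: filterS => n hn.
by rewrite /plateau (step_ge1 hn) step_ge1 ?subrr // lerDr mulr_ge0 // subr_ge0.
Qed.

(** The du Bois-Reymond argument with plateaus as test functions. One side tends to [step 1] times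
    the integral of [g]; on the other, the derivative of the plateau consists of two bumps of mass
    [step 1] that concentrate at [a] and [b]. *)
Lemma weak_ac f g : continuous f -> measurable_fun setT g ->
  (forall a b, intg `[a, b] g) ->
  (forall k : R -> R, test_function k ->
    Int setT (fun x => f x * derive1 k x) = - Int setT (fun x => g x * k x)) ->
  ac f g.
Proof.
move=> cf mg ig H a b ab; split => //.
pose k (n : nat) := plateau n.+1%:R a b.
have n1 (n : nat) : (1 : R) <= n.+1%:R by rewrite ler1n.
have kder n : derive1 (k n) = fun x => n.+1%:R * (beta (n.+1%:R * (x - a) + 1) - beta (n.+1%:R * (x - b))).
  by apply/funext => x; rewrite derive1E; apply/(@derive_val _ _ _ _ _ _ _ (plateau_derive _ a b x)).
have kc n : continuous (k n) by exact: is_derive_cont (plateau_derive _ a b).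
have R1 : Int setT (fun x => g x * k n x) @[n --> \oo] --> step 1 * Int `[a, b] g.
  have -> : step 1 * Int `[a, b] g =
      Int setT (fun x => g x * (if (a <= x) && (x <= b) then step 1 else 0)).
    rewrite -IntZ // /Int Rintegral_mkcond; apply: eq_Rintegral => x _.
    rewrite patchE mem_setE in_itv /=; case: ifP => _; rewrite ?mulr0 //.
    exact: mulrC.
  (* All plateaus live in [[a - 1, b + 1]] and are bounded by [step 1], which gives one dominating
     function for every [n]. *)
  pose G := fun x => if (a - 1 <= x) && (x <= b + 1) then step 1 * `|g x| else 0.
  have eG : G = (fun x => step 1 * `|g x|) \_ `[a - 1, b + 1].
    by apply/funext => x; rewrite patchE mem_setE in_itv.
  apply: (@Int_dct _ _ _ _ G) => //.
  - by move=> n; apply: measurable_funM => //; exact: continuous_meas.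
  - apply: measurable_funM => //.
    rewrite (_ : (fun x => if _ then _ else _) = (fun x => step 1 * \1_(`[a, b] : set R) x)); last first.
      by apply/funext => x; rewrite indicE mem_setE in_itv /=; case: ifP; rewrite ?mulr1 ?mulr0.
    by apply: measurable_funM => //; exact: measurable_indic.
  - rewrite eG; apply: intg_patch => //.
    by apply: intgZ => //; exact: intg_abs.
  - move=> n x _; rewrite normrM mulrC /G.
    case: ifP => [_|hx].
      rewrite ler_wpM2r //.
      have := step_bnd (n.+1%:R * (x - a) + 1); have := step_bnd (n.+1%:R * (x - b)).
      by rewrite /k /plateau ler_norml => /andP[h1 h2] /andP[h3 h4]; apply/andP; split; lra.
    rewrite /k plateau_out ?normr0 ?mul0r //.
    move: hx => /negbT; rewrite negb_and -!ltNge => /orP[h|h]; [left|right]; exact: ltW.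
  - by move=> x _; apply: cvgM; [exact: cvg_cst|exact: plateau_cvg].
have L1 : Int setT (fun x => f x * derive1 (k n) x) @[n --> \oo] --> step 1 * (f a - f b).
  apply/cvgrPdist_le => e e0.
  have e1 : 0 < e / (2 * step 1) by rewrite divr_gt0 // mulr_gt0 // step1_gt0.
  have [d1 d10 H1] := continuousEP cf a e1; have [d2 d20 H2] := continuousEP cf b e1.
  pose d := Num.min 1 (Num.min d1 d2).
  have d0 : 0 < d by rewrite !lt_min ltr01 d10.
  exists (Num.truncn d^-1) => // n /= hn.
  have hnd : n.+1%:R^-1 <= d.
    rewrite -[d]invrK lef_pV2 ?posrE ?invr_gt0 // ltW // (lt_le_trans (truncnS_gt _)) //.
    by rewrite ler_nat ltnS.
  move: hnd; rewrite !le_min => /and3P[hd0 hd1 hd2].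
  move: hd0 hd1 hd2; set N : R := n.+1%:R => hd0 hd1 hd2; have N0 : 0 < N by rewrite ltr0n.
  pose B1 x := N * beta (N * (x - a) + 1); pose B2 x := N * beta (N * (x - b)).
  have lin_cont (p q : R) : continuous (fun x : R => p * (x - q)).
    move=> x; apply: cvgM; [exact: cvg_cst|apply: cvgB; [exact: cvg_id|exact: cvg_cst]].
  have cB1 : continuous B1.
    move=> x; apply: cvgM; first exact: cvg_cst.
    apply: (@continuous_comp _ _ _ (fun x => N * (x - a) + 1)); last exact: beta_cont.
    by apply: cvgD; [exact: lin_cont|exact: cvg_cst].
  have cB2 : continuous B2.
    move=> x; apply: cvgM; first exact: cvg_cst.
    by apply: (@continuous_comp _ _ _ (fun x => N * (x - b))); [exact: lin_cont|exact: beta_cont].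
  have B1d (x : R) : is_derive x 1 (fun x => step (N * (x - a) + 1)) (B1 x).
    have := affine_derive N (1 - N * a) x step_derive.
    rewrite (_ : (fun x => step (N * x + _)) = (fun x => step (N * (x - a) + 1))); last first.
      by apply/funext => y; congr step; ring.
    by move=> h; apply: (is_derive_eq h); rewrite /B1; congr (_ * beta _); ring.
  have B2d (x : R) : is_derive x 1 (fun x => step (N * (x - b))) (B2 x).
    have := affine_derive N (- (N * b)) x step_derive.
    rewrite (_ : (fun x => step (N * x + _)) = (fun x => step (N * (x - b)))); last first.
      by apply/funext => y; congr step; ring.
    by move=> h; apply: (is_derive_eq h); rewrite /B2; congr (_ * beta _); ring.
  have dE (F F' : R -> R) : (forall x : R, is_derive x 1 F (F' x)) -> derive1 F = F'.
    by move=> h; apply/funext => x; rewrite derive1E; apply/(@derive_val _ _ _ _ _ _ _ (h x)).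
  have aB1 : ac (fun x => step (N * (x - a) + 1)) B1.
    rewrite -(dE _ _ B1d); apply: ac_C1; first by move=> x; have [] := B1d x.
    by rewrite (dE _ _ B1d).
  have aB2 : ac (fun x => step (N * (x - b))) B2.
    rewrite -(dE _ _ B2d); apply: ac_C1; first by move=> x; have [] := B2d x.
    by rewrite (dE _ _ B2d).
  (* An approximate identity: a nonnegative bump of mass [step 1], supported where [f] is close to
     [f p], integrates [f] to nearly [step 1 * f p]. It serves at [a] from the left and at [b] from
     the right. *)
  have key (B : R -> R) (p l r : R) : continuous B -> (forall x, 0 <= B x) ->
      (forall x, ~~ (l <= x <= r) -> B x = 0) -> l <= r -> Int `[l, r] B = step 1 ->
      (forall x, l <= x <= r -> `|f x - f p| <= e / (2 * step 1)) ->
      intg setT (fun x => f x * B x) /\ `|Int setT (fun x => f x * B x) - step 1 * f p| <= e / 2.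
    move=> cB B0 Bout lr IB hp.
    pose M := `|l| + `|r|.
    have out x : M < `|x| -> f x * B x = 0.
      move=> hx; rewrite Bout ?mulr0 //; apply/negP => /andP[h1 h2].
      move: hx; rewrite ltNge ler_norml => /negP; apply.
      have := ler_norm r; have := ler_norm (- l); rewrite normrN.
      have := normr_ge0 l; have := normr_ge0 r; rewrite /M => ? ? ? ?.
      by apply/andP; split; lra.
    have cfB : continuous (fun x => f x * B x) by move=> x; apply: cvgM; [exact: cf|exact: cB].
    have [iT eT] := Int_support out (continuous_intg _ _ cfB) (continuous_meas cfB).
    split => //.
    have -> : Int setT (fun x => f x * B x) = Int `[l, r] (fun x => f x * B x).
      rewrite {1}(_ : setT = `[l, r]%classic `|` ~` `[l, r]%classic); last by rewrite setUv.
      rewrite Int_setU ?setICr //; last 2 first.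
      - exact: measurableC.
      - by rewrite setUv.
      rewrite (@Int_ext _ (~` _) _ (fun=> 0)) ?Int0 ?addr0 // => x /negP.
      by rewrite in_itv /= => hx; rewrite Bout ?mulr0 //; apply/negP.
    have iB : intg `[l, r] B by exact: continuous_intg.
    have ifB : intg `[l, r] (fun x => f x * B x) by exact: continuous_intg.
    have ipB : intg `[l, r] (fun x => f p * B x) by exact: intgZ.
    have ieB : intg `[l, r] (fun x => e / (2 * step 1) * B x) by exact: intgZ.
    rewrite -IB (mulrC _ (f p)) -IntZ // -IntB //.
    apply: (@le_trans _ _ (Int `[l, r] (fun x => e / (2 * step 1) * B x))).
      apply: Int_norm_le => //; first by apply: intg_meas; exact: intgB.
      move=> x /=; rewrite in_itv /= => hx; rewrite -mulrBl normrM (ger0_norm (B0 x)).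
      by rewrite ler_wpM2r // hp.
    rewrite IntZ // IB.
    rewrite le_eqVlt; apply/orP; left; apply/eqP; field.
    by rewrite gt_eqF // step1_gt0.
  have [i1 k1] : intg setT (fun x => f x * B1 x) /\
      `|Int setT (fun x => f x * B1 x) - step 1 * f a| <= e / 2.
    apply: (key B1 a (a - N^-1) a) => //.
    - by move=> x; rewrite mulr_ge0 ?beta_ge0 // ltW.
    - move=> x; rewrite negb_and -!ltNge => hx; rewrite /B1 beta_out ?mulr0 //.
      case/orP: hx => hx; [left|right]; last by rewrite lerDr mulr_ge0 ?subr_ge0 ?ltW.
      have : N * (x - a) <= N * - N^-1 by rewrite ler_pM2l // lerBlDr addrC; exact: ltW.
      by rewrite mulrN divff ?gt_eqF //; lra.
    - by rewrite gerBl invr_ge0 ltW.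
    - have [|_ <-] := aB1 (a - N^-1) a; first by rewrite gerBl invr_ge0 ltW.
      rewrite subrr mulr0 add0r (_ : N * _ + 1 = 0); last by field; rewrite gt_eqF.
      by rewrite [X in _ - X]step_le0 ?subr0.
    - move=> x /andP[h1 h2]; apply: H1; move: (N^-1) hd1 h1 => M hd1 h1; rewrite ler_norml; apply/andP; split; lra.
  have [i2 k2] : intg setT (fun x => f x * B2 x) /\
      `|Int setT (fun x => f x * B2 x) - step 1 * f b| <= e / 2.
    apply: (key B2 b b (b + N^-1)) => //.
    - by move=> x; rewrite mulr_ge0 ?beta_ge0 // ltW.
    - move=> x; rewrite negb_and -!ltNge => hx; rewrite /B2 beta_out ?mulr0 //.
      case/orP: hx => hx; [left|right]; first by rewrite mulr_ge0_le0 ?ltW ?subr_lt0.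
      have : N * N^-1 <= N * (x - b) by rewrite ler_pM2l // lerBrDr addrC; exact: ltW.
      by rewrite divff ?gt_eqF.
    - by rewrite lerDl invr_ge0 ltW.
    - have [|_ <-] := aB2 b (b + N^-1); first by rewrite lerDl invr_ge0 ltW.
      rewrite subrr mulr0 [X in _ - X]step_le0 // subr0 (_ : N * _ = 1) //.
      by field; rewrite gt_eqF.
    - move=> x /andP[h1 h2]; apply: H2; move: (N^-1) hd2 h2 => M hd2 h2; rewrite ler_norml; apply/andP; split; lra.
  have -> : Int setT (fun x => f x * derive1 (k n) x) =
      Int setT (fun x => f x * B1 x) - Int setT (fun x => f x * B2 x).
    by rewrite -IntB //; apply: Int_ext => x _; rewrite kder /B1 /B2 -/N; ring.
  rewrite (_ : _ - _ = - ((Int setT (fun x => f x * B1 x) - step 1 * f a) -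
     (Int setT (fun x => f x * B2 x) - step 1 * f b))); last first.
    by move: (Int _ _) (Int _ _) (step 1) => p q r; ring.
  by rewrite normrN (le_trans (ler_normB _ _)) //; lra.
have R2 : Int setT (fun x => f x * derive1 (k n) x) @[n --> \oo] --> - (step 1 * Int `[a, b] g).
  rewrite (_ : (fun n => _) = (fun n => - Int setT (fun x => g x * k n x))); last first.
    by apply/funext => n; rewrite H //; exact: plateau_test.
  exact: cvgN.
have E : step 1 * (f a - f b) = - (step 1 * Int `[a, b] g).
  by rewrite -(cvg_lim (@norm_hausdorff _ _) L1); exact: (cvg_lim (@norm_hausdorff _ _) R2).
have : step 1 * (f b - f a) = step 1 * Int `[a, b] g by lra.
by apply: mulfI; rewrite gt_eqF // step1_gt0.
Qed.

End test_functions.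

(** * Square integrable functions and dyadic slopes *)

Section L2_complete.
Context {R : realType}.
Local Notation mu := (@lebesgue_measure R).
Implicit Types (f g h u v : R -> R).

Definition L2r f : Prop := measurable_fun setT f /\ intg setT (fun x => f x ^+ 2).

Lemma sqr_lin_le (a b c : R) : (c * a + b) ^+ 2 <= 2 * c ^+ 2 * a ^+ 2 + 2 * b ^+ 2.
Proof.
rewrite -subr_ge0 (_ : _ - _ = (c * a - b) ^+ 2); last by ring.
exact: sqr_ge0.
Qed.

Lemma normr_le_sqr (a : R) : `|a| <= 1 + a ^+ 2.
Proof.
rewrite -(real_normK (num_real a)) -subr_ge0.
rewrite (_ : _ - _ = (`|a| - 1 / 2) ^+ 2 + 3 / 4); last by field.
by rewrite addr_ge0 ?sqr_ge0 //; lra.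
Qed.

Lemma L2r_lin f g (c : R) : L2r f -> L2r g -> L2r (fun x => c * f x + g x).
Proof.
move=> [mf hf] [mg hg]; have m : measurable_fun setT (fun x => c * f x + g x).
  by apply: measurable_funD => //; apply: measurable_funM.
split => //.
apply: (@intg_dom _ _ _ (fun x => 2 * c ^+ 2 * f x ^+ 2 + 2 * g x ^+ 2)) => //.
- exact: measurable_funX.
- by move=> x _; rewrite ger0_norm ?sqr_ge0 //; exact: sqr_lin_le.
- by apply: intgD => //; exact: intgZ.
Qed.

Lemma L2rZ f (c : R) : L2r f -> L2r (fun x => c * f x).
Proof.
move=> [mf hf]; split; first exact: measurable_funM.
apply: (@intg_ext _ _ (fun x => c ^+ 2 * f x ^+ 2)); last exact: intgZ.
by move=> x; rewrite exprMn.
Qed.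

Lemma L2rB f g : L2r f -> L2r g -> L2r (fun x => f x - g x).
Proof.
move=> hf hg; have := L2r_lin (-1) hg hf.
by rewrite (_ : (fun x => _ + _) = (fun x => f x - g x)) //; apply/funext => x; ring.
Qed.

Lemma L2rD f g : L2r f -> L2r g -> L2r (fun x => f x + g x).
Proof.
move=> hf hg; have := L2r_lin 1 hf hg.
by rewrite (_ : (fun x => _ + _) = (fun x => f x + g x)) //; apply/funext => x; ring.
Qed.

Lemma L2rM f g : L2r f -> L2r g -> intg setT (fun x => f x * g x).
Proof. by move=> [mf hf] [mg hg]; exact: CS_intg. Qed.

Lemma L2r_intg f (a b : R) : L2r f -> intg `[a, b] f.
Proof.
move=> [mf hf]; apply: (@intg_dom _ _ _ (fun x => 1 + f x ^+ 2)) => //.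
- exact: measurable_funS mf.
- by move=> x _; exact: normr_le_sqr.
- by apply: intgD => //; [exact: cst_intg|exact: intg_sub].
Qed.

Lemma L2r_Int_le f (a b : R) : a <= b -> L2r f ->
  Int `[a, b] f ^+ 2 <= (b - a) * Int setT (fun x => f x ^+ 2).
Proof.
move=> ab [mf hf]; have mi : measurable (`[a, b]%classic : set R) by [].
have h2 : intg `[a, b] (fun x => f x ^+ 2) by exact: intg_sub.
have := @CS_Int _ `[a, b]%classic (fun=> 1) f mi (measurable_cst _) (measurable_funS _ _ mf).
rewrite (_ : (fun x => 1 * f x) = f); last by apply/funext => x; rewrite mul1r.
rewrite (_ : (fun=> 1 ^+ 2) = (fun=> 1)); last by apply/funext => x; rewrite expr1n.
rewrite Int_cst // mul1r => H; apply: (le_trans (H _ _ _ _)) => //; first exact: cst_intg.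
rewrite ler_wpM2l ?subr_ge0 //; apply: Int_subset => // x _; exact: sqr_ge0.
Qed.

Lemma cvg_geo_incr (s : nat -> R) (M : R) :
  (forall i, `|s i.+1 - s i| <= M * (1 / 2) ^+ i) -> cvgn s.
Proof.
move=> H; have : cvgn (series (fun i => s i.+1 - s i)).
  apply: normed_cvg; apply: (@series_le_cvg _ _ (geometric M (1 / 2))) => //.
  - by move=> n; exact: normr_ge0.
  - by move=> n; rewrite /geometric /= (le_trans _ (H n)).
  - apply: is_cvg_geometric_series; rewrite ger0_norm; lra.
have -> : series (fun i => s i.+1 - s i) = (fun n => s n - s 0%N).
  by apply/funext => n; rewrite /series /= telescope_sumr.
move=> /cvgP/cvg_ex[l hl]; apply/cvg_ex; exists (l + s 0%N).
have h : (fun n => (s n - s 0%N) + s 0%N) n @[n --> \oo] --> l + s 0%N.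
  by apply: cvgD => //; exact: cvg_cst.
by move: h; rewrite (_ : (fun n => _) = s) //; apply/funext => n; rewrite subrK.
Qed.

(** The weights [4^i] against the rate [16^(-i)] leave [4^(-i)], so the weighted sum [T] of squared
    increments is integrable and finite almost everywhere. There each increment is at most
    [sqrt T * 2^(-i)], and the sequence converges geometrically. *)
Lemma L2_fast_limit (f : nat -> R -> R) : (forall i, measurable_fun setT (f i)) ->
  (forall i, intg setT (fun x => (f i.+1 x - f i x) ^+ 2)) ->
  (forall i, Int setT (fun x => (f i.+1 x - f i x) ^+ 2) <= (1 / 16) ^+ i) ->
  exists2 g : R -> R, measurable_fun setT g & {ae mu, forall x, f i x @[i --> \oo] --> g x}.
Proof.
move=> mf hi hI.
pose t i x := 4 ^+ i * (f i.+1 x - f i x) ^+ 2.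
have mt i : measurable_fun setT (t i).
  by apply: measurable_funM => //; apply: measurable_funX; exact: measurable_funB.
have t0 i x : 0 <= t i x by rewrite mulr_ge0 ?sqr_ge0 // exprn_ge0.
pose T x := (\sum_(0 <= i <oo) (t i x)%:E)%E.
have mT : measurable_fun setT T.
  apply: ge0_emeasurable_sum => // [i x _ _|i _]; first by rewrite lee_fin.
  by apply/measurable_EFinP; exact: mt.
have IT : (\int[mu]_x T x < +oo)%E.
  rewrite integral_nneseries //; last 2 first.
  - by move=> i; apply/measurable_EFinP; exact: mt.
  - by move=> i x _; rewrite lee_fin.
  have le i : (\int[mu]_x (t i x)%:E <= ((geometric 1 (1 / 4) i) : R)%:E)%E.
    rewrite intg_EFin //; last exact: intgZ.
    rewrite lee_fin IntZ // /geometric /= mul1r.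
    apply: (le_trans (ler_wpM2l _ (hI i))); first exact: exprn_ge0.
    by rewrite -exprMn; rewrite (_ : 4 * (1 / 16) = 1 / 4) //; lra.
  apply: (@le_lt_trans _ _ (\sum_(0 <= i <oo) ((geometric 1 (1 / 4) i) : R)%:E)%E).
    apply: lee_nneseries => [i _ _|i _ //].
    by apply: integral_ge0 => x _; rewrite lee_fin.
  have cg : cvgn (series (geometric 1 (1 / 4 : R))).
    by apply: is_cvg_geometric_series; rewrite ger0_norm; lra.
  rewrite (_ : (\sum_(0 <= i <oo) _)%E = (limn (series (geometric 1 (1 / 4 : R))))%:E) ?ltry //.
  rewrite -EFin_lim //; congr (limn _); apply/funext => n.
  by rewrite /= /series /= sumEFin.
have aeT : {ae mu, forall x, (T x < +oo)%E}.
  have iT : mu.-integrable setT T.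
    apply/integrableP; split => //.
    have T0 x : (0 <= T x)%E by apply: nneseries_ge0 => i _ _; rewrite lee_fin.
    by under eq_integral do rewrite (gee0_abs (T0 _)).
  have := integrable_ae (@measurableT _ _) iT.
  apply: filterS => x /(_ I); rewrite fin_numE => /andP[_]; rewrite -ltey; exact.
pose g x := fine (limn_esup (fun i => (f i x)%:E)).
exists g.
  apply: measurableT_comp => //; apply: measurable_fun_limn_esup => i.
  by apply/measurable_EFinP; exact: mf.
apply: (@filterS _ _ (ae_filter_ringOfSetsType mu) _ _ _ aeT) => x Tx.
have Tfin : T x \is a fin_num.
  by rewrite ge0_fin_numE // nneseries_ge0 // => i _ _; rewrite lee_fin.
have tM i : t i x <= fine (T x).
  rewrite -lee_fin fineK //; apply: (@le_trans _ _ (\sum_(0 <= j < i.+1) (t j x)%:E)%E).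
    by rewrite big_nat_recr //= leeDr // sume_ge0 // => j _; rewrite lee_fin.
  by apply: nneseries_lim_ge => j _ _; rewrite lee_fin.
have M0 : 0 <= fine (T x) by apply: le_trans (t0 0%N x) (tM 0%N).
have cs : cvgn (fun i => f i x).
  apply: (@cvg_geo_incr _ (Num.sqrt (fine (T x)))) => i.
  have h12 : (0 : R) <= 1 / 2 by lra.
  rewrite -(@ler_pXn2r _ 2) ?nnegrE ?mulr_ge0 ?sqrtr_ge0 ?exprn_ge0 //.
  rewrite real_normK ?num_real // exprMn sqr_sqrtr // exprAC.
  rewrite (_ : (1 / 2) ^+ 2 = 4^-1 :> R); last by lra.
  by rewrite exprVn ler_pdivlMr ?exprn_gt0 // mulrC; exact: tM.
have [l hl] := (cvg_ex _).1 cs.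
suff -> : g x = l by [].
rewrite /g; have : (f i x)%:E @[i --> \oo] --> l%:E by apply/fine_cvgP; split; [exact: nearW|].
move=> hc; rewrite is_cvg_limn_esupE; first by rewrite (cvg_lim _ hc).
by apply/cvg_ex; exists l%:E.
Qed.

Lemma fatou_le (h : nat -> R -> R) g (e : R) : (forall i, measurable_fun setT (h i)) ->
  (forall i x, 0 <= h i x) -> (forall i, intg setT (h i)) -> measurable_fun setT g ->
  (\forall i \near \oo, Int setT (h i) <= e) ->
  {ae mu, forall x, h i x @[i --> \oo] --> g x} -> (forall x, 0 <= g x) ->
  intg setT g /\ Int setT g <= e.
Proof.
move=> mh h0 hi mg hN cv g0.
have E : (\int[mu]_x (g x)%:E <= e%:E)%E.
  have -> : (\int[mu]_x (g x)%:E = \int[mu]_x (limn_einf (fun i => (h i x)%:E)))%E.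
    apply: ae_eq_integral => //; first exact/measurable_EFinP.
    - rewrite /limn_einf; apply: measurableT_comp => //.
      apply: measurable_fun_limn_esup => i; apply: measurableT_comp => //.
      by apply/measurable_EFinP; exact: mh.
    - apply: (@filterS _ _ (ae_filter_ringOfSetsType mu) _ _ _ cv) => x hx _.
      have : (h i x)%:E @[i --> \oo] --> (g x)%:E by apply/fine_cvgP; split; [exact: nearW|].
      move=> hc; rewrite is_cvg_limn_einfE; first by rewrite (cvg_lim _ hc).
      by apply/cvg_ex; exists (g x)%:E.
  apply: le_trans (fatou _ _ _ _) _ => //.
  - by move=> i; apply/measurable_EFinP; exact: mh.
  - by move=> i x _; rewrite lee_fin.
  rewrite limn_einf_lim; apply: lime_le.
    by apply: ereal_nondecreasing_is_cvgn; exact: nondecreasing_einfs.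
  case: hN => N _ HN; near=> n.
  apply: (@le_trans _ _ (\int[mu]_x (h (maxn n N) x)%:E)%E).
    by apply: ereal_inf_lbound; exists (maxn n N) => //=; exact: leq_maxl.
  by rewrite intg_EFin // lee_fin HN //=; exact: leq_maxr.
have ig : intg setT g.
  apply/integrableP; split; first exact/measurable_EFinP.
  under eq_integral do rewrite /= ger0_norm //.
  exact: le_lt_trans E (ltry _).
by split => //; rewrite -lee_fin -intg_EFin.
Unshelve. all: by end_near. Qed.

(** Riesz-Fischer: a fast subsequence converges almost everywhere, and Fatou's lemma transfers the
    Cauchy bound to its limit. *)
Lemma L2_complete (f : nat -> R -> R) : (forall i, L2r (f i)) ->
  (forall e : R, 0 < e -> exists N, forall m n, (N <= m)%N -> (N <= n)%N ->
     Int setT (fun x => (f m x - f n x) ^+ 2) <= e) ->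
  exists2 g, L2r g & forall e : R, 0 < e -> exists N, forall n, (N <= n)%N ->
     Int setT (fun x => (f n x - g x) ^+ 2) <= e.
Proof.
move=> hf hC.
have [i|N hN] := @choice nat nat (fun i N => forall m n, (N <= m)%N -> (N <= n)%N ->
     Int setT (fun x => (f m x - f n x) ^+ 2) <= (1 / 16) ^+ i).
  by apply: hC; rewrite exprn_gt0 //; lra.
pose k := fix k (i : nat) : nat := if i is i'.+1 then maxn (k i') (maxn i (N i)) else N 0%N.
have kN i : (N i <= k i)%N by case: i => [//|i] /=; rewrite !leq_max leqnn !orbT.
have ki i : (i <= k i)%N by case: i => [//|i] /=; rewrite !leq_max leqnn !orbT.
have kS i : (k i <= k i.+1)%N by rewrite /= leq_maxl.
have hd m n : L2r (fun x => f m x - f n x) by exact: L2rB.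
have [|||g mg cv] := @L2_fast_limit (fun i => f (k i)).
- by move=> i; have [] := hf (k i).
- by move=> i; have [] := hd (k i.+1) (k i).
- by move=> i; apply: hN => //; rewrite (leq_trans (kN i)).
have key n (e : R) : (exists M, (M <= n)%N /\ forall m, (M <= m)%N -> Int setT (fun x => (f n x - f m x) ^+ 2) <= e) ->
    intg setT (fun x => (f n x - g x) ^+ 2) /\ Int setT (fun x => (f n x - g x) ^+ 2) <= e.
  move=> [M [_ HM]]; apply: (@fatou_le (fun i x => (f n x - f (k i) x) ^+ 2)).
  - by move=> i; apply: measurable_funX; have [] := hd n (k i).
  - by move=> i x; exact: sqr_ge0.
  - by move=> i; have [] := hd n (k i).
  - by apply: measurable_funX; apply: measurable_funB => //; have [] := hf n.
  - exists M => // i /= Mi; apply: HM; exact: leq_trans (ki i).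
  - apply: (@filterS _ _ (ae_filter_ringOfSetsType mu) _ _ _ cv) => x hx.
    by apply: cvgM; apply: cvgB => //; exact: cvg_cst.
  - by move=> x; exact: sqr_ge0.
have hg : L2r g.
  have [N1 HN1] := hC 1 ltr01.
  have [] := key N1 1; first by exists N1; split => // m Nm; exact: HN1.
  move=> i1 _; have l2 : L2r (fun x => f N1 x - g x).
    by split => //; apply: measurable_funB => //; have [] := hf N1.
  have := L2rB (hf N1) l2.
  by rewrite (_ : (fun x => _ - _) = g) //; apply/funext => x; ring.
exists g => // e e0; have [M HM] := hC _ e0; exists M => n Mn.
by apply: (key n e _).2; exists M; split => // m Mm; exact: HM.
Qed.

End L2_complete.

Section dyadic.
Context {R : realType}.
Local Notation mu := (@lebesgue_measure R).
Implicit Types (f g h u v : R -> R).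

Definition mesh (k : nat) : R := (2 ^+ k)^-1.
Definition node (k j : nat) : R := - k%:R + j%:R * mesh k.
Definition ncell (k : nat) : nat := (k * 2 ^ k.+1)%N.
Definition incr (k : nat) u (j : nat) : R := u (node k j.+1) - u (node k j).
Definition cell (k j : nat) : set R := `[node k j, node k j.+1[%classic.

(* Slopes of the piecewise linear interpolation of [u] at the dyadic points of
   level [k] in [[-k, k]]. *)
Definition slope (k : nat) u (x : R) : R :=
  \sum_(j < ncell k) (2 ^+ k * incr k u j) * \1_(cell k j) x.

Definition energy (k : nat) u : R := \sum_(j < ncell k) 2 ^+ k * incr k u j ^+ 2.

Lemma mesh_gt0 k : 0 < mesh k. Proof. by rewrite invr_gt0 exprn_gt0. Qed.

Lemma nodeS k j : node k j.+1 = node k j + mesh k.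
Proof. by rewrite /node -natr1; ring. Qed.

Lemma node_lt k i j : (i < j)%N -> node k i < node k j.
Proof. by move=> ij; rewrite /node ltrD2l ltr_pM2r ?mesh_gt0 // ltr_nat. Qed.

Lemma node_le k i j : (i <= j)%N -> node k i <= node k j.
Proof. by move=> ij; rewrite /node lerD2l ler_pM2r ?mesh_gt0 // ler_nat. Qed.

Lemma measurable_cell k j : measurable (cell k j).
Proof. exact: measurable_itv. Qed.

Lemma slope_cell k u j x : (j < ncell k)%N -> cell k j x -> slope k u x = 2 ^+ k * incr k u j.
Proof.
move=> jN; rewrite /cell /= in_itv /= => /andP[h1 h2].
rewrite /slope (bigD1 (Ordinal jN)) //= big1 ?addr0.
  by rewrite indicE mem_set ?mulr1 // /cell /= in_itv /= h1.
move=> i ij; rewrite indicE memNset ?mulr0 // /cell /= in_itv /= => /andP[h3 h4].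
have : (val i < j)%N || (j < val i)%N by rewrite -neq_ltn.
case/orP => h; [have := node_le k h|have := node_le k h] => h5.
  by have := lt_le_trans h4 (le_trans h5 h1); rewrite ltxx.
by have := lt_le_trans h2 (le_trans h5 h3); rewrite ltxx.
Qed.

Lemma slope_meas k u : measurable_fun setT (slope k u).
Proof.
apply: measurable_sum => j; apply: measurable_funM => //.
by apply: measurable_indic; exact: measurable_cell.
Qed.

Lemma Int_indic (D : set R) h : measurable D -> intg D h ->
  intg setT (fun x => h x * \1_D x) /\ Int setT (fun x => h x * \1_D x) = Int D h.
Proof.
move=> mD hD.
have e : (fun x => h x * \1_D x) = h \_ D.
  by apply/funext => x; rewrite patchE indicE; case: ifP; rewrite ?mulr1 ?mulr0.
rewrite e; split; first exact: intg_patch.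
by rewrite /Int -Rintegral_mkcond.
Qed.

Lemma intg_bigsum (D : set R) (n : nat) (F : nat -> R -> R) : measurable D ->
  (forall j, (j < n)%N -> intg D (F j)) ->
  intg D (fun x => \sum_(j < n) F j x) /\
  Int D (fun x => \sum_(j < n) F j x) = \sum_(j < n) Int D (F j).
Proof.
move=> mD; elim: n => [|n IH] hF.
  rewrite (_ : (fun x => _) = (fun=> 0)); last by apply/funext => x; rewrite big_ord0.
  by rewrite big_ord0 Int0; split => //; exact: intg0.
have [i1 e1] := IH (fun j jn => hF j (ltnW jn)).
rewrite (_ : (fun x => _) = (fun x => \sum_(j < n) F j x + F n x)); last first.
  by apply/funext => x; rewrite big_ord_recr.
by rewrite big_ord_recr /= -e1 -IntD //; [split => //; apply: intgD => //|]; exact: hF.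
Qed.

Lemma Int_mul_slope k u h : (forall a b : R, intg `[a, b] h) ->
  intg setT (fun x => h x * slope k u x) /\
  Int setT (fun x => h x * slope k u x) =
    \sum_(j < ncell k) (2 ^+ k * incr k u j) * Int (cell k j) h.
Proof.
move=> hh.
have hc j : intg (cell k j) h.
  apply: (intgS _ _ _ (hh (node k j) (node k j.+1))) => //; first exact: measurable_cell.
  by move=> x; rewrite /cell /= !in_itv /= => /andP[-> /ltW ->].
have e : (fun x => h x * slope k u x) =
   (fun x => \sum_(j < ncell k) ((2 ^+ k * incr k u j) * (h x * \1_(cell k j) x))).
  apply/funext => x; rewrite /slope mulr_sumr; apply: eq_bigr => j _.
  by rewrite mulrCA.
have [||i1 i2] := @intg_bigsum setT (ncell k) (fun j x => (2 ^+ k * incr k u j) * (h x * \1_(cell k j) x)).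
- by [].
- by move=> j _; apply: intgZ => //; exact: (Int_indic (measurable_cell k j) (hc j)).1.
rewrite e; split => //; rewrite i2; apply: eq_bigr => j _.
have [q1 q2] := Int_indic (measurable_cell k j) (hc j).
by rewrite IntZ // q2.
Qed.

Lemma Int_co_itv (a b : R) h : a <= b -> intg `[a, b] h -> Int `[a, b[ h = Int `[a, b] h.
Proof.
move=> ab hh; rewrite /Int Rintegral_itv_bndo_bndc //.
by apply: (intgS _ _ _ hh) => // x /=; rewrite !in_itv /= => /andP[-> /ltW ->].
Qed.

Lemma slope_itv k u (a b : R) : intg `[a, b] (slope k u).
Proof.
have h1 : forall a b : R, intg `[a, b] (fun=> (1 : R)) by move=> ? ?; exact: cst_intg.
have [i _] := Int_mul_slope k u h1.
apply: intg_sub => //; apply: intg_ext i => x; by rewrite mul1r.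
Qed.

Lemma Int_slope_cell k u j : (j < ncell k)%N -> Int (cell k j) (slope k u) = incr k u j.
Proof.
move=> jN; rewrite (@Int_ext _ _ _ (fun=> 2 ^+ k * incr k u j)); last first.
  by move=> x /(slope_cell u jN).
rewrite /cell Int_co_itv ?node_le // ?Int_cst ?node_le //; last exact: cst_intg.
by rewrite nodeS addrAC subrr add0r mulrAC /mesh divff ?mul1r.
Qed.

Lemma Int_slope_nodes k u i j : (i <= j)%N -> (j <= ncell k)%N ->
  Int `[node k i, node k j] (slope k u) = u (node k j) - u (node k i).
Proof.
move=> ij; elim: j ij => [|j IH].
  by rewrite leqn0 => /eqP -> _; rewrite Int_itv1 subrr.
rewrite leq_eqVlt => /predU1P[-> _|ij jN]; first by rewrite Int_itv1 subrr.
rewrite (@Int_itv_split _ _ (node k j)) ?node_le //; last exact: slope_itv.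
rewrite IH // ?(ltnW jN) // -Int_co_itv ?node_le //; last exact: slope_itv.
by rewrite -/(cell k j) Int_slope_cell // /incr; ring.
Qed.

(** Besides the mesh, the interval also grows, from [[-k, k]] to [[-l, l]]; this accounts for the
    shift [(l - k) * 2 ^ l] of the index. *)
Lemma node_refine k l j : (k <= l)%N ->
  node k j = node l ((l - k) * 2 ^ l + j * 2 ^ (l - k)).
Proof.
move=> kl; rewrite /node /mesh natrD !natrM natrB // !natrX mulrDl.
have -> : 2 ^+ l = 2 ^+ (l - k) * 2 ^+ k :> R by rewrite -exprD subnK.
have h2 n : (2 : R) ^+ n != 0 by rewrite gt_eqF // exprn_gt0.
by field; rewrite !h2.
Qed.

Lemma node_refine_le k l j : (k <= l)%N -> (j <= ncell k)%N ->
  ((l - k) * 2 ^ l + j * 2 ^ (l - k) <= ncell l)%N.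
Proof.
move=> kl jN; apply: (@leq_trans ((l - k) * 2 ^ l + ncell k * 2 ^ (l - k))%N).
  by rewrite leq_add2l leq_mul2r jN orbT.
rewrite /ncell -mulnA -expnD.
have -> : (k.+1 + (l - k) = l.+1)%N by rewrite addSn addnC subnK.
have : ((l - k) * 2 ^ l <= (l - k) * 2 ^ l.+1)%N by rewrite leq_mul2l leq_exp2l // leqnSn orbT.
move=> h; apply: (@leq_trans ((l - k) * 2 ^ l.+1 + k * 2 ^ l.+1)%N); first by rewrite leq_add2r.
by rewrite -mulnDl subnK.
Qed.

Lemma Int_slope_refine k l u j : (k <= l)%N -> (j < ncell k)%N ->
  Int (cell k j) (slope l u) = incr k u j.
Proof.
move=> kl jN; rewrite /cell Int_co_itv ?node_le //; last exact: slope_itv.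
rewrite /incr !(node_refine _ kl) Int_slope_nodes //.
- by rewrite leq_add2l leq_mul2r leqnSn orbT.
- exact: node_refine_le.
Qed.

(** On a cell of level [k] the coarse slope is the mean of the fine one, so the slopes behave like a
    martingale. Pythagoras then expresses the distance of two levels by the difference of their
    energies. *)
Lemma Int_slope_slope k l u : (k <= l)%N ->
  Int setT (fun x => slope l u x * slope k u x) = energy k u.
Proof.
move=> kl; have [_ ->] := Int_mul_slope k u (slope_itv l u).
by apply: eq_bigr => j _; rewrite Int_slope_refine // expr2 mulrA.
Qed.

Lemma slope_L2 k u : L2r (slope k u).
Proof.
split; first exact: slope_meas.
have [i _] := Int_mul_slope k u (slope_itv k u).
by apply: intg_ext i => x; rewrite expr2.
Qed.

Lemma slope_sqr k u : Int setT (fun x => slope k u x ^+ 2) = energy k u.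
Proof. by rewrite -(Int_slope_slope u (leqnn k)); apply: Int_ext => x _; rewrite expr2. Qed.

Lemma Int_sqrB f g : L2r f -> L2r g -> Int setT (fun x => (f x - g x) ^+ 2) =
  Int setT (fun x => f x ^+ 2) - 2 * Int setT (fun x => f x * g x) + Int setT (fun x => g x ^+ 2).
Proof.
move=> hf hg; have hfg := L2rM hf hg; have [_ if_] := hf; have [_ ig] := hg.
have i2 : intg setT (fun x => 2 * (f x * g x)) by exact: intgZ.
have i3 : intg setT (fun x => f x ^+ 2 - 2 * (f x * g x)) by exact: intgB.
rewrite -IntZ // -IntB // -IntD //.
by apply: Int_ext => x _; ring.
Qed.

Lemma Int_slope_diff k l u : (k <= l)%N ->
  Int setT (fun x => (slope l u x - slope k u x) ^+ 2) = energy l u - energy k u.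
Proof.
move=> kl; rewrite Int_sqrB; try exact: slope_L2.
by rewrite Int_slope_slope // !slope_sqr; ring.
Qed.

Lemma energy_nd u k l : (k <= l)%N -> energy k u <= energy l u.
Proof.
by move=> kl; rewrite -subr_ge0 -Int_slope_diff //; apply: Int_ge0 => x _; exact: sqr_ge0.
Qed.

Lemma nd_cauchy (s : nat -> R) (M : R) : (forall k l, (k <= l)%N -> s k <= s l) ->
  (forall k, s k <= M) -> forall e, 0 < e -> exists N, forall l, (N <= l)%N -> s l - s N <= e.
Proof.
move=> nd sM e e0; pose S := range s.
have hs : has_sup S by split; [exists (s 0%N); exists 0%N|exists M => _ [k _ <-]].
have [_ [N _ <-] hN] := sup_adherent e0 hs.
exists N => l Nl; have : s l <= sup S by apply: sup_upper_bound => //; exists l.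
by rewrite lerBlDr => h; apply: (le_trans h); rewrite addrC -lerBlDr ltW.
Qed.

Lemma dyadic_dense (x e : R) : 0 < e -> exists k0, forall k, (k0 <= k)%N ->
  exists j, (j <= ncell k)%N /\ `|node k j - x| <= e.
Proof.
move=> e0; pose k0 := (Num.truncn `|x|).+1; pose k1 := (Num.truncn e^-1).+1.
exists (maxn k0 k1) => k; rewrite geq_max => /andP[h0 h1].
have hk : `|x| <= k%:R by rewrite (le_trans (ltW (truncnS_gt _))) // ler_nat.
have xk : 0 <= x + k%:R by move: hk; rewrite ler_norml; lra.
have m0 := mesh_gt0 k.
pose j := Num.truncn ((x + k%:R) / mesh k).
have q0 : 0 <= (x + k%:R) / mesh k by rewrite divr_ge0 // ltW.
have [j1 j2] : j%:R <= (x + k%:R) / mesh k /\ (x + k%:R) / mesh k < j.+1%:R.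
  by have /andP[] := truncn_itv q0.
move: j1 j2; rewrite ler_pdivlMr // ltr_pdivrMr // -natr1 mulrDl mul1r => j1 j2.
have jm : (j <= ncell k)%N.
  rewrite -(ler_nat R) /ncell natrM natrX -(ler_pM2r m0) (le_trans j1) //.
  have -> : k%:R * 2 ^+ k.+1 * mesh k = k%:R + k%:R.
    by rewrite /mesh exprS; field; rewrite gt_eqF // exprn_gt0.
  by move: hk; rewrite ler_norml; lra.
exists j; split => //; rewrite /node.
have me : mesh k <= e.
  rewrite /mesh -[e]invrK lef_pV2 ?posrE ?invr_gt0 ?exprn_gt0 //.
  rewrite (le_trans (ltW (truncnS_gt _))) // (@le_trans _ _ k%:R) ?ler_nat //.
  by rewrite -natrX ler_nat ltnW // ltn_expl.
rewrite ler_norml; apply/andP; split; lra.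
Qed.

(** The criterion of F. Riesz: bounded dyadic energies make the slopes Cauchy in [L^2], and their
    limit is the derivative. The energies see only finitely many values of [u] at a time, so they
    pass to pointwise limits, which is how weak derivatives of limits are obtained later. *)
Lemma riesz_slope u (M : R) : continuous u -> (forall k, energy k u <= M) ->
  exists g, [/\ L2r g, ac u g, Int setT (fun x => g x ^+ 2) <= M &
    forall e, 0 < e -> exists N, forall k, (N <= k)%N ->
      Int setT (fun x => (slope k u x - g x) ^+ 2) <= e].
Proof.
move=> cu eM.
have [||g hg cv] := @L2_complete R (fun k => slope k u).
- by move=> k; exact: slope_L2.
- move=> e e0; have e4 : 0 < e / 4 by lra.
  have [N HN] := nd_cauchy (energy_nd u) eM e4; exists N => m n Nm Nn.
  have sq a b c : (a - b) ^+ 2 <= 2 * (a - c) ^+ 2 + 2 * (b - c) ^+ 2 :> R.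
    by have := sqr_lin_le (b - c) (a - c) (-1); rewrite sqrrN expr1n mulr1; 
       rewrite (_ : -1 * (b - c) + (a - c) = a - b); [lra|ring].
  have l2 p q : L2r (fun x => slope p u x - slope q u x) by apply: L2rB; exact: slope_L2.
  have i2 p q : intg setT (fun x => (slope p u x - slope q u x) ^+ 2) by have [] := l2 p q.
  apply: (@le_trans _ _ (Int setT (fun x => 2 * (slope m u x - slope N u x) ^+ 2 +
     2 * (slope n u x - slope N u x) ^+ 2))).
    by apply: Int_le => //; apply: intgD => //; exact: intgZ.
  rewrite IntD // ?IntZ //; try exact: intgZ.
  by rewrite !Int_slope_diff //; have := HN _ Nm; have := HN _ Nn; lra.
have mono (a b e : R) : a <= b -> 0 < e -> exists N, forall k, (N <= k)%N ->
    `|Int `[a, b] (slope k u) - Int `[a, b] g| <= e.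
  move=> ab e0.
  have e1 : 0 < e ^+ 2 / (b - a + 1) by rewrite divr_gt0 ?exprn_gt0 //; lra.
  have [N HN] := cv _ e1; exists N => k Nk.
  rewrite -IntB //; [|exact: slope_itv|exact: L2r_intg].
  have l2 : L2r (fun x => slope k u x - g x) by apply: L2rB => //; exact: slope_L2.
  rewrite -(@ler_pXn2r _ 2) ?nnegrE ?(ltW e0) // real_normK ?num_real //.
  apply: (le_trans (L2r_Int_le ab l2)).
  apply: (@le_trans _ _ ((b - a) * (e ^+ 2 / (b - a + 1)))).
    by rewrite ler_wpM2l ?subr_ge0 //; exact: HN.
  rewrite mulrCA ler_piMr ?sqr_ge0 // ler_pdivrMr; lra.
(* Between two dyadic points every fine slope has the exact integral, hence so does the limit
   [g]. *)
have nodes (k i j : nat) : (i <= j)%N -> (j <= ncell k)%N ->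
    Int `[node k i, node k j] g = u (node k j) - u (node k i).
  move=> ij jN; apply/eqP; rewrite -subr_eq0 -normr_eq0 eq_le normr_ge0 andbT.
  apply/ler_addgt0Pl => e e0; rewrite addr0.
  have [N HN] := mono _ _ _ (node_le k ij) e0.
  have kl : (k <= maxn k N)%N by exact: leq_maxl.
  have := HN _ (leq_maxr k N).
  have := @Int_slope_nodes (maxn k N) u ((maxn k N - k) * 2 ^ maxn k N + i * 2 ^ (maxn k N - k))
    ((maxn k N - k) * 2 ^ maxn k N + j * 2 ^ (maxn k N - k)).
  rewrite -!(node_refine _ kl) => -> //; first by rewrite distrC.
  - by rewrite leq_add2l leq_mul2r ij orbT.
  - exact: node_refine_le.
have acg : ac u g.
  move=> a b ab; split; first exact: L2r_intg.
  apply/eqP; rewrite -subr_eq0 -normr_eq0 eq_le normr_ge0 andbT.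
  apply/ler_addgt0Pl => e e0; rewrite addr0.
  move: ab; rewrite le_eqVlt => /predU1P[->|ab].
    by rewrite subrr Int_itv1 subrr normr0 ltW.
  pose G := Int setT (fun x => g x ^+ 2).
  have G0 : 0 <= G by apply: Int_ge0 => x _; exact: sqr_ge0.
  have e4 : 0 < e / 4 by lra.
  have [d1 d10 H1] := continuousEP cu a e4.
  have [d2 d20 H2] := continuousEP cu b e4.
  pose d := Num.min (Num.min d1 d2) (Num.min ((b - a) / 2) ((e / 4) ^+ 2 / (G + 1))).
  have G1 : 0 < G + 1 by rewrite ltr_wpDl.
  have d0 : 0 < d by rewrite !lt_min d10 d20 /= !divr_gt0 ?exprn_gt0 ?subr_gt0.
  have /and4P[dd1 dd2 dba dG] : [&& d <= d1, d <= d2, d <= (b - a) / 2 & d <= (e / 4) ^+ 2 / (G + 1)].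
    by rewrite /d !ge_min !lexx ?orbT.
  have [k1 K1] := dyadic_dense a d0; have [k2 K2] := dyadic_dense b d0.
  have [i [iN hi]] := K1 (maxn k1 k2) (leq_maxl _ _).
  have [j [jN hj]] := K2 (maxn k1 k2) (leq_maxr _ _).
  set k := maxn k1 k2 in iN jN hi hj.
  have small (x y : R) : `|x - y| <= d -> x <= y -> `|Int `[x, y] g| <= e / 4.
    move=> xyd xy; rewrite -(@ler_pXn2r _ 2) ?nnegrE ?(ltW e4) // real_normK ?num_real //.
    apply: (le_trans (L2r_Int_le xy hg)); rewrite -/G.
    have yd : y - x <= (e / 4) ^+ 2 / (G + 1).
      by apply: le_trans dG; move: xyd; rewrite distrC ger0_norm // subr_ge0.
    apply: (@le_trans _ _ ((e / 4) ^+ 2 / (G + 1) * G)); first by rewrite ler_wpM2r.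
    by rewrite -mulrA ler_piMr ?sqr_ge0 // mulrC ler_pdivrMr // mul1r lerDl.
  have ij : (i <= j)%N.
    rewrite leqNgt; apply/negP => /(node_lt k) h.
    by move: hi hj; rewrite !ler_norml; lra.
  have nij := nodes k i j ij jN.
  set p := node k i in hi nij *; set q := node k j in hj nij *.
  have ig x y : intg `[x, y] g by exact: L2r_intg.
  (* The nodes [p] and [q] may lie on either side of [a] and [b]; the four orders give the same
     correction up to sign. *)
  have E1 : Int `[a, b] g - Int `[p, q] g = (if a <= p then Int `[a, p] g else - Int `[p, a] g) +
     (if q <= b then Int `[q, b] g else - Int `[b, q] g).
    have pq : p <= q by exact: node_le.
    have ab' := ltW ab.
    have pb : p <= b by move: hi; rewrite ler_norml; lra.
    have aq : a <= q by move: hj; rewrite ler_norml; lra.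
    have [ap|/ltW pa] := leP a p; have [qb|/ltW bq] := leP q b.
    - by rewrite (Int_itv_split ap pb) // (Int_itv_split pq qb) //; ring.
    - by rewrite (Int_itv_split ap pb) // (Int_itv_split pb bq) //; ring.
    - by rewrite (Int_itv_split aq qb) // (Int_itv_split pa aq) //; ring.
    - by rewrite (Int_itv_split pb bq) // (Int_itv_split pa ab') //; ring.
  have E2 : `|Int `[a, b] g - Int `[p, q] g| <= e / 4 + e / 4.
    rewrite E1 (le_trans (ler_normD _ _)) // lerD //.
      by case: (leP a p) => [ap|/ltW pa]; rewrite ?normrN small // distrC.
    by case: (leP q b) => [qb|/ltW bq]; rewrite ?normrN small // distrC.
  have U1 := H1 p (le_trans hi dd1); have U2 := H2 q (le_trans hj dd2).
  rewrite (_ : _ - _ = (u p - u a) - (u q - u b) - (Int `[a, b] g - Int `[p, q] g)); last first.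
    by rewrite nij; ring.
  rewrite (le_trans (ler_normB _ _)) // (le_trans (lerD (ler_normB _ _) E2)) //.
  lra.
(* Pythagoras once more: the squared distance from the slope to [g] is the norm of [g] minus the
   dyadic energy. Its smallness yields the bound by [M]. *)
have sqE k : Int setT (fun x => (slope k u x - g x) ^+ 2) = Int setT (fun x => g x ^+ 2) - energy k u.
  rewrite Int_sqrB //; last exact: slope_L2.
  rewrite slope_sqr (@Int_ext _ _ (fun x => slope k u x * g x) (fun x => g x * slope k u x)); last first.
    by move=> x _; rewrite mulrC.
  have [_ ->] := Int_mul_slope k u (fun a b => L2r_intg a b hg).
  rewrite (_ : \sum_(j < ncell k) _ = energy k u); first by ring.
  apply: eq_bigr => j _; rewrite /cell Int_co_itv ?node_le //; last exact: L2r_intg.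
  have [_ <-] := acg _ _ (node_le k (leqnSn j)).
  by rewrite -/(incr k u j) expr2 mulrA.
exists g; split => //.
apply/ler_addgt0Pl => e e0; have [N HN] := cv _ e0.
by have := HN N (leqnn N); rewrite sqE; have := eM N; lra.
Qed.

Lemma riesz u (M : R) : continuous u -> (forall k, energy k u <= M) ->
  exists g, [/\ L2r g, ac u g & Int setT (fun x => g x ^+ 2) <= M].
Proof. by move=> cu /(riesz_slope cu)[g [? ? ? _]]; exists g. Qed.

Lemma Int_ac_slope k u v g : L2r g -> ac v g ->
  Int setT (fun x => g x * slope k u x) = \sum_(j < ncell k) (2 ^+ k * incr k u j) * incr k v j.
Proof.
move=> hg av; have [_ ->] := Int_mul_slope k u (fun a b => L2r_intg a b hg).
apply: eq_bigr => j _; rewrite /cell Int_co_itv ?node_le //; last exact: L2r_intg.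
by have [_ <-] := av _ _ (node_le k (leqnSn j)).
Qed.

Lemma energy_le u g k : L2r g -> ac u g -> energy k u <= Int setT (fun x => g x ^+ 2).
Proof.
move=> hg au.
have E : Int setT (fun x => g x * slope k u x) = energy k u.
  by rewrite (Int_ac_slope k u hg au); apply: eq_bigr => j _; rewrite expr2 mulrA.
have := Int_sqrB hg (slope_L2 k u); rewrite E slope_sqr => h.
have : 0 <= Int setT (fun x => (g x - slope k u x) ^+ 2) by apply: Int_ge0 => x _; exact: sqr_ge0.
by rewrite h; lra.
Qed.

(** The Riesz limit of the slopes is some derivative of [u]; uniqueness almost everywhere identifies
    it with the given [g]. *)
Lemma slope_approx u g : continuous u -> L2r g -> ac u g ->
  forall e, 0 < e -> exists k, Int setT (fun x => (slope k u x - g x) ^+ 2) <= e.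
Proof.
move=> cu hg au e e0.
have [g' [hg' ag' _ cv]] := riesz_slope cu (fun k => energy_le k hg au).
have [N HN] := cv _ e0; exists N; apply: le_trans (HN N (leqnn N)).
have ae : ae_eq mu setT g g' by apply: ac_uniq au ag'; right; [have [] := hg|have [] := hg'].
rewrite le_eqVlt; apply/orP; left; apply/eqP; apply: ae_eq_Int => //.
- by apply: measurable_funX; apply: measurable_funB; [exact: slope_meas|have [] := hg].
- by apply: measurable_funX; apply: measurable_funB; [exact: slope_meas|have [] := hg'].
- by apply: (@filterS _ _ (ae_filter_ringOfSetsType mu) _ _ _ ae) => x h /h ->.
Qed.

End dyadic.

(** * The logarithmic nonlinearity *)

Section log_inequalities.
Context {R : realType}.
Implicit Types s t r x y M : R.

Lemma ln_le_sub1 x : 0 < x -> ln x <= x - 1.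
Proof.
move=> x0; have := @le_ln1Dx R (x - 1); rewrite (_ : 1 + (x - 1) = x); last by ring.
by apply; lra.
Qed.

Lemma ln_diff_le x y : 0 < x -> 0 < y -> ln x - ln y <= (x - y) / y.
Proof.
move=> x0 y0; have := ln_le_sub1 (divr_gt0 x0 y0).
by rewrite ln_div ?posrE // mulrBl divff ?gt_eqF.
Qed.

Lemma ln_sqr x : 0 < x -> ln (x ^+ 2) = 2 * ln x.
Proof. by move=> x0; rewrite lnXn // mulr_natl. Qed.

Lemma ln_le x y : 0 < x -> x <= y -> ln x <= ln y.
Proof. by move=> x0 xy; rewrite ler_ln // posrE // (lt_le_trans x0). Qed.

Lemma ln_le0' x : x <= 1 -> ln x <= 0.
Proof.
move=> x1; have [x0|x0] := leP x 0; first by rewrite ln0.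
by rewrite -ln1; apply: ln_le.
Qed.

Lemma ln_ge0' x : 1 <= x -> 0 <= ln x.
Proof. by move=> x1; rewrite -ln1; apply: ln_le. Qed.

Lemma ln2_le : ln 2 <= 1 :> R.
Proof. have h : (0 : R) < 2 by []; have := ln_le_sub1 h; lra. Qed.

Definition c3 : R := expR (- 3).

Lemma c3_gt0 : 0 < c3. Proof. exact: expR_gt0. Qed.

Lemma c3_lt1 : c3 < 1.
Proof. by rewrite /c3 -[ltRHS]expR0 ltr_expR; lra. Qed.

Lemma c3_sq : expR (- 6) = c3 ^+ 2 :> R.
Proof. by rewrite /c3 -expRM_natl; congr expR; ring. Qed.

Lemma ln_c3 : ln c3 = - 3. Proof. exact: expRK. Qed.

Lemma Afun_small s : s <= c3 -> Afun s = - (s ^+ 2 * ln (s ^+ 2)).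
Proof. by move=> h; rewrite /Afun h. Qed.

Lemma Afun_large s : c3 <= s -> Afun s = 3 * s ^+ 2 + 4 * c3 * s - c3 ^+ 2.
Proof.
rewrite /Afun -/c3 c3_sq => h; case: ifP => // h'.
have -> : s = c3 by apply/eqP; rewrite eq_le h h'.
by rewrite ln_sqr ?c3_gt0 // ln_c3; ring.
Qed.

Lemma Afun0 : Afun (0 : R) = 0.
Proof. by rewrite Afun_small ?ltW ?c3_gt0 // expr0n /= mul0r oppr0. Qed.

Lemma ln_small s : 0 < s -> s <= c3 -> ln s <= - 3.
Proof. by move=> s0 h; rewrite -ln_c3; exact: ln_le. Qed.

(** Below the break point [e^(-3)] one has [- ln (s^2) >= 6]; above it the inequality is read off
    the quadratic formula. *)
Lemma Afun_ge s : 0 <= s -> 3 * s ^+ 2 <= Afun s.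
Proof.
move=> s0; have [h|/ltW h] := leP s c3; last first.
  by rewrite Afun_large //; have := c3_gt0; move: (c3) h => c; nra.
move: s0; rewrite le_eqVlt => /predU1P[<-|s0]; first by rewrite Afun0 expr0n mulr0.
rewrite Afun_small // ln_sqr //; have := ln_small s0 h; have : 0 < s ^+ 2 by rewrite exprn_gt0.
by move: (ln s) (s ^+ 2) => a b; nra.
Qed.

Lemma Afun_ge0 s : 0 <= s -> 0 <= Afun s.
Proof. by move=> s0; apply: le_trans (Afun_ge s0); rewrite mulr_ge0 // sqr_ge0. Qed.

Lemma Afun_le6 s : c3 <= s -> Afun s <= 6 * s ^+ 2.
Proof. by move=> h; rewrite Afun_large //; have := c3_gt0; move: (c3) h => c; nra. Qed.

Lemma Afun_le s : 0 <= s -> Afun s <= 6 * s ^+ 2 + s ^+ 2 * `|ln (s ^+ 2)|.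
Proof.
move=> s0; have [h|/ltW h] := leP s c3; last first.
  by apply: (le_trans (Afun_le6 h)); rewrite lerDl mulr_ge0 ?sqr_ge0.
rewrite Afun_small // -mulrN; apply: (@le_trans _ _ (s ^+ 2 * `|ln (s ^+ 2)|)).
  by rewrite ler_wpM2l ?sqr_ge0 // -normrN ler_norm.
by rewrite lerDr mulr_ge0 // sqr_ge0.
Qed.

Lemma abs_ln_large s M : c3 <= s -> s <= M -> `|ln (s ^+ 2)| <= 6 + 2 * M.
Proof.
move=> h sM; have c0 := c3_gt0; have s0 : 0 < s by exact: lt_le_trans h.
rewrite ln_sqr //; have := ln_le c0 h; rewrite ln_c3; have := ln_le_sub1 s0.
by rewrite ler_norml; move: (ln s) => l; lra.
Qed.

Lemma sqr_ln_le s M : 0 <= s -> s <= M -> s ^+ 2 * `|ln (s ^+ 2)| <= (6 + 2 * M) * Afun s.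
Proof.
move=> s0 sM; have [h|/ltW h] := leP s c3.
  rewrite Afun_small //; have : ln (s ^+ 2) <= 0.
    by apply: ln_le0'; rewrite exprn_ile1 // (le_trans h) // ltW // c3_lt1.
  move=> hl; rewrite ler0_norm // mulrN; apply: ler_peMl; last by lra.
  by rewrite -mulrN mulr_ge0 ?sqr_ge0 // oppr_ge0.
apply: (@le_trans _ _ (s ^+ 2 * (6 + 2 * M))).
  by rewrite ler_wpM2l ?sqr_ge0 // abs_ln_large.
rewrite mulrC ler_wpM2l //; first by lra.
by apply: le_trans (Afun_ge s0); rewrite ler_peMl ?sqr_ge0 //; lra.
Qed.

(** The doubling condition for the Young function, in the sharp quadratic form. It makes modular
    smallness and smallness of the Luxemburg norm equivalent. *)
Lemma AfunZ s t : 1 <= t -> 0 <= s -> Afun (t * s) <= t ^+ 2 * Afun s.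
Proof.
move=> t1 s0; have t0 : 0 < t by lra.
have sts : s <= t * s by rewrite ler_peMl.
move: s0; rewrite le_eqVlt => /predU1P[<-|s0]; first by rewrite mulr0 !Afun0 mulr0.
have ts0 : 0 < t * s by exact: mulr_gt0.
have [h|/ltW h] := leP (t * s) c3.
  rewrite !Afun_small // ?(le_trans sts) // exprMn mulrN lerN2.
  rewrite -[leRHS](mulrA (t ^+ 2)).
  rewrite ler_wpM2l ?sqr_ge0 // ler_wpM2l ?sqr_ge0 // ln_le ?exprn_gt0 //.
  by rewrite -exprMn lerXn2r // nnegrE ltW.
have [h'|/ltW h'] := leP s c3.
  apply: (le_trans (Afun_le6 h)); rewrite exprMn mulrCA ler_wpM2l ?sqr_ge0 //.
  rewrite Afun_small // ln_sqr //; have := ln_small s0 h'.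
  have : 0 < s ^+ 2 by rewrite exprn_gt0.
  by move: (ln s) (s ^+ 2) => a b; nra.
rewrite !Afun_large //; have := c3_gt0; move: (c3) h' => c h' c0.
rewrite -subr_ge0 (_ : _ - _ = c * ((t - 1) * (4 * s * t - c * (t + 1)))); last by ring.
by rewrite mulr_ge0 ?(ltW c0) // mulr_ge0 ?subr_ge0 //; nra.
Qed.

Lemma xlnx_mono x y : 0 <= x -> x <= y -> y <= expR (- 1) -> - (x * ln x) <= - (y * ln y).
Proof.
rewrite le_eqVlt => /predU1P[<-|x0] xy ye.
  have e1 : expR (- 1) <= 1 :> R by rewrite -[leRHS]expR0 ler_expR; lra.
  by rewrite mul0r oppr0 oppr_ge0 mulr_ge0_le0 // ln_le0' // (le_trans ye).
have y0 : 0 < y by exact: lt_le_trans xy.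
have h1 := ln_diff_le y0 x0; have h2 : ln y <= - 1 by rewrite -[leRHS]expRK; exact: ln_le.
have h3 : x * (ln y - ln x) <= y - x.
  by rewrite (le_trans (ler_wpM2l (ltW x0) h1)) // mulrC mulfVK // gt_eqF.
by move: (ln x) (ln y) h2 h3 {h1} => a b; nra.
Qed.

Lemma c3_le_e1 : c3 <= expR (- 1). Proof. by rewrite ler_expR; lra. Qed.

Lemma Afun_mono s t : 0 <= s -> s <= t -> Afun s <= Afun t.
Proof.
move=> s0 st; have c0 := c3_gt0.
have small x y : 0 <= x -> x <= y -> y <= c3 -> Afun x <= Afun y.
  move=> x0 xy yc; rewrite !Afun_small // ?(le_trans xy) //.
  apply: xlnx_mono; rewrite ?sqr_ge0 // ?lerXn2r ?nnegrE ?(le_trans x0) //.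
  apply: (@le_trans _ _ (c3 ^+ 2)); first by rewrite lerXn2r ?nnegrE ?(ltW c0) ?(le_trans x0 xy).
  by apply: (le_trans _ c3_le_e1); rewrite expr2 ler_piMl // ltW // c3_lt1.
have large x y : c3 <= x -> x <= y -> Afun x <= Afun y.
  move=> x0 xy; rewrite !Afun_large // ?(le_trans x0) //.
  by move: (c3) c0 x0 => c c0 x0; nra.
have [tc|/ltW tc] := leP t c3; first exact: small.
have [sc|/ltW sc] := leP s c3; last exact: large.
by apply: le_trans (small s c3 s0 sc (lexx _)) (large _ _ (lexx _) tc).
Qed.

Lemma AfunD s t : 0 <= s -> 0 <= t -> Afun (s + t) <= 4 * (Afun s + Afun t).
Proof.
move=> s0 t0.
have key x y : 0 <= x -> x <= y -> Afun (x + y) <= 4 * (Afun x + Afun y).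
  move=> x0 xy; have y0 : 0 <= y by exact: le_trans xy.
  apply: (@le_trans _ _ (Afun (2 * y))); first by apply: Afun_mono; lra.
  have h : (1 : R) <= 2 by lra.
  apply: (le_trans (AfunZ h y0)); have := Afun_ge0 x0; have := Afun_ge0 y0.
  by move: (Afun x) (Afun y) => a b; lra.
have [st|/ltW ts] := leP s t; first exact: key.
by rewrite addrC (addrC (Afun s)); exact: key.
Qed.

(* Young's inequality for the pair formed by [Afun] and its conjugate. *)
Lemma orlicz s r M : 0 <= s -> s <= M -> 0 <= r ->
  s * `|ln (s ^+ 2)| * r <= (6 + 2 * M) * (Afun s + Afun r).
Proof.
move=> s0 sM r0; have As := Afun_ge0 s0; have Ar := Afun_ge0 r0.
have A3s := Afun_ge s0; have A3r := Afun_ge r0; have c0 := c3_gt0.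
have M0 : 0 <= M by exact: le_trans sM.
have [h|/ltW h] := leP s c3; last first.
  apply: (@le_trans _ _ ((6 + 2 * M) * (s * r))).
    by rewrite mulrAC mulrC ler_wpM2r ?mulr_ge0 // abs_ln_large.
  rewrite ler_wpM2l //; first by lra.
  have := sqr_ge0 (s - r); move: (Afun s) (Afun r) As Ar A3s A3r => a b; nra.
suff H : s * `|ln (s ^+ 2)| * r <= 6 * (Afun s + Afun r).
  by apply: (le_trans H); rewrite ler_wpM2r ?addr_ge0 //; lra.
move: s0; rewrite le_eqVlt => /predU1P[<-|s0].
  by rewrite !mul0r mulr_ge0 // addr_ge0 // Afun0.
have l0 : ln (s ^+ 2) <= 0.
  by apply: ln_le0'; rewrite exprn_ile1 // ?(ltW s0) // (le_trans h) // ltW // c3_lt1.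
rewrite ler0_norm //.
have [rs|/ltW sr] := leP r s.
  apply: (@le_trans _ _ (Afun s)); last by move: (Afun s) (Afun r) As Ar => a b; lra.
  by rewrite Afun_small // expr2 -mulrN -(mulrA s s) (mulrC s (s * _)) ler_wpM2l ?mulr_ge0 ?oppr_ge0 ?(ltW s0).
have mono y : s <= y -> y <= c3 -> s * - ln (s ^+ 2) <= y * - ln (y ^+ 2).
  move=> sy yc; have y0 : 0 < y by exact: lt_le_trans sy.
  rewrite !ln_sqr // mulrN (mulrN y) (mulrCA s) (mulrCA y) -!mulrN ler_pM2l //.
  by rewrite !mulrN; apply: xlnx_mono => //; [exact: ltW|exact: le_trans c3_le_e1].
have [rc|/ltW cr] := leP r c3.
  apply: (@le_trans _ _ (Afun r)); last by move: (Afun s) (Afun r) As Ar => a b; lra.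
  by rewrite Afun_small // expr2 -mulrN -(mulrA r r) (mulrC r (r * _)) ler_wpM2r // mono.
have := mono c3 h (lexx _); rewrite (ln_sqr c0) ln_c3 => h1.
apply: (@le_trans _ _ (6 * r * r)).
  rewrite ler_wpM2r // (le_trans h1) //; move: (c3) cr => c; lra.
move: (Afun s) (Afun r) As Ar A3s A3r => a b; nra.
Qed.

(** The regular part of [s^2 ln s^2]. It vanishes for [s <= e^(-3)], so on bounded functions it is
    controlled by the [L^2] norm alone, while the singular behaviour at 0 stays in [Afun]. *)
Definition Psi s : R := Afun s + s ^+ 2 * ln (s ^+ 2).

Lemma Psi_lip s t M : 0 <= s -> s <= M -> 0 <= t -> t <= M ->
  `|Psi s - Psi t| <= (12 + 2 * M) * `|s ^+ 2 - t ^+ 2|.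
Proof.
have c0 := c3_gt0.
have large x y : c3 <= y -> y <= x -> x <= M ->
    `|Psi x - Psi y| <= (12 + 2 * M) * (x ^+ 2 - y ^+ 2).
  move=> cy yx xM; have cx : c3 <= x by exact: le_trans yx.
  have x0 : 0 < x by exact: lt_le_trans cx.
  have y0 : 0 < y by exact: lt_le_trans cy.
  rewrite /Psi !Afun_large //.
  have hx := abs_ln_large cx xM.
  have hd := ln_diff_le (exprn_gt0 2 x0) (exprn_gt0 2 y0).
  have hd' : y ^+ 2 * (ln (x ^+ 2) - ln (y ^+ 2)) <= x ^+ 2 - y ^+ 2.
    have := ler_wpM2l (sqr_ge0 y) hd.
    by rewrite (_ : y ^+ 2 * ((x ^+ 2 - y ^+ 2) / y ^+ 2) = x ^+ 2 - y ^+ 2) //; field; rewrite gt_eqF.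
  have hd0 : 0 <= ln (x ^+ 2) - ln (y ^+ 2).
    by rewrite subr_ge0 ln_le ?exprn_gt0 // lerXn2r // nnegrE ltW.
  have hd1 : 0 <= y ^+ 2 * (ln (x ^+ 2) - ln (y ^+ 2)) by rewrite mulr_ge0 // sqr_ge0.
  have xy2 : 0 <= x ^+ 2 - y ^+ 2 by rewrite subr_ge0 lerXn2r // nnegrE ltW.
  rewrite (_ : _ - _ = 3 * (x ^+ 2 - y ^+ 2) + 4 * c3 * (x - y) + (x ^+ 2 - y ^+ 2) * ln (x ^+ 2)
     + y ^+ 2 * (ln (x ^+ 2) - ln (y ^+ 2))); last by ring.
  have h4 : 0 <= 4 * c3 * (x - y) <= 2 * (x ^+ 2 - y ^+ 2).
    by move: (c3) c0 cx cy => c c0 cx cy; apply/andP; split; nra.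
  have h5 : `|(x ^+ 2 - y ^+ 2) * ln (x ^+ 2)| <= (x ^+ 2 - y ^+ 2) * (6 + 2 * M).
    by rewrite normrM (ger0_norm xy2) ler_wpM2l.
  move: h5 hd' hd1 xy2 h4; set p := (x ^+ 2 - y ^+ 2) * ln _; set q := y ^+ 2 * (_ - _).
  set w := 4 * _ * _; set d := x ^+ 2 - y ^+ 2; rewrite !ler_norml => /andP[p1 p2] q1 q2 d0 /andP[w1 w2].
  by apply/andP; split; clear -p1 p2 q1 q2 d0 w1 w2; lra.
have small x : 0 <= x -> x <= c3 -> Psi x = 0.
  by move=> x0 xc; rewrite /Psi Afun_small // addNr.
have key x y : 0 <= y -> y <= x -> x <= M -> `|Psi x - Psi y| <= (12 + 2 * M) * (x ^+ 2 - y ^+ 2).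
  move=> y0 yx xM; have x0 : 0 <= x by exact: le_trans yx.
  have M0 : 0 <= 12 + 2 * M by have := le_trans x0 xM; lra.
  have [xc|/ltW cx] := leP x c3.
    rewrite !small // ?(le_trans yx) // subrr normr0 mulr_ge0 // subr_ge0 lerXn2r // nnegrE.
  have [yc|/ltW cy] := leP y c3; last exact: large.
  rewrite (small y) // -(small c3 (ltW c0) (lexx _)).
  apply: (le_trans (large x c3 (lexx _) cx xM)); rewrite ler_wpM2l // lerD2l lerN2.
  by rewrite lerXn2r // nnegrE ltW.
move=> s0 sM t0 tM; have [st|/ltW ts] := leP s t.
  rewrite distrC (distrC (s ^+ 2)) (ger0_norm (_ : 0 <= t ^+ 2 - s ^+ 2)); first exact: key.
  by rewrite subr_ge0 lerXn2r // nnegrE.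
rewrite (ger0_norm (_ : 0 <= s ^+ 2 - t ^+ 2)); first exact: key.
by rewrite subr_ge0 lerXn2r // nnegrE.
Qed.

(** A substitute for monotonicity of [x |ln x|], which fails around 1: the defect is at most [y]. *)
Lemma abs_xlnx_le x y : 0 <= x -> x <= y -> x * `|ln x| <= y * (`|ln y| + 1).
Proof.
rewrite le_eqVlt => /predU1P[<- y0|x0 xy]; first by rewrite mul0r mulr_ge0 // addr_ge0.
have y0 : 0 < y by exact: lt_le_trans xy.
have h1 := ln_le x0 xy.
have [x1|x1] := leP 1 x.
  have := ln_ge0' x1 => l0; rewrite (ger0_norm l0) (ger0_norm (le_trans l0 h1)).
  by move: (ln x) (ln y) l0 h1 => a b; nra.
have l0 : ln x <= 0 by apply: ln_le0'; exact: ltW.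
rewrite (ler0_norm l0).
have h2 := ln_diff_le y0 x0.
have h3 : x * (ln y - ln x) <= y - x.
  by rewrite (le_trans (ler_wpM2l (ltW x0) h2)) // mulrC mulfVK // gt_eqF.
have h4 : - ln y <= `|ln y| by rewrite -normrN ler_norm.
have h5 : 0 <= `|ln y| by [].
by move: (ln x) (ln y) (`|ln y|) h3 h4 h5 {h1 h2 l0} => a b c; nra.
Qed.

End log_inequalities.

(** * The map [z ln |z|^2] and the density of its energy *)

Section log_nonlinearity.
Context {R : realType}.
Implicit Types z w d : R[i].

Definition Flog z : R[i] := z * (ln (cmod z ^+ 2))%:C.

Lemma Flog0 : Flog 0 = 0. Proof. by rewrite /Flog mul0r. Qed.

Lemma cdot_Flog z w : cdot (Flog z) w = ln (cmod z ^+ 2) * cdot z w.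
Proof. by rewrite /Flog mulrC cdotZl. Qed.

Lemma cmod_Flog z : cmod (Flog z) = cmod z * `|ln (cmod z ^+ 2)|.
Proof. by rewrite /Flog mulrC cmodZ mulrC. Qed.

Lemma cdot_Flog_le z w (M : R) : cmod z <= M ->
  `|cdot (Flog z) w| <= (6 + 2 * M) * (Afun (cmod z) + Afun (cmod w)).
Proof.
move=> zM; apply: (le_trans (cdot_le _ _)); rewrite cmod_Flog.
by apply: orlicz; rewrite ?cmod_ge0.
Qed.

(** With [|w| <= |z|], split the difference into [(z - w) ln |z|^2] and [w (ln |z|^2 - ln |w|^2)].
    The second term is Lipschitz, and in the first [|z|] is at least half of [|z - w|], which bounds
    a large negative logarithm. *)
Lemma Flog_mod z w (M : R) : cmod z <= M -> cmod w <= M ->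
  cmod (Flog z - Flog w) <= cmod (z - w) * (4 + 2 * M + `|ln (cmod (z - w) ^+ 2)|).
Proof.
wlog wz : z w / cmod w <= cmod z.
  move=> H zM wM; have [h|/ltW h] := leP (cmod w) (cmod z); first exact: H.
  by rewrite cmodB (cmodB z w); exact: H.
move=> zM wM.
have M0 : 0 <= M by apply: le_trans zM; exact: cmod_ge0.
have [->|w0] := eqVneq w 0.
  rewrite Flog0 !subr0 cmod_Flog ler_wpM2l ?cmod_ge0 // lerDr; lra.
have [zw|zw] := eqVneq z w.
  by rewrite zw !subrr cmod0 mul0r.
have cw0 : 0 < cmod w.
  by rewrite lt_def cmod_ge0 andbT; apply/eqP => /cmod_eq0 h; rewrite h eqxx in w0.
have cd0 : 0 < cmod (z - w).
  by rewrite lt_def cmod_ge0 andbT; apply/eqP => /cmod_eq0/eqP; rewrite subr_eq0 (negbTE zw).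
have cz0 : 0 < cmod z by exact: lt_le_trans wz.
have -> : Flog z - Flog w = (ln (cmod z ^+ 2))%:C * (z - w) +
    (ln (cmod z ^+ 2) - ln (cmod w ^+ 2))%:C * w.
  by rewrite /Flog rmorphB /=; ring.
apply: (le_trans (cmodD_le _ _)); rewrite !cmodZ !ln_sqr //.
have h1 : `|2 * ln (cmod z) - 2 * ln (cmod w)| * cmod w <= 2 * cmod (z - w).
  have := ln_le cw0 wz; have := ln_diff_le cz0 cw0 => q1 q2.
  rewrite ger0_norm; last by lra.
  have := ler_wpM2r (ltW cw0) q1; rewrite mulfVK ?gt_eqF // => q3.
  have := cmod_dist z w; rewrite ler_norml => /andP[_ q4].
  by move: (ln (cmod z)) (ln (cmod w)) q3 q4 {q1 q2} => a b; nra.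
have h2 : `|2 * ln (cmod z)| <= 2 + 2 * M + `|2 * ln (cmod (z - w))|.
  have d2 : cmod (z - w) <= 2 * cmod z by have := cmodB_le z w; lra.
  have q1 : ln (cmod (z - w)) <= ln 2 + ln (cmod z).
    by rewrite -lnM ?posrE //; exact: ln_le.
  have q2 := @ln2_le R; have q3 := ln_le_sub1 cz0.
  have q4 : - (2 * ln (cmod (z - w))) <= `|2 * ln (cmod (z - w))| by rewrite -normrN ler_norm.
  have q5 : 0 <= `|2 * ln (cmod (z - w))| by [].
  clear -q1 q2 q3 q4 q5 zM M0.
  by rewrite ler_norml; apply/andP; split; lra.
apply: (@le_trans _ _ ((2 + 2 * M + `|2 * ln (cmod (z - w))|) * cmod (z - w) + 2 * cmod (z - w))).
  by rewrite lerD // ler_wpM2r ?cmod_ge0.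
by rewrite le_eqVlt; apply/orP; left; apply/eqP; ring.
Qed.

(* The inequality of Cazenave and Haraux behind the well-posedness in [L^2]. *)
Lemma Flog_monotone z w :
  `|cdot (Flog z - Flog w) (- 'i * (z - w))| <= 2 * nsq (z - w).
Proof.
wlog wz : z w / cmod w <= cmod z.
  move=> H; have [h|/ltW h] := leP (cmod w) (cmod z); first exact: H.
  have := H w z h; rewrite -(opprB z w) -(opprB (Flog z)) nsqN mulrN cdotNl cdotNr opprK.
  by [].
(* Since [-i z] is orthogonal to [z], only a difference of logarithms survives, multiplied by a
   product with the smaller of the two numbers. *)
have E : cdot (Flog z - Flog w) (- 'i * (z - w)) =
    (ln (cmod w ^+ 2) - ln (cmod z ^+ 2)) * cdot w (- 'i * (w - z)) .
  rewrite cdotBl !cdot_Flog !cdotE; case: z w {wz} => a b [c e] /=; ring.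
have [w0|w0] := eqVneq w 0.
  by rewrite E w0 cdot0l mulr0 normr0 mulr_ge0 // nsq_ge0.
have cw0 : 0 < cmod w.
  by rewrite lt_def cmod_ge0 andbT; apply/eqP => /cmod_eq0 h; rewrite h eqxx in w0.
have cz0 : 0 < cmod z by exact: lt_le_trans wz.
rewrite E normrM.
have h1 : `|ln (cmod w ^+ 2) - ln (cmod z ^+ 2)| * cmod w <= 2 * cmod (z - w).
  have := ln_le cw0 wz; have := ln_diff_le cz0 cw0 => q1 q2.
  rewrite !ln_sqr // ler0_norm; last by lra.
  have := ler_wpM2r (ltW cw0) q1; rewrite mulfVK ?gt_eqF // => q3.
  have := cmod_dist z w; rewrite ler_norml => /andP[_ q4].
  by move: (ln (cmod z)) (ln (cmod w)) q3 q4 {q1 q2} => a b; nra.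
have h2 : `|cdot w (- 'i * (w - z))| <= cmod w * cmod (z - w).
  by apply: (le_trans (cdot_le _ _)); rewrite cmod_i cmodB.
apply: (@le_trans _ _ (`|ln (cmod w ^+ 2) - ln (cmod z ^+ 2)| * (cmod w * cmod (z - w)))).
  by rewrite ler_wpM2l.
rewrite mulrA -cmod_sq expr2 mulrA ler_wpM2r ?cmod_ge0 //.
Qed.

(** The primitive of [ln] that vanishes at 0. Its integral along [|u|^2] is the logarithmic part of
    the energy minus the charge. *)
Definition Glog (y : R) : R := y * ln y - y.

Lemma Glog_diff (s s' : R) : 0 < s -> 0 <= s' ->
  0 <= Glog s' - Glog s - ln s * (s' - s) <= (s' - s) ^+ 2 / s.
Proof.
move=> s0; rewrite /Glog le_eqVlt => /predU1P[<-|s'0].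
  rewrite mul0r subr0 !sub0r sqrrN; have -> : s ^+ 2 / s = s by field; rewrite gt_eqF.
  by apply/andP; split; [nra|lra].
have h1 := ln_diff_le s'0 s0; have h2 := ln_diff_le s0 s'0.
have -> : s' * ln s' - s' - (s * ln s - s) - ln s * (s' - s) =
  s' * (ln s' - ln s) - s' + s by ring.
have k1 : s' * (ln s - ln s') <= s - s'.
  by rewrite (le_trans (ler_wpM2l (ltW s'0) h2)) // mulrC mulfVK // gt_eqF.
have k2 : s' * (ln s' - ln s) <= s' * ((s' - s) / s) by rewrite ler_wpM2l // ltW.
have -> : (s' - s) ^+ 2 / s = s' * ((s' - s) / s) - s' + s by field; rewrite gt_eqF.
by apply/andP; split; lra.
Qed.

Lemma cross_le (p a b x y : R) : x * a <= y * (b + 1) -> p <= x * y ->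
  0 < x -> 0 < y -> 0 <= p -> 0 <= a -> 2 * a * p <= y ^+ 2 * (2 * b + 2).
Proof.
move=> k1 k2 x0 y0 p0 a0.
apply: (@le_trans _ _ (2 * a * (x * y))); first by rewrite ler_wpM2l // mulr_ge0.
by rewrite (_ : 2 * a * (x * y) = 2 * y * (x * a)); [nra|ring].
Qed.

(** First-order expansion of the energy density, with an error of order [|d|^2 (1 + |ln |d|^2|)]. If
    [|d| <= |z|], the second-order remainder of [Glog] applies; otherwise each of the three terms is
    separately of that size. The logarithm reflects that the density is not twice differentiable at
    0. *)
Lemma Glog_taylor z d (M : R) : cmod z <= M -> cmod d <= M ->
  `|Glog (cmod (z + d) ^+ 2) - Glog (cmod z ^+ 2) - 2 * cdot (Flog z) d| <=
    (40 + 2 * M) * (nsq d * (1 + `|ln (nsq d)|)).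
Proof.
move=> zM dM; have M0 : 0 <= M by apply: le_trans zM; exact: cmod_ge0.
rewrite cdot_Flog !cmod_sq nsqD.
set q := nsq d; set s := nsq z; set p := cdot z d; set L : R := `|ln q|.
have q0 : 0 <= q by exact: nsq_ge0.
have s0 : 0 <= s by exact: nsq_ge0.
have p2 : p ^+ 2 <= s * q by exact: cdot_sq_le.
have L0 : 0 <= L by exact: normr_ge0.
have s'0 : 0 <= s + 2 * p + q by rewrite -nsqD nsq_ge0.
have [q0'|qn0] := eqVneq q 0.
  have -> : p = 0 by apply/eqP; rewrite -sqrf_eq0 eq_le sqr_ge0 andbT (le_trans p2) // q0' mulr0.
  by rewrite q0' !mulr0 !addr0 subrr subr0 normr0 mul0r mulr0.
have qp : 0 < q by rewrite lt_def qn0.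
have [qs|/ltW sq] := leP q s.
  have sp : 0 < s by exact: lt_le_trans qs.
  have /andP[k0 k1] := Glog_diff sp s'0.
  have k2 : (s + 2 * p + q - s) ^+ 2 / s <= 9 * q.
    rewrite ler_pdivrMr //; clear -p2 qs q0 s0.
    have pq : `|p| <= s by rewrite -(@ler_pXn2r _ 2) ?nnegrE // real_normK ?num_real //; nra.
    have e : (s + 2 * p + q - s) ^+ 2 = 4 * p ^+ 2 + 4 * p * q + q ^+ 2 by ring.
    rewrite e; move: pq; rewrite ler_norml => /andP[pq1 pq2]; nra.
  have k3 : `|ln s| <= L + 2 * M.
    rewrite /L ler_norml; have := ln_le qp qs; have := ln_le_sub1 sp => a1 a2.
    have a3 : ln s <= 2 * M.
      have cz : 0 < cmod z by rewrite cmod_sqrt sqrtr_gt0.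
      by rewrite /s -cmod_sq ln_sqr //; have := ln_le_sub1 cz; lra.
    have a4 : - ln q <= `|ln q| by rewrite -normrN ler_norm.
    have a5 := normr_ge0 (ln q).
    by apply/andP; split; lra.
  have k4 : `|ln s * q| <= (L + 2 * M) * q by rewrite normrM (ger0_norm q0) ler_wpM2r.
  move: k0 k1 k4; set K := Glog _ - _ - ln s * _ => k0 k1 k4.
  have -> : Glog (s + 2 * p + q) - Glog s - 2 * (ln s * p) = K + ln s * q by rewrite /K; ring.
  apply: (le_trans (ler_normD _ _)); rewrite (ger0_norm k0).
  apply: (@le_trans _ _ (9 * q + (L + 2 * M) * q)); first by rewrite lerD // (le_trans k1).
  have qL := mulr_ge0 q0 L0; have MqL := mulr_ge0 M0 qL; have Mq := mulr_ge0 M0 q0.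
  by clear -q0 qL MqL Mq; lra.
have h1 : s * `|ln s| <= q * (L + 1) by exact: abs_xlnx_le.
have s'4 : s + 2 * p + q <= 4 * q.
  have : p <= q; last by clear -sq; lra.
  apply: le_trans (ler_norm _) _; rewrite -(@ler_pXn2r _ 2) ?nnegrE // real_normK ?num_real //.
  by clear -p2 sq q0 s0; nra.
have h2 : (s + 2 * p + q) * `|ln (s + 2 * p + q)| <= 4 * q * (L + 3).
  apply: (le_trans (abs_xlnx_le s'0 s'4)); rewrite ler_wpM2l ?mulr_ge0 //.
  have e4 : ln (4 * q) = 2 * ln 2 + ln q.
    rewrite lnM ?posrE // (_ : 4 = 2 ^+ 2) ?ln_sqr //; ring.
  rewrite e4; have := ler_normD (2 * ln 2) (ln q); have := @ln2_le R.
  have l2 : 0 <= ln 2 :> R by apply: ln_ge0'; lra.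
  by rewrite (ger0_norm (mulr_ge0 _ l2)) // -/L; move: (`|_ + _|) => a; lra.
have h3 : `|2 * (ln s * p)| <= 2 * q * (L + 2).
  have [zz|z0] := eqVneq z 0; first by rewrite /p zz cdot0l !mulr0 normr0 !mulr_ge0 // addr_ge0.
  have a0 : 0 < cmod z.
    by rewrite lt_def cmod_ge0 andbT; apply/eqP => /cmod_eq0 h; rewrite h eqxx in z0.
  have b0 : 0 < cmod d by rewrite cmod_sqrt sqrtr_gt0.
  have ab : cmod z <= cmod d by rewrite !cmod_sqrt ler_wsqrtr.
  have k1 := abs_xlnx_le (ltW a0) ab.
  have k2 : `|p| <= cmod z * cmod d by exact: cdot_le.
  have es : `|ln s| = 2 * `|ln (cmod z)| by rewrite /s -cmod_sq ln_sqr // normrM ger0_norm.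
  have eL : L = 2 * `|ln (cmod d)| by rewrite /L /q -cmod_sq ln_sqr // normrM ger0_norm.
  rewrite normrM ger0_norm // -mulrA ler_pM2l // normrM es eL /q -cmod_sq.
  by apply: cross_le k1 k2 _ _ _ _.
have g1 : `|Glog (s + 2 * p + q)| <= 4 * q * (L + 4).
  rewrite /Glog (le_trans (ler_normB _ _)) // normrM (ger0_norm s'0).
  by clear -h2 s'4; lra.
have g2 : `|Glog s| <= q * (L + 2).
  rewrite /Glog (le_trans (ler_normB _ _)) // normrM (ger0_norm s0).
  by clear -h1 sq; lra.
apply: (le_trans (ler_normB _ _)); apply: (le_trans (lerD (ler_normB _ _) (lexx _))).
move: (`|Glog _|) (`|Glog s|) (`|2 * _|) g1 g2 h3 => a b c.
have qL := mulr_ge0 q0 L0; have MqL := mulr_ge0 M0 qL; have Mq := mulr_ge0 M0 q0.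
by clear -q0 qL MqL Mq; lra.
Qed.

End log_nonlinearity.

(** * The energy space *)

Section log_continuity.
Context {R : realType}.

Lemma xlnx_sqrt (y : R) : 0 <= y -> y <= 1 -> y * `|ln y| <= 2 * Num.sqrt y.
Proof.
rewrite le_eqVlt => /predU1P[<- _|y0 y1]; first by rewrite mul0r sqrtr0 mulr0.
have s0 : 0 < Num.sqrt y by rewrite sqrtr_gt0.
have l0 := ln_le0' y1; rewrite ler0_norm //.
have e : y = Num.sqrt y ^+ 2 by rewrite sqr_sqrtr // ltW.
have h : ln y = 2 * ln (Num.sqrt y) by rewrite {1}e ln_sqr.
have := ln_diff_le ltr01 s0; rewrite ln1 sub0r => h1.
rewrite h {1}e; have := ler_wpM2l (sqr_ge0 (Num.sqrt y)) h1.
have -> : Num.sqrt y ^+ 2 * ((1 - Num.sqrt y) / Num.sqrt y) = Num.sqrt y - Num.sqrt y ^+ 2.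
  by field; rewrite gt_eqF.
have := sqr_ge0 (Num.sqrt y); move: (ln (Num.sqrt y)) (Num.sqrt y) => a b q1 q2.
by clear -q1 q2; lra.
Qed.

Lemma xlnx_cont : continuous (fun y : R => y * ln y).
Proof.
move=> y; have [y0|y0|<-] := ltgtP 0 y; last first.
- rewrite /continuous_at mul0r; apply/cvgrPdist_le => e e0.
  pose d := Num.min 1 ((e / 2) ^+ 2).
  have d0 : 0 < d by rewrite lt_min ltr01 exprn_gt0 // divr_gt0.
  exists d => //= x; rewrite sub0r normrN => xd; rewrite ?sub0r ?normrN.
  have [x0|x0] := leP x 0; first by rewrite ln0 // mulr0 normr0 ltW.
  move: xd; rewrite /= sub0r normrN gtr0_norm // lt_min => /andP[x1 xe].
  rewrite normrM gtr0_norm // (le_trans (xlnx_sqrt (ltW x0) (ltW x1))) //.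
  have : Num.sqrt x <= e / 2.
    rewrite -(@ler_pXn2r _ 2) ?nnegrE ?sqrtr_ge0 ?divr_ge0 ?(ltW e0) // sqr_sqrtr ltW //.
  by lra.
- rewrite /continuous_at ln0 ?(ltW y0) // mulr0; apply/cvgrPdist_le => e e0.
  near=> x; have x0 : x <= 0 by near: x; exact: lt_le_nbhsl.
  by rewrite (ln0 x0) mulr0 subrr normr0 ltW.
- by apply: cvgM; [exact: cvg_id|exact: continuous_ln].
Unshelve. all: by end_near. Qed.

Lemma Afun_abs_cont : continuous (fun s : R => Afun `|s|).
Proof.
have cs : continuous (fun s : R => s ^+ 2) by move=> x; exact: exprn_continuous.
have c1 : continuous (fun s : R => s ^+ 2 * ln (s ^+ 2)).
  move=> x; apply: (@continuous_comp _ _ _ (fun s : R => s ^+ 2) (fun y => y * ln y)); first exact: cs.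
  exact: xlnx_cont.
have c2 : continuous (fun s : R => Psi `|s|).
  apply: continuousEI => x e e0.
  pose M : R := `|x| + 1; have M0 : 0 < 12 + 2 * M by rewrite /M; have := normr_ge0 x; lra.
  have [d d0 Hd] := continuousEP cs x (divr_gt0 e0 M0).
  exists (Num.min d 1); first by rewrite lt_min d0 ltr01.
  move=> y; rewrite le_min => /andP[yd y1].
  have yM : `|y| <= M.
    have -> : y = x + (y - x) by ring.
    by apply: le_trans (ler_normD _ _) _; rewrite lerD2l.
  have xM : `|x| <= M by rewrite lerDl.
  apply: (le_trans (Psi_lip (normr_ge0 y) yM (normr_ge0 x) xM)).
  rewrite !real_normK ?num_real // mulrC -ler_pdivlMr //; exact: Hd.
have -> : (fun s : R => Afun `|s|) = (fun s => Psi `|s| - s ^+ 2 * ln (s ^+ 2)).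
  by apply/funext => s; rewrite /Psi real_normK ?num_real // addrK.
by move=> x; apply: cvgB; [exact: c2|exact: c1].
Qed.

Lemma Afun_unif (M e : R) : 0 < e -> exists2 d : R, 0 < d &
  forall s t : R, 0 <= s -> s <= M -> 0 <= t -> `|s - t| <= d -> `|Afun s - Afun t| <= e.
Proof.
move=> e0; have [d d0 Hd] := continuous_unif 0 M Afun_abs_cont e0.
exists d => // s t s0 sM t0 st.
have h : 0 <= s <= M by rewrite s0.
have := Hd s t h; rewrite (ger0_norm s0) (ger0_norm t0) distrC => /(_ st).
by rewrite distrC.
Qed.

(** The modulus of continuity of [Flog] on the disc of radius [M]. As it need not be monotone in
    [d], its smallness is stated for every smaller argument. *)
Definition om (M d : R) : R := d * (4 + 2 * M + `|ln (d ^+ 2)|).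

Lemma om_small (M e : R) : 0 <= M -> 0 < e -> exists2 d : R, 0 < d &
  forall r : R, 0 <= r -> r <= d -> om M r <= e.
Proof.
move=> M0 e0; pose K := 4 + 2 * M + 4.
have K0 : 0 < K by rewrite /K; lra.
exists (Num.min 1 ((e / K) ^+ 2)); first by rewrite lt_min ltr01 exprn_gt0 // divr_gt0.
move=> r r0; rewrite le_min => /andP[r1 re].
have s0 := sqrtr_ge0 r.
have re' : Num.sqrt r <= e / K.
  by rewrite -(@ler_pXn2r _ 2) ?nnegrE // ?divr_ge0 ?(ltW e0) ?(ltW K0) // sqr_sqrtr.
have rs : r <= Num.sqrt r.
  rewrite -{1}(sqr_sqrtr r0) expr2 ler_piMl // -(@ler_pXn2r _ 2) ?nnegrE // sqr_sqrtr //.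
  by rewrite expr1n.
have h : r * `|ln (r ^+ 2)| <= 4 * Num.sqrt r.
  move: r0; rewrite le_eqVlt => /predU1P[<-|r0]; first by rewrite mul0r mulr_ge0 ?sqrtr_ge0.
  rewrite ln_sqr // normrM (ger0_norm (_ : 0 <= 2)) // mulrCA.
  by have := xlnx_sqrt (ltW r0) r1; move: (_ * _) => a; lra.
have : Num.sqrt r * K <= e by rewrite -ler_pdivlMr.
rewrite /om /K (_ : r * (_ + _ + _) = r * (4 + 2 * M) + r * `|ln (r ^+ 2)|); last by ring.
move: (r * `|_|) (Num.sqrt r) h rs s0 => a b h rs s0 k.
have q : r * (4 + 2 * M) <= b * (4 + 2 * M) by rewrite ler_wpM2r //; lra.
by clear -k h q; lra.
Qed.

End log_continuity.

(** * [H^1] on the line through primitives *)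

Section sobolev.
Context {R : realType}.
Local Notation mu := (@lebesgue_measure R).
Local Notation fn := (R -> R[i]).
Implicit Types (u v g h k : fn) (c : R[i]) (a : R).

Local Notation Re u := (fun x => complex.Re (u x)).
Local Notation Im u := (fun x => complex.Im (u x)).

Definition L2c u : Prop := L2r (Re u) /\ L2r (Im u).

Lemma L2P u : L2 u <-> L2c u.
Proof.
have e : (fun x => (cmod (u x) ^+ 2)%:E) = EFin \o (fun x => complex.Re (u x) ^+ 2 + complex.Im (u x) ^+ 2).
  by apply/funext => x; rewrite /= cmod_sq.
split=> [[m1 m2 h]|[[m1 h1] [m2 h2]]].
  have h' : intg setT (fun x => complex.Re (u x) ^+ 2 + complex.Im (u x) ^+ 2) by rewrite /intg -e.
  split; split => //; apply: (intg_dom _ _ _ h') => //; try exact: measurable_funX.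
  - by move=> x _; rewrite ger0_norm ?sqr_ge0 // lerDl sqr_ge0.
  - by move=> x _; rewrite ger0_norm ?sqr_ge0 // lerDr sqr_ge0.
by split => //; rewrite e; exact: intgD.
Qed.

Definition lcc c u v : fn := fun x => c * u x + v x.

Lemma Re_lcc c u v x : complex.Re (lcc c u v x) =
  complex.Re c * complex.Re (u x) + ((- complex.Im c) * complex.Im (u x) + complex.Re (v x)).
Proof. by rewrite /lcc ReD; case: c (u x) => p q [r s] /=; ring. Qed.

Lemma Im_lcc c u v x : complex.Im (lcc c u v x) =
  complex.Re c * complex.Im (u x) + (complex.Im c * complex.Re (u x) + complex.Im (v x)).
Proof. by rewrite /lcc ImD; case: c (u x) => p q [r s] /=; ring. Qed.

Lemma L2c_lcc c u v : L2c u -> L2c v -> L2c (lcc c u v).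
Proof.
move=> [u1 u2] [v1 v2]; split.
  rewrite (_ : Re _ = fun x => complex.Re c * complex.Re (u x) +
     ((- complex.Im c) * complex.Im (u x) + complex.Re (v x))); last by apply/funext => x; exact: Re_lcc.
  by do 2 ! apply: L2r_lin => //.
rewrite (_ : Im _ = fun x => complex.Re c * complex.Im (u x) +
     (complex.Im c * complex.Re (u x) + complex.Im (v x))); last by apply/funext => x; exact: Im_lcc.
by do 2 ! apply: L2r_lin => //.
Qed.

Definition Ic u v : R := Int setT (fun x => cdot (u x) (v x)).

Lemma intg_Ic u v : L2c u -> L2c v -> intg setT (fun x => cdot (u x) (v x)).
Proof.
move=> [u1 u2] [v1 v2]; apply: (intg_ext (f := fun x => complex.Re (u x) * complex.Re (v x) +
  complex.Im (u x) * complex.Im (v x))); first by move=> x; rewrite cdotE.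
by apply: intgD => //; exact: L2rM.
Qed.

Lemma Ic_sym u v : Ic u v = Ic v u.
Proof. by apply: Int_ext => x _; rewrite cdotC. Qed.

Definition lin a u v : fn := fun x => a%:C * u x + v x.

Lemma lin_lcc a u v : lin a u v = lcc a%:C u v. Proof. by []. Qed.

Lemma L2c_lin a u v : L2c u -> L2c v -> L2c (lin a u v).
Proof. exact: L2c_lcc. Qed.

Lemma Ic_linl a u v h : L2c u -> L2c v -> L2c h -> Ic (lin a u v) h = a * Ic u h + Ic v h.
Proof.
move=> hu hv hh; rewrite /Ic -IntZ; last exact: intg_Ic.
  rewrite -IntD //; [|by apply: intgZ => //; exact: intg_Ic|exact: intg_Ic].
  by apply: Int_ext => x _; rewrite /lin cdotDl cdotZl.
exact: measurableT.
Qed.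

Lemma Ic_linr a u v h : L2c u -> L2c v -> L2c h -> Ic h (lin a u v) = a * Ic h u + Ic h v.
Proof. by move=> *; rewrite Ic_sym Ic_linl // !(Ic_sym h). Qed.

Lemma Ic_ge0 u : 0 <= Ic u u.
Proof. by apply: Int_ge0 => x _; rewrite cdotzz nsq_ge0. Qed.

Lemma Ic_lin_sq a u v : L2c u -> L2c v ->
  Ic (lin a u v) (lin a u v) = a ^+ 2 * Ic u u + 2 * a * Ic u v + Ic v v.
Proof.
move=> hu hv; have hl := L2c_lin a hu hv.
rewrite Ic_linl // !Ic_linr // (Ic_sym v u).
by move: (Ic u u) (Ic u v) (Ic v v) => p q r; ring.
Qed.

Lemma Ic_CS u v : L2c u -> L2c v -> Ic u v ^+ 2 <= Ic u u * Ic v v.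
Proof.
move=> hu hv; rewrite mulrC; apply: discr_le => [|t]; first exact: Ic_ge0.
by have := Ic_ge0 (lin t u v); rewrite Ic_lin_sq //; lra.
Qed.

Lemma Ic_abs_le u v (p q : R) : L2c u -> L2c v -> Ic u u <= p ^+ 2 -> Ic v v <= q ^+ 2 ->
  0 <= p -> 0 <= q -> `|Ic u v| <= p * q.
Proof.
move=> hu hv hp hq p0 q0; rewrite -(@ler_pXn2r _ 2) ?nnegrE ?mulr_ge0 //.
rewrite real_normK ?num_real // (le_trans (Ic_CS hu hv)) // exprMn.
by apply: ler_pM => //; exact: Ic_ge0.
Qed.

(** The form of a square integrable weak derivative used throughout, with primitives in place of
    test functions. *)
Definition hasd u g : Prop := [/\ L2c g, ac (Re u) (Re g) & ac (Im u) (Im g)].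

Lemma ac_ext (f f' g g' : R -> R) : f =1 f' -> g =1 g' -> ac f g -> ac f' g'.
Proof. by move=> /funext -> /funext ->. Qed.

Lemma hasd_lcc c u v g k : hasd u g -> hasd v k -> hasd (lcc c u v) (lcc c g k).
Proof.
move=> [g1 g2 g3] [k1 k2 k3]; split; first exact: L2c_lcc.
  apply: (ac_ext (fun x => esym (Re_lcc c u v x)) (fun x => esym (Re_lcc c g k x))).
  by do 2 ! apply: ac_lin => //.
apply: (ac_ext (fun x => esym (Im_lcc c u v x)) (fun x => esym (Im_lcc c g k x))).
by do 2 ! apply: ac_lin => //.
Qed.

Lemma weak_hasd u g : continuous (Re u) -> continuous (Im u) -> L2c g ->
  weak_derivative u g <-> hasd u g.
Proof.
move=> c1 c2 [g1 g2]; split=> [H|[_ a1 a2] f tf]; last first.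
  split; [exact: (ac_weak c1 a1 g1.1 tf)|exact: (ac_weak c2 a2 g2.1 tf)].
split => //; apply: weak_ac => //; try by have [] := g1.
- by move=> a b; exact: L2r_intg.
- by move=> f tf; exact: (H f tf).1.
- by have [] := g2.
- by move=> a b; exact: L2r_intg.
- by move=> f tf; exact: (H f tf).2.
Qed.

Lemma H1P u : H1 u <-> [/\ continuous (Re u), continuous (Im u), L2c u & exists g, hasd u g].
Proof.
split=> [[c1 c2 /L2P l [g [/L2P lg w]]]|[c1 c2 l [g hg]]].
  by split => //; exists g; apply/weak_hasd.
split => //; first exact/L2P.
by exists g; have [lg _ _] := hg; split; [exact/L2P|apply/weak_hasd].
Qed.

Lemma dx_hasd u : H1 u -> hasd u (dx u).
Proof.
move=> [c1 c2 _ [g [lg w]]].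
have [|l' w'] := @xgetPex _ (fun=> 0) [set g | L2 g /\ weak_derivative u g]; first by exists g.
by apply/weak_hasd => //; exact/L2P.
Qed.

Lemma H1_L2c u : H1 u -> L2c u. Proof. by case/H1P. Qed.

Lemma IntE (f : R -> R) : (\int[mu]_x f x) = Int setT f.
Proof. by []. Qed.

Lemma intgE (f : R -> R) : mu.-integrable setT (fun x => (f x)%:E) = intg setT f :> Prop.
Proof. by []. Qed.

Opaque H1 dx Int intg.

Lemma cont_lcc c u v : continuous (Re u) -> continuous (Im u) -> continuous (Re v) -> continuous (Im v) ->
  continuous (Re (lcc c u v)) /\ continuous (Im (lcc c u v)).
Proof.
move=> u1 u2 v1 v2; split.
  rewrite (_ : Re _ = fun x => complex.Re c * complex.Re (u x) +
     ((- complex.Im c) * complex.Im (u x) + complex.Re (v x))); last by apply/funext => x; exact: Re_lcc.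
  move=> x; apply: cvgD; first by apply: cvgM; [exact: cvg_cst|exact: u1].
  by apply: cvgD; [apply: cvgM; [exact: cvg_cst|exact: u2]|exact: v1].
rewrite (_ : Im _ = fun x => complex.Re c * complex.Im (u x) +
     (complex.Im c * complex.Re (u x) + complex.Im (v x))); last by apply/funext => x; exact: Im_lcc.
move=> x; apply: cvgD; first by apply: cvgM; [exact: cvg_cst|exact: u2].
by apply: cvgD; [apply: cvgM; [exact: cvg_cst|exact: u1]|exact: v2].
Qed.

Lemma H1_lcc c u v : H1 u -> H1 v -> H1 (lcc c u v).
Proof.
move=> /H1P[u1 u2 u3 [g hg]] /H1P[v1 v2 v3 [k hk]]; apply/H1P.
have [c1 c2] := cont_lcc c u1 u2 v1 v2.
by split => //; [exact: L2c_lcc|exists (lcc c g k); exact: hasd_lcc].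
Qed.

Lemma hasd_ae u g g' : hasd u g -> hasd u g' -> {ae mu, forall x, g x = g' x}.
Proof.
move=> [[l1 l2] a1 a2] [[l1' l2'] a1' a2'].
have e1 := ac_uniq (or_intror l1.1) (or_intror l1'.1) a1 a1'.
have e2 := ac_uniq (or_intror l2.1) (or_intror l2'.1) a2 a2'.
have := @filterS2 _ _ (ae_filter_ringOfSetsType mu) _ _ (fun x => g x = g' x) _ e1 e2.
by apply => x /(_ I) /= h1 /(_ I) /= h2; case: (g x) (g' x) h1 h2 => ? ? [? ?] /= -> ->.
Qed.

(** Frees the Dirichlet form from the arbitrary choice made in [dx]: any explicit derivative may be
    substituted. *)
Lemma Ic_hasd u v g g' k k' : hasd u g -> hasd u g' -> hasd v k -> hasd v k' -> Ic g k = Ic g' k'.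
Proof.
move=> hg hg' hk hk'; have e1 := hasd_ae hg hg'; have e2 := hasd_ae hk hk'.
have [lg _ _] := hg; have [lg' _ _] := hg'; have [lk _ _] := hk; have [lk' _ _] := hk'.
apply: ae_eq_Int => //; try by apply: intg_meas; exact: intg_Ic.
by apply: (@filterS2 _ _ (ae_filter_ringOfSetsType mu) _ _ _ _ e1 e2) => x -> ->.
Qed.

Definition Qf u : R := Ic u u.
Definition Bf u v : R := Ic (dx u) (dx v).
Definition Df u : R := Bf u u.

Lemma Bf_hasd u v g k : H1 u -> H1 v -> hasd u g -> hasd v k -> Bf u v = Ic g k.
Proof. by move=> hu hv hg hk; apply: Ic_hasd hg _ hk => //; exact: dx_hasd. Qed.

Lemma Bf_sym u v : Bf u v = Bf v u. Proof. exact: Ic_sym. Qed.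

Lemma linE a u v x : lin a u v x = a%:C * u x + v x. Proof. by []. Qed.

Lemma lccE c u v x : lcc c u v x = c * u x + v x. Proof. by []. Qed.

Opaque lin lcc.

Lemma H1_lin a u v : H1 u -> H1 v -> H1 (lin a u v). Proof. by rewrite lin_lcc; exact: H1_lcc. Qed.

Lemma Bf_linl a u v h : H1 u -> H1 v -> H1 h -> Bf (lin a u v) h = a * Bf u h + Bf v h.
Proof.
move=> hu hv hh; have [du dv dh] := And3 (dx_hasd hu) (dx_hasd hv) (dx_hasd hh).
have hd := hasd_lcc a%:C du dv; rewrite -!lin_lcc in hd.
rewrite (Bf_hasd (H1_lin a hu hv) hh hd dh).
by have [lu _ _] := du; have [lv _ _] := dv; have [lh _ _] := dh; rewrite Ic_linl.
Qed.

Lemma Bf_linr a u v h : H1 u -> H1 v -> H1 h -> Bf h (lin a u v) = a * Bf h u + Bf h v.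
Proof. by move=> hu hv hh; rewrite Bf_sym (Bf_linl a hu hv hh) (Bf_sym u) (Bf_sym v). Qed.

Lemma Df_ge0 u : 0 <= Df u. Proof. exact: Ic_ge0. Qed.
Lemma Qf_ge0 u : 0 <= Qf u. Proof. exact: Ic_ge0. Qed.

Lemma Qf_lin a u v : L2c u -> L2c v -> Qf (lin a u v) = a ^+ 2 * Qf u + 2 * a * Ic u v + Qf v.
Proof. exact: Ic_lin_sq. Qed.

Lemma Df_lin a u v : H1 u -> H1 v -> Df (lin a u v) = a ^+ 2 * Df u + 2 * a * Bf u v + Df v.
Proof.
move=> hu hv; have hl := H1_lin a hu hv.
rewrite /Df (Bf_linl a hu hv hl) (Bf_linr a hu hv hu) (Bf_linr a hu hv hv) (Bf_sym v u).
by move: (Bf u u) (Bf u v) (Bf v v) => p q r; ring.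
Qed.

Lemma Bf_abs_le u v (p q : R) : H1 u -> H1 v -> Df u <= p ^+ 2 -> Df v <= q ^+ 2 ->
  0 <= p -> 0 <= q -> `|Bf u v| <= p * q.
Proof.
move=> hu hv; have [lu _ _] := dx_hasd hu; have [lv _ _] := dx_hasd hv.
exact: Ic_abs_le.
Qed.

Lemma Qf_nsq u : Qf u = Int setT (fun x => nsq (u x)).
Proof. by apply: Int_ext => x _; rewrite cdotzz. Qed.

Lemma Ic_nsq u : Ic u u = Int setT (fun x => nsq (u x)).
Proof. by apply: Int_ext => x _; rewrite cdotzz. Qed.

Lemma L2c_nsq u : L2c u -> intg setT (fun x => nsq (u x)).
Proof. by move=> h; apply: intg_ext (intg_Ic h h) => x; rewrite cdotzz. Qed.

Lemma Ic_ReIm u : L2c u -> Ic u u = Int setT (fun x => complex.Re (u x) ^+ 2) +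
  Int setT (fun x => complex.Im (u x) ^+ 2).
Proof.
move=> [[_ h1] [_ h2]]; rewrite -IntD //; apply: Int_ext => x _.
by rewrite cdotE !expr2.
Qed.

Lemma hasd_holder u g (x y : R) : hasd u g -> nsq (u y - u x) <= `|y - x| * Ic g g.
Proof.
move=> hg; wlog xy : x y / x <= y.
  move=> H; have [xy|/ltW yx] := leP x y; first exact: H.
  by rewrite -nsqN opprB distrC; exact: H.
have [[g1 g2] a1 a2] := hg.
have [_ e1] := a1 _ _ xy; have [_ e2] := a2 _ _ xy.
rewrite /nsq ReB ImB e1 e2 (ger0_norm (_ : 0 <= y - x)) ?subr_ge0 // Ic_ReIm // mulrDr.
by rewrite lerD //; exact: L2r_Int_le.
Qed.

Lemma H1_holder u (x y : R) : H1 u -> nsq (u y - u x) <= `|y - x| * Df u.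
Proof. by move=> /dx_hasd; exact: hasd_holder. Qed.

Lemma nsq_le_add (a : R) (z w : R[i]) : nsq (z - w) <= a -> nsq w <= 2 * nsq z + 2 * a.
Proof.
move=> h; have := nsqB_le z (z - w); rewrite (_ : z - (z - w) = w); last by ring.
by move: (nsq w) (nsq z) (nsq (z - w)) h => a1 a2 a3; lra.
Qed.

(** Average the Hoelder estimate over [[x, x + d]]. The free length [d] trades the charge against
    the Dirichlet integral: a small [d] makes the latter absorbable in the energy, and makes a small
    charge force a small supremum. *)
Lemma H1_sup u (x d : R) : H1 u -> 0 < d -> nsq (u x) <= 2 * (Qf u / d + d * Df u).
Proof.
move=> hu d0; have lu := H1_L2c hu; have iu := L2c_nsq lu.
have xd : x <= x + d by rewrite lerDl ltW.
have pt y : `[x, x + d]%classic y -> nsq (u x) - 2 * (d * Df u) <= 2 * nsq (u y).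
  rewrite /= in_itv /= => /andP[xy yd].
  have h : nsq (u y - u x) <= d * Df u.
    apply: (le_trans (H1_holder x y hu)); rewrite ler_wpM2r ?Df_ge0 //.
    by rewrite ger0_norm ?subr_ge0 // lerBlDl.
  by have := nsq_le_add h; lra.
have i1 : intg `[x, x + d] (fun y => nsq (u y)) by exact: intg_sub.
have h1 : Int `[x, x + d] (fun=> nsq (u x) - 2 * (d * Df u)) <= Int `[x, x + d] (fun y => 2 * nsq (u y)).
  by apply: Int_le => //; [exact: cst_intg|exact: intgZ].
have h2 : Int `[x, x + d] (fun y => nsq (u y)) <= Qf u.
  by rewrite Qf_nsq; apply: Int_subset => // y _; exact: nsq_ge0.
move: h1; rewrite Int_cst // IntZ // (_ : x + d - x = d); last by ring.
move=> h1; have e : Qf u / d * d = Qf u by rewrite mulfVK // gt_eqF.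
rewrite -(ler_pM2r d0) (_ : 2 * (Qf u / d + d * Df u) * d = 2 * Qf u + 2 * (d * Df u) * d); last first.
  by rewrite -[in RHS]e; ring.
by move: (Qf u) (Int _ _) (nsq _) (d * Df u) h1 h2 => q i n m; clear; lra.
Qed.

Lemma nsq_le_cmod (z : R[i]) (M : R) : 0 <= M -> nsq z <= M ^+ 2 -> cmod z <= M.
Proof. by move=> M0 h; rewrite -(@ler_pXn2r _ 2) ?nnegrE ?cmod_ge0 // cmod_sq. Qed.

Lemma H1_cmod_le u (x q d : R) : H1 u -> Qf u <= q -> Df u <= d ->
  cmod (u x) <= 2 * (q + d) + 1.
Proof.
move=> hu hq hd; have := H1_sup x hu ltr01; rewrite divr1 mul1r => h.
have q0 := le_trans (Qf_ge0 u) hq; have d0 := le_trans (Df_ge0 u) hd.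
apply: nsq_le_cmod; first by lra.
by move: (nsq _) h => n h; nra.
Qed.

End sobolev.

(** * The space [W], its bounded sets and the operator of the equation *)

Section energy_space.
Context {R : realType}.
Local Notation mu := (@lebesgue_measure R).
Local Notation fn := (R -> R[i]).
Implicit Types (u v w g h k : fn) (c : R[i]) (a : R).

Local Notation Re u := (fun x => complex.Re (u x)).
Local Notation Im u := (fun x => complex.Im (u x)).

Definition zf : fn := fun=> 0.

Lemma H1_cont u : H1 u -> continuous (Re u) /\ continuous (Im u).
Proof. by case/H1P. Qed.

Lemma cmod_cont u : continuous (Re u) -> continuous (Im u) -> continuous (fun x => cmod (u x)).
Proof.
move=> c1 c2.
have -> : (fun x => cmod (u x)) = (fun x => Num.sqrt (complex.Re (u x) ^+ 2 + complex.Im (u x) ^+ 2)).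
  by apply/funext => x; rewrite cmod_sqrt.
move=> x; apply: (@continuous_comp _ _ _ (fun x => complex.Re (u x) ^+ 2 + complex.Im (u x) ^+ 2)).
  by apply: cvgD; apply: cvgM; (exact: c1 || exact: c2).
exact: sqrt_continuous.
Qed.

Definition Ax u (x : R) : R := Afun (cmod (u x)).

Lemma Ax_ge0 u x : 0 <= Ax u x. Proof. by apply: Afun_ge0; exact: cmod_ge0. Qed.

Lemma Ax_cont u : H1 u -> continuous (Ax u).
Proof.
move=> /H1_cont[c1 c2].
have -> : Ax u = (fun x => Afun `|cmod (u x)|).
  by apply/funext => x; rewrite /Ax ger0_norm ?cmod_ge0.
move=> x; apply: (@continuous_comp _ _ _ (fun x => cmod (u x)) (fun s => Afun `|s|)).
  exact: cmod_cont.
exact: Afun_abs_cont.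
Qed.

Lemma H1_bounded u : H1 u -> exists2 M : R, 0 < M & forall x, cmod (u x) <= M.
Proof.
move=> hu; exists (2 * (Qf u + Df u) + 1); last by move=> x; exact: H1_cmod_le.
by have := Qf_ge0 u; have := Df_ge0 u; move: (Qf u) (Df u) => p q; lra.
Qed.

Lemma W_H1 u : W u -> H1 u. Proof. by case. Qed.

Lemma sqln_cont u : H1 u -> continuous (fun x => cmod (u x) ^+ 2 * ln (cmod (u x) ^+ 2)).
Proof.
move=> /H1_cont[c1 c2] x.
apply: (@continuous_comp _ _ _ (fun x => cmod (u x) ^+ 2) (fun y => y * ln y)); last exact: xlnx_cont.
by apply: cvgM; exact: cmod_cont.
Qed.

(** Elements of [H^1] are bounded, and on bounded functions [s^2 |ln s^2|] and [Afun s] control each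
    other up to a multiple of [s^2]. *)
Lemma WP u : W u <-> H1 u /\ intg setT (Ax u).
Proof.
split=> [[hu hl]|[hu hA]].
  split => //; have iu := L2c_nsq (H1_L2c hu).
  have hl' : intg setT (fun x => `|cmod (u x) ^+ 2 * ln (cmod (u x) ^+ 2)|).
    by apply: intg_abs => //; rewrite -intgE.
  apply: (@intg_dom _ _ _ (fun x => 6 * nsq (u x) + `|cmod (u x) ^+ 2 * ln (cmod (u x) ^+ 2)|)) => //.
  - exact: continuous_meas (Ax_cont hu).
  - move=> x _; rewrite ger0_norm ?Ax_ge0 // (le_trans (Afun_le (cmod_ge0 _))) //.
    by rewrite cmod_sq normrM (ger0_norm (nsq_ge0 _)).
  - by apply: intgD => //; exact: intgZ.
split => //; rewrite intgE; have [M M0 hM] := H1_bounded hu.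
apply: (@intg_dom _ _ _ (fun x => (6 + 2 * M) * Ax u x)) => //.
- exact: continuous_meas (sqln_cont hu).
- move=> x _; rewrite normrM (ger0_norm (sqr_ge0 _)).
  by apply: sqr_ln_le; rewrite ?cmod_ge0.
- exact: intgZ.
Qed.

Opaque W.

Definition Au u : R := Int setT (Ax u).

Lemma Au_ge0 u : 0 <= Au u. Proof. by apply: Int_ge0 => x _; exact: Ax_ge0. Qed.

Lemma W_intg u : W u -> intg setT (Ax u). Proof. by case/WP. Qed.

Lemma AfunM (s t : R) : 0 <= t -> 0 <= s -> Afun (t * s) <= (1 + t) ^+ 2 * Afun s.
Proof.
move=> t0 s0; apply: le_trans (AfunZ _ s0); last by rewrite lerDl.
by apply: Afun_mono; rewrite ?mulr_ge0 // ler_wpM2r // lerDr.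
Qed.

Lemma Ax_lcc c u v x : Ax (lcc c u v) x <= 4 * ((1 + cmod c) ^+ 2 * Ax u x + Ax v x).
Proof.
rewrite /Ax lccE; apply: (@le_trans _ _ (Afun (cmod c * cmod (u x) + cmod (v x)))).
  by apply: Afun_mono; rewrite ?cmod_ge0 // -cmodM cmodD_le.
apply: (le_trans (AfunD _ _)); rewrite ?mulr_ge0 ?cmod_ge0 // ler_pM2l // lerD2r.
by apply: AfunM; exact: cmod_ge0.
Qed.

Lemma W_lcc c u v : W u -> W v -> W (lcc c u v).
Proof.
move=> /WP[hu iu] /WP[hv iv]; apply/WP; have hl := H1_lcc c hu hv; split => //.
apply: (@intg_dom _ _ _ (fun x => 4 * ((1 + cmod c) ^+ 2 * Ax u x + Ax v x))) => //.
- exact: continuous_meas (Ax_cont hl).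
- by move=> x _; rewrite ger0_norm ?Ax_ge0 // Ax_lcc.
- by apply: intgZ => //; apply: intgD => //; exact: intgZ.
Qed.

Lemma Au_lcc c u v : W u -> W v -> Au (lcc c u v) <= 4 * ((1 + cmod c) ^+ 2 * Au u + Au v).
Proof.
move=> wu wv; have iu := W_intg wu; have iv := W_intg wv; have il := W_intg (W_lcc c wu wv).
have i1 : intg setT (fun x => (1 + cmod c) ^+ 2 * Ax u x) by exact: intgZ.
rewrite -IntZ // -IntD // -IntZ //; last exact: intgD.
apply: Int_le => //; first by apply: intgZ => //; exact: intgD.
by move=> x _; exact: Ax_lcc.
Qed.

Lemma W_lin a u v : W u -> W v -> W (lin a u v).
Proof. by rewrite lin_lcc; exact: W_lcc. Qed.

Lemma ac0 : ac (fun=> 0 : R) (fun=> 0 : R).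
Proof. by move=> a b ab; split; [exact: cst_intg|rewrite Int0 subrr]. Qed.

Lemma L2r0 : L2r (fun=> 0 : R).
Proof.
split; first exact: measurable_cst.
by apply: (intg_ext (f := fun=> 0)); [move=> x; rewrite expr0n|exact: intg0].
Qed.

Lemma W0 : W zf.
Proof.
apply/WP; split.
  apply/H1P; split; try by move=> x; exact: cvg_cst.
    by split; exact: L2r0.
  by exists zf; split; [split; exact: L2r0|exact: ac0|exact: ac0].
by apply: (intg_ext (f := fun=> 0)); [move=> x; rewrite /Ax cmod0 Afun0|exact: intg0].
Qed.

Definition scl a u : fn := lin a u zf.
(** Multiplication by [-i], the sign with which the multiplication by [i] acts on test functions in
    the dual. *)
Definition mi u : fn := lcc (- 'i) u zf.

Lemma sclE a u x : scl a u x = a%:C * u x. Proof. by rewrite /scl linE addr0. Qed.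
Lemma miE u x : mi u x = - 'i * u x. Proof. by rewrite /mi lccE addr0. Qed.
Lemma W_scl a u : W u -> W (scl a u). Proof. by move=> wu; apply: W_lin => //; exact: W0. Qed.
Lemma W_mi u : W u -> W (mi u). Proof. by move=> wu; apply: W_lcc => //; exact: W0. Qed.

Lemma Ic0l u : Ic zf u = 0.
Proof. by rewrite /Ic (@Int_ext _ _ _ (fun=> 0)) ?Int0 // => x _; rewrite cdot0l. Qed.

Lemma W_L2c u : W u -> L2c u. Proof. by move=> /W_H1/H1_L2c. Qed.

Lemma Qf_scl a u : W u -> Qf (scl a u) = a ^+ 2 * Qf u.
Proof.
move=> wu; rewrite Qf_lin; [|exact: W_L2c|exact: W_L2c W0].
by rewrite Ic_sym Ic0l /Qf Ic0l mulr0 !addr0.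
Qed.

Lemma Bf0l u : W u -> Bf zf u = 0.
Proof.
move=> wu; have h0 := W_H1 W0; have hu := W_H1 wu.
have := Bf_linl 1 h0 h0 hu; rewrite (_ : lin 1 zf zf = zf); last first.
  by apply/funext => x; rewrite linE mulr0 addr0.
by move: (Bf zf u) => p; lra.
Qed.

Lemma Df_scl a u : W u -> Df (scl a u) = a ^+ 2 * Df u.
Proof.
move=> wu; rewrite (Df_lin a (W_H1 wu) (W_H1 W0)).
by rewrite Bf_sym /Df (Bf0l wu) (Bf0l W0) mulr0 !addr0.
Qed.

Lemma cmod_scl a u x : cmod (scl a u x) = `|a| * cmod (u x).
Proof. by rewrite sclE cmodZ. Qed.

Lemma cmod_mi u x : cmod (mi u x) = cmod (u x).
Proof. by rewrite miE cmod_i. Qed.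

Lemma Au_mi u : Au (mi u) = Au u.
Proof. by apply: Int_ext => x _; rewrite /Ax cmod_mi. Qed.

Lemma Qf_mi u : Qf (mi u) = Qf u.
Proof. by rewrite !Qf_nsq; apply: Int_ext => x _; rewrite miE nsq_i. Qed.

Lemma hasd_mi u g : hasd u g -> hasd (mi u) (mi g).
Proof.
move=> hg; apply: hasd_lcc => //.
by split; [split; exact: L2r0|exact: ac0|exact: ac0].
Qed.

Lemma Bf_mi u v : W u -> W v -> Bf (mi u) v = - Bf u (mi v).
Proof.
move=> wu wv; have hu := W_H1 wu; have hv := W_H1 wv.
have du := dx_hasd hu; have dv := dx_hasd hv.
rewrite (Bf_hasd (W_H1 (W_mi wu)) hv (hasd_mi du) dv).
rewrite (Bf_hasd hu (W_H1 (W_mi wv)) du (hasd_mi dv)).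
rewrite /Ic -IntN //; last first.
  by apply: intg_Ic; [have [] := du|have [] := hasd_mi dv].
by apply: Int_ext => x _; rewrite !miE cdot_mulil.
Qed.

Lemma Df_mi u : W u -> Df (mi u) = Df u.
Proof.
move=> wu; rewrite /Df Bf_mi //; last exact: W_mi.
have -> : mi (mi u) = scl (-1) u.
  by apply/funext => x; rewrite !miE sclE; case: (u x) => p q; apply/eqP; rewrite eq_complex /=;
     apply/andP; split; apply/eqP; ring.
rewrite /scl (Bf_linr _ (W_H1 wu) (W_H1 W0) (W_H1 wu)) (Bf_sym u zf) (Bf0l wu).
by move: (Bf u u) => p; ring.
Qed.

Lemma Bf_rot u : W u -> Bf u (mi u) = 0.
Proof.
move=> wu; have := Bf_mi wu wu; rewrite Bf_sym.
by move: (Bf u (mi u)) => p; lra.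
Qed.

Lemma Flog_cont u : H1 u ->
  continuous (Re (fun x => Flog (u x))) /\ continuous (Im (fun x => Flog (u x))).
Proof.
move=> hu; have [c1 c2] := H1_cont hu; have [M M0 hM] := H1_bounded hu.
have key (x e : R) : 0 < e -> exists2 d : R, 0 < d & forall y, `|y - x| <= d ->
    cmod (Flog (u y) - Flog (u x)) <= e.
  move=> e0; have [d d0 Hd] := om_small (ltW M0) e0.
  have d2 : 0 < d / 2 by rewrite divr_gt0.
  have [d1 d10 H1'] := continuousEP c1 x d2; have [d3 d30 H3] := continuousEP c2 x d2.
  exists (Num.min d1 d3); first by rewrite lt_min d10.
  move=> y; rewrite le_min => /andP[y1 y3].
  apply: (le_trans (Flog_mod (hM y) (hM x))); apply: Hd; first exact: cmod_ge0.
  apply: (le_trans (cmod_le _)); rewrite ReB ImB.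
  by have := H1' y y1; have := H3 y y3; move: (`|_ - _|) => p; move: (`|_ - _|) => q; lra.
split; apply: continuousEI => x e e0; have [d d0 H] := key x e e0; exists d => // y yx.
  by rewrite -ReB (le_trans (Re_le _)) // H.
by rewrite -ImB (le_trans (Im_le _)) // H.
Qed.

Definition Nf u h : R := Int setT (fun x => cdot (Flog (u x)) (h x)).

Lemma Nf_meas u h : H1 u -> H1 h -> measurable_fun setT (fun x => cdot (Flog (u x)) (h x)).
Proof.
move=> /Flog_cont[f1 f2] /H1_cont[c1 c2].
rewrite (_ : (fun x => _) = fun x => complex.Re (Flog (u x)) * complex.Re (h x) +
   complex.Im (Flog (u x)) * complex.Im (h x)); last by apply/funext => x; rewrite cdotE.
by apply: measurable_funD; apply: measurable_funM; exact: continuous_meas.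
Qed.

Lemma Nf_intg u h : W u -> W h -> intg setT (fun x => cdot (Flog (u x)) (h x)).
Proof.
move=> wu wh; have [M M0 hM] := H1_bounded (W_H1 wu).
apply: (@intg_dom _ _ _ (fun x => (6 + 2 * M) * (Ax u x + Ax h x))) => //.
- exact: Nf_meas (W_H1 wu) (W_H1 wh).
- by move=> x _; apply: cdot_Flog_le; exact: hM.
- by apply: intgZ => //; apply: intgD => //; exact: W_intg.
Qed.

Lemma Nf_le u h (M : R) : W u -> W h -> (forall x, cmod (u x) <= M) ->
  `|Nf u h| <= (6 + 2 * M) * (Au u + Au h).
Proof.
move=> wu wh hM; have iu := W_intg wu; have ih := W_intg wh.
rewrite -IntD // -IntZ //; last exact: intgD.
apply: Int_norm_le => //; first exact: Nf_meas (W_H1 wu) (W_H1 wh).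
  by apply: intgZ => //; exact: intgD.
by move=> x _; apply: cdot_Flog_le; exact: hM.
Qed.

Lemma Nf_linr u a h k : W u -> W h -> W k -> Nf u (lin a h k) = a * Nf u h + Nf u k.
Proof.
move=> wu wh wk; have i1 := Nf_intg wu wh; have i2 := Nf_intg wu wk.
have i3 : intg setT (fun x => a * cdot (Flog (u x)) (h x)) by exact: intgZ.
by rewrite /Nf -IntZ // -IntD //; apply: Int_ext => x _; rewrite linE cdotDr cdotZr.
Qed.

Definition Lam (gamma : R) u h : R := - Bf u h + gamma * cdot (u 0) (h 0) + Nf u h.

Lemma LamE gamma u h : logNLS_op gamma u h = Lam gamma u h.
Proof. by rewrite /logNLS_op /Lam /Bf /Ic /Nf !IntE. Qed.

Lemma Lam_linr gamma u a h k : W u -> W h -> W k ->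
  Lam gamma u (lin a h k) = a * Lam gamma u h + Lam gamma u k.
Proof.
move=> wu wh wk; rewrite /Lam (Bf_linr a (W_H1 wh) (W_H1 wk) (W_H1 wu)) Nf_linr //.
rewrite linE cdotDr cdotZr.
move: (Bf u h) (Bf u k) (Nf u h) (Nf u k) (cdot _ _) (cdot _ _) => b1 b2 n1 n2 c1 c2; ring.
Qed.

(** Gauge invariance in infinitesimal form; it yields conservation of the charge. *)
Lemma Lam_rot gamma u : W u -> Lam gamma u (mi u) = 0.
Proof.
move=> wu; rewrite /Lam Bf_rot // miE cdot_rot /Nf (@Int_ext _ _ _ (fun=> 0)) ?Int0; first by ring.
by move=> x _; rewrite miE cdot_Flog cdot_rot mulr0.
Qed.

(** Tested against [-i] times the difference, the Dirichlet and the delta terms cancel, and the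
    Cazenave-Haraux inequality bounds what is left pointwise. *)
Lemma Lam_monotone gamma u v : W u -> W v ->
  `|Lam gamma u (mi (lin (-1) v u)) - Lam gamma v (mi (lin (-1) v u))| <= 2 * Qf (lin (-1) v u).
Proof.
move=> wu wv; set w := lin (-1) v u.
have ww : W w by exact: W_lin.
have wm : W (mi w) by exact: W_mi.
have eB : Bf u (mi w) - Bf v (mi w) = 0.
  have := Bf_linl (-1) (W_H1 wv) (W_H1 wu) (W_H1 wm); rewrite -/w (Bf_rot ww).
  by move: (Bf u _) (Bf v _) => p q; lra.
have eC : cdot (u 0) (mi w 0) - cdot (v 0) (mi w 0) = 0.
  rewrite -cdotBl (_ : u 0 - v 0 = w 0) ?miE ?cdot_rot //.
  by rewrite /w linE rmorphN1 mulN1r addrC.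
have -> : Lam gamma u (mi w) - Lam gamma v (mi w) = Nf u (mi w) - Nf v (mi w).
  rewrite /Lam; move: (Bf u _) (Bf v _) (Nf u _) (Nf v _) (cdot (u 0) _) (cdot (v 0) _) eB eC.
  move=> b1 b2 n1 n2 p q e1 e2; rewrite (_ : b1 = b2); last by lra.
  by rewrite (_ : p = q); [ring|lra].
have i1 := Nf_intg wu wm; have i2 := Nf_intg wv wm.
have iq := L2c_nsq (W_L2c ww).
rewrite /Nf -IntB // Qf_nsq -IntZ //; apply: Int_norm_le => //.
- by apply: intg_meas; exact: intgB.
- exact: intgZ.
move=> x _; rewrite -cdotBl miE (_ : w x = u x - v x); last first.
  by rewrite /w linE rmorphN1 mulN1r addrC.
exact: Flog_monotone.
Qed.

(** Boundedness in [W] through the three quantities that the estimates use, so that the infimum in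
    the Luxemburg norm appears only at the interface with the norm. *)
Definition bdd (K : R) u : Prop := [/\ W u, Qf u <= K, Df u <= K & Au u <= K].

Lemma bdd_W K u : bdd K u -> W u. Proof. by case. Qed.

Lemma bdd_cmod K u x : bdd K u -> cmod (u x) <= 4 * K + 1.
Proof.
move=> [wu hq hd _]; apply: (le_trans (H1_cmod_le x (W_H1 wu) hq hd)).
by lra.
Qed.

Lemma bdd_ge0 K u : bdd K u -> 0 <= K.
Proof. by move=> [_ hq _ _]; exact: le_trans (Qf_ge0 u) hq. Qed.

Lemma bdd_sub K u v : bdd K u -> bdd K v -> bdd (8 * (4 * K + K)) (lin (-1) u v).
Proof.
move=> bu bv; have K0 := bdd_ge0 bu; have [wu u1 u2 u3] := bu; have [wv v1 v2 v3] := bv.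
have hu := W_H1 wu; have hv := W_H1 wv.
split; first exact: W_lin.
- rewrite (Qf_lin _ (H1_L2c hu) (H1_L2c hv)).
  have := Qf_lin 1 (H1_L2c hu) (H1_L2c hv); have := Qf_ge0 (lin 1 u v).
  move: (Qf u) (Qf v) (Qf (lin 1 u v)) (Ic u v) u1 v1; clear -K0 => a b c d u1 v1 e1 e2.
  by lra.
- rewrite (Df_lin _ hu hv).
  have := Df_lin 1 hu hv; have := Df_ge0 (lin 1 u v).
  move: (Df u) (Df v) (Df (lin 1 u v)) (Bf u v) u2 v2; clear -K0 => a b c d u1 v1 e1 e2.
  by lra.
- rewrite lin_lcc; apply: (le_trans (Au_lcc _ wu wv)).
  have -> : cmod (-1)%:C = 1 :> R by rewrite -[(-1)%:C]mulr1 cmodZ normrN1 mul1r cmod_sqrt /nsq /= expr1n expr0n addr0 sqrtr1.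
  by move: (Au u) (Au v) u3 v3 => a b; clear -K0; move=> *; lra.
Qed.

Lemma Lam_le gamma K u h : bdd K u -> bdd K h ->
  `|Lam gamma u h| <= K + `|gamma| * (4 * K + 1) ^+ 2 + (6 + 2 * (4 * K + 1)) * (K + K).
Proof.
move=> bu bh; have K0 := bdd_ge0 bu; have [wu u1 u2 u3] := bu; have [wh h1 h2 h3] := bh.
have s0 := sqrtr_ge0 K.
rewrite /Lam; apply: le_trans (ler_normD _ _) _; apply: lerD; last first.
  apply: (le_trans (Nf_le wu wh (fun x => bdd_cmod x bu))); rewrite ler_wpM2l ?lerD //.
  by clear -K0; lra.
apply: le_trans (ler_normD _ _) _; rewrite normrN normrM; apply: lerD.
  have := @Bf_abs_le _ u h (Num.sqrt K) (Num.sqrt K) (W_H1 wu) (W_H1 wh).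
  by rewrite -expr2 !sqr_sqrtr //; apply.
rewrite ler_wpM2l // (le_trans (cdot_le _ _)) // expr2.
by apply: ler_pM; rewrite ?cmod_ge0 // bdd_cmod.
Qed.

Lemma IcE u v : Ic u v = Int setT (fun x => cdot (u x) (v x)). Proof. by []. Qed.
Lemma QfE u : Qf u = Ic u u. Proof. by []. Qed.
Lemma DfE u : Df u = Bf u u. Proof. by []. Qed.
Lemma BfE u v : Bf u v = Ic (dx u) (dx v). Proof. by []. Qed.
Lemma NfE u h : Nf u h = Int setT (fun x => cdot (Flog (u x)) (h x)). Proof. by []. Qed.
Lemma AuE u : Au u = Int setT (Ax u). Proof. by []. Qed.

End energy_space.

Opaque Ic Qf Df Bf Nf Au.

(** * Comparison of the norm of [W] with its modulars *)

Section luxemburg_norm.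
Context {R : realType}.
Local Notation mu := (@lebesgue_measure R).
Local Notation fn := (R -> R[i]).
Implicit Types (u v w h k : fn) (a : R).

Lemma H1normE u : H1norm u = Num.sqrt (Qf u + Df u).
Proof.
rewrite /H1norm !IntE QfE DfE BfE !Ic_nsq; congr (Num.sqrt (_ + _));
  by apply: Int_ext => x _; rewrite cmod_sq.
Qed.

(** Shrinking by [t] gains only a factor [t] and not [t^2], because of [t^2 |ln t|]. The constant is
    [6 + 2 M] from the logarithm of [s] plus 4, since [10 s^2 <= 4 Afun s]. *)
Lemma AfunZ_small (t s M : R) : 0 <= t -> t <= 1 -> 0 <= s -> s <= M ->
  Afun (t * s) <= t * (10 + 2 * M) * Afun s.
Proof.
move=> t0 t1 s0 sM.
move: t0; rewrite le_eqVlt => /predU1P[<-|t0]; first by rewrite !mul0r Afun0.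
move: s0; rewrite le_eqVlt => /predU1P[<-|s0]; first by rewrite mulr0 Afun0 mulr0.
have M0 : 0 < M by exact: lt_le_trans sM.
have ts0 : 0 <= t * s by rewrite mulr_ge0 ?ltW.
apply: (le_trans (Afun_le ts0)).
have h1 : `|ln ((t * s) ^+ 2)| <= 2 * `|ln t| + `|ln (s ^+ 2)|.
  rewrite exprMn lnM ?posrE ?exprn_gt0 // (ln_sqr t0) (le_trans (ler_normD _ _)) //.
  by rewrite normrM ger0_norm.
have h2 : t * `|ln t| <= 2.
  apply: (le_trans (xlnx_sqrt (ltW t0) t1)).
  have : Num.sqrt t <= 1 by rewrite -sqrtr1 ler_wsqrtr.
  by move: (Num.sqrt t) => q; lra.
have h3 := sqr_ln_le (ltW s0) sM; have h4 := Afun_ge (ltW s0).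
have h5 := normr_ge0 (ln (s ^+ 2)); have h6 := normr_ge0 (ln t).
apply: (@le_trans _ _ (6 * (t * s) ^+ 2 + (t * s) ^+ 2 * (2 * `|ln t| + `|ln (s ^+ 2)|))).
  by rewrite lerD2l ler_wpM2l // sqr_ge0.
move: (`|ln t|) (`|ln (s ^+ 2)|) (Afun s) h2 h3 h4 h5 h6 => a b A h2 h3 h4 h5 h6.
have tt : t ^+ 2 <= t by rewrite expr2 ler_piMl // ltW.
have s2 : 0 <= s ^+ 2 by exact: sqr_ge0.
have k1 : (t * s) ^+ 2 <= t * s ^+ 2 by rewrite exprMn ler_wpM2r.
have k2 : (t * s) ^+ 2 * (2 * a) <= t * s ^+ 2 * 4.
  by rewrite (_ : (t * s) ^+ 2 * (2 * a) = t * s ^+ 2 * (2 * (t * a))); [rewrite ler_wpM2l ?mulr_ge0 ?(ltW t0) //; lra|ring].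
have k3 : (t * s) ^+ 2 * b <= t * ((6 + 2 * M) * A).
  apply: (@le_trans _ _ (t * (s ^+ 2 * b))); last by rewrite ler_wpM2l // ltW.
  by rewrite mulrA ler_wpM2r.
have k4 : t * s ^+ 2 * 10 <= t * (4 * A) by rewrite -mulrA ler_pM2l //; lra.
by clear -k1 k2 k3 k4; lra.
Qed.

Lemma Au_scl_small (t M : R) u : W u -> 0 <= t -> t <= 1 -> (forall x, cmod (u x) <= M) ->
  Au (scl t u) <= t * (10 + 2 * M) * Au u.
Proof.
move=> wu t0 t1 hM; have iu := W_intg wu; have is' := W_intg (W_scl t wu).
rewrite !AuE -IntZ //; apply: Int_le => //; first exact: intgZ.
move=> x _; rewrite /Ax cmod_scl ger0_norm //.
by apply: AfunZ_small; rewrite ?cmod_ge0.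
Qed.

Lemma Au_scl_big (t : R) u : W u -> 1 <= t -> Au (scl t u) <= t ^+ 2 * Au u.
Proof.
move=> wu t1; have iu := W_intg wu; have is' := W_intg (W_scl t wu).
rewrite !AuE -IntZ //; apply: Int_le => //; first exact: intgZ.
move=> x _; rewrite /Ax cmod_scl ger0_norm; last by rewrite (le_trans _ t1).
by apply: AfunZ; rewrite ?cmod_ge0.
Qed.

Lemma Au_scl_mono (t s : R) u : W u -> 0 <= t -> t <= s -> Au (scl t u) <= Au (scl s u).
Proof.
move=> wu t0 ts; rewrite !AuE; apply: Int_le => //; try by apply: W_intg; exact: W_scl.
move=> x _; rewrite /Ax !cmod_scl !ger0_norm // ?(le_trans t0) //.
by apply: Afun_mono; rewrite ?mulr_ge0 ?cmod_ge0 // ler_wpM2r ?cmod_ge0.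
Qed.

Lemma scl_scl (a b : R) u : scl a (scl b u) = scl (a * b) u.
Proof. by apply/funext => x; rewrite !sclE rmorphM /= mulrA. Qed.

Lemma scl1 u : scl 1 u = u.
Proof. by apply/funext => x; rewrite sclE rmorph1 mul1r. Qed.

Definition LAset u : set R := [set k : R | 0 < k /\
    ((\int[mu]_x (Afun (k^-1 * cmod (u x)))%:E) <= 1)%E].

Lemma LAsetP u (k : R) : W u -> 0 < k -> LAset u k <-> Au (scl k^-1 u) <= 1.
Proof.
move=> wu k0.
have e : (\int[mu]_x (Afun (k^-1 * cmod (u x)))%:E)%E = (Au (scl k^-1 u))%:E.
  rewrite AuE -intg_EFin //; last by apply: W_intg; exact: W_scl.
  apply: eq_integral => x _; congr (_%:E); rewrite /Ax cmod_scl ger0_norm // invr_ge0; exact: ltW.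
rewrite /LAset /= e lee_fin.
by split=> [[]//|h]; split.
Qed.

Lemma LAset_nonempty u : W u -> exists k : R, LAset u k.
Proof.
move=> wu; have [M M0 hM] := H1_bounded (W_H1 wu).
pose c := 1 + (10 + 2 * M) * Au u.
have A0 := Au_ge0 u.
have c1 : 1 <= c by rewrite /c lerDl mulr_ge0 // addr_ge0 // mulr_ge0 // ltW.
have c0 : 0 < c by exact: lt_le_trans c1.
exists c; apply/LAsetP => //.
have ci1 : c^-1 <= 1 by rewrite invf_le1.
apply: (le_trans (Au_scl_small wu _ ci1 hM)); first by rewrite invr_ge0 ltW.
rewrite -mulrA ler_pdivrMl // mulr1 /c lerDr; exact: ler01.
Qed.

Lemma LAnorm_ge0 u : 0 <= LAnorm u.
Proof.
rewrite /LAnorm -/(LAset u); have [->|/set0P ne] := eqVneq (LAset u) set0; first by rewrite inf0.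
by apply: lb_le_inf => // k [/ltW].
Qed.

Lemma LAnorm_lt u (k : R) : W u -> LAnorm u < k -> 0 < k /\ Au (scl k^-1 u) <= 1.
Proof.
move=> wu lk; have k0 : 0 < k by exact: le_lt_trans (LAnorm_ge0 u) lk.
split => //.
have hi : has_inf (LAset u).
  by split; [exact: LAset_nonempty|exists 0 => x [/ltW]].
have kl : 0 < k - LAnorm u by rewrite subr_gt0.
have [j hj jk] := inf_adherent kl hi.
have j0 : 0 < j by case: hj.
have /(LAsetP wu j0) h := hj.
have {}jk : j < k by move: jk; rewrite -/(LAnorm u) addrC subrK.
apply: le_trans h; apply: Au_scl_mono => //; first by rewrite invr_ge0 ltW.
by rewrite lef_pV2 ?posrE // ltW.
Qed.

Lemma LAnorm_le u (k : R) : W u -> 0 < k -> Au (scl k^-1 u) <= 1 -> LAnorm u <= k.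
Proof.
move=> wu k0 h; apply: ge_inf; first by exists 0 => x [/ltW].
exact/(LAsetP wu k0).
Qed.

Lemma Wnorm_ge0 u : 0 <= Wnorm u.
Proof. by rewrite addr_ge0 ?LAnorm_ge0 // sqrtr_ge0. Qed.

(** By the doubling condition, enlarging [w] by [1 / e] multiplies its modular by at most [e^(-2)],
    which keeps it below 1. *)
Lemma Wnorm_small w (e : R) : W w -> 0 < e -> e <= 1 -> Qf w + Df w <= e ^+ 2 -> Au w <= e ^+ 2 ->
  Wnorm w <= 2 * e.
Proof.
move=> ww e0 e1 h1 h2; rewrite /Wnorm mulr_natl mulr2n lerD //.
  by rewrite H1normE -(ger0_norm (ltW e0)) -sqrtr_sqr ler_wsqrtr.
apply: LAnorm_le => //.
have ei : 1 <= e^-1 by rewrite invf_ge1.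
apply: (le_trans (Au_scl_big ww ei)); rewrite exprVn mulrC ler_pdivrMr ?exprn_gt0 // mul1r.
exact: h2.
Qed.

Lemma Wnorm_ball w (k : R) : W w -> Wnorm w < k -> 0 < k /\ bdd 1 (scl k^-1 w).
Proof.
move=> ww wk; have k0 : 0 < k by exact: le_lt_trans (Wnorm_ge0 w) wk.
have h1 : H1norm w <= k by rewrite (le_trans _ (ltW wk)) // lerDl LAnorm_ge0.
have h2 : LAnorm w < k by rewrite (le_lt_trans _ wk) // lerDr sqrtr_ge0.
have [_ h3] := LAnorm_lt ww h2.
have h4 : Qf w + Df w <= k ^+ 2.
  have q0 : 0 <= Qf w + Df w by rewrite addr_ge0 ?Qf_ge0 ?Df_ge0.
  by rewrite -(sqr_sqrtr q0) -H1normE lerXn2r ?nnegrE ?(ltW k0) // H1normE sqrtr_ge0.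
have := Qf_ge0 w; have := Df_ge0 w => q1 q2.
split => //; split => //; first exact: W_scl.
- rewrite Qf_scl // exprVn mulrC ler_pdivrMr ?exprn_gt0 // mul1r (le_trans _ h4) // lerDl //.
- rewrite Df_scl // exprVn mulrC ler_pdivrMr ?exprn_gt0 // mul1r (le_trans _ h4) // lerDr //.
Qed.

Lemma Wnorm_scl_le1 h (k : R) : W h -> Wnorm h < k -> Wnorm (scl k^-1 h) <= 1.
Proof.
move=> wh hk; have k0 : 0 < k by exact: le_lt_trans (Wnorm_ge0 h) hk.
have ki : 0 <= k^-1 by rewrite invr_ge0 ltW.
pose j := k - H1norm h.
have hj : LAnorm h < j by rewrite /j ltrBrDl.
have [j0 hA] := LAnorm_lt wh hj.
have h1 : H1norm (scl k^-1 h) = k^-1 * H1norm h.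
  rewrite !H1normE Qf_scl // Df_scl // -mulrDr sqrtrM ?sqr_ge0 // sqrtr_sqr ger0_norm //.
have h2 : LAnorm (scl k^-1 h) <= k^-1 * j.
  apply: LAnorm_le; first exact: W_scl.
  - by rewrite mulr_gt0 // invr_gt0.
  - rewrite scl_scl invfM invrK (_ : k * j^-1 * k^-1 = j^-1) //.
    by field; rewrite !gt_eqF.
rewrite /Wnorm h1; apply: (le_trans (lerD (lexx _) h2)); rewrite -mulrDr /j addrC subrK.
by rewrite mulVf // gt_eqF.
Qed.

Lemma bdd_scl2 h : bdd 1 (scl 2^-1 h) -> W h -> bdd 4 h.
Proof.
move=> [_ b2 b3 b4] wh.
have e : h = scl 2 (scl 2^-1 h) by rewrite scl_scl divff ?scl1.
have w2 := W_scl 2^-1 wh.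
have i2 : (1 : R) <= 2 by rewrite ler1n.
rewrite e; split; first exact: W_scl.
- by rewrite Qf_scl //; move: (Qf _) b2 => q; lra.
- by rewrite Df_scl //; move: (Df _) b3 => q; lra.
- by apply: (le_trans (Au_scl_big w2 i2)); move: (Au _) b4 => q; lra.
Qed.

(** The infimum in the norm need not be attained, so [h] is divided by 2 to make the inequality
    strict; undoing this costs the factor 4. *)
Lemma bdd_ball h : W h -> Wnorm h <= 1 -> bdd 4 h.
Proof.
move=> wh h1; apply: bdd_scl2 => //; apply: (Wnorm_ball wh _).2.
by rewrite (le_lt_trans h1) // ltr1n.
Qed.

Lemma Wnorm_lt_small w (k : R) : W w -> Wnorm w < k -> k <= 1 ->
  [/\ Qf w <= k ^+ 2, Df w <= k ^+ 2 & Au w <= 20 * k].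
Proof.
move=> ww wk k1; have [k0 b] := Wnorm_ball ww wk.
have [ws q d A] := b.
have e : w = scl k (scl k^-1 w) by rewrite scl_scl divff ?scl1 // gt_eqF.
have k0' := ltW k0.
split.
- rewrite e Qf_scl // -[leRHS]mulr1 ler_wpM2l ?sqr_ge0 //.
- rewrite e Df_scl // -[leRHS]mulr1 ler_wpM2l ?sqr_ge0 //.
- rewrite e; apply: (le_trans (Au_scl_small ws k0' k1 (fun x => bdd_cmod x b))).
  by move: (Au _) A (Au_ge0 (scl k^-1 w)) => a A a0; nra.
Qed.

Lemma fun_linE a h k : (fun x => a%:C * h x + k x) = lin a h k.
Proof. by apply/funext => x; rewrite linE. Qed.

Lemma fun_subE u v : (fun x => u x - v x) = lin (-1) v u.
Proof. by apply/funext => x; rewrite linE rmorphN1 mulN1r addrC. Qed.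

Lemma fun_miE h : (fun x => (0 -i* 1) * h x) = mi h.
Proof.
apply/funext => x; rewrite miE; congr (_ * _).
by apply/eqP; rewrite eq_complex /= oppr0 !eqxx.
Qed.

Definition Wlinear (F : fn -> R) : Prop :=
  forall a h k, W h -> W k -> F (lin a h k) = a * F h + F k.

Lemma Wlinear0 F : Wlinear F -> F zf = 0.
Proof.
move=> HF; have := HF 1 zf zf W0 W0; rewrite (_ : lin 1 zf zf = zf); last first.
  by apply/funext => x; rewrite linE mulr0 addr0.
by move: (F zf) => p; lra.
Qed.

Lemma Wlinear_scl F a h : Wlinear F -> W h -> F (scl a h) = a * F h.
Proof. by move=> HF wh; rewrite /scl (HF _ _ _ wh W0) (Wlinear0 HF) addr0. Qed.

Lemma Wlinear_le F (C : R) : Wlinear F -> 0 <= C -> (forall h, bdd 1 h -> `|F h| <= C) ->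
  forall h, W h -> `|F h| <= C * Wnorm h.
Proof.
move=> HF C0 HC h wh.
have key (k : R) : Wnorm h < k -> `|F h| <= C * k.
  move=> hk; have [k0 b] := Wnorm_ball wh hk.
  have e : h = scl k (scl k^-1 h) by rewrite scl_scl divff ?scl1 // gt_eqF.
  rewrite e (Wlinear_scl _ HF); last by case: b.
  by rewrite normrM gtr0_norm // mulrC ler_wpM2r ?(ltW k0) // HC.
apply/ler_addgt0Pl => e e0.
have C1 : 0 < C + 1 by rewrite ltr_wpDl.
have d0 : 0 < e / (C + 1) by rewrite divr_gt0.
have hlt : Wnorm h < Wnorm h + e / (C + 1) by rewrite ltrDl.
apply: (le_trans (key _ hlt)); rewrite mulrDr addrC lerD2r.
rewrite mulrA ler_pdivrMr // mulrC ler_pM2l // lerDl; exact: ler01.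
Qed.

Lemma Wdual_norm_le (F : fn -> R) (C : R) :
  (forall h, W h -> Wnorm h <= 1 -> `|F h| <= C) -> (Wdual_norm F <= C%:E)%E.
Proof. by move=> H; apply: ge_ereal_sup => _ [h [wh h1] <-]; rewrite lee_fin H. Qed.

Lemma Wdual_norm_ge (F : fn -> R) h : W h -> Wnorm h <= 1 -> (`|F h|%:E <= Wdual_norm F)%E.
Proof. by move=> wh h1; apply: ereal_sup_ubound; exists h. Qed.

Lemma Wdual_norm_ge0 (F : fn -> R) : (0 <= Wdual_norm F)%E.
Proof.
apply: (@le_trans _ _ (`|F zf|%:E)); first by rewrite lee_fin.
apply: Wdual_norm_ge; first exact: W0.
have := @Wnorm_scl_le1 zf (Wnorm zf + 1) W0; rewrite ltrDl => /(_ ltr01).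
by rewrite (_ : scl _ zf = zf) //; apply/funext => x; rewrite sclE mulr0.
Qed.

End luxemburg_norm.

(** * Weak and strong convergence in the energy space *)

Section real_helpers.
Context {R : realType}.
Local Notation mu := (@lebesgue_measure R).
Local Notation fn := (R -> R[i]).
Implicit Types (u v w h : fn) (f g : R -> R).

Local Notation Re u := (fun x => complex.Re (u x)).
Local Notation Im u := (fun x => complex.Im (u x)).

Lemma sqrt_small (K e : R) : 0 <= K -> 0 < e -> exists2 d : R, 0 < d &
  forall s : R, 0 <= s -> s <= d -> Num.sqrt (s * K) <= e.
Proof.
move=> K0 e0; exists (e ^+ 2 / (K + 1)); first by rewrite divr_gt0 ?exprn_gt0 // ltr_wpDl.
move=> s s0 sd; rewrite -[leRHS](ger0_norm (ltW e0)) -sqrtr_sqr ler_sqrt ?sqr_ge0 //.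
have K1 : 0 < K + 1 by rewrite ltr_wpDl.
rewrite (le_trans (ler_wpM2r K0 sd)) // -mulrA ler_piMr ?sqr_ge0 // mulrC ler_pdivrMr // mul1r.
by rewrite lerDl.
Qed.

Lemma cmod_cont_EI u : (forall (x e : R), 0 < e -> exists2 d : R, 0 < d &
    forall y, `|y - x| <= d -> cmod (u y - u x) <= e) ->
  continuous (Re u) /\ continuous (Im u).
Proof.
move=> H; split; apply: continuousEI => x e e0; have [d d0 hd] := H x e e0; exists d => // y /hd.
  by rewrite -ReB; apply: le_trans; exact: Re_le.
by rewrite -ImB; apply: le_trans; exact: Im_le.
Qed.

Lemma cmod_cont_EP u : continuous (Re u) -> continuous (Im u) ->
  forall (x e : R), 0 < e -> exists2 d : R, 0 < d & forall y, `|y - x| <= d -> cmod (u y - u x) <= e.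
Proof.
move=> c1 c2 x e e0; have e2 : 0 < e / 2 by rewrite divr_gt0.
have [d1 d10 h1] := continuousEP c1 x e2; have [d2 d20 h2] := continuousEP c2 x e2.
exists (Num.min d1 d2) => [|y]; first by rewrite lt_min d10.
rewrite le_min => /andP[/h1 + /h2]; rewrite -ReB -ImB => a1 a2.
by apply: (le_trans (cmod_le _)); rewrite (splitr e) lerD.
Qed.

(** Uniform continuity on bounded sets, with only [z] required to be bounded. Locally uniform
    convergence then passes through integrals of [Phi] over bounded intervals. *)
Definition ucb (Phi : R[i] -> R) : Prop := forall M e : R, 0 < e -> exists2 d : R, 0 < d &
  forall z w : R[i], cmod z <= M -> cmod (z - w) <= d -> `|Phi z - Phi w| <= e.

Lemma ucb_nsq : ucb nsq.
Proof.
move=> M e e0; pose D := 2 * `|M| + 2.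
have D0 : 0 < D by rewrite /D ltr_wpDl // mulr_ge0.
exists (Num.min 1 (e / D)) => [|z w hz]; first by rewrite lt_min ltr01 divr_gt0.
rewrite le_min => /andP[h1 h2]; apply: (le_trans (nsq_sub_le z w)).
have hM : cmod z <= `|M| by rewrite (le_trans hz) ?ler_norm.
have hw : cmod w <= `|M| + 1.
  rewrite -[w](subKr z); apply: (le_trans (cmodB_le _ _)).
  by rewrite lerD.
have := ler_pM (cmod_ge0 (z - w)) (addr_ge0 (cmod_ge0 z) (cmod_ge0 w)) h2 (lerD hM hw).
move=> h; apply: (le_trans h); rewrite mulrAC ler_pdivrMr // ler_wpM2l ?ltW // /D.
by move: `|M| => m; lra.
Qed.

Lemma ucb_A : ucb (fun z => Afun (cmod z)).
Proof.
move=> M e e0; have [d d0 hd] := Afun_unif M e0; exists d => // z w hz hzw.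
by apply: hd => //; rewrite ?cmod_ge0 // (le_trans (cmod_dist _ _)).
Qed.

Lemma ucb_cont Phi u : ucb Phi -> continuous (Re u) -> continuous (Im u) ->
  continuous (fun x => Phi (u x)).
Proof.
move=> hP c1 c2; apply: continuousEI => x e e0; have [d d0 hd] := hP (cmod (u x)) e e0.
have [d' d'0 h] := cmod_cont_EP c1 c2 x d0; exists d' => // y /h hy.
by rewrite distrC; apply: hd => //; rewrite cmodB.
Qed.

Lemma Int_loc_le f (r e : R) : 0 <= r -> measurable_fun (`[- r, r] : set R) f ->
  (forall x, `|x| <= r -> `|f x| <= e) -> `|Int `[- r, r] f| <= e * (r + r).
Proof.
move=> r0 mf hf; have rr : - r <= r by rewrite -subr_ge0 opprK addr_ge0.
have -> : e * (r + r) = Int `[- r, r] (fun=> e) by rewrite Int_cst // opprK.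
apply: Int_norm_le => //; first exact: cst_intg.
by move=> x /=; rewrite in_itv /= -ler_norml; exact: hf.
Qed.

Lemma energy_ge0 k (f : R -> R) : 0 <= energy k f.
Proof. by apply: sumr_ge0 => j _; rewrite mulr_ge0 ?sqr_ge0 // exprn_ge0. Qed.

(** Together with the monotonicity of the dyadic energies, this presents the Dirichlet integral as a
    supremum of functions of finitely many values. *)
Lemma ac_energy f g (e : R) : continuous f -> L2r g -> ac f g -> 0 < e ->
  exists N, forall k, (N <= k)%N -> Int setT (fun x => g x ^+ 2) <= energy k f + e.
Proof.
move=> cf Lg af e0; have [N hN] := slope_approx cf Lg af e0; exists N => k Nk.
have h := energy_nd f Nk; move: hN; rewrite (Int_sqrB (slope_L2 N f) Lg) slope_sqr.
have -> : Int setT (fun x => slope N f x * g x) = energy N f.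
  rewrite (@Int_ext _ _ _ (fun x => g x * slope N f x)); last by move=> x _; rewrite mulrC.
  by rewrite (Int_ac_slope _ _ Lg af); apply: eq_bigr => j _; rewrite -mulrA expr2.
move: (Int _ _) (energy N f) (energy k f) h => a b c; clear; lra.
Qed.

Lemma Df_ReIm u (g : fn) : H1 u -> hasd u g -> Df u =
  Int setT (fun x => complex.Re (g x) ^+ 2) + Int setT (fun x => complex.Im (g x) ^+ 2).
Proof. by move=> hu hg; rewrite DfE (Bf_hasd hu hu hg hg) Ic_ReIm //; case: hg. Qed.

Lemma Df_energy_le u k : H1 u -> energy k (Re u) + energy k (Im u) <= Df u.
Proof.
move=> hu; have hg := dx_hasd hu; rewrite (Df_ReIm hu hg); case: hg => -[L1 L2] a1 a2.
by rewrite lerD //; exact: energy_le.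
Qed.

Lemma Df_le_energy u (e : R) : H1 u -> 0 < e ->
  exists k, Df u <= energy k (Re u) + energy k (Im u) + e.
Proof.
move=> hu e0; have hg := dx_hasd hu; rewrite (Df_ReIm hu hg); case: hg => -[L1 L2] a1 a2.
have [c1 c2] := H1_cont hu; have e2 : 0 < e / 2 by rewrite divr_gt0.
have [N1 h1] := ac_energy c1 L1 a1 e2; have [N2 h2] := ac_energy c2 L2 a2 e2.
exists (maxn N1 N2); have := h1 _ (leq_maxl N1 N2); have := h2 _ (leq_maxr N1 N2).
move: (Int _ _) (Int _ _) (energy _ _) (energy _ _) => a b c d; clear; lra.
Qed.

End real_helpers.

Section weak_convergence.
Context {R : realType} (I : Type) (F : set_system I) (FF : ProperFilter F).
Local Notation mu := (@lebesgue_measure R).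
Local Notation fn := (R -> R[i]).
Implicit Types (u w h : fn) (v : I -> fn) (K : R).

Local Notation Re u := (fun x => complex.Re (u x)).
Local Notation Im u := (fun x => complex.Im (u x)).

(** The substitute for weak convergence in [W], along an arbitrary filter. Nothing is assumed about
    [u]: its membership in [W] and its bound are derived in [wcv_bdd]. *)
Definition wcv K v u : Prop := (\forall i \near F, bdd K (v i)) /\
  (forall x (e : R), 0 < e -> \forall i \near F, cmod (v i x - u x) <= e).

Lemma cvgEP (f : I -> R) (l : R) : f i @[i --> F] --> l <->
  forall e : R, 0 < e -> \forall i \near F, `|f i - l| <= e.
Proof.
split=> [/cvgrPdist_le h e e0|h]; last apply/cvgrPdist_le => e e0.
  by apply: filterS (h e e0) => i; rewrite distrC.
by apply: filterS (h e e0) => i; rewrite distrC.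
Qed.

Lemma cvg_osum n (f : I -> nat -> R) (l : nat -> R) : (forall j, f i j @[i --> F] --> l j) ->
  (\sum_(j < n) f i j) @[i --> F] --> \sum_(j < n) l j.
Proof.
move=> h; elim: n => [|n IH].
  rewrite big_ord0 (_ : (fun i => _) = fun=> 0); first exact: cvg_cst.
  by apply/funext => i; rewrite big_ord0.
rewrite big_ord_recr (_ : (fun i => _) = fun i => \sum_(j < n) f i j + f i n); first exact: cvgD.
by apply/funext => i; rewrite big_ord_recr.
Qed.

Lemma cvg_le_near (f : I -> R) (l q : R) : f i @[i --> F] --> l ->
  (\forall i \near F, f i <= q) -> l <= q.
Proof.
move=> /cvgEP h hq; apply/ler_addgt0Pr => e e0; have [i [h1 h2]] := filter_ex (filterI (h e e0) hq).
by move: h1; rewrite ler_norml => /andP[+ _]; lra.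
Qed.

Lemma wcv_ge0 K v u : wcv K v u -> 0 <= K.
Proof. by case=> hb _; have [i bi] := filter_ex hb; exact: bdd_ge0 bi. Qed.

Lemma wcv_holder K v u x y : wcv K v u -> cmod (u y - u x) <= Num.sqrt (`|y - x| * K).
Proof.
move=> wc; have [hb hp] := wc; have K0 := wcv_ge0 wc; apply/ler_addgt0Pr => e e0.
have e2 : 0 < e / 2 by rewrite divr_gt0.
have [i [[bi cx] cy]] := filter_ex (filterI (filterI hb (hp x _ e2)) (hp y _ e2)).
have [wi _ di _] := bi.
have h : cmod (v i y - v i x) <= Num.sqrt (`|y - x| * K).
  rewrite cmod_sqrt ler_sqrt ?mulr_ge0 //.
  by rewrite (le_trans (H1_holder _ _ (W_H1 wi))) // ler_wpM2l.
have -> : u y - u x = (v i y - v i x) - (v i y - u y) + (v i x - u x) by ring.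
apply: (le_trans (cmodD_le _ _)); rewrite (splitr e) addrA lerD //.
by apply: (le_trans (cmodB_le _ _)); rewrite lerD.
Qed.

Lemma wcv_cont K v u : wcv K v u -> continuous (Re u) /\ continuous (Im u).
Proof.
move=> wc; apply: cmod_cont_EI => x e e0; have [d d0 hd] := sqrt_small (wcv_ge0 wc) e0.
by exists d => // y yd; apply: (le_trans (wcv_holder x y wc)); exact: hd.
Qed.

Lemma wcv_cmod K v u x : wcv K v u -> cmod (u x) <= 4 * K + 1.
Proof.
case=> hb hp; apply/ler_addgt0Pr => e e0; have [i [bi ci]] := filter_ex (filterI hb (hp x e e0)).
rewrite -[u x](subKr (v i x)); apply: (le_trans (cmodB_le _ _)); rewrite lerD //.
exact: bdd_cmod.
Qed.

(** The Dirichlet bound makes the family equicontinuous, so closeness on a finite net of spacing [d]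
    spreads to the whole interval. *)
Lemma wcv_unif K v u (r e : R) : wcv K v u -> 0 < e ->
  \forall i \near F, forall x, `|x| <= r -> cmod (v i x - u x) <= e.
Proof.
move=> wc e0; have [hb hp] := wc; have K0 := wcv_ge0 wc.
have e3 : 0 < e / 3 by rewrite divr_gt0.
have [d d0 hd] := sqrt_small K0 e3.
pose N := (Num.truncn (2 * r / d)).+1; pose p (j : nat) : R := - r + j%:R * d.
have hN : \forall i \near F, forall j : 'I_N, cmod (v i (p j) - u (p j)) <= e / 3.
  by apply: filter_forall => j; exact: hp.
apply: filterS (filterI hb hN) => i [bi hi] x; rewrite ler_norml => /andP[x1 x2].
have z0 : 0 <= (x + r) / d by rewrite divr_ge0 ?(ltW d0) //; move: x1; clear; lra.
pose j := Num.truncn ((x + r) / d).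
have jN : (j < N)%N.
  rewrite /N ltnS; apply: le_truncn; rewrite ler_wpM2r ?invr_ge0 ?(ltW d0) //.
  by rewrite mulr_natl mulr2n lerD2r.
have j1 : j%:R * d <= x + r by rewrite -ler_pdivlMr // truncn_le.
have j2 : x + r < j.+1%:R * d by rewrite -ltr_pdivrMr //; apply: truncnS_gt.
have xp : `|x - p j| <= d.
  by rewrite ler_norml /p; move: j2; rewrite -natr1 mulrDl mul1r; move: (j%:R * d) j1 => q; clear; lra.
have hj := hi (Ordinal jN); have [wi _ di _] := bi.
have h1 : cmod (v i x - v i (p j)) <= e / 3.
  apply: le_trans (hd _ (normr_ge0 (x - p j)) xp).
  rewrite cmod_sqrt ler_sqrt ?mulr_ge0 //.
  by rewrite (le_trans (H1_holder _ _ (W_H1 wi))) // ler_wpM2l.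
have h2 : cmod (u x - u (p j)) <= e / 3.
  apply: le_trans (hd _ (normr_ge0 (x - p j)) xp); exact: wcv_holder wc.
have -> : v i x - u x = (v i x - v i (p j)) - (u x - u (p j)) + (v i (p j) - u (p j)) by ring.
apply: (le_trans (cmodD_le _ _)); rewrite (_ : e = e / 3 + e / 3 + e / 3); last by field.
by rewrite lerD //; apply: (le_trans (cmodB_le _ _)); rewrite lerD.
Qed.

Lemma wcv_loc Phi K v u (r : R) : ucb Phi -> wcv K v u -> 0 <= r ->
  Int `[- r, r] (fun x => Phi (v i x)) @[i --> F] --> Int `[- r, r] (fun x => Phi (u x)).
Proof.
move=> hP wc r0; apply/cvgEP => e e0; have [hb hp] := wc.
have [c1 c2] := wcv_cont wc.
have e1 : 0 < e / (r + r + 1) by rewrite divr_gt0 // ltr_wpDl // addr_ge0.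
have [d d0 hd] := hP (4 * K + 1) _ e1.
apply: filterS (filterI hb (wcv_unif r wc d0)) => i [bi hi].
have [k1 k2] := H1_cont (W_H1 (bdd_W bi)).
have q1 := ucb_cont hP k1 k2; have q2 := ucb_cont hP c1 c2.
rewrite -IntB //; [|exact: continuous_intg q1|exact: continuous_intg q2].
apply: (@le_trans _ _ (e / (r + r + 1) * (r + r))); last first.
  by rewrite mulrAC ler_pdivrMr ?ltr_wpDl ?addr_ge0 // ler_wpM2l ?(ltW e0) // lerDl.
apply: Int_loc_le => // [|x hx]; last by apply: hd; [exact: bdd_cmod|exact: hi].
by apply: measurable_funB; apply: continuous_measD.
Qed.

Lemma wcv_Int Phi K v u (q : R) : ucb Phi -> (forall z, 0 <= Phi z) -> wcv K v u ->
  (\forall i \near F, intg setT (fun x => Phi (v i x)) /\ Int setT (fun x => Phi (v i x)) <= q) ->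
  intg setT (fun x => Phi (u x)) /\ Int setT (fun x => Phi (u x)) <= q.
Proof.
move=> hP P0 wc hq; have [c1 c2] := wcv_cont wc; have cu := ucb_cont hP c1 c2.
apply: ge0_intg_sup => //; [exact: continuous_meas cu| |by move=> n; exact: continuous_intg].
move=> n; apply: (cvg_le_near (wcv_loc hP wc (ler0n _ n))).
apply: filterS hq => i [hi]; apply: le_trans; apply: Int_subset => //.
Qed.

Lemma wcv_lsc Phi K v u (e : R) : ucb Phi -> (forall z, 0 <= Phi z) -> wcv K v u -> 0 < e ->
  intg setT (fun x => Phi (u x)) -> (\forall i \near F, intg setT (fun x => Phi (v i x))) ->
  \forall i \near F, Int setT (fun x => Phi (u x)) <= Int setT (fun x => Phi (v i x)) + e.
Proof.
move=> hP P0 wc e0 hu hv; have e2 : 0 < e / 2 by rewrite divr_gt0.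
have [n hn] := Int_tail hu (fun x => P0 (u x)) e2.
have /cvgEP h := wcv_loc hP wc (ler0n _ n).
apply: filterS (filterI (h _ e2) hv) => i [hi iv].
have h3 : Int `[- n%:R, n%:R] (fun x => Phi (v i x)) <= Int setT (fun x => Phi (v i x)).
  exact: Int_subset.
rewrite (Int_co n%:R hu); move: hi; rewrite ler_norml => /andP[+ _].
move: (Int _ _) (Int _ _) (Int _ _) (Int _ _) hn h3 => a b c d; clear; lra.
Qed.

Lemma wcv_Re K v u x : wcv K v u -> complex.Re (v i x) @[i --> F] --> complex.Re (u x).
Proof.
case=> _ hp; apply/cvgEP => e e0; apply: filterS (hp x e e0) => i; rewrite -ReB.
by apply: le_trans; exact: Re_le.
Qed.

Lemma wcv_Im K v u x : wcv K v u -> complex.Im (v i x) @[i --> F] --> complex.Im (u x).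
Proof.
case=> _ hp; apply/cvgEP => e e0; apply: filterS (hp x e e0) => i; rewrite -ImB.
by apply: le_trans; exact: Im_le.
Qed.

Lemma cvg_incr k j (f : I -> R -> R) (g : R -> R) : (forall x, f i x @[i --> F] --> g x) ->
  incr k (f i) j @[i --> F] --> incr k g j.
Proof. by move=> h; apply: cvgB; exact: h. Qed.

Lemma cvg_energy k (f : I -> R -> R) (g : R -> R) : (forall x, f i x @[i --> F] --> g x) ->
  energy k (f i) @[i --> F] --> energy k g.
Proof.
move=> h; apply: (@cvg_osum _ (fun i j => 2 ^+ k * incr k (f i) j ^+ 2)
  (fun j => 2 ^+ k * incr k g j ^+ 2)) => j.
apply: cvgM; first exact: cvg_cst.
by rewrite expr2; apply: cvgM; exact: cvg_incr.
Qed.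

Lemma wcv_energy (k : nat) K v u : wcv K v u ->
  (energy k (Re (v i)) + energy k (Im (v i))) @[i --> F] --> energy k (Re u) + energy k (Im u).
Proof.
move=> wc; apply: cvgD; apply: cvg_energy => x; [exact: wcv_Re wc|exact: wcv_Im wc].
Qed.

(** The charge and the modular pass to the limit on bounded intervals first. The dyadic energies of
    the limit are bounded as limits, so the Riesz criterion supplies its weak derivative. *)
Lemma wcv_bdd K v u : wcv K v u -> bdd K u.
Proof.
move=> wc; have [hb hp] := wc; have [c1 c2] := wcv_cont wc.
have [iQ lQ] : intg setT (fun x => nsq (u x)) /\ Int setT (fun x => nsq (u x)) <= K.
  apply: (wcv_Int ucb_nsq nsq_ge0 wc); apply: filterS hb => i [wi + _ _]; rewrite Qf_nsq.
  by split=> //; apply: L2c_nsq; exact: W_L2c.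
have [iA lA] : intg setT (Ax u) /\ Int setT (Ax u) <= K.
  apply: (wcv_Int ucb_A _ wc) => [z|]; first by apply: Afun_ge0; exact: cmod_ge0.
  by apply: filterS hb => i [wi _ _]; rewrite AuE; split=> //; exact: W_intg.
have en k : energy k (Re u) + energy k (Im u) <= K.
  apply: (cvg_le_near (wcv_energy wc)); apply: filterS hb => i [wi _ + _]; apply: le_trans.
  exact: Df_energy_le (W_H1 wi).
have [g1 [L1 a1 _]] : exists g, [/\ L2r g, ac (Re u) g & Int setT (fun x => g x ^+ 2) <= K].
  by apply: riesz => // k; apply: le_trans (en k); rewrite lerDl energy_ge0.
have [g2 [L2 a2 _]] : exists g, [/\ L2r g, ac (Im u) g & Int setT (fun x => g x ^+ 2) <= K].
  by apply: riesz => // k; apply: le_trans (en k); rewrite lerDr energy_ge0.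
have hu : H1 u.
  apply/H1P; split=> //; last by exists (fun x => g1 x +i* g2 x).
  split; (split; first exact: continuous_meas);
    apply: (intg_dom _ _ _ iQ) => //;
    try (by apply: measurable_funX; exact: continuous_meas);
    by move=> x _; rewrite ger0_norm ?sqr_ge0 // /nsq ?lerDl ?lerDr sqr_ge0.
have wu : W u by apply/WP.
split; [by []|by rewrite Qf_nsq| |by rewrite AuE].
apply/ler_addgt0Pr => e e0; have [k hk] := Df_le_energy hu e0.
by apply: (le_trans hk); rewrite lerD2r.
Qed.

Lemma wcv_lscD K v u (e : R) : wcv K v u -> 0 < e -> \forall i \near F, Df u <= Df (v i) + e.
Proof.
move=> wc e0; have bu := wcv_bdd wc; have [hb _] := wc; have e2 : 0 < e / 2 by rewrite divr_gt0.
have [k hk] := Df_le_energy (W_H1 (bdd_W bu)) e2.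
have /cvgEP /(_ _ e2) h := wcv_energy (k := k) wc.
apply: filterS (filterI hb h) => i [bi]; have := Df_energy_le k (W_H1 (bdd_W bi)).
rewrite ler_norml => + /andP[+ _].
move: (Df u) (Df _) (energy _ _) (energy _ _) (energy _ _) (energy _ _) hk => a b c d f g; clear; lra.
Qed.

Lemma wcv_lscA K v u (e : R) : wcv K v u -> 0 < e -> \forall i \near F, Au u <= Au (v i) + e.
Proof.
move=> wc e0; have [hb _] := wc.
have iu : intg setT (fun x => Afun (cmod (u x))) := W_intg (bdd_W (wcv_bdd wc)).
have iv : \forall i \near F, intg setT (fun x => Afun (cmod (v i x))).
  by apply: filterS hb => i /bdd_W wi; exact: W_intg.
have A0 (z : R[i]) : 0 <= Afun (cmod z) by apply: Afun_ge0; exact: cmod_ge0.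
by apply: filterS (wcv_lsc ucb_A A0 wc e0 iu iv) => i; rewrite !AuE.
Qed.

(** Local uniform convergence takes care of [[-n, n]]. Outside, a Young splitting puts a small
    factor [t] on the merely bounded part [P i] and [1 / t] on the fixed integrable [H], whose tail
    is made small after [t] is fixed. *)
Lemma cvg_Int_tail (f P : I -> R -> R) (H : R -> R) (C : R) : 0 <= C -> intg setT H -> (forall x, 0 <= H x) ->
  (\forall i \near F, [/\ measurable_fun setT (f i), intg setT (P i), Int setT (P i) <= C &
     forall (t x : R), 0 < t -> t <= 1 -> 0 <= P i x /\ `|f i x| <= t * P i x + t^-1 * H x]) ->
  (forall r e : R, 0 < e -> \forall i \near F, forall x, `|x| <= r -> `|f i x| <= e) ->
  Int setT (f i) @[i --> F] --> 0.
Proof.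
move=> C0 iH H0 hf hloc; apply/cvgEP => e e0.
(* This makes [t C <= e / 4]; the tail of [H] is then taken below [t e / 4]. *)
pose t := Num.min 1 (e / (4 * (C + 1))).
have C1 : 0 < 4 * (C + 1) by rewrite mulr_gt0 // ltr_wpDl.
have t0 : 0 < t by rewrite lt_min ltr01 divr_gt0.
have t1 : t <= 1 by rewrite ge_min lexx.
have tC : t * C <= e / 4.
  have : t <= e / (4 * (C + 1)) by rewrite ge_min lexx orbT.
  rewrite ler_pdivlMr //; move: t0; clear -C0; nra.
have te : 0 < t * (e / 4) by rewrite mulr_gt0 // divr_gt0.
have [n hn] := Int_tail iH H0 te.
have n1 : 0 < (n%:R + n%:R + 1 : R) by rewrite ltr_wpDl // addr_ge0.
have e1 : 0 < e / 4 / (n%:R + n%:R + 1) by rewrite !divr_gt0.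
apply: filterS (filterI hf (hloc n%:R _ e1)) => i [[mf iP lP hd] hl].
rewrite subr0; have mc := @measurable_co R n%:R.
have i2 : intg setT (fun x => t * P i x + t^-1 * H x) by apply: intgD => //; apply: intgZ.
have if' : intg setT (f i) by apply: (intg_dom _ mf _ i2) => // x _; exact: (hd t x t0 t1).2.
rewrite (Int_co n%:R if'); apply: (le_trans (ler_normD _ _)).
have h1 : `|Int `[- n%:R, n%:R] (f i)| <= e / 4.
  apply: le_trans (Int_loc_le (ler0n _ n) (measurable_funS measurableT (@subsetT _ _) mf) hl) _.
  by rewrite mulrAC ler_pdivrMr // ler_wpM2l ?divr_ge0 ?(ltW e0) // lerDl.
have iPc : intg (co n%:R) (P i) by exact: intg_sub.
have iHc : intg (co n%:R) H by exact: intg_sub.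
have h2 : `|Int (co n%:R) (f i)| <= t * Int (co n%:R) (P i) + t^-1 * Int (co n%:R) H.
  rewrite -!IntZ // -IntD //; [|exact: intgZ|exact: intgZ].
  apply: Int_norm_le => //; [exact: measurable_funS mf|by apply: intgD => //; exact: intgZ|].
  by move=> x _; exact: (hd t x t0 t1).2.
have h3 : Int (co n%:R) (P i) <= C.
  by apply: le_trans lP; apply: Int_subset => // x _; exact: (hd t x t0 t1).1.
have h4 : t^-1 * Int (co n%:R) H <= e / 4 by rewrite mulrC ler_pdivrMr // mulrC ltW.
have h5 : t * Int (co n%:R) (P i) <= t * C by rewrite ler_wpM2l // ltW.
move: (Int _ (f i)) (Int _ (f i)) (t * Int _ _) (t^-1 * _) h1 h2 h4 h5 tC e0.
by move=> a b c d; clear; move: `|a| `|b| (t * C) => *; lra.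
Qed.

Lemma wcv_sub K v u : wcv K v u -> wcv (8 * (4 * K + K)) (fun i => lin (-1) u (v i)) zf.
Proof.
move=> wc; have [hb hp] := wc; have bu := wcv_bdd wc; split.
  by apply: filterS hb => i bi; exact: bdd_sub.
move=> x e e0; apply: filterS (hp x e e0) => i.
by rewrite linE rmorphN1 mulN1r subr0 addrC.
Qed.

Lemma young_cdot (z w : R[i]) (t : R) : 0 < t -> `|cdot z w| <= t * nsq z + t^-1 * nsq w.
Proof.
move=> t0; apply: (le_trans (cdot_le z w)); rewrite -!cmod_sq.
move: (cmod_ge0 z) (cmod_ge0 w); move: (cmod z) (cmod w) => a b a0 b0.
have -> : b = t * (t^-1 * b) by rewrite mulrA divff ?mul1r // gt_eqF.
have b'0 : 0 <= t^-1 * b by rewrite mulr_ge0 // invr_ge0 ltW.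
move: (t^-1 * b) b'0 => c c0; have -> : t^-1 * (t * c) ^+ 2 = t * c ^+ 2.
  by field; rewrite gt_eqF.
rewrite -mulrDr mulrCA ler_wpM2l ?(ltW t0) //; nra.
Qed.

Lemma wcv_Ic0 K v h : wcv K v zf -> W h -> Ic (v i) h @[i --> F] --> 0.
Proof.
move=> wc wh; have [hb hp] := wc; have K0 := wcv_ge0 wc.
apply: (@cvg_Int_tail (fun i x => cdot (v i x) (h x)) (fun i x => nsq (v i x)) (fun x => nsq (h x)) K) => //.
- exact: L2c_nsq (W_L2c wh).
- by move=> x; exact: nsq_ge0.
- apply: filterS hb => i [wi qi _ _]; split; last first.
  + by move=> t x t0 _; split; [exact: nsq_ge0|exact: young_cdot].
  + by rewrite -Qf_nsq.
  + exact: L2c_nsq (W_L2c wi).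
  + exact: intg_meas (intg_Ic (W_L2c wi) (W_L2c wh)).
- move=> r e e0; have [M M0 hM] := H1_bounded (W_H1 wh).
  apply: filterS (wcv_unif r wc (divr_gt0 e0 M0)) => i hi x /hi; rewrite subr0 => hx.
  apply: (le_trans (cdot_le _ _)); rewrite -[leRHS](divfK (lt0r_neq0 M0)).
  by apply: ler_pM => //; exact: cmod_ge0.
Qed.

Lemma wcv_Ic K v u h : wcv K v u -> W h -> Ic (v i) h @[i --> F] --> Ic u h.
Proof.
move=> wc wh; have /cvgEP H := wcv_Ic0 (wcv_sub wc) wh; apply/cvgEP => e e0.
have [hb _] := wc; apply: filterS (filterI hb (H e e0)) => i [/bdd_W wi].
rewrite subr0 Ic_linl ?mulN1r 1?addrC //; [exact: W_L2c (bdd_W (wcv_bdd wc))|exact: W_L2c wi|].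
exact: W_L2c wh.
Qed.

Lemma wcv_Nf K v u h : wcv K v u -> W h -> Nf (v i) h @[i --> F] --> Nf u h.
Proof.
move=> wc wh; have [hb hp] := wc; have K0 := wcv_ge0 wc; have bu := wcv_bdd wc; have [wu _ _ au] := bu.
pose M := 4 * K + 1; have M0 : 0 <= M by rewrite /M; lra.
pose C := 6 + 2 * M; have C0 : 0 <= C by rewrite /C; lra.
(* Write [h = t (h / t)] in the Orlicz inequality: the doubling condition bounds [Afun (|h| / t)] by
   [t^(-2) Afun |h|], which leaves the factors [t] and [1 / t] of the tail lemma. *)
have hA (z : R[i]) (t x : R) : cmod z <= M -> 0 < t -> t <= 1 ->
    `|cdot (Flog z) (h x)| <= t * (C * Afun (cmod z)) + t^-1 * (C * Ax h x).
  move=> hz t0 t1; have -> : h x = t%:C * (t^-1%:C * h x).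
    by rewrite mulrA -rmorphM divff ?gt_eqF // rmorph1 mul1r.
  rewrite cdotZr normrM (gtr0_norm t0); have := @cdot_Flog_le _ z (t^-1%:C * h x) M hz.
  rewrite cmodZ normfV (gtr0_norm t0) -/C => h1.
  apply: (le_trans (ler_wpM2l (ltW t0) h1)).
  have := @AfunZ _ (cmod (h x)) t^-1; rewrite invf_ge1 // => /(_ t1 (cmod_ge0 _)) h2.
  have h3 : t * (C * Afun (t^-1 * cmod (h x))) <= t * (C * (t^-1 ^+ 2 * Afun (cmod (h x)))).
    by rewrite ler_wpM2l ?(ltW t0) // ler_wpM2l.
  rewrite mulrDr mulrDr lerD2l (le_trans h3) // /Ax.
  move: (Afun _) => a; rewrite le_eqVlt; apply/orP; left; apply/eqP; field; exact: lt0r_neq0.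
rewrite cvgEP => e e0.
have iAh := W_intg wh.
have key : Int setT (fun x => cdot (Flog (v i x)) (h x) - cdot (Flog (u x)) (h x)) @[i --> F] --> 0.
  apply: (@cvg_Int_tail _ (fun i x => C * Ax (v i) x + C * Ax u x) (fun x => 2 * (C * Ax h x)) (2 * (C * K))).
  - by rewrite !mulr_ge0.
  - by do 2 apply: intgZ => //.
  - by move=> x; rewrite !mulr_ge0 // Ax_ge0.
  - apply: filterS hb => i bi; have [wi _ _ ai] := bi; have iA := W_intg wi; have iU := W_intg wu; split.
    + by apply: measurable_funB; apply: Nf_meas; apply: W_H1.
    + by apply: intgD => //; apply: intgZ.
    + rewrite IntD ?IntZ // -?AuE; try exact: intgZ.
      by rewrite (mulr_natl (C * K)) mulr2n lerD // ler_wpM2l.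
    + move=> t x t0 t1; split; first by rewrite addr_ge0 // mulr_ge0 // Ax_ge0.
      apply: (le_trans (ler_normB _ _)).
      have := hA (v i x) t x (bdd_cmod x bi) t0 t1; have := hA (u x) t x (bdd_cmod x bu) t0 t1.
      rewrite /Ax; move: (cdot _ _) (cdot _ _) (C * _) (C * _) (C * _) => a b c d f; clear.
      by move: `|a| `|b| t^-1 => *; lra.
  - move=> r e' e'0; have [Mh Mh0 hMh] := H1_bounded (W_H1 wh).
    have e1 : 0 < e' / Mh by rewrite divr_gt0.
    have [d d0 hd] := om_small M0 e1.
    apply: filterS (filterI hb (wcv_unif r wc d0)) => i [bi hi] x /hi hx.
    rewrite -cdotBl; apply: (le_trans (cdot_le _ _)); rewrite -[leRHS](divfK (lt0r_neq0 Mh0)).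
    apply: ler_pM => //; try exact: cmod_ge0.
    apply: (le_trans (Flog_mod (bdd_cmod x bi) (bdd_cmod x bu))).
    by have := hd _ (cmod_ge0 _) hx; rewrite /om /M.
have /cvgEP /(_ e e0) key' := key; apply: filterS (filterI hb key') => i [bi].
by rewrite subr0 !NfE IntB //; apply: Nf_intg => //; exact: bdd_W bi.
Qed.

(** Replace [b] by a dyadic slope of its primitive [a]. The pairing becomes a finite combination of
    increments of [f i], which tend to 0, and the replacement error is uniform by Cauchy-Schwarz. *)
Lemma ac_weak_cvg0 (f g : I -> R -> R) (a b : R -> R) (K : R) : continuous a -> L2r b -> ac a b ->
  (\forall i \near F, [/\ L2r (g i), ac (f i) (g i) & Int setT (fun x => g i x ^+ 2) <= K]) ->
  (forall x, f i x @[i --> F] --> 0) -> Int setT (fun x => g i x * b x) @[i --> F] --> 0.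
Proof.
move=> ca Lb ab hg hf; apply/cvgEP => e e0.
have K0 : 0 <= K.
  by have [i [_ _]] := filter_ex hg; apply: le_trans; apply: Int_ge0 => x _; exact: sqr_ge0.
pose d := e ^+ 2 / 4 / (K + 1).
have K1 : 0 < K + 1 by rewrite ltr_wpDl.
have d0 : 0 < d by rewrite !divr_gt0 ?exprn_gt0.
have [k hk] := slope_approx ca Lb ab d0.
have hs : \sum_(j < ncell k) (2 ^+ k * incr k a j) * incr k (f i) j @[i --> F] --> 0.
  rewrite [X in _ --> X](_ : 0 = \sum_(j < ncell k) (2 ^+ k * incr k a j) * incr k (fun=> 0) j); last first.
    by rewrite big1 // => j _; rewrite /incr subrr mulr0.
  apply: (@cvg_osum _ (fun i j => 2 ^+ k * incr k a j * incr k (f i) j)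
    (fun j => 2 ^+ k * incr k a j * incr k (fun=> 0) j)) => j.
  by apply: cvgM; [exact: cvg_cst|exact: cvg_incr].
have e2 : 0 < e / 2 by rewrite divr_gt0.
have /cvgEP /(_ _ e2) hs' := hs.
apply: filterS (filterI hg hs') => i [[Lg ag gK]]; rewrite !subr0 => hi.
have Ls := slope_L2 k a; have Ld := L2rB Ls Lb.
have i1 : intg setT (fun x => g i x * slope k a x) by exact: L2rM.
have i2 : intg setT (fun x => g i x * (slope k a x - b x)) by exact: L2rM.
have -> : Int setT (fun x => g i x * b x) =
    Int setT (fun x => g i x * slope k a x) - Int setT (fun x => g i x * (slope k a x - b x)).
  by rewrite -IntB //; apply: Int_ext => x _; ring.
rewrite (Int_ac_slope _ _ Lg ag).
apply: (le_trans (ler_normB _ _)); rewrite (splitr e) lerD //.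
rewrite -(@ler_pXn2r _ 2) ?nnegrE ?(ltW e2) // -normrX ger0_norm ?sqr_ge0 //.
case: Lg Ld => mg Lg [md Ld]; apply: (le_trans (CS_Int measurableT mg md Lg Ld)).
have h : K * d <= (e / 2) ^+ 2.
  rewrite /d mulrCA; have -> : (e / 2) ^+ 2 = e ^+ 2 / 4 by field.
  by rewrite ler_piMr ?divr_ge0 ?sqr_ge0 // ler_pdivrMr // mul1r lerDl.
apply: le_trans h; apply: ler_pM => //; by apply: Int_ge0 => x _; exact: sqr_ge0.
Qed.

Lemma wcv_Bf0 K v h : wcv K v zf -> W h -> Bf (v i) h @[i --> F] --> 0.
Proof.
move=> wc wh; have [hb _] := wc; have hh := W_H1 wh; have [c1 c2] := H1_cont hh.
have [[L1 L2] a1 a2] := dx_hasd hh.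
have h1 : Int setT (fun x => complex.Re (dx (v i) x) * complex.Re (dx h x)) @[i --> F] --> 0.
  apply: (ac_weak_cvg0 (f := fun i => Re (v i)) (K := K) c1 L1 a1); last by move=> x; exact: (wcv_Re wc).
  apply: filterS hb => i [wi _ di _]; have hi := W_H1 wi; have [[l1 l2] b1 b2] := dx_hasd hi.
  split=> //; apply: le_trans di; rewrite (Df_ReIm hi (dx_hasd hi)) lerDl.
  by apply: Int_ge0 => x _; exact: sqr_ge0.
have h2 : Int setT (fun x => complex.Im (dx (v i) x) * complex.Im (dx h x)) @[i --> F] --> 0.
  apply: (ac_weak_cvg0 (f := fun i => Im (v i)) (K := K) c2 L2 a2); last by move=> x; exact: (wcv_Im wc).
  apply: filterS hb => i [wi _ di _]; have hi := W_H1 wi; have [[l1 l2] b1 b2] := dx_hasd hi.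
  split=> //; apply: le_trans di; rewrite (Df_ReIm hi (dx_hasd hi)) lerDr.
  by apply: Int_ge0 => x _; exact: sqr_ge0.
have h12 : (Int setT (fun x => complex.Re (dx (v i) x) * complex.Re (dx h x)) +
    Int setT (fun x => complex.Im (dx (v i) x) * complex.Im (dx h x))) @[i --> F] --> 0.
  by rewrite -[X in _ --> X]addr0; exact: cvgD.
have /cvgEP H := h12; apply/cvgEP => e e0.
apply: filterS (filterI hb (H e e0)) => i [/bdd_W/W_H1 hi]; have [[l1 l2] _ _] := dx_hasd hi.
rewrite /= BfE IcE -IntD; [|by []|exact: L2rM|exact: L2rM].
by rewrite (@Int_ext _ _ _ (fun x => cdot (dx (v i) x) (dx h x))) // => x _; rewrite cdotE.
Qed.

Lemma wcv_Bf K v u h : wcv K v u -> W h -> Bf (v i) h @[i --> F] --> Bf u h.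
Proof.
move=> wc wh; have /cvgEP H := wcv_Bf0 (wcv_sub wc) wh; apply/cvgEP => e e0.
have [hb _] := wc; apply: filterS (filterI hb (H e e0)) => i [/bdd_W wi].
rewrite (Bf_linl (-1) (W_H1 (bdd_W (wcv_bdd wc))) (W_H1 wi) (W_H1 wh)).
by move: (Bf u h) (Bf (v i) h) => a b; rewrite subr0 mulN1r addrC.
Qed.

Lemma wcv_pt K v u x (z : R[i]) : wcv K v u -> cdot (v i x) z @[i --> F] --> cdot (u x) z.
Proof.
move=> wc; rewrite cdotE (_ : (fun i => _) = fun i => complex.Re (v i x) * complex.Re z +
  complex.Im (v i x) * complex.Im z); last by apply/funext => i; rewrite cdotE.
by apply: cvgD; (apply: cvgM; last exact: cvg_cst); [exact: wcv_Re wc|exact: wcv_Im wc].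
Qed.

Lemma wcv_nsq K v u x : wcv K v u -> nsq (v i x) @[i --> F] --> nsq (u x).
Proof.
move=> wc; rewrite /nsq !expr2; under eq_fun do rewrite !expr2.
by apply: cvgD; apply: cvgM; (exact: wcv_Re wc || exact: wcv_Im wc).
Qed.

Lemma wcv_Lam gamma K v u h : wcv K v u -> W h -> Lam gamma (v i) h @[i --> F] --> Lam gamma u h.
Proof.
move=> wc wh; rewrite /Lam; apply: cvgD; last exact: wcv_Nf wc wh.
apply: cvgD; first by apply: cvgN; exact: wcv_Bf wc wh.
by apply: cvgM; [exact: cvg_cst|exact: wcv_pt wc].
Qed.

End weak_convergence.

Arguments cvgEP {R I F FF} f l.
Arguments cvg_osum {R I F FF} n f l.

(** * The energy and its coercivity *)

Section energy.
Context {R : realType}.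
Local Notation fn := (R -> R[i]).
Implicit Types (u v w h : fn) (K gamma : R).

Local Notation Re u := (fun x => complex.Re (u x)).
Local Notation Im u := (fun x => complex.Im (u x)).

Definition Pu u : R := Int setT (fun x => Psi (cmod (u x))).

(* Twice the conserved energy: [Pu u - Au u] is the integral of [|u|^2 ln |u|^2]. *)
Definition En gamma u : R := Df u - gamma * nsq (u 0) + Au u - Pu u.

Lemma Psi0 : Psi (0 : R) = 0.
Proof. by rewrite /Psi Afun0 expr0n /= mul0r addr0. Qed.

Lemma ucb_Psi : ucb (fun z : R[i] => Psi (cmod z)).
Proof.
move=> M e e0; pose C := 12 + 2 * (`|M| + 1).
have C0 : 0 < C by rewrite /C; move: (normr_ge0 M) => ?; lra.
have [d d0 hd] := ucb_nsq M (divr_gt0 e0 C0).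
exists (Num.min 1 d) => [|z w hz]; first by rewrite lt_min ltr01.
rewrite le_min => /andP[h1 /(hd _ _ hz) h2].
have hM : cmod z <= `|M| by rewrite (le_trans hz) ?ler_norm.
have hw : cmod w <= `|M| + 1.
  by rewrite -[w](subKr z); apply: (le_trans (cmodB_le _ _)); rewrite lerD.
apply: (le_trans (Psi_lip (cmod_ge0 z) (M := `|M| + 1) _ (cmod_ge0 w) hw)).
  by rewrite (le_trans hM) // lerDl.
by rewrite !cmod_sq -/C mulrC -ler_pdivlMr.
Qed.

Lemma Pu_intg u : W u -> intg setT (fun x => Psi (cmod (u x))).
Proof.
move=> wu; have [M M0 hM] := H1_bounded (W_H1 wu); have [c1 c2] := H1_cont (W_H1 wu).
have iq := L2c_nsq (W_L2c wu).
apply: (@intg_dom _ _ _ (fun x => (12 + 2 * M) * nsq (u x))) => //.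
- exact: continuous_meas (ucb_cont ucb_Psi c1 c2).
- move=> x _; have := Psi_lip (cmod_ge0 (u x)) (hM x) (lexx 0) (ltW M0).
  by rewrite Psi0 subr0 expr0n subr0 cmod_sq (ger0_norm (nsq_ge0 _)).
- exact: intgZ.
Qed.

Lemma nsq_sub_young (z w : R[i]) (t : R) : 0 < t ->
  `|nsq z - nsq w| <= t * (2 * nsq z + 2 * nsq w) + t^-1 * nsq (w - z).
Proof.
move=> t0; apply: (le_trans (nsq_sub_le z w)); rewrite (cmodB z w) -!cmod_sq.
have -> : cmod (w - z) = t * (t^-1 * cmod (w - z)) by rewrite mulrA divff ?mul1r // gt_eqF.
have c0 : 0 <= t^-1 * cmod (w - z) by rewrite mulr_ge0 ?cmod_ge0 // invr_ge0 ltW.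
move: (t^-1 * _) c0 => c c0; have -> : t^-1 * (t * c) ^+ 2 = t * c ^+ 2.
  by field; rewrite gt_eqF.
move: (cmod_ge0 z) (cmod_ge0 w); move: (cmod z) (cmod w) => a b a0 b0.
rewrite -mulrDr -mulrA ler_wpM2l ?(ltW t0) //.
have ha : c * a <= c ^+ 2 / 2 + a ^+ 2 / 2 by have := sqr_ge0 (c - a); clear; rewrite !expr2; lra.
have hb : c * b <= c ^+ 2 / 2 + b ^+ 2 / 2 by have := sqr_ge0 (c - b); clear; rewrite !expr2; lra.
have := sqr_ge0 a; have := sqr_ge0 b; rewrite mulrDr.
by move: (c * a) (c * b) (c ^+ 2) (a ^+ 2) (b ^+ 2) ha hb; clear => *; lra.
Qed.

(** [Psi] is Lipschitz in [s^2] on bounded sets; the free parameter [t] of Young's inequality turns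
    smallness of the charge of the difference into smallness of the result. *)
Lemma Pu_diff u v (M t : R) : W u -> W v -> 0 <= M -> (forall x, cmod (u x) <= M) -> (forall x, cmod (v x) <= M) ->
  0 < t -> `|Pu v - Pu u| <= (12 + 2 * M) * (t * (2 * Qf v + 2 * Qf u) + t^-1 * Qf (lin (-1) u v)).
Proof.
move=> wu wv M0 hu hv t0; have iu := Pu_intg wu; have iv := Pu_intg wv.
have qu := L2c_nsq (W_L2c wu); have qv := L2c_nsq (W_L2c wv).
have qw := L2c_nsq (W_L2c (W_lin (-1) wu wv)).
have i1 : intg setT (fun x => t * (2 * nsq (v x) + 2 * nsq (u x))).
  by apply: intgZ => //; apply: intgD => //; apply: intgZ.
have i2 : intg setT (fun x => t^-1 * nsq (lin (-1) u v x)) by exact: intgZ.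
have -> : (12 + 2 * M) * (t * (2 * Qf v + 2 * Qf u) + t^-1 * Qf (lin (-1) u v)) =
    Int setT (fun x => (12 + 2 * M) * (t * (2 * nsq (v x) + 2 * nsq (u x)) + t^-1 * nsq (lin (-1) u v x))).
  rewrite IntZ //; last exact: intgD.
  rewrite IntD // IntZ ?IntD ?IntZ ?Qf_nsq //; try exact: intgZ.
  by apply: intgD => //; exact: intgZ.
rewrite -IntB //; apply: Int_norm_le => //.
- by apply: measurable_funB; apply: intg_meas.
- by apply: intgZ => //; exact: intgD.
move=> x _; apply: (le_trans (Psi_lip (cmod_ge0 _) (hv x) (cmod_ge0 _) (hu x))).
rewrite ler_wpM2l ?addr_ge0 ?mulr_ge0 // !cmod_sq.
have := nsq_sub_young (v x) (u x) t0; rewrite linE rmorphN1 mulN1r.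
by rewrite -[u x - v x]opprB nsqN [- u x + _]addrC.
Qed.

Lemma Psi_le s : 0 <= s -> Psi s <= s ^+ 2 * (7 + ln (1 + s ^+ 2)) :> R.
Proof.
move=> s0; have l0 : 0 <= ln (1 + s ^+ 2) by apply: ln_ge0'; rewrite lerDl sqr_ge0.
rewrite /Psi; have [h|h] := leP s c3.
  rewrite Afun_small // addNr mulr_ge0 ?sqr_ge0 //; lra.
have c0 := @c3_gt0 R; have sp : 0 < s by exact: lt_trans c0 h.
rewrite Afun_large ?ltW //.
have h1 : ln (s ^+ 2) <= ln (1 + s ^+ 2) by apply: ln_le; rewrite ?exprn_gt0 // lerDr.
have := ler_wpM2l (sqr_ge0 s) h1; move: (ln _) (ln _) => a b.
by move: c3 c0 h => c c0 h; nra.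
Qed.

Lemma ln1_le (S d : R) : 0 <= S -> 0 < d -> ln (1 + S) <= d * S + (d - 1 - ln d).
Proof.
move=> S0 d0; have p : 0 < 1 + S by rewrite ltr_pwDl.
have := ln_le_sub1 (mulr_gt0 d0 p); rewrite lnM ?posrE //; move: (ln _) (ln _) => a b; nra.
Qed.

Lemma Pu_le u (d : R) : W u -> 0 < d ->
  Pu u <= Qf u * (7 + d * (2 * (Qf u + Df u)) + (d - 1 - ln d)).
Proof.
move=> wu d0; have hu := W_H1 wu; have q := L2c_nsq (W_L2c wu).
set C := (X in Qf u * X); rewrite /Pu.
have -> : Qf u * C = Int setT (fun x => C * nsq (u x)) by rewrite IntZ // Qf_nsq mulrC.
apply: Int_le => //; [exact: Pu_intg|exact: intgZ|move=> x _].
apply: (le_trans (Psi_le (cmod_ge0 _))); rewrite cmod_sq mulrC ler_wpM2r ?nsq_ge0 //.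
rewrite /C -[leRHS]addrA lerD2l; apply: (le_trans (ln1_le (nsq_ge0 _) d0)); rewrite lerD2r.
rewrite ler_wpM2l ?(ltW d0) //; have := H1_sup x hu ltr01; rewrite divr1 mul1r.
by [].
Qed.

(** At bounded charge the two negative terms are subcritical: the delta term through [H1_sup], the
    term [Pu] through the slow growth of the logarithm of the supremum. *)
Lemma En_coercive gamma (q E : R) : 0 <= q -> exists K : R, forall u, W u -> Qf u <= q -> En gamma u <= E ->
  bdd K u.
Proof.
move=> q0; pose g := `|gamma|; have g0 : 0 <= g by exact: normr_ge0.
(* With these lengths each negative term uses at most a quarter of the Dirichlet integral, so half
   of it remains. *)
pose d : R := (8 * (g + 1))^-1; pose k : R := (8 * (q + 1))^-1.
have d0 : 0 < d by rewrite invr_gt0 mulr_gt0 // ltr_wpDl.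
have k0 : 0 < k by rewrite invr_gt0 mulr_gt0 // ltr_wpDl.
have gd : g * (2 * d) <= 4^-1.
  rewrite /d; have : 0 < g + 1 by rewrite ltr_wpDl.
  by move=> h; rewrite mulrA ler_pdivrMr ?mulr_gt0 //; lra.
have kd : q * (2 * k) <= 4^-1.
  rewrite /k; have : 0 < q + 1 by rewrite ltr_wpDl.
  by move=> h; rewrite mulrA ler_pdivrMr ?mulr_gt0 //; lra.
pose L := `|7 + k * (2 * q) + (k - 1 - ln k)|.
pose X := `|E| + g * (2 * (q / d)) + q * L.
exists (q + 2 * X) => u wu hq hE; have hu := W_H1 wu.
have D0 := Df_ge0 u; have A0 := Au_ge0 u; have Q0 := Qf_ge0 u.
have h1 : gamma * nsq (u 0) <= g * (2 * (q / d)) + 4^-1 * Df u.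
  apply: (@le_trans _ _ (g * (2 * (Qf u / d + d * Df u)))).
    apply: le_trans (ler_wpM2l g0 (H1_sup 0 hu d0)).
    by rewrite ler_wpM2r ?nsq_ge0 // ler_norm.
  rewrite mulrDr mulrDr lerD //.
    by rewrite ler_wpM2l // ler_wpM2l // ler_wpM2r // invr_ge0 ltW.
  by rewrite !mulrA -(mulrA g) ler_wpM2r.
have h2 : Pu u <= q * L + 4^-1 * Df u.
  apply: (le_trans (Pu_le wu k0)).
  have hL : 7 + k * (2 * (Qf u + Df u)) + (k - 1 - ln k) <= L + k * (2 * Df u).
    have h : 7 + k * (2 * q) + (k - 1 - ln k) <= L by exact: ler_norm.
    have h' := ler_wpM2l (ltW k0) hq.
    move: (Qf u) (Df u) (ln k) h h' => a b l; clear; lra.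
  have hL0 : 0 <= L + k * (2 * Df u) by rewrite addr_ge0 ?normr_ge0 // !mulr_ge0 // ltW.
  apply: (@le_trans _ _ (q * (L + k * (2 * Df u)))).
    apply: (le_trans (ler_wpM2l Q0 hL)); exact: ler_wpM2r.
  rewrite mulrDr lerD2l (_ : q * (k * (2 * Df u)) = q * (2 * k) * Df u); last by ring.
  exact: ler_wpM2r.
have hX : Df u + Au u <= 2 * X.
  move: hE; rewrite /En /X => hE; have hE' := ler_norm E.
  have z0 : 0 <= q * L by rewrite mulr_ge0 // normr_ge0.
  have z1 : 0 <= g * (2 * (q / d)) by rewrite !mulr_ge0 // invr_ge0 ltW.
  move: (gamma * _) (Pu u) (g * _) (q * L) h1 h2 z0 z1 hE hE' => a b c f.
  by move: (Df u) (Au u) `|E| D0 A0 => p r s; clear; lra.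
by split=> //; move: X (Df u) (Au u) hX D0 A0 => x a b; clear -hq q0; lra.
Qed.

Lemma bdd_mi K u : bdd K u -> bdd K (mi u).
Proof. by case=> wu q d a; split; rewrite ?Qf_mi ?Df_mi ?Au_mi //; exact: W_mi. Qed.

Lemma mi_mi u x : mi (mi u) x = - u x.
Proof. by rewrite !miE mulrA mulrNN -expr2 sqr_i mulN1r. Qed.

(** Two multiplications by [-i] give the opposite function, which reduces the sum to the
    difference. *)
Lemma bdd_add K u v : bdd K u -> bdd K v -> bdd (8 * (4 * K + K)) (lin 1 u v).
Proof.
move=> bu bv; have := bdd_sub (bdd_mi (bdd_mi bu)) bv.
rewrite (_ : lin (-1) _ _ = lin 1 u v) //; apply/funext => x.
by rewrite !linE mi_mi rmorphN1 rmorph1 mulN1r opprK mul1r.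
Qed.

Lemma bdd_W_ex u : W u -> exists2 K : R, 4 <= K & bdd K u.
Proof.
move=> wu; exists (4 + (Qf u + Df u + Au u)); have := Qf_ge0 u; have := Df_ge0 u; have := Au_ge0 u.
  by move: (Qf u) (Df u) (Au u) => a b c; clear; lra.
by split=> //; move: (Qf u) (Df u) (Au u) H H0 H1 => a b c; clear; lra.
Qed.

Lemma bdd_le K K' u : K <= K' -> bdd K u -> bdd K' u.
Proof. by move=> h [wu a b c]; split=> //; exact: le_trans h. Qed.

End energy.

(** * From convergence of charge and energy to convergence in norm *)

Section strong_convergence.
Context {R : realType} (I : Type) (F : set_system I) (FF : ProperFilter F).
Local Notation fn := (R -> R[i]).
Implicit Types (u w h : fn) (v : I -> fn) (K gamma : R).

Lemma wcv_Q0 K v u : wcv F K v u -> (forall e : R, 0 < e -> \forall i \near F, Qf (v i) <= Qf u + e) ->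
  Qf (lin (-1) u (v i)) @[i --> F] --> 0.
Proof.
move=> wc hQ; apply/cvgEP => e e0; have e3 : 0 < e / 3 by rewrite divr_gt0.
have wu := bdd_W (wcv_bdd FF wc); have [hb _] := wc; have /cvgEP hI := wcv_Ic FF wc wu.
apply: filterS (filterI hb (filterI (hQ _ e3) (hI _ e3))) => i [/bdd_W wi [h1 h2]].
have q0 := Qf_ge0 (lin (-1) u (v i)); rewrite subr0 (ger0_norm q0).
rewrite (Qf_lin _ (W_L2c wu) (W_L2c wi)) Ic_sym; move: h2; rewrite -QfE ler_norml => /andP[+ _].
move: (Qf u) (Qf (v i)) (Ic _ _) h1 => a b c; clear; lra.
Qed.

Lemma wcv_Pu K v u : wcv F K v u -> Qf (lin (-1) u (v i)) @[i --> F] --> 0 ->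
  Pu (v i) @[i --> F] --> Pu u.
Proof.
move=> wc /cvgEP hw; apply/cvgEP => e e0; have bu := wcv_bdd FF wc; have [hb _] := wc.
have K0 := wcv_ge0 FF wc; pose M := 4 * K + 1; have M0 : 0 <= M by rewrite /M; lra.
pose C := 12 + 2 * M; have C0 : 0 < C by rewrite /C; lra.
have K1 : 0 < 4 * K + 1 by lra.
pose t := e / (2 * C * (4 * K + 1)).
have t0 : 0 < t by rewrite divr_gt0 // !mulr_gt0.
have d0 : 0 < t * (e / (2 * C)) by rewrite mulr_gt0 // divr_gt0 // mulr_gt0.
apply: filterS (filterI hb (hw _ d0)) => i [bi]; rewrite subr0 (ger0_norm (Qf_ge0 _)) => hq.
have [wi qi _ _] := bi; have [wu qu _ _] := bu.
apply: (le_trans (Pu_diff wu wi M0 (fun x => bdd_cmod x bu) (fun x => bdd_cmod x bi) t0)).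
rewrite -/C -ler_pdivlMl //.
have h1 : t * (2 * Qf (v i) + 2 * Qf u) <= e / (2 * C).
  rewrite (_ : e / (2 * C) = t * (4 * K + 1)); last first.
    by rewrite /t; field; rewrite !gt_eqF.
  by rewrite ler_wpM2l ?(ltW t0) //; move: (Qf _) (Qf _) qi qu => a b; clear; lra.
have h2 : t^-1 * Qf (lin (-1) u (v i)) <= e / (2 * C) by rewrite ler_pdivrMl.
rewrite (_ : C^-1 * e = e / (2 * C) + e / (2 * C)); first exact: lerD.
by field; rewrite gt_eqF.
Qed.

Lemma wcv_En_lsc gamma K v u (e : R) : wcv F K v u -> Qf (lin (-1) u (v i)) @[i --> F] --> 0 -> 0 < e ->
  \forall i \near F, En gamma u <= En gamma (v i) + e.
Proof.
move=> wc hw e0; have e4 : 0 < e / 4 by rewrite divr_gt0.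
have /cvgEP /(_ _ e4) hP := wcv_Pu wc hw.
have hn : (gamma * nsq (v i 0)) @[i --> F] --> gamma * nsq (u 0).
  by apply: cvgM; [exact: cvg_cst|exact: (@wcv_nsq _ _ _ FF _ _ _ 0 wc)].
have /cvgEP /(_ _ e4) hn' := hn.
apply: filterS (filterI (filterI hP hn') (filterI (wcv_lscD FF wc e4) (wcv_lscA FF wc e4))).
move=> i [[+ +] [h3 h4]]; rewrite /En !ler_norml => /andP[_ h1] /andP[_ h2].
move: (gamma * _) (gamma * _) (Pu _) (Pu _) (Df _) (Df _) (Au _) (Au _) h1 h2 h3 h4.
by move=> a b c d f g k l h1 h2 h3 h4; clear -e0 h1 h2 h3 h4; lra.
Qed.

(** A Brezis-Lieb type statement. On [[-n, n]] convergence is uniform; outside, the modular of the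
    difference is at most 16 times the tail of [u] plus 4 times that of [v i], and the total bound
    prevents mass of [v i] from staying in the tail. *)
Lemma wcv_A0 K v u : wcv F K v u -> (forall e : R, 0 < e -> \forall i \near F, Au (v i) <= Au u + e) ->
  Au (lin (-1) u (v i)) @[i --> F] --> 0.
Proof.
move=> wc hA; have [hb _] := wc; have bu := wcv_bdd FF wc; have wu := bdd_W bu.
apply/cvgEP => e e0; have e4 : 0 < e / 100 by rewrite divr_gt0.
have iu := W_intg wu; have [n hn] := Int_tail iu (Ax_ge0 u) e4.
have /cvgEP /(_ _ e4) h1 := wcv_loc FF ucb_A wc (ler0n _ n).
have /cvgEP /(_ _ e4) h2 := wcv_loc FF ucb_A (wcv_sub FF wc) (ler0n _ n).
apply: filterS (filterI (filterI hb (hA _ e4)) (filterI h1 h2)) => i [[bi a1] [a2 a3]].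
have wi := bdd_W bi; have ii := W_intg wi; have ww := W_lin (-1) wu wi; have iw := W_intg ww.
rewrite subr0 (ger0_norm (Au_ge0 _)) AuE (Int_co n%:R iw).
have mc := @measurable_co R n%:R.
have ci := intg_sub mc ii; have cu := intg_sub mc iu; have cw := intg_sub mc iw.
have b1 : Int (co n%:R) (Ax (lin (-1) u (v i))) <= 16 * Int (co n%:R) (Ax u) + 4 * Int (co n%:R) (Ax (v i)).
  rewrite -!IntZ // -IntD //; try exact: intgZ.
  apply: Int_le => //; first by apply: intgD => //; exact: intgZ.
  move=> x _; have := Ax_lcc (-1)%:C u (v i) x; rewrite -lin_lcc.
  have -> : cmod (-1)%:C = 1 :> R.
    by rewrite -[(-1)%:C]mulr1 cmodZ normrN1 mul1r cmod_sqrt /nsq /= expr1n expr0n addr0 sqrtr1.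
  by move: (Ax _ _) (Ax _ _) (Ax _ _) => p q r; clear; lra.
have b2 : Int `[- n%:R, n%:R] (fun x => Afun (cmod ((zf : fn) x))) = 0.
  by rewrite (@Int_ext _ _ _ (fun=> 0)) ?Int0 // => x _; rewrite cmod0 Afun0.
move: a3; rewrite b2 subr0 ler_norml => /andP[_ a3].
have := Int_co n%:R ii; have := Int_co n%:R iu; move: a1; rewrite !AuE => a1 c1 c2.
move: a2; rewrite ler_norml => /andP[a2 _]; move: a2 a3; rewrite -/(Ax _) -!/(Ax _ _) => a2 a3.
change (fun x : R => Afun (cmod (v i x))) with (Ax (v i)) in a2.
change (fun x : R => Afun (cmod (u x))) with (Ax u) in a2.
change (fun x : R => Afun (cmod (lin (-1) u (v i) x))) with (Ax (lin (-1) u (v i))) in a3.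
move: (Int _ (Ax (lin _ _ _))) (Int _ (Ax (lin _ _ _))) a3 b1 => A B; move: a1 a2 c1 c2 hn.
move: (Int _ (Ax (v i))) (Int _ (Ax (v i))) (Int _ (Ax (v i))) => C D E.
move: (Int _ (Ax u)) (Int _ (Ax u)) (Int _ (Ax u)) => G H J; clear -e0; lra.
Qed.

Lemma wcv_Wnorm0 v : (\forall i \near F, W (v i)) -> Qf (v i) @[i --> F] --> 0 -> Df (v i) @[i --> F] --> 0 ->
  Au (v i) @[i --> F] --> 0 -> Wnorm (v i) @[i --> F] --> 0.
Proof.
move=> hw /cvgEP hQ /cvgEP hD /cvgEP hA; apply/cvgEP => e e0; pose d := Num.min 1 (e / 2).
have d0 : 0 < d by rewrite lt_min ltr01 divr_gt0.
have d1 : d <= 1 by rewrite ge_min lexx.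
have de : 2 * d <= e.
  have : d <= e / 2 by rewrite ge_min lexx orbT.
  by clear; lra.
have d2 : 0 < d ^+ 2 / 2 by rewrite divr_gt0 // exprn_gt0.
apply: filterS (filterI hw (filterI (hQ _ d2) (filterI (hD _ d2) (hA _ d2)))) => i [wi [+ [+ +]]].
rewrite !subr0 (ger0_norm (Qf_ge0 _)) (ger0_norm (Df_ge0 _)) (ger0_norm (Au_ge0 _)) => h1 h2 h3.
rewrite (ger0_norm (Wnorm_ge0 _)); apply: le_trans de; apply: Wnorm_small => //.
  by move: (Qf _) (Df _) h1 h2 => a b; move: (d ^+ 2) => c; clear; lra.
by apply: (le_trans h3); rewrite ler_pdivrMr // ler_peMr ?sqr_ge0 // ler1n.
Qed.

(** The charge bound gives strong convergence in [L^2], hence convergence of [Pu]. The energy bound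
    then controls the sum of [Df] and [Au] from above; since each is lower semicontinuous, neither
    can drop in the limit, and both converge. *)
Lemma wcv_strong gamma K v u : wcv F K v u ->
  (forall e : R, 0 < e -> \forall i \near F, Qf (v i) <= Qf u + e) ->
  (forall e : R, 0 < e -> \forall i \near F, En gamma (v i) <= En gamma u + e) ->
  Wnorm (lin (-1) u (v i)) @[i --> F] --> 0.
Proof.
move=> wc hQ hE; have hw := wcv_Q0 wc hQ; have [hb _] := wc; have wu := bdd_W (wcv_bdd FF wc).
have hn : (gamma * nsq (v i 0)) @[i --> F] --> gamma * nsq (u 0).
  by apply: cvgM; [exact: cvg_cst|exact: (@wcv_nsq _ _ _ FF _ _ _ 0 wc)].
have hDA (e : R) : 0 < e -> \forall i \near F, Df (v i) <= Df u + e /\ Au (v i) <= Au u + e.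
  move=> e0; have e4 : 0 < e / 4 by rewrite divr_gt0.
  have /cvgEP /(_ _ e4) hP := wcv_Pu wc hw; have /cvgEP /(_ _ e4) hn' := hn.
  apply: filterS (filterI (hE _ e4) (filterI (filterI hP hn') (filterI (wcv_lscD FF wc e4) (wcv_lscA FF wc e4)))).
  move=> i [+ [[+ +] [h3 h4]]]; rewrite /En !ler_norml => h0 /andP[_ h1] /andP[_ h2].
  move: h0 h1 h2 h3 h4; move: (gamma * _) (gamma * _) (Pu _) (Pu _) (Df _) (Df _) (Au _) (Au _).
  by move=> a b c d f g k l h0 h1 h2 h3 h4; clear -e0 h0 h1 h2 h3 h4; split; lra.
apply: wcv_Wnorm0 => //.
- by apply: filterS hb => i /bdd_W wi; exact: W_lin.
- apply/cvgEP => e e0; have e3 : 0 < e / 3 by rewrite divr_gt0.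
  have /cvgEP hI := wcv_Bf FF wc wu.
  apply: filterS (filterI hb (filterI (hDA _ e3) (hI _ e3))) => i [/bdd_W wi [[h1 _] h2]].
  have q0 := Df_ge0 (lin (-1) u (v i)); rewrite subr0 (ger0_norm q0).
  rewrite (Df_lin _ (W_H1 wu) (W_H1 wi)) Bf_sym; move: h2; rewrite -DfE ler_norml => /andP[+ _].
  by move: (Df u) (Df (v i)) (Bf _ _) h1 => a b c; clear; lra.
- by apply: (wcv_A0 wc) => e e0; apply: filterS (hDA _ e0) => i [].
Qed.

Lemma cvg_polar (a b c : I -> R) (p : R) : (\forall i \near F, b i = 2 * c i - p + a i) ->
  a i @[i --> F] --> 0 -> c i @[i --> F] --> p -> b i @[i --> F] --> p.
Proof.
move=> hb /cvgEP ha /cvgEP hc; apply/cvgEP => e e0; have e3 : 0 < e / 3 by rewrite divr_gt0.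
apply: filterS (filterI hb (filterI (ha _ e3) (hc _ e3))) => i [-> []]; rewrite subr0 !ler_norml.
move: (a i) (c i) => x y; clear -e0; move=> /andP[? ?] /andP[? ?]; apply/andP; split; lra.
Qed.

Lemma Wnorm_cvg gamma v u : W u -> (\forall i \near F, W (v i)) -> Wnorm (lin (-1) u (v i)) @[i --> F] --> 0 ->
  [/\ exists K, wcv F K v u, Qf (v i) @[i --> F] --> Qf u & En gamma (v i) @[i --> F] --> En gamma u].
Proof.
move=> wu hv /cvgEP hw; have [K K4 bu] := bdd_W_ex wu.
have hs (k : R) : 0 < k -> k <= 1 -> \forall i \near F, let w := lin (-1) u (v i) in
    [/\ W (v i), W w, Qf w <= k ^+ 2, Df w <= k ^+ 2 & Au w <= 20 * k].
  move=> k0 k1; have k2 : 0 < k / 2 by rewrite divr_gt0.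
  apply: filterS (filterI hv (hw _ k2)) => i [wi]; rewrite subr0 (ger0_norm (Wnorm_ge0 _)) => hi.
  have ww := W_lin (-1) wu wi; have hlt : Wnorm (lin (-1) u (v i)) < k.
    by apply: (le_lt_trans hi); rewrite ltr_pdivrMr // ltr_pMr // ltr1n.
  by have [] := Wnorm_lt_small ww hlt k1.
have vE i : v i = lin 1 (lin (-1) u (v i)) u.
  by apply/funext => x; rewrite !linE rmorphN1 rmorph1; ring.
have wc : wcv F (8 * (4 * K + K)) v u.
  split.
    apply: filterS (filterI hv (hw _ ltr01)) => i [wi]; rewrite subr0 (ger0_norm (Wnorm_ge0 _)) => hi.
    by rewrite (vE i); apply: bdd_add => //; apply: (bdd_le K4); apply: bdd_ball => //; exact: W_lin.
  move=> x e e0; pose k := Num.min 1 (e / 2).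
  have k0 : 0 < k by rewrite lt_min ltr01 divr_gt0.
  have k1 : k <= 1 by rewrite ge_min lexx.
  have ke : 2 * k <= e.
    have : k <= e / 2 by rewrite ge_min lexx orbT.
    by clear; lra.
  apply: filterS (hs _ k0 k1) => i [wi ww h1 h2 _].
  have := H1_sup x (W_H1 ww) ltr01; rewrite divr1 mul1r linE rmorphN1 mulN1r addrC => h.
  rewrite cmod_sqrt -[leRHS](ger0_norm (ltW e0)) -sqrtr_sqr ler_sqrt ?sqr_ge0 //.
  apply: (le_trans h); apply: (@le_trans _ _ ((2 * k) ^+ 2)); last by rewrite ler_pXn2r ?nnegrE ?(ltW e0) // mulr_ge0 // ltW.
  by move: (Qf _) (Df _) h1 h2 => a b; clear; rewrite expr2; lra.
have hQ0 : Qf (lin (-1) u (v i)) @[i --> F] --> 0.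
  apply/cvgEP => e e0; pose k := Num.min 1 e.
  have k0 : 0 < k by rewrite lt_min ltr01.
  have k1 : k <= 1 by rewrite ge_min lexx.
  have ke : k <= e by rewrite ge_min lexx orbT.
  apply: filterS (hs _ k0 k1) => i [_ _ h _ _]; rewrite subr0 (ger0_norm (Qf_ge0 _)).
  by apply: (le_trans h); apply: le_trans ke; rewrite expr2 ler_piMr // ltW.
have hD0 : Df (lin (-1) u (v i)) @[i --> F] --> 0.
  apply/cvgEP => e e0; pose k := Num.min 1 e.
  have k0 : 0 < k by rewrite lt_min ltr01.
  have k1 : k <= 1 by rewrite ge_min lexx.
  have ke : k <= e by rewrite ge_min lexx orbT.
  apply: filterS (hs _ k0 k1) => i [_ _ _ h _]; rewrite subr0 (ger0_norm (Df_ge0 _)).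
  by apply: (le_trans h); apply: le_trans ke; rewrite expr2 ler_piMr // ltW.
have hA0 : Au (lin (-1) u (v i)) @[i --> F] --> 0.
  apply/cvgEP => e e0; pose k := Num.min 1 (e / 20).
  have k0 : 0 < k by rewrite lt_min ltr01 divr_gt0.
  have k1 : k <= 1 by rewrite ge_min lexx.
  have ke : k <= e / 20 by rewrite ge_min lexx orbT.
  apply: filterS (hs _ k0 k1) => i [_ _ _ _ h]; rewrite subr0 (ger0_norm (Au_ge0 _)).
  by apply: (le_trans h); move: ke; clear; lra.
have hQ : Qf (v i) @[i --> F] --> Qf u.
  have hI := wcv_Ic FF wc wu; rewrite -QfE in hI; apply: (cvg_polar _ hQ0 hI).
  apply: filterS hv => i wi; rewrite (Qf_lin _ (W_L2c wu) (W_L2c wi)) (Ic_sym u).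
  by move: (Qf u) (Qf (v i)) (Ic _ _) => a b c; ring.
have hD : Df (v i) @[i --> F] --> Df u.
  have hI := wcv_Bf FF wc wu; rewrite -DfE in hI; apply: (cvg_polar _ hD0 hI).
  apply: filterS hv => i wi; rewrite (Df_lin _ (W_H1 wu) (W_H1 wi)) (Bf_sym u).
  by move: (Df u) (Df (v i)) (Bf _ _) => a b c; ring.
split=> //; first by exists (8 * (4 * K + K)).
have hA : Au (v i) @[i --> F] --> Au u.
  apply/cvgEP => e e0; have e4 : 0 < e / 100 by rewrite divr_gt0.
  have iu := W_intg wu; have [n hn] := Int_tail iu (Ax_ge0 u) e4.
  have /cvgEP /(_ _ e4) h1 := wcv_loc FF ucb_A wc (ler0n _ n).
  have /cvgEP /(_ _ e4) h2 := hA0.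
  apply: filterS (filterI (filterI hv (wcv_lscA FF wc e0)) (filterI h1 h2)) => i [[wi a1] [a2 a3]].
  have ii := W_intg wi; have ww := W_lin (-1) wu wi; have iw := W_intg ww.
  have mc := @measurable_co R n%:R.
  have ci := intg_sub mc ii; have cu := intg_sub mc iu; have cw := intg_sub mc iw.
  have b1 : Int (co n%:R) (Ax (v i)) <= 16 * Int (co n%:R) (Ax (lin (-1) u (v i))) + 4 * Int (co n%:R) (Ax u).
    rewrite -!IntZ // -IntD //; try exact: intgZ.
    apply: Int_le => //; first by apply: intgD => //; exact: intgZ.
    move=> x _; have := Ax_lcc 1%:C (lin (-1) u (v i)) u x; rewrite -lin_lcc -vE.
    have -> : cmod 1%:C = 1 :> R by rewrite cmod_sqrt /nsq /= expr1n expr0n addr0 sqrtr1.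
    by move: (Ax _ _) (Ax _ _) (Ax _ _) => p q r; clear; lra.
  have b3 : Int (co n%:R) (Ax (lin (-1) u (v i))) <= Au (lin (-1) u (v i)).
    by rewrite AuE; apply: Int_subset => // x _; exact: Ax_ge0.
  move: a3; rewrite subr0 (ger0_norm (Au_ge0 _)) => a3.
  have b4 : Int `[- n%:R, n%:R] (Ax u) <= Au u.
    by rewrite AuE; apply: Int_subset => // x _; exact: Ax_ge0.
  have := Int_co n%:R ii; rewrite -AuE => c2.
  change (fun x : R => Afun (cmod (v i x))) with (Ax (v i)) in a2.
  change (fun x : R => Afun (cmod (u x))) with (Ax u) in a2.
  move: a2; rewrite !ler_norml => /andP[_ a2]; apply/andP; move: a1 a2 a3 b1 b3 b4 c2 hn.
  move: (Au (v i)) (Au u) (Au (lin _ _ _)) (Int _ (Ax (v i))) (Int _ (Ax (v i))) (Int _ (Ax u)) (Int _ (Ax u)).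
  by move: (Int _ _) => a b c d f g k l; clear -e0; split; lra.
rewrite /En; apply: cvgB; last exact: wcv_Pu wc hQ0.
apply: cvgD => //; apply: cvgB => //; apply: cvgM; [exact: cvg_cst|exact: (@wcv_nsq _ _ _ FF _ _ _ 0 wc)].
Qed.

End strong_convergence.

(** * Well-posedness *)

Section dini.
Context {R : realType}.
Implicit Types (f : R -> R) (a b t s C : R).

Lemma nearEP (t : R) (P : R -> Prop) :
  (\forall s \near t, P s) <-> exists2 d : R, 0 < d & forall s, `|s - t| <= d -> P s.
Proof.
split=> [/nbhs_ballP [d /= d0 hd]|[d d0 hd]].
  exists (d / 2); first by rewrite divr_gt0.
  move=> s hs; apply: hd; rewrite /ball /= distrC (le_lt_trans hs) //.
  by rewrite ltr_pdivrMr // ltr_pMr // ltr1n.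
by apply/nbhs_ballP; exists d => //= s; rewrite /ball /= distrC => /ltW; exact: hd.
Qed.

(** The set of [t] from which the bound up to [b] holds contains its infimum by the right-hand
    semicontinuity, and the left-hand bound would push it further left unless it is [a]. No
    derivative of [f] is required, which matters because the charge of a difference of weak
    solutions is only estimated from one side. *)
Lemma dini_le f a b C : a <= b ->
  (forall t, a <= t <= b -> forall e : R, 0 < e -> exists2 d : R, 0 < d &
     forall s, t - d <= s <= t -> f t - f s <= (C + e) * (t - s)) ->
  (forall t, a <= t <= b -> forall e : R, 0 < e -> exists2 d : R, 0 < d &
     forall s, t <= s <= t + d -> f s - f t <= e) ->
  f b - f a <= C * (b - a).
Proof.
move=> ab h1 h2.
suff key (e : R) : 0 < e -> f b - f a <= (C + e) * (b - a).
  apply/ler_addgt0Pr => e e0; have d0 : 0 < b - a + 1 by rewrite ltr_wpDl // subr_ge0.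
  apply: (le_trans (key _ (divr_gt0 e0 d0))); rewrite mulrDl lerD2l mulrAC ler_pdivrMr //.
  by rewrite ler_wpM2l ?(ltW e0) // lerDl.
move=> e0; pose S := [set t | a <= t <= b /\ f b - f t <= (C + e) * (b - t)].
have Sb : S b by split; [rewrite ab lexx|rewrite !subrr mulr0].
have hS : has_inf S by split; [exists b|exists a => t [/andP[]]].
pose c := inf S; have ca : a <= c by apply: lb_le_inf; [exists b|move=> t [/andP[]]].
have cb : c <= b by apply: ge_inf => //; case: hS.
have Sc : S c.
  split; first by rewrite ca.
  apply/ler_addgt0Pr => q q0.
  have q2 : 0 < q / 2 by rewrite divr_gt0.
  have [d d0 hd] := h2 c (introT andP (conj ca cb)) _ q2.
  pose K := `|C + e| + 1; have K0 : 0 < K by rewrite ltr_wpDl.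
  pose d' := Num.min d (q / 2 / K).
  have d'0 : 0 < d' by rewrite lt_min d0 divr_gt0.
  have [t [tab St] tc] := inf_adherent d'0 hS; rewrite -/c in tc.
  have ct : c <= t by apply: ge_inf; [case: hS|split].
  have tcd : t - c <= d' by rewrite lerBlDl ltW.
  have hfc : f t - f c <= q / 2.
    by apply: hd; rewrite ct /= -lerBlDl (le_trans tcd) // ge_min lexx.
  have hK : (C + e) * (b - t) <= (C + e) * (b - c) + q / 2.
    have -> : (C + e) * (b - t) = (C + e) * (b - c) + - (C + e) * (t - c) by ring.
    rewrite lerD2l; apply: (@le_trans _ _ (K * (t - c))).
      rewrite ler_wpM2r ?subr_ge0 // (@le_trans _ _ `|C + e|) //; last by rewrite /K lerDl.
      by rewrite -normrN ler_norm.
    rewrite mulrC -ler_pdivlMr // (le_trans tcd) // ge_min lexx orbT //.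
  move: (f b) (f c) (f t) hfc hK St => x y z; clear; move: (_ * (b - t)) (_ * (b - c)) => p r; lra.
have [cEa|ac] : c = a \/ a < c by move: ca; rewrite le_eqVlt => /predU1P[->|]; [left|right].
  by rewrite -cEa; case: Sc.
have [d d0 hd] := h1 c (introT andP (conj ca cb)) _ e0.
pose s := Num.max a (c - d).
have sc : s < c by rewrite gt_max ac ltrBlDr ltrDl.
have as' : a <= s by rewrite le_max lexx.
have : S s.
  split; first by rewrite as' (le_trans (ltW sc)).
  have := hd s; rewrite le_max lexx orbT (ltW sc) => /(_ isT); case: Sc => _.
  move: (f b) (f c) (f s) => x y z; clear; move=> p r.
  have -> : (C + e) * (b - s) = (C + e) * (b - c) + (C + e) * (c - s) by ring.
  by move: (_ * (b - c)) (_ * (c - s)) p r => p r; lra.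
move=> /(ge_inf (proj2 hS)); rewrite -/c => h.
by have := lt_le_trans sc h; rewrite ltxx.
Qed.

Lemma dini_gronwall f C : 0 <= C -> (forall t, 0 <= f t) ->
  (forall t (e : R), 0 < e -> \forall s \near t, f t - f s <= (C * f t + e) * `|s - t|) ->
  (forall t (e : R), 0 < e -> \forall s \near t, f s - f t <= e) ->
  f 0 <= 0 -> forall T, 0 <= T -> f T <= 0.
Proof.
move=> C0 f0 h1 h2 z T T0; pose g t := expR (- C * t) * f t.
have E0 t : 0 < expR (- C * t) by exact: expR_gt0.
have E1 t : 0 <= t -> expR (- C * t) <= 1.
  by move=> t0; rewrite -expR0 ler_expR mulNr oppr_le0 mulr_ge0.
have gT : g T - g 0 <= 0 * (T - 0).
  apply: dini_le => // t /andP[t0 tT] e e0.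
  - have e2 : 0 < e / 2 by rewrite divr_gt0.
    have /nearEP [d1 d10 hd1] := h1 t _ e2; have /nearEP [d2 d20 hd2] := h1 t _ ltr01.
    have X0 : 0 < C * (C * f t + 1) + 1 by rewrite ltr_wpDl // mulr_ge0 // addr_ge0 // mulr_ge0.
    exists (Num.min (Num.min d1 d2) (e / 2 / (C * (C * f t + 1) + 1))).
      by rewrite !lt_min d10 d20 divr_gt0.
    move=> s /andP[s1 s2]; have ts : 0 <= t - s by rewrite subr_ge0.
    have := s1; rewrite lerBlDl -lerBlDr !le_min => /andP[/andP[p1 p2] p3].
    have ab : `|s - t| = t - s by rewrite distrC ger0_norm.
    have a1 := hd1 s; rewrite ab in a1; have {}a1 := a1 p1.
    have a2 := hd2 s; rewrite ab in a2; have {}a2 := a2 p2.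
    have cv : expR (- C * t) * (1 + C * (t - s)) <= expR (- C * s).
      have -> : - C * s = - C * t + C * (t - s) by ring.
      by rewrite expRD ler_wpM2l ?(ltW (E0 _)) // expR_ge1Dx.
    have b1 : C * (f t - f s) <= e / 2.
      apply: (le_trans (ler_wpM2l C0 a2)).
      move: p3; rewrite ler_pdivlMr // => p3; apply: le_trans p3.
      move: (f0 t) => q; rewrite mulrA [leRHS]mulrC ler_wpM2r // lerDl //.
    have b2 : g t - g s <= expR (- C * t) * (f t - f s - C * (t - s) * f s).
      rewrite /g; have := ler_wpM2r (f0 s) cv; move: (expR _) (expR _) => x y; clear; nra.
    apply: (le_trans b2); rewrite add0r.
    have b3 : f t - f s - C * (t - s) * f s <= e * (t - s).
      apply: (@le_trans _ _ ((C * f t + e / 2) * (t - s) - C * (t - s) * f s)); first by rewrite lerD2r.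
      have := ler_wpM2r ts b1; clear; lra.
    have [n0|n0] := leP 0 (f t - f s - C * (t - s) * f s).
      by apply: le_trans b3; rewrite ler_piMl // E1.
    apply: (@le_trans _ _ 0); last by rewrite mulr_ge0 // ltW.
    by rewrite pmulr_rle0 // ltW.
  - have /nearEP [d d0 hd] := h2 t _ e0; exists d => // s /andP[s1 s2].
    have := hd s; rewrite ger0_norm ?subr_ge0 // lerBlDl => /(_ s2) h.
    have m : expR (- C * s) <= expR (- C * t) by rewrite ler_expR !mulNr lerN2 ler_wpM2l.
    have := ler_wpM2r (f0 s) m; rewrite /g => h'.
    have [n0|n0] := leP 0 (f s - f t).
      apply: (@le_trans _ _ (expR (- C * t) * (f s - f t))); first by rewrite mulrBr lerD2r.
      by apply: le_trans h; rewrite ler_piMl // E1.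
    apply: (@le_trans _ _ (expR (- C * t) * (f s - f t))); first by rewrite mulrBr lerD2r.
    by apply: (@le_trans _ _ 0); [rewrite pmulr_rle0 // ltW|exact: ltW].
move: gT; rewrite /g mulr0 expR0 mul1r mul0r => gT.
have : expR (- C * T) * f T <= 0 by move: (_ * f T) (f 0) gT z => a b; clear; lra.
by rewrite pmulr_rle0.
Qed.

Lemma near_opp (t : R) (P : R -> Prop) : (\forall s \near - t, P s) -> \forall s \near t, P (- s).
Proof.
move=> /nearEP[d d0 hd]; apply/nearEP; exists d => // s hs; apply: hd.
by rewrite -opprD normrN.
Qed.

Lemma dini_gronwall_abs f C : 0 <= C -> (forall t, 0 <= f t) ->
  (forall t (e : R), 0 < e -> \forall s \near t, f t - f s <= (C * f t + e) * `|s - t|) ->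
  (forall t (e : R), 0 < e -> \forall s \near t, f s - f t <= e) ->
  f 0 <= 0 -> forall T, f T <= 0.
Proof.
move=> C0 f0 h1 h2 z T; have [T0|T0] := leP 0 T; first exact: dini_gronwall h1 h2 z T T0.
rewrite -[T]opprK; apply: (@dini_gronwall (fun t => f (- t)) C) => //; last by rewrite oppr_ge0 ltW.
- move=> t e e0; have := near_opp (h1 (- t) e e0).
  by apply: filterS => s; rewrite -opprD normrN.
- by move=> t e e0; exact: near_opp (h2 (- t) e e0).
- by rewrite oppr0.
Qed.

Lemma dini_noninc f :
  (forall t (e : R), 0 < e -> \forall s \near t, f t - f s <= e * `|s - t|) ->
  (forall t (e : R), 0 < e -> \forall s \near t, f s - f t <= e) ->
  forall a b, a <= b -> f b <= f a.
Proof.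
move=> h1 h2 a b ab; rewrite -subr_le0 -[leRHS](mul0r (b - a)); apply: dini_le => // t _ e e0.
- have /nearEP [d d0 hd] := h1 t e e0; exists d => // s /andP[s1 s2]; rewrite add0r.
  have := hd s; rewrite distrC ger0_norm ?subr_ge0 //; apply.
  by move: s1; rewrite lerBlDl -lerBlDr.
- have /nearEP [d d0 hd] := h2 t e e0; exists d => // s /andP[s1 s2]; apply: hd.
  by rewrite ger0_norm ?subr_ge0 // lerBlDl.
Qed.

Lemma dini_const f :
  (forall t (e : R), 0 < e -> \forall s \near t, f t - f s <= e * `|s - t|) ->
  (forall t (e : R), 0 < e -> \forall s \near t, f s - f t <= e) ->
  forall t, f t = f 0.
Proof.
move=> h1 h2; have k1 := dini_noninc h1 h2.
have k2 : forall a b, a <= b -> f (- b) <= f (- a).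
  apply: (@dini_noninc (fun t => f (- t))) => t e e0; last exact: near_opp (h2 (- t) e e0).
  by have := near_opp (h1 (- t) e e0); apply: filterS => s; rewrite -opprD normrN.
have k3 a b : a <= b -> f a <= f b.
  by move=> ab; have := k2 (- b) (- a); rewrite !opprK lerN2 => /(_ ab).
move=> t; apply/eqP; rewrite eq_le; have [t0|/ltW t0] := leP 0 t.
  by rewrite (k1 _ _ t0) (k3 _ _ t0).
by rewrite (k1 _ _ t0) (k3 _ _ t0).
Qed.

Lemma deriv_le f (df : R -> R) a b C : a <= b ->
  (forall t, a <= t <= b -> forall e : R, 0 < e ->
     \forall s \near t, `|f s - f t - (s - t) * df t| <= e * `|s - t|) ->
  (forall t, a <= t <= b -> df t <= C) -> f b - f a <= C * (b - a).
Proof.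
move=> ab h hC; apply: dini_le => // t tab e e0.
- have /nearEP [d d0 hd] := h t tab e e0; exists d => // s /andP[s1 s2].
  have := hd s; rewrite (distrC s) (@ger0_norm _ (t - s)) ?subr_ge0 //.
  have -> : t - s <= d by move: s1; rewrite lerBlDl -lerBlDr.
  move=> /(_ isT); rewrite ler_norml => /andP[h1 _].
  have := ler_wpM2r (_ : 0 <= t - s) (hC t tab); rewrite subr_ge0 => /(_ s2) h2.
  by move: h1 h2; move: (f t) (f s) (df t) => x y z; clear; lra.
- have /nearEP [d d0 hd] := h t tab 1 ltr01.
  pose K := `|df t| + 1; have K0 : 0 < K by rewrite ltr_wpDl.
  exists (Num.min d (e / K)); first by rewrite lt_min d0 divr_gt0.
  move=> s /andP[s1 s2]; have := s2; rewrite -lerBlDl le_min ler_pdivlMr // => /andP[p1 p2].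
  have st : 0 <= s - t by rewrite subr_ge0.
  have := hd s; rewrite (ger0_norm st) => /(_ p1); rewrite ler_norml => /andP[_ h1].
  have h2 := ler_wpM2l st (ler_norm (df t)).
  move: h1 h2 p2; rewrite /K; move: (f s) (f t) (df t) `|df t| => x y z w; clear; lra.
Qed.

End dini.

(** * Weak solutions: charge, Lipschitz bound and uniqueness *)

Section weak_solutions.
Context {R : realType} (gamma : R).
Local Notation fn := (R -> R[i]).
Implicit Types (u v w : R -> fn) (h k : fn) (L : R -> fn -> R) (t : R).

Definition wdiff w L : Prop := [/\ forall t, W (w t),
  forall t (e : R), 0 < e -> \forall s \near t, Qf (lin (-1) (w t) (w s)) <= e &
  forall t h, W h -> forall e : R, 0 < e ->
    \forall s \near t, `|Ic (w s) h - Ic (w t) h - (s - t) * L t h| <= e * `|s - t|].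

(** Dropping the square [Qf (w s - w t) >= 0] bounds the loss of charge by a pairing with the fixed
    element [w t]. Only the weak derivative at [t] enters, so no product rule is needed. *)
Lemma wdiff_dini w L (C : R) : 0 <= C -> wdiff w L -> (forall t, `|L t (w t)| <= C * Qf (w t)) ->
  forall t (e : R), 0 < e -> \forall s \near t,
    Qf (w t) - Qf (w s) <= (2 * C * Qf (w t) + e) * `|s - t|.
Proof.
move=> C0 [hW _ hd] hL t e e0; have e2 : 0 < e / 2 by rewrite divr_gt0.
apply: filterS (hd t _ (hW t) _ e2) => s; rewrite -QfE.
have := Qf_ge0 (lin (-1) (w t) (w s)); rewrite (Qf_lin _ (W_L2c (hW t)) (W_L2c (hW s))) Ic_sym => h1.
rewrite ler_norml => /andP[h2 _].
have h3 : - ((s - t) * L t (w t)) <= `|s - t| * (C * Qf (w t)).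
  by rewrite (le_trans (ler_norm _)) // normrN normrM ler_wpM2l.
move: (Qf (w t)) (Qf (w s)) (Ic _ _) (_ * L _ _) `|s - t| h1 h2 h3 => a b c d f; clear; lra.
Qed.

Lemma wdiff_cont w L : wdiff w L ->
  forall t (e : R), 0 < e -> \forall s \near t, Qf (w s) - Qf (w t) <= e.
Proof.
move=> [hW hc hd] t e e0; have e4 : 0 < e / 4 by rewrite divr_gt0.
pose K := `|L t (w t)| + 1; have K0 : 0 < K by rewrite ltr_wpDl.
have hn : \forall s \near t, `|s - t| <= e / 4 / K.
  by apply/nearEP; exists (e / 4 / K) => //; rewrite divr_gt0.
apply: filterS (filterI hn (filterI (hc t _ e4) (hd t _ (hW t) _ ltr01))) => s [+ [h1]].
rewrite -QfE ler_pdivlMr // => h0.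
rewrite (Qf_lin _ (W_L2c (hW t)) (W_L2c (hW s))) Ic_sym in h1.
rewrite ler_norml => /andP[_ h2].
have h3 : (s - t) * L t (w t) <= `|s - t| * `|L t (w t)| by rewrite (le_trans (ler_norm _)) // normrM.
move: h0 h3; rewrite /K; move: (Qf (w t)) (Qf (w s)) (Ic _ _) (_ * L _ _) `|s - t| `|L _ _| h1 h2 => a b c d f g.
by clear -e0; lra.
Qed.

Lemma wdiff_zero w L (C : R) : 0 <= C -> wdiff w L -> (forall t, `|L t (w t)| <= C * Qf (w t)) ->
  Qf (w 0) = 0 -> forall t, Qf (w t) = 0.
Proof.
move=> C0 hw hL z t; apply/eqP; rewrite eq_le Qf_ge0 andbT.
apply: (@dini_gronwall_abs _ (fun t => Qf (w t)) (2 * C)); rewrite ?mulr_ge0 ?z //.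
- by move=> s; exact: Qf_ge0.
- exact: wdiff_dini hw hL.
- exact: wdiff_cont hw.
Qed.

Lemma wdiff_const w L : wdiff w L -> (forall t, L t (w t) = 0) -> forall t, Qf (w t) = Qf (w 0).
Proof.
move=> hw hL; apply: (dini_const (f := fun t => Qf (w t))); last exact: wdiff_cont hw.
move=> t e e0; have h (s : R) : `|L s (w s)| <= 0 * Qf (w s) by rewrite hL normr0 mul0r.
have h' := wdiff_dini (lexx 0) hw h t e0.
by apply: filterS h' => s; rewrite mulr0 mul0r add0r.
Qed.

Lemma Qf_eq0 h : W h -> Qf h = 0 -> h = zf.
Proof.
move=> wh q0; apply/funext => x; apply: nsq_eq0; apply/eqP; rewrite eq_le nsq_ge0 andbT.
apply/ler_addgt0Pr => e e0; rewrite add0r.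
have D1 : 0 < 2 * (Df h + 1) by rewrite mulr_gt0 // ltr_wpDl // Df_ge0.
have := H1_sup x (W_H1 wh) (divr_gt0 e0 D1); rewrite q0 mul0r add0r => h'; apply: (le_trans h').
rewrite mulrC -ler_pdivlMr // mulrAC ler_pdivrMr // mulrAC -mulrA ler_wpM2l ?(ltW e0) //.
by move: (Df h) => d; clear; lra.
Qed.

Definition wsol u : Prop := [/\ forall t, W (u t),
  forall t, exists K : R, \forall s \near t, bdd K (u s) &
  forall t h, W h -> forall e : R, 0 < e ->
    \forall s \near t, `|Ic (u s) h - Ic (u t) h - (s - t) * Lam gamma (u t) (mi h)| <= e * `|s - t|].

Lemma Qf_linC h k : W h -> W k -> Qf (lin (-1) h k) = Qf (lin (-1) k h).
Proof.
move=> wh wk; rewrite !Qf_lin; try exact: W_L2c.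
by rewrite (Ic_sym k h); move: (Qf h) (Qf k) (Ic _ _) => a b c; ring.
Qed.

(** The charge of [u r - u s] is the increment of the pairing with the fixed function
    [h = u r - u s], and the derivative of that pairing is bounded on bounded sets of [W]. *)
Lemma wsol_lip u : wsol u -> forall t, exists C : R, \forall s \near t,
  Qf (lin (-1) (u t) (u s)) <= C * `|s - t|.
Proof.
move=> [hW hb hd] t; have [K /nearEP[d d0 hK]] := hb t.
have bt : bdd K (u t) by apply: hK; rewrite subrr normr0 ltW.
have K0 := bdd_ge0 bt; pose K' := 8 * (4 * K + K); have KK : K <= K' by rewrite /K'; lra.
pose C := K' + `|gamma| * (4 * K' + 1) ^+ 2 + (6 + 2 * (4 * K' + 1)) * (K' + K').
have main (s r : R) : `|s - t| <= d -> `|r - t| <= d -> s <= r -> Qf (lin (-1) (u s) (u r)) <= C * (r - s).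
  move=> sd rd sr; set h := lin (-1) (u s) (u r).
  have bs := hK s sd; have br := hK r rd.
  have bh : bdd K' h by exact: bdd_sub.
  have wh := bdd_W bh.
  have -> : Qf h = Ic (u r) h - Ic (u s) h.
    by rewrite QfE {1}/h (Ic_linl _ (W_L2c (hW s)) (W_L2c (hW r)) (W_L2c wh)) mulN1r addrC.
  apply: (deriv_le (f := fun q => Ic (u q) h) (df := fun q => Lam gamma (u q) (mi h))) => // q /andP[q1 q2].
    by move=> e e0; exact: hd.
  apply: (le_trans (ler_norm _)); apply: Lam_le; last exact: bdd_mi.
  apply: (bdd_le KK); apply: hK; move: sd rd; rewrite !ler_norml => /andP[? ?] /andP[? ?].
  by apply/andP; split; [apply: (@le_trans _ _ (s - t))|apply: (@le_trans _ _ (r - t))]; rewrite ?lerD2r.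
exists C; apply/nearEP; exists d => // s sd; have [ts|/ltW st] := leP t s.
  by rewrite ger0_norm ?subr_ge0 //; apply: main => //; rewrite subrr normr0 ltW.
rewrite distrC ger0_norm ?subr_ge0 // Qf_linC //; apply: main => //; by rewrite subrr normr0 ltW.
Qed.

Lemma wsol_Qcont u : wsol u -> forall t (e : R), 0 < e -> \forall s \near t, Qf (lin (-1) (u t) (u s)) <= e.
Proof.
move=> hu t e e0; have [C hC] := wsol_lip hu t.
have K0 : 0 < `|C| + 1 by rewrite ltr_wpDl.
have hn : \forall s \near t, `|s - t| <= e / (`|C| + 1).
  by apply/nearEP; exists (e / (`|C| + 1)) => //; rewrite divr_gt0.
apply: filterS (filterI hC hn) => s [h1]; rewrite ler_pdivlMr // => h2.
apply: (le_trans h1); apply: le_trans h2; rewrite [leRHS]mulrC ler_wpM2r //.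
by rewrite (le_trans (ler_norm _)) // lerDl.
Qed.

Lemma wsol_wdiff u : wsol u -> wdiff u (fun t h => Lam gamma (u t) (mi h)).
Proof. by move=> hu; have [hW _ hd] := hu; split=> //; exact: wsol_Qcont hu. Qed.

Lemma wsol_Q u : wsol u -> forall t, Qf (u t) = Qf (u 0).
Proof.
move=> hu; have [hW _ _] := hu; apply: (wdiff_const (wsol_wdiff hu)) => t; exact: Lam_rot.
Qed.

(** The difference [w] satisfies [|L t (w t)| <= 2 Qf (w t)] by the monotonicity inequality, so
    Gronwall in both time directions gives zero. *)
Lemma wsol_unique u v : wsol u -> wsol v -> u 0 = v 0 -> u = v.
Proof.
move=> hu hv e0; have [uW _ ud] := hu; have [vW _ vd] := hv.
pose w t := lin (-1) (v t) (u t).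
have wW t : W (w t) by exact: W_lin.
pose L t h := Lam gamma (u t) (mi h) - Lam gamma (v t) (mi h).
have hw : wdiff w L.
  split=> // t.
    move=> e ep; have e4 : 0 < e / 4 by rewrite divr_gt0.
    apply: filterS (filterI (wsol_Qcont hu t e4) (wsol_Qcont hv t e4)) => s [h1 h2].
    have E : lin (-1) (w t) (w s) = lin (-1) (lin (-1) (v t) (v s)) (lin (-1) (u t) (u s)).
      by apply/funext => x; rewrite /w !linE !rmorphN1; ring.
    have a1 := W_L2c (W_lin (-1) (vW t) (vW s)); have a2 := W_L2c (W_lin (-1) (uW t) (uW s)).
    rewrite E (Qf_lin (-1) a1 a2).
    have := Qf_ge0 (lin 1 (lin (-1) (v t) (v s)) (lin (-1) (u t) (u s))); rewrite (Qf_lin 1 a1 a2).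
    by move: (Qf _) (Qf _) (Ic _ _) h1 h2 => a b c; clear -ep; lra.
  move=> h wh e ep; have e2 : 0 < e / 2 by rewrite divr_gt0.
  apply: filterS (filterI (ud t h wh _ e2) (vd t h wh _ e2)) => s [h1 h2].
  have E r : Ic (w r) h = Ic (u r) h - Ic (v r) h.
    by rewrite (Ic_linl _ (W_L2c (vW r)) (W_L2c (uW r)) (W_L2c wh)) mulN1r addrC.
  rewrite !E /L; move: h1 h2; move: (Ic _ _) (Ic _ _) (Ic _ _) (Ic _ _) (Lam _ _ _) (Lam _ _ _) => a b c d f g.
  move=> h1 h2; rewrite (splitr e) [leRHS]mulrDl.
  have -> : d - b - (c - a) - (s - t) * (g - f) = (d - c - (s - t) * g) - (b - a - (s - t) * f) by ring.
  by apply: (le_trans (ler_normB _ _)); rewrite lerD.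
have h0 : Qf (w 0) = 0.
  rewrite (_ : w 0 = zf) ?QfE ?Ic0l //; apply/funext => x.
  by rewrite /w e0 linE rmorphN1 mulN1r addNr.
have hz := wdiff_zero (ler0n _ 2) hw (fun t => Lam_monotone gamma (uW t) (vW t)) h0.
apply/funext => t; apply/funext => x; have := congr1 (fun f => f x) (Qf_eq0 (wW t) (hz t)).
by rewrite /w linE rmorphN1 mulN1r /zf addrC => /eqP; rewrite subr_eq0 => /eqP.
Qed.

Lemma wsol_shift u (a : R) : wsol u -> wsol (fun t => u (t + a)).
Proof.
have sh (t : R) (P : R -> Prop) : (\forall s \near t + a, P s) -> \forall s \near t, P (s + a).
  move=> /nearEP [d d0 hd]; apply/nearEP; exists d => // s hs; apply: hd.
  by rewrite opprD addrACA subrr addr0.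
move=> [hW hb hd]; split=> [t|t|t]; first exact: hW.
  by have [K hK] := hb (t + a); exists K; exact: sh hK.
move=> h wh e e0; apply: filterS (sh _ _ (hd (t + a) h wh e e0)) => s.
by rewrite opprD addrACA subrr addr0.
Qed.

End weak_solutions.

(** * Finite-dimensional complex subspaces of [W] *)

Section finite_dimensional.
Context {R : realType}.
Local Notation fn := (R -> R[i]).
Implicit Types (u v w h k e f : fn) (V : fn -> Prop).

(* What is used of a finite-dimensional complex subspace of [W]: representers for
   the [L^2] product, and comparability of all norms. *)
Record nice V : Prop := Nice {
  nice_W : forall u, V u -> W u;
  nice0 : V zf;
  nice_lin : forall (a : R) u v, V u -> V v -> V (lin a u v);
  nice_mi : forall u, V u -> V (mi u);
  nice_rep : forall F, Wlinear F -> exists2 v, V v & forall h, V h -> Ic v h = F h;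
  nice_le : exists C : R, forall v, V v -> Qf v <= 1 -> Df v <= C /\ Au v <= C }.

Lemma Df_lin_le (a : R) u v : H1 u -> H1 v -> Df (lin a u v) <= 2 * a ^+ 2 * Df u + 2 * Df v.
Proof.
move=> hu hv; rewrite (Df_lin a hu hv).
have := Df_ge0 (lin (- a) u v); rewrite (Df_lin (- a) hu hv) sqrrN.
by move: (Df u) (Df v) (Bf u v) => x y z; move: (a ^+ 2) => q; clear; lra.
Qed.

Lemma Au_lin_le (a : R) u v : W u -> W v -> Au (lin a u v) <= 4 * ((1 + `|a|) ^+ 2 * Au u + Au v).
Proof.
move=> wu wv; rewrite lin_lcc; apply: (le_trans (Au_lcc _ wu wv)).
have -> // : cmod a%:C = `|a|.
by rewrite -[a%:C]mulr1 cmodZ cmod_sqrt /nsq /= expr1n expr0n addr0 sqrtr1 mulr1.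
Qed.

Lemma Ic0r u : Ic u zf = 0. Proof. by rewrite Ic_sym Ic0l. Qed.

Lemma nice_zero : nice (fun v => v = zf).
Proof.
split=> //.
- by move=> u ->; exact: W0.
- by move=> a u v -> ->; apply/funext => x; rewrite linE mulr0 addr0.
- by move=> u ->; apply/funext => x; rewrite miE mulr0.
- by move=> F lF; exists zf => // h ->; rewrite Ic0r (Wlinear0 lF).
- exists (Df (zf : fn) + Au (zf : fn)) => v -> _.
  by rewrite lerDl lerDr Df_ge0 Au_ge0.
Qed.

Lemma Ic_mil u v : W u -> W v -> Ic (mi u) v = - Ic u (mi v).
Proof.
move=> wu wv; rewrite !IcE -IntN //; last exact: intg_Ic (W_L2c wu) (W_L2c (W_mi wv)).
by apply: Int_ext => x _; rewrite !miE cdot_mulil.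
Qed.

(** One step of Gram-Schmidt over the complex numbers: remove from [f] its projection [p], normalise
    to [e], and adjoin both [e] and [-i e], which are orthogonal for the real product. If nothing
    remains, [f] was already in [V]. *)
Lemma nice_extend V f : nice V -> W f -> exists2 V', nice V' & V' f /\ forall v, V v -> V' v.
Proof.
move=> nV wf; have VW := nice_W nV.
have [p Vp hp] : exists2 v, V v & forall h, V h -> Ic v h = Ic f h.
  by apply: (nice_rep nV) => a h k wh wk; rewrite Ic_linr //; exact: W_L2c.
have wp := VW _ Vp; pose g := lin (-1) p f; have wg : W g by exact: W_lin.
have fE : f = lin 1 p g by apply/funext => x; rewrite /g !linE rmorphN1 rmorph1; ring.
have gV h : V h -> Ic g h = 0.
  move=> Vh; rewrite (Ic_linl _ (W_L2c wp) (W_L2c wf) (W_L2c (VW _ Vh))) hp //.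
  by move: (Ic _ _) => a; ring.
have [q0|qn0] := eqVneq (Qf g) 0.
  exists V => //; split=> //; rewrite fE (Qf_eq0 wg q0); apply: nice_lin => //; exact: nice0.
have q0 : 0 < Qf g by rewrite lt_neqAle eq_sym qn0 Qf_ge0.
pose e := scl (Num.sqrt (Qf g))^-1 g; have we : W e by exact: W_scl.
pose m := mi e; have wm : W m by exact: W_mi.
have ee : Ic e e = 1.
  by rewrite -QfE Qf_scl // exprVn sqr_sqrtr ?mulVf // ltW.
have em : Ic e m = 0.
  rewrite IcE (@Int_ext _ _ _ (fun=> 0)) ?Int0 // => x _; rewrite /m miE cdot_rot //.
have mm : Ic m m = 1 by rewrite -QfE Qf_mi QfE.
have eV h : V h -> Ic e h = 0.
  move=> Vh; rewrite /e /scl (Ic_linl _ (W_L2c wg) (W_L2c W0) (W_L2c (VW _ Vh))) gV // Ic0l.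
  by rewrite mulr0 addr0.
have mV h : V h -> Ic m h = 0 by move=> Vh; rewrite (Ic_mil we (VW _ Vh)) eV ?oppr0 //; exact: nice_mi.
pose V' w := exists a b : R, exists2 v, V v & w = lin a e (lin b m v).
have V'W w : V' w -> W w by move=> [a [b [v Vv ->]]]; exact: W_lin we (W_lin b wm (VW _ Vv)).
have Ice (a b : R) v h : V v -> W h -> Ic (lin a e (lin b m v)) h = a * Ic e h + (b * Ic m h + Ic v h).
  move=> Vv wh; have wv := VW _ Vv.
  by rewrite (Ic_linl _ (W_L2c we) (W_L2c (W_lin b wm wv)) (W_L2c wh)) (Ic_linl _ (W_L2c wm) (W_L2c wv) (W_L2c wh)).
exists V'; last first.
  have VV' v : V v -> V' v.
    move=> Vv; exists 0, 0, v => //; apply/funext => x; rewrite !linE rmorph0; ring.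
  split=> //; exists (Num.sqrt (Qf g)), 0, p => //.
  rewrite {1}fE; apply/funext => x; rewrite !linE rmorph0 rmorph1 /e sclE mulrA -rmorphM divff ?rmorph1.
    by ring.
  by rewrite gt_eqF // sqrtr_gt0.
split.
- exact: V'W.
- by exists 0, 0, zf; [exact: nice0|apply/funext => x; rewrite !linE rmorph0 /zf; ring].
- move=> a w1 w2 [a1 [b1 [v1 V1 ->]]] [a2 [b2 [v2 V2 ->]]].
  exists (a * a1 + a2), (a * b1 + b2), (lin a v1 v2); first exact: nice_lin.
  by apply/funext => x; rewrite !linE !rmorphD !rmorphM; ring.
- move=> w [a [b [v Vv ->]]]; exists (- b), a, (mi v); first exact: nice_mi.
  apply/funext => x; rewrite !linE /m !miE !linE miE rmorphN.
  have : - 'i * (- 'i * e x) = - e x by rewrite mulrA mulrNN -expr2 sqr_i mulN1r.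
  by move: (e x) (v x) => z y h; rewrite !mulrDr [- 'i * (b%:C * _)]mulrCA h; ring.
- move=> F lF; have [vF VF hF] := nice_rep nV lF.
  exists (lin (F e) e (lin (F m) m vF)); first by exists (F e), (F m), vF.
  move=> h [a [b [v Vv ->]]]; have wv := VW _ Vv; have wvF := VW _ VF.
  rewrite (lF _ _ _ we (W_lin b wm wv)) (lF _ _ _ wm wv) -(hF _ Vv).
  have wh : W (lin a e (lin b m v)) by exact: W_lin we (W_lin b wm wv).
  rewrite (Ice _ _ _ _ VF wh) !(Ic_sym _ (lin a _ _)) !Ice // (Ic_sym m e) ee em mm.
  by rewrite !(Ic_sym v) !eV // !mV //; move: (F e) (F m) (Ic _ _) => x y z; ring.
- have [C hC] := nice_le nV.
  exists (2 * Df e + 2 * (2 * Df m + 2 * C) + 4 * (4 * Au e + 4 * (4 * Au m + C))) => w [a [b [v Vv ->]]].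
  have wv := VW _ Vv; have wbv := W_lin b wm wv.
  have -> : Qf (lin a e (lin b m v)) = a ^+ 2 + b ^+ 2 + Qf v.
    rewrite QfE (Ice _ _ _ _ Vv (W_lin a we wbv)) !(Ic_sym _ (lin a _ _)) !Ice // (Ic_sym m e) ee em mm.
    by rewrite !(Ic_sym v) !eV // !mV // -QfE; move: (Qf v) => x; ring.
  have := Qf_ge0 v; have := sqr_ge0 a; have := sqr_ge0 b => b0 a0 v0 hq.
  have a1 : a ^+ 2 <= 1 by move: hq b0 v0; move: (Qf v) (a ^+ 2) (b ^+ 2) => x y z; clear; lra.
  have b1 : b ^+ 2 <= 1 by move: hq a0 v0; move: (Qf v) (a ^+ 2) (b ^+ 2) => x y z; clear; lra.
  have v1 : Qf v <= 1 by move: hq a0 b0; move: (Qf v) (a ^+ 2) (b ^+ 2) => x y z; clear; lra.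
  have [dv av] := hC _ Vv v1.
  have n1 (c : R) : c ^+ 2 <= 1 -> (1 + `|c|) ^+ 2 <= 4.
    rewrite -[c ^+ 2](ger0_norm (sqr_ge0 c)) normrX => h; have : `|c| <= 1.
      by rewrite -(@ler_pXn2r _ 2) ?nnegrE // expr1n.
    by move: `|c| (normr_ge0 c) => y; clear; rewrite expr2; nra.
  have d1 := Df_lin_le a (W_H1 we) (W_H1 wbv); have d2 := Df_lin_le b (W_H1 wm) (W_H1 wv).
  have c1 := Au_lin_le a we wbv; have c2 := Au_lin_le b wm wv.
  have := ler_wpM2r (Df_ge0 e) a1; have := ler_wpM2r (Df_ge0 m) b1.
  have := ler_wpM2r (Au_ge0 e) (n1 _ a1); have := ler_wpM2r (Au_ge0 m) (n1 _ b1).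
  have := Df_ge0 e; have := Df_ge0 m; have := Au_ge0 e; have := Au_ge0 m.
  have := le_trans (Df_ge0 v) dv.
  move: d1 d2 c1 c2 dv av; move: (a ^+ 2) (b ^+ 2) ((1 + `|a|) ^+ 2) ((1 + `|b|) ^+ 2) => A B A' B'.
  rewrite -!mulrA; move: (A * _) (B * _) (A' * _) (B' * _) => q1 q2 q3 q4.
  move: (Df (lin a _ _)) (Df (lin b _ _)) (Au (lin a _ _)) (Au (lin b _ _)) (Df e) (Df m) (Au e) (Au m) (Df v) (Au v).
  by clear; move=> *; split; lra.
Qed.

Lemma nice_list (S : seq fn) : exists2 V, nice V & forall h, List.In h S -> W h -> V h.
Proof.
elim: S => [|f S [V nV hV]]; first by exists (fun v => v = zf); [exact: nice_zero|].
have [wf|nwf] := pselect (W f); last first.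
  by exists V => // h [<- //|]; exact: hV.
have [V' nV' [V'f VV']] := nice_extend nV wf; exists V' => // h [<- //|hS wh].
by apply: VV'; exact: hV.
Qed.

Lemma nice_bdd V (q : R) : nice V -> exists2 K : R, 0 <= K & forall v, V v -> Qf v <= q -> bdd K v.
Proof.
move=> nV; have [C hC] := nice_le nV; pose r := Num.max 1 q.
have r1 : 1 <= r by rewrite le_max lexx.
have r0 : 0 < r by exact: lt_le_trans r1.
pose s := Num.sqrt r; have s0 : 0 < s by rewrite sqrtr_gt0.
have s2 : s ^+ 2 = r by rewrite sqr_sqrtr // ltW.
have s1 : 1 <= s by rewrite -(@ler_pXn2r _ 2) ?nnegrE ?(ltW s0) // expr1n s2.
exists (r + r * `|C|); first by rewrite addr_ge0 ?mulr_ge0 // ltW.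
move=> v Vv hq; have wv := nice_W nV Vv; pose w := scl s^-1 v.
have Vw : V w by apply: (nice_lin nV) => //; exact: nice0.
have ww := nice_W nV Vw.
have vE : v = scl s w by rewrite /w scl_scl divff ?scl1 // gt_eqF.
have qr : Qf v <= r by rewrite (le_trans hq) // le_max lexx orbT.
have [d1 a1] : Df w <= C /\ Au w <= C.
  by apply: hC => //; rewrite /w Qf_scl // exprVn s2 ler_pdivrMl // mulr1.
have hn : r * C <= r * `|C| by rewrite ler_wpM2l ?(ltW r0) // ler_norm.
have hD : Df v <= r * C by rewrite vE Df_scl // s2 ler_wpM2l // ltW.
have hA : Au v <= r * C.
  by rewrite vE (le_trans (Au_scl_big ww s1)) // s2 ler_wpM2l // ltW.
have z : 0 <= r * `|C| by rewrite mulr_ge0 // ltW.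
split=> //; [by rewrite (le_trans qr) // lerDl|rewrite (le_trans hD)|rewrite (le_trans hA)] => //;
  by rewrite (le_trans hn) // lerDr ltW.
Qed.

End finite_dimensional.

Section energy_step.
Context {R : realType} (gamma : R).
Local Notation fn := (R -> R[i]).
Implicit Types (u v h : fn).

Lemma Lg_intg u : W u -> intg setT (fun x => Glog (nsq (u x))) /\
  Int setT (fun x => Glog (nsq (u x))) = Pu u - Au u - Qf u.
Proof.
move=> wu; have i1 := Pu_intg wu; have i2 := W_intg wu; have i3 := L2c_nsq (W_L2c wu).
have E : (fun x => Glog (nsq (u x))) = (fun x => Psi (cmod (u x)) - Ax u x - nsq (u x)).
  by apply/funext => x; rewrite /Glog /Psi /Ax cmod_sq; ring.
have i4 : intg setT (fun x => Psi (cmod (u x)) - Ax u x) by exact: intgB.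
by rewrite E; split; [exact: intgB|rewrite IntB // IntB // Qf_nsq AuE].
Qed.

Lemma nsq_ln_scale (c M : R) (z : R[i]) : c != 0 -> cmod z <= M ->
  nsq (c%:C * z) * (1 + `|ln (nsq (c%:C * z))|) <=
    c ^+ 2 * ((1 + `|ln (c ^+ 2)|) * nsq z + (6 + 2 * M) * Afun (cmod z)).
Proof.
move=> c0 hz; rewrite nsqZ -mulrA ler_wpM2l ?sqr_ge0 //.
have h := sqr_ln_le (cmod_ge0 z) hz; rewrite cmod_sq in h.
have [z0|zn] := eqVneq (nsq z) 0.
  rewrite z0 !mulr0 !mul0r add0r mulr_ge0 ?Afun_ge0 ?cmod_ge0 //.
  by have := le_trans (cmod_ge0 z) hz; lra.
have zp : 0 < nsq z by rewrite lt_neqAle eq_sym zn nsq_ge0.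
have cp : 0 < c ^+ 2 by rewrite exprn_even_gt0.
rewrite lnM ?posrE //; have := ler_normD (ln (c ^+ 2)) (ln (nsq z)) => h2.
have h3 := ler_wpM2l (nsq_ge0 z) h2; move: h h3 {h2}; move: (ln (c ^+ 2)) (ln (nsq z)) (Afun _) (nsq z) => a b f g.
by clear; lra.
Qed.

(** The derivative of the energy at [u] in the direction [v] is [- 2 Lam gamma u v - 2 Ic u v], so
    both hypotheses are needed for the first-order terms to vanish. The remainder is quadratic up to
    the logarithm of [Glog_taylor]. *)
Lemma En_step (K M c : R) u v : M = 4 * K + 1 -> bdd K u -> bdd K v -> c != 0 -> `|c| <= 1 ->
  Ic v u = 0 -> Lam gamma u v = 0 ->
  En gamma (lin c v u) <= En gamma u +
    (K + `|gamma| * M ^+ 2 + (40 + 2 * M) * (K + (6 + 2 * M) * K)) * (c ^+ 2 * (1 + `|ln (c ^+ 2)|)).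
Proof.
move=> ME bu bv c0 c1 hI hL; have [wu qu du au] := bu; have [wv qv dv av] := bv.
have K0 := bdd_ge0 bu; have M0 : 0 <= M by rewrite ME; move: K0; clear; lra.
have bM x : cmod (u x) <= M by rewrite ME; exact: bdd_cmod.
have bMv x : cmod (v x) <= M by rewrite ME; exact: bdd_cmod.
have ww := W_lin c wv wu; pose u' := lin c v u.
pose l := 1 + `|ln (c ^+ 2)|; have l1 : 1 <= l by rewrite lerDl.
have [g1 e1] := Lg_intg wu; have [g2 e2] := Lg_intg ww; have iN := Nf_intg wu wv.
have iq := L2c_nsq (W_L2c wv); have iA := W_intg wv.
pose E := (40 + 2 * M) * (c ^+ 2 * (l * K + (6 + 2 * M) * K)).
have cmv x : cmod (c%:C * v x) <= M.
  rewrite cmodZ; apply: (@le_trans _ _ (1 * cmod (v x))).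
    by rewrite ler_wpM2r // cmod_ge0.
  by rewrite mul1r.
have err : `|Int setT (fun x => Glog (nsq (u' x))) - Int setT (fun x => Glog (nsq (u x))) - 2 * c * Nf u v| <= E.
  rewrite NfE -IntZ // -IntB // -IntB //; last 2 first.
  - exact: intgB.
  - exact: intgZ.
  pose B x := (40 + 2 * M) * (c ^+ 2 * (l * nsq (v x) + (6 + 2 * M) * Ax v x)).
  have iB0 : intg setT (fun x => l * nsq (v x) + (6 + 2 * M) * Ax v x) by apply: intgD => //; apply: intgZ.
  have iB1 : intg setT (fun x => c ^+ 2 * (l * nsq (v x) + (6 + 2 * M) * Ax v x)) by exact: intgZ.
  have iB : intg setT B by exact: intgZ.
  have hB : Int setT B <= E.
    rewrite /B /E IntZ // IntZ // IntD; [|by []|exact: intgZ|exact: intgZ].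
    rewrite IntZ // IntZ // -Qf_nsq -AuE.
    rewrite ler_wpM2l ?addr_ge0 ?mulr_ge0 // ler_wpM2l ?sqr_ge0 // lerD // ler_wpM2l //.
      exact: le_trans l1.
    by rewrite addr_ge0 // mulr_ge0.
  apply: le_trans hB; apply: Int_norm_le => //.
    by apply: intg_meas; apply: intgB => //; [exact: intgB|exact: intgZ].
  move=> x _; have := Glog_taylor (bM x) (cmv x); rewrite cdotZr mulrA.
  rewrite !cmod_sq (addrC (u x)) -linE => h; apply: (le_trans h).
  rewrite /B ler_wpM2l ?addr_ge0 ?mulr_ge0 // /l.
  exact: nsq_ln_scale.
have eD : Df u' = c ^+ 2 * Df v + 2 * c * Bf u v + Df u.
  by rewrite (Df_lin c (W_H1 wv) (W_H1 wu)) (Bf_sym v).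
have eQ : Qf u' = c ^+ 2 * Qf v + Qf u.
  by rewrite (Qf_lin c (W_L2c wv) (W_L2c wu)) hI mulr0 addr0.
have en : nsq (u' 0) = c ^+ 2 * nsq (v 0) + 2 * c * cdot (u 0) (v 0) + nsq (u 0).
  by rewrite /u' linE nsqD nsqZ cdotZl mulrA (cdotC (v 0)).
have gv : - (gamma * nsq (v 0)) <= `|gamma| * M ^+ 2.
  apply: (le_trans (ler_norm _)); rewrite normrN normrM (ger0_norm (nsq_ge0 _)) ler_wpM2l //.
  by rewrite -cmod_sq ler_pXn2r ?nnegrE ?cmod_ge0.
have c2 : 0 <= c ^+ 2 by exact: sqr_ge0.
rewrite /En -/u' eD en; move: err; rewrite e1 e2 -/u' eQ ler_norml => /andP[err _].
move: hL; rewrite /Lam => hL.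
have q1 := ler_wpM2l c2 (le_trans dv (lexx K)); have q2 := ler_wpM2l c2 gv.
have q3 : c ^+ 2 * (K + `|gamma| * M ^+ 2) <= c ^+ 2 * ((K + `|gamma| * M ^+ 2) * l).
  by rewrite ler_wpM2l // ler_peMr // addr_ge0 // mulr_ge0 ?sqr_ge0.
have q4 : E <= (40 + 2 * M) * (c ^+ 2 * ((K + (6 + 2 * M) * K) * l)).
  rewrite /E ler_wpM2l ?addr_ge0 ?mulr_ge0 // ler_wpM2l // [leRHS]mulrDl (mulrC K l) lerD2l.
  by rewrite ler_peMr // mulr_ge0 // addr_ge0 // mulr_ge0.
have q5 : 0 <= c ^+ 2 * Qf v by rewrite mulr_ge0 // Qf_ge0.
have -> : (K + `|gamma| * M ^+ 2 + (40 + 2 * M) * (K + (6 + 2 * M) * K)) * (c ^+ 2 * l) =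
  c ^+ 2 * ((K + `|gamma| * M ^+ 2) * l) + (40 + 2 * M) * (c ^+ 2 * ((K + (6 + 2 * M) * K) * l)) by ring.
have hL' : 2 * c * Bf u v - 2 * c * (gamma * cdot (u 0) (v 0)) - 2 * c * Nf u v = 0.
  have h (x y z : R) : - x + y + z = 0 -> 2 * c * x - 2 * c * y - 2 * c * z = 0.
    by move=> h; rewrite (_ : x = y + z); [ring|move: h; clear; lra].
  exact: h.
move: hL' q1 q2 q3 q4 q5 err; move: (Qf v) (Df v) (nsq (v 0)) (nsq (u 0)) (cdot _ _) (Bf u v) (Nf u v).
move: (Df u) (Au u) (Pu u) (Au u') (Pu u') (Qf u) => Du Aa Pp A' P' Qu qv' dv' nv nu cd bf nf.
rewrite [c ^+ 2 * (K + _)]mulrDr; move: ((40 + _) * _) (c ^+ 2 * (_ * l)) (c ^+ 2 * K) (c ^+ 2 * (`|gamma| * _)) => r1 r2 r3 r4.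
move: (c ^+ 2) E => cc EE; clear; lra.
Qed.

End energy_step.

(** * Explicit Euler approximations in a finite-dimensional subspace *)

Section galerkin.
Context {R : realType} (gamma : R).
Local Notation fn := (R -> R[i]).
Implicit Types (u v w h : fn) (V : fn -> Prop).

Lemma mi_lin (a : R) h k : mi (lin a h k) = lin a (mi h) (mi k).
Proof. by apply/funext => x; rewrite !miE !linE !miE; ring. Qed.

Lemma Lam_mi_linear u : W u -> Wlinear (fun h => Lam gamma u (mi h)).
Proof. by move=> wu a h k wh wk; rewrite mi_lin Lam_linr //; exact: W_mi. Qed.

Lemma galerkin_field V : nice V -> exists f : fn -> fn,
  forall u, V u -> V (f u) /\ forall h, V h -> Ic (f u) h = Lam gamma u (mi h).
Proof.
move=> nV; have H u : exists v, V u -> V v /\ forall h, V h -> Ic v h = Lam gamma u (mi h).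
  have [Vu|nVu] := pselect (V u); last by exists zf.
  by have [v Vv hv] := nice_rep nV (Lam_mi_linear (nice_W nV Vu)); exists v.
by have [f hf] := choice H; exists f.
Qed.

(** Testing the field against its own normalisation bounds its [L^2] norm, as all norms are
    comparable on [V]. *)
Lemma galerkin_field_le V f (q : R) : nice V ->
  (forall u, V u -> V (f u) /\ forall h, V h -> Ic (f u) h = Lam gamma u (mi h)) ->
  exists2 P : R, 0 <= P & forall u, V u -> Qf u <= q -> Qf (f u) <= P.
Proof.
move=> nV hf; have [K1 K10 h1] := nice_bdd q nV; have [K2 K20 h2] := nice_bdd 1 nV.
pose K := Num.max K1 K2.
have k1 : K1 <= K by rewrite le_max lexx.
have k2 : K2 <= K by rewrite le_max lexx orbT.
pose C := K + `|gamma| * (4 * K + 1) ^+ 2 + (6 + 2 * (4 * K + 1)) * (K + K).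
exists (C ^+ 2) => [|u Vu hq]; first exact: sqr_ge0.
have [Vf hI] := hf u Vu; pose v := f u; rewrite -/v in Vf hI *.
have wv := nice_W nV Vf; have wu := nice_W nV Vu.
have [q0|qn0] := eqVneq (Qf v) 0; first by rewrite q0 sqr_ge0.
have q0 : 0 < Qf v by rewrite lt_neqAle eq_sym qn0 Qf_ge0.
pose s := Num.sqrt (Qf v); have s0 : 0 < s by rewrite sqrtr_gt0.
have s2 : s ^+ 2 = Qf v by rewrite sqr_sqrtr // ltW.
pose h := scl s^-1 v; have Vh : V h by apply: (nice_lin nV) => //; exact: nice0.
have wh := nice_W nV Vh.
have bh : bdd K h.
  by apply: (bdd_le k2); apply: h2 => //; rewrite /h Qf_scl // exprVn s2 mulVf.
have bu : bdd K u by apply: (bdd_le k1); exact: h1.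
have := Lam_le gamma bu (bdd_mi bh); rewrite -/C -(hI _ Vh).
have -> : Ic v h = s.
  rewrite /h /scl (Ic_linr _ (W_L2c wv) (W_L2c W0) (W_L2c wv)) Ic0r addr0 -QfE -s2 expr2 mulrA.
  by rewrite mulVf ?mul1r // gt_eqF.
rewrite (gtr0_norm s0) => sC; rewrite -s2 ler_pXn2r ?nnegrE ?(ltW s0) //.
exact: le_trans (ltW s0) sC.
Qed.

(** Charge and energy are stationary to first order along the projected field. The second identity
    uses that [V] is stable under [-i]. *)
Lemma galerkin_field_Lam V f : nice V ->
  (forall u, V u -> V (f u) /\ forall h, V h -> Ic (f u) h = Lam gamma u (mi h)) ->
  forall u, V u -> Ic (f u) u = 0 /\ Lam gamma u (f u) = 0.
Proof.
move=> nV hf u Vu; have [Vf hI] := hf u Vu; have wu := nice_W nV Vu; have wf := nice_W nV Vf.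
split; first by rewrite hI // Lam_rot.
pose h := scl (-1) (mi (f u)).
have Vh : V h by apply: (nice_lin nV); [exact: nice_mi|exact: nice0].
have -> : f u = mi h by apply/funext => x; rewrite miE /h sclE rmorphN1 mulN1r mulrN -miE mi_mi opprK.
rewrite -(hI _ Vh) /h /scl (Ic_linr _ (W_L2c (W_mi wf)) (W_L2c W0) (W_L2c wf)) Ic0r addr0.
rewrite IcE (@Int_ext _ _ _ (fun=> 0)) ?Int0 ?mulr0 // => x _.
by rewrite miE cdot_rot.
Qed.

Fixpoint euler (f : fn -> fn) (c : R) u (j : nat) : fn :=
  if j is i.+1 then lin c (f (euler f c u i)) (euler f c u i) else u.

(** Since the field is orthogonal to [u], a step adds exactly [t^2 Qf (f u)] to the charge. Over a
    time [T] this sums to [T t P], which keeps all iterates inside the charge ball where the bounds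
    hold. *)
Lemma euler_bound V f (c t P CE q T : R) u0 : nice V -> V u0 ->
  (forall u, V u -> V (f u) /\ forall h, V h -> Ic (f u) h = Lam gamma u (mi h)) ->
  (forall u, V u -> Qf u <= q -> Qf (f u) <= P) ->
  (forall u, V u -> Qf u <= q -> En gamma (lin c (f u) u) <= En gamma u + t * CE) ->
  0 <= t -> c ^+ 2 = t ^+ 2 -> 0 <= P -> 0 <= T -> Qf u0 + T * (t * P) <= q ->
  forall j : nat, j%:R * t <= T -> [/\ V (euler f c u0 j), Qf (euler f c u0 j) <= Qf u0 + j%:R * t * (t * P) &
    En gamma (euler f c u0 j) <= En gamma u0 + j%:R * t * CE].
Proof.
move=> nV V0 hf hP hE t0 ct P0 T0 hq; elim=> [|j IH] hj.
  by rewrite !mul0r !addr0.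
have jT : j%:R * t <= T by apply: le_trans hj; rewrite ler_wpM2r // ler_nat.
have [Vj Qj Ej] := IH jT; set u := euler f c u0 j in Vj Qj Ej *.
have [Vf hI] := hf u Vj; have [i0 l0] := galerkin_field_Lam nV hf Vj.
have Qq : Qf u <= q.
  by apply: (le_trans Qj); apply: le_trans hq; rewrite lerD2l ler_wpM2r // mulr_ge0.
have wu := nice_W nV Vj; have wf := nice_W nV Vf.
rewrite /= -/u; split.
- exact: nice_lin.
- rewrite (Qf_lin c (W_L2c wf) (W_L2c wu)) i0 ct mulr0 addr0.
  have := ler_wpM2l (sqr_ge0 t) (hP u Vj Qq); rewrite -natr1.
  by move: (Qf u) (Qf (f u)) (Qf u0) Qj => a b d; clear; rewrite expr2; lra.
- apply: (le_trans (hE u Vj Qq)); rewrite -natr1 mulrDl mul1r mulrDl.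
  by move: (En _ u) (En _ u0) Ej => a b; clear; lra.
Qed.

Lemma euler_telescope V f (sg t l d T : R) u0 h (j m : nat) : nice V -> V h ->
  (forall k : nat, k%:R * t <= T -> V (euler f (sg * t) u0 k)) ->
  (forall u, V u -> V (f u) /\ forall h, V h -> Ic (f u) h = Lam gamma u (mi h)) ->
  `|sg| = 1 -> 0 <= t -> (j + m)%:R * t <= T ->
  (forall k, (j <= k < j + m)%N -> `|Lam gamma (euler f (sg * t) u0 k) (mi h) - l| <= d) ->
  `|Ic (euler f (sg * t) u0 (j + m)) h - Ic (euler f (sg * t) u0 j) h - sg * (m%:R * t) * l| <= d * (m%:R * t).
Proof.
move=> nV Vh hV hf s1 t0; elim: m => [|m IH] hm hd.
  by rewrite addn0 subrr !mul0r mulr0 mul0r subrr normr0 mulr0.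
have hm' : (j + m)%:R * t <= T by apply: le_trans hm; rewrite ler_wpM2r // ler_nat addnS.
have {}IH := IH hm'; have Vu := hV _ hm'; set u := euler f (sg * t) u0 (j + m) in Vu IH *.
have [Vf hI] := hf u Vu; have wu := nice_W nV Vu; have wf := nice_W nV Vf; have wh := nice_W nV Vh.
rewrite addnS /= -/u (Ic_linl _ (W_L2c wf) (W_L2c wu) (W_L2c wh)) hI //.
have hk := hd (j + m)%N; rewrite -/u in hk; rewrite -natr1.
have {}IH : `|Ic u h - Ic (euler f (sg * t) u0 j) h - sg * (m%:R * t) * l| <= d * (m%:R * t).
  by apply: IH => k /andP[k1 k2]; apply: hd; rewrite k1 addnS ltnS ltnW.
have {}hk : `|Lam gamma u (mi h) - l| <= d by apply: hk; rewrite leq_addr addnS ltnS /=.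
move: (Ic u h) (Ic (euler _ _ _ j) h) (Lam _ u (mi h)) IH hk => a b L IH hk.
have -> : sg * t * L + a - b - sg * ((m%:R + 1) * t) * l =
  (a - b - sg * (m%:R * t) * l) + sg * t * (L - l) by ring.
apply: (le_trans (ler_normD _ _)); rewrite mulrDl mul1r mulrDr lerD //.
by rewrite !normrM s1 mul1r (ger0_norm t0) mulrC ler_wpM2r.
Qed.

(** The sign [sg] chooses the direction of time. The solution is a step function of time, so its
    value at [s] comes from a slightly earlier grid point; this explains the enlarged window
    [s - e <= r]. *)
Lemma galerkin V u0 (sg T e : R) : nice V -> V u0 -> `|sg| = 1 -> 0 <= T -> 0 < e ->
  exists U : R -> fn, [/\ U 0 = u0,
    forall t, 0 <= t <= T -> [/\ V (U t), Qf (U t) <= Qf u0 + e & En gamma (U t) <= En gamma u0 + e] &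
    forall h, V h -> forall s t l d : R, 0 <= s -> s <= t -> t <= T ->
      (forall r, 0 <= r -> s - e <= r <= t -> `|Lam gamma (U r) (mi h) - l| <= d) ->
      `|Ic (U t) h - Ic (U s) h - sg * (t - s) * l| <= d * (t - s + e) + e * `|l|].
Proof.
move=> nV V0 s1 T0 e0; have [f hf] := galerkin_field nV; pose q := Qf u0 + 1.
have [P P0 hP] := galerkin_field_le q nV hf.
have [K1 K10 h1] := nice_bdd q nV; have [K2 K20 h2] := nice_bdd P nV.
pose K := Num.max K1 K2.
have k1 : K1 <= K by rewrite le_max lexx.
have k2 : K2 <= K by rewrite le_max lexx orbT.
have K0 : 0 <= K by exact: le_trans k1.
pose M := 4 * K + 1; have M0 : 0 <= M by rewrite /M; move: K0; clear; lra.
pose C := K + `|gamma| * M ^+ 2 + (40 + 2 * M) * (K + (6 + 2 * M) * K).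
have C0 : 0 <= C by rewrite /C !addr_ge0 // ?mulr_ge0 ?sqr_ge0 // !addr_ge0 // !mulr_ge0 // addr_ge0 // mulr_ge0.
pose e1 := Num.min 1 e; have e10 : 0 < e1 by rewrite lt_min ltr01.
have X0 : 0 < (T + 1) * (P + C + 1) by rewrite mulr_gt0 // ltr_wpDl // addr_ge0.
(* Per unit of time, the charge drifts by at most [t P] and the energy by at most
   [C t (1 + |ln t^2|)]; this [ep] makes both totals at most [e1] over [[0, T]]. As [e1 <= 1], the
   charge stays below [q]. *)
pose ep := e1 / ((T + 1) * (P + C + 1)); have ep0 : 0 < ep by rewrite divr_gt0.
have [d0 d00 hd0] := om_small (lexx 0) ep0.
pose t := Num.min 1 d0; have t0 : 0 < t by rewrite lt_min ltr01.
have t1 : t <= 1 by rewrite ge_min lexx.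
have := hd0 t (ltW t0); rewrite ge_min lexx orbT => /(_ isT); rewrite /om mulr0 addr0 => hom.
pose lt := 1 + `|ln (t ^+ 2)|.
have lt1 : t * lt <= ep.
  apply: le_trans hom; rewrite ler_wpM2l ?(ltW t0) // /lt lerD2r; clear; lra.
have tep : t <= ep by apply: le_trans lt1; rewrite ler_peMr ?(ltW t0) // lerDl.
have epT (Y : R) : 0 <= Y -> Y <= P + C -> T * (ep * Y) <= e1.
  move=> Y0 YP; have : ep * ((T + 1) * (P + C + 1)) = e1 by rewrite /ep divfK // gt_eqF.
  have := ler_wpM2l T0 (ler_wpM2l (ltW ep0) YP).
  have := mulr_ge0 T0 (ltW ep0); have := mulr_ge0 (ltW ep0) (addr_ge0 P0 C0).
  by move: (P + C) ep0 => Z; clear; nra.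
have e1e : e1 <= e by rewrite ge_min lexx orbT.
have e11 : e1 <= 1 by rewrite ge_min lexx.
have epe : ep <= e.
  apply: le_trans e1e; rewrite /ep ler_pdivrMr // ler_peMr ?(ltW e10) //.
  have PC := addr_ge0 P0 C0; have TPC := mulr_ge0 T0 PC.
  by move: (P + C) PC TPC T0 => Z; clear => *; rewrite mulrDr mulrDl; lra.
have te : t <= e by exact: le_trans epe.
pose c := sg * t.
have c2 : c ^+ 2 = t ^+ 2 by rewrite /c exprMn -[sg ^+ 2]ger0_norm ?sqr_ge0 // normrX s1 expr1n mul1r.
have hE u : V u -> Qf u <= q -> En gamma (lin c (f u) u) <= En gamma u + t * (C * (t * lt)).
  move=> Vu hq; have [Vf _] := hf u Vu; have [i0 l0] := galerkin_field_Lam nV hf Vu.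
  have bu := bdd_le k1 (h1 u Vu hq); have bf := bdd_le k2 (h2 _ Vf (hP u Vu hq)).
  have cn : c != 0.
    by apply/eqP => cz; move: c2; rewrite cz expr0n => /esym/eqP; rewrite sqrf_eq0 gt_eqF.
  have c1 : `|c| <= 1 by rewrite /c normrM s1 mul1r gtr0_norm.
  have := En_step (M := M) erefl bu bf cn c1 i0 l0; rewrite c2 -/C -/lt.
  by rewrite expr2 -mulrA mulrCA.
have hq : Qf u0 + T * (t * P) <= q.
  rewrite /q lerD2l (le_trans _ e11) // (le_trans _ (epT P P0 _)) ?lerDl //.
  by rewrite ler_wpM2l // ler_wpM2r.
have hB := euler_bound nV V0 hf hP hE (ltW t0) c2 P0 T0 hq.
pose X := euler f c u0; pose j (r : R) := Num.truncn (r / t); pose U r := X (j r).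
have j1 r : 0 <= r -> (j r)%:R * t <= r.
  by move=> r0; rewrite -ler_pdivlMr // truncn_le divr_ge0 // ltW.
have j2 r : r < (j r)%:R * t + t.
  by rewrite -[X in _ + X]mul1r -mulrDl natr1 -ltr_pdivrMr // truncnS_gt.
have jk (k : nat) : j (k%:R * t) = k by rewrite /j mulfK ?natrK // gt_eqF.
exists U; split.
- by rewrite /U /j mul0r truncn0.
- move=> r /andP[r0 rT]; have jT := le_trans (j1 r r0) rT; have [h3 h4 h5] := hB _ jT.
  have j0 : 0 <= (j r)%:R * t by rewrite mulr_ge0 // ltW.
  split; first exact: h3.
    apply: (le_trans h4); rewrite lerD2l; apply: le_trans e1e; apply: le_trans (epT P P0 _).
      by apply: ler_pM => //; [rewrite mulr_ge0 // ltW|rewrite ler_wpM2r].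
    by rewrite lerDl.
  apply: (le_trans h5); rewrite lerD2l; apply: le_trans e1e; apply: le_trans (epT C C0 _).
    apply: ler_pM => //; first by rewrite !mulr_ge0 // ?(ltW t0) // addr_ge0.
    by rewrite mulrC ler_wpM2r.
  by rewrite lerDr.
- move=> h Vh s r l d s0 sr rT hd; have r0 := le_trans s0 sr.
  have jsr : (j s <= j r)%N by apply: le_truncn; rewrite ler_wpM2r // invr_ge0 ltW.
  pose m := (j r - j s)%N; have jm : (j s + m)%N = j r by rewrite /m subnKC.
  have hT : (j s + m)%:R * t <= T by rewrite jm (le_trans (j1 r r0)).
  have dge : 0 <= d by apply: le_trans (normr_ge0 _) (hd s s0 _); rewrite sr gerBl ltW.
  have hk k : (j s <= k < j s + m)%N -> `|Lam gamma (X k) (mi h) - l| <= d.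
    move=> /andP[ka kb]; rewrite -(jk k); apply: hd; first by rewrite mulr_ge0 // ltW.
    apply/andP; split.
      have : (j s)%:R * t <= k%:R * t by rewrite ler_wpM2r ?(ltW t0) // ler_nat.
      by have := j2 s; move: te; clear; move: (_ * t) (_ * t) => x y; lra.
    apply: le_trans (j1 r r0); rewrite ler_wpM2r ?(ltW t0) // ler_nat; rewrite jm in kb; exact: ltnW.
  have := euler_telescope nV Vh (fun k hk' => let: And3 v _ _ := hB k hk' in v) hf s1 (ltW t0) hT hk.
  rewrite jm -/c -/X /U => tel.
  have mt : m%:R * t = (j r)%:R * t - (j s)%:R * t by rewrite -jm natrD mulrDl addrC addKr.
  have m1 : m%:R * t <= r - s + t.
    by have := j1 r r0; have := j2 s; rewrite mt; move: (_ * t) (_ * t) => x y; clear; lra.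
  have m2 : `|m%:R * t - (r - s)| <= t.
    have := j1 r r0; have := j2 s; have := j1 s s0; have := j2 r; rewrite mt ler_norml.
    by move: (_ * t) (_ * t) => x y; clear => *; apply/andP; split; lra.
  have -> : Ic (X (j r)) h - Ic (X (j s)) h - sg * (r - s) * l =
      (Ic (X (j r)) h - Ic (X (j s)) h - sg * (m%:R * t) * l) + sg * (m%:R * t - (r - s)) * l.
    by move: (Ic _ _) (Ic _ _) => x y; ring.
  apply: (le_trans (ler_normD _ _)); rewrite lerD //.
    apply: (le_trans tel); rewrite ler_wpM2l // (le_trans m1) // lerD2l //.
  by rewrite !normrM s1 mul1r ler_wpM2r // (le_trans m2).
Qed.

End galerkin.

(** * The limit of the approximations, and conservation of the energy *)

Section forward_limit.
Context {R : realType} (gamma : R).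
Local Notation fn := (R -> R[i]).
Implicit Types (h : fn).

Lemma ultra_lim (I : Type) (F : set_system I) (UF : UltraFilter F) (f : I -> R) (M : R) :
  (\forall i \near F, `|f i| <= M) -> exists l : R, f i @[i --> F] --> l.
Proof.
move=> hM; have PF : ProperFilter F by case: UF.
pose S := [set x : R | \forall i \near F, x <= f i].
have S1 : S (- M) by apply: filterS hM => i; rewrite ler_norml => /andP[].
have hub : ubound S M.
  move=> x Sx; have [i [h1 h2]] := filter_ex (filterI Sx hM).
  by rewrite (le_trans h1) // (le_trans (ler_norm _)).
have hS : has_sup S by split; [exists (- M)|exists M].
exists (sup S); apply/cvgEP => e e0.
have [x Sx hx] := sup_adherent e0 hS.
have h2 : \forall i \near F, f i <= sup S + e.
  have [h|h] := in_ultra_setVsetC [set i | sup S + e <= f i] UF.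
    by have := sup_upper_bound hS h; rewrite gerDl leNgt e0.
  by apply: filterS h => i /negP; rewrite -ltNge => /ltW.
apply: filterS (filterI Sx h2) => i [a b]; rewrite ler_norml; move: hx a b; clear => *.
by apply/andP; split; lra.
Qed.

Lemma galerkin_family (sg : R) u0 : `|sg| = 1 -> W u0 ->
  exists (Vi : seq fn * nat -> fn -> Prop) (U : seq fn * nat -> R -> fn),
  (forall S n h, List.In h S -> W h -> Vi (S, n) h) /\
  (forall i, [/\ nice (Vi i), U i 0 = u0,
    forall t, 0 <= t <= i.2%:R -> [/\ Vi i (U i t), Qf (U i t) <= Qf u0 + i.2.+1%:R^-1 &
      En gamma (U i t) <= En gamma u0 + i.2.+1%:R^-1] &
    forall h, Vi i h -> forall s t l d : R, 0 <= s -> s <= t -> t <= i.2%:R ->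
      (forall r, 0 <= r -> s - i.2.+1%:R^-1 <= r <= t -> `|Lam gamma (U i r) (mi h) - l| <= d) ->
      `|Ic (U i t) h - Ic (U i s) h - sg * (t - s) * l| <= d * (t - s + i.2.+1%:R^-1) + i.2.+1%:R^-1 * `|l|]).
Proof.
move=> s1 w0; have H (S : seq fn) : exists V, nice V /\ forall h, List.In h S -> W h -> V h.
  by have [V nV hV] := nice_list S; exists V.
have [VS hVS] := choice H; pose Vi (i : seq fn * nat) := VS (u0 :: i.1).
have e0 (n : nat) : 0 < (n.+1%:R^-1 : R) by rewrite invr_gt0.
have H2 i : exists U : R -> fn, [/\ U 0 = u0,
    forall t, 0 <= t <= i.2%:R -> [/\ Vi i (U t), Qf (U t) <= Qf u0 + i.2.+1%:R^-1 &
      En gamma (U t) <= En gamma u0 + i.2.+1%:R^-1] &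
    forall h, Vi i h -> forall s t l d : R, 0 <= s -> s <= t -> t <= i.2%:R ->
      (forall r, 0 <= r -> s - i.2.+1%:R^-1 <= r <= t -> `|Lam gamma (U r) (mi h) - l| <= d) ->
      `|Ic (U t) h - Ic (U s) h - sg * (t - s) * l| <= d * (t - s + i.2.+1%:R^-1) + i.2.+1%:R^-1 * `|l|].
  have [nV hV] := hVS (u0 :: i.1).
  by apply: galerkin => //; apply: hV => //; left.
have [U hU] := choice H2; exists Vi, U; split.
  by move=> S n h hS wh; have [_] := hVS (u0 :: S); apply=> //; right.
by move=> i; have [a b c] := hU i; split=> //; case: (hVS (u0 :: i.1)).
Qed.

(* The approximations are indexed by a finite spanning family and a number of time
   steps; both are refined along this filter. *)
Definition family_filter : set_system (seq fn * nat) :=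
  [set A | exists H N, forall S n, (forall h, List.In h H -> List.In h S) -> (N <= n)%N -> A (S, n)].

Lemma family_filter_proper : ProperFilter family_filter.
Proof.
split; first by move=> [H [N h]]; exact: (h H N (fun _ x => x) (leqnn N)).
split.
- by exists [::], 0%N.
- move=> A B [H1 [N1 h1]] [H2 [N2 h2]]; exists (H1 ++ H2), (maxn N1 N2) => S n hS.
  rewrite geq_max => /andP[n1 n2]; split; [apply: h1|apply: h2] => // h hh; apply: hS;
    apply: List.in_or_app; by [left|right].
- by move=> A B AB [H [N h]]; exists H, N => S n hS hn; apply: AB; exact: h.
Qed.

(** Interpolation by [H1_sup]: [d] makes the Dirichlet part at most a quarter of [e^2], and then [q]
    does the same for the charge part. *)
Lemma cmod_small_of_Q (K e : R) : 0 <= K -> 0 < e -> exists2 q : R, 0 < q &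
  forall w : fn, W w -> Df w <= K -> Qf w <= q -> forall x, cmod (w x) <= e.
Proof.
move=> K0 e0; pose d := e ^+ 2 / (4 * (K + 1)).
have K1 : 0 < 4 * (K + 1) by rewrite mulr_gt0 // ltr_wpDl.
have e2 : 0 < e ^+ 2 by rewrite exprn_gt0.
have d0 : 0 < d by rewrite divr_gt0.
exists (e ^+ 2 * d / 4) => [|w ww hD hQ x]; first by rewrite divr_gt0 // mulr_gt0.
rewrite cmod_sqrt -[leRHS](ger0_norm (ltW e0)) -sqrtr_sqr ler_sqrt ?sqr_ge0 //.
apply: (le_trans (H1_sup x (W_H1 ww) d0)).
have h1 : Qf w / d <= e ^+ 2 / 4 by rewrite ler_pdivrMr // mulrAC.
have h2 : d * Df w <= e ^+ 2 / 4.
  apply: (le_trans (ler_wpM2l (ltW d0) hD)); rewrite /d mulrAC ler_pdivrMr //.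
  by rewrite -[leRHS]mulrA ler_wpM2l ?(ltW e2) // mulrA mulVf // mul1r lerDl.
by move: (Qf w / d) (d * _) h1 h2 => a b; clear; lra.
Qed.

Lemma natSinv_le (e : R) : 0 < e -> exists N : nat, forall n, (N <= n)%N -> (n.+1%:R^-1 : R) <= e.
Proof.
move=> e0; exists (Num.truncn e^-1) => n hn; rewrite invf_ple ?posrE ?ltr0n //.
by apply/ltW; apply: (lt_le_trans (truncnS_gt _)); rewrite ler_nat.
Qed.

(** The energy inequality is conditional on the charge, because passing [Pu] to the limit requires
    strong convergence in [L^2]. Conservation of the charge becomes available once the two time
    directions are glued together. *)
Lemma forward (sg : R) u0 : `|sg| = 1 -> W u0 -> exists (u : R -> fn) (K : R), [/\ u 0 = u0,
  forall t, 0 <= t -> bdd K (u t),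
  forall t, 0 <= t -> forall h, W h -> forall e : R, 0 < e -> exists2 d : R, 0 < d &
    forall s, 0 <= s -> `|s - t| <= d ->
      `|Ic (u s) h - Ic (u t) h - sg * (s - t) * Lam gamma (u t) (mi h)| <= e * `|s - t| &
  forall t, 0 <= t -> Qf (u t) = Qf u0 -> En gamma (u t) <= En gamma u0].
Proof.
move=> s1 w0; have [Vi [U [hVi hU]]] := galerkin_family s1 w0.
have [F [UF sF]] := ultraFilterLemma family_filter_proper.
have FF : ProperFilter F by case: UF.
have q0 : 0 <= Qf u0 + 1 by rewrite addr_ge0 // Qf_ge0.
have [K hK] := En_coercive gamma (En gamma u0 + 1) q0.
have nN (N : nat) : \forall i \near F, (N <= i.2)%N by apply: sF; exists [::], N.
have nE (e : R) : 0 < e -> \forall i \near F, i.2.+1%:R^-1 <= e.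
  by move=> e0; have [N hN] := natSinv_le e0; apply: filterS (nN N) => i; exact: hN.
have nT (t : R) : \forall i \near F, t <= i.2%:R.
  apply: filterS (nN (Num.truncn t).+1) => i hi; apply: ltW.
  by apply: (lt_le_trans (truncnS_gt t)); rewrite ler_nat.
have nV h : W h -> \forall i \near F, Vi i h.
  by move=> wh; apply: sF; exists [:: h], 0%N => S n hS _; apply: hVi => //; apply: hS; left.
have n1 (n : nat) : (n.+1%:R^-1 : R) <= 1 by rewrite invf_le1 ?ltr0n // ler1n.
have hb i t : 0 <= t -> t <= i.2%:R -> bdd K (U i t).
  move=> t0 ti; have [nVi _ hi _] := hU i; have := hi t; rewrite t0 ti => /(_ isT) [v q e].
  apply: hK; [exact: nice_W nVi _ v|exact: le_trans q (lerD (lexx _) (n1 _))|].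
  exact: le_trans e (lerD (lexx _) (n1 _)).
have K0 : 0 <= K by have [i hi] := filter_ex (nT 0); exact: bdd_ge0 (hb i 0 (lexx 0) hi).
pose K' := 8 * (4 * K + K); have KK : K <= K' by rewrite /K'; move: K0; clear; lra.
have K'0 : 0 <= K' by exact: le_trans KK.
pose C := K' + `|gamma| * (4 * K' + 1) ^+ 2 + (6 + 2 * (4 * K' + 1)) * (K' + K').
(* Test the scheme with the increment itself, which belongs to the subspace, taking 0 for the
   reference value [l]. *)
have lip0 i s t : 0 <= s -> s <= t -> t <= i.2%:R ->
    Qf (lin (-1) (U i s) (U i t)) <= C * (t - s + i.2.+1%:R^-1).
  move=> s0 st ti; have [nVi _ hi hB] := hU i; have t0 := le_trans s0 st.
  have [vt _ _] := hi t (introT andP (conj t0 ti)).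
  have [vs _ _] := hi s (introT andP (conj s0 (le_trans st ti))).
  pose h := lin (-1) (U i s) (U i t); have Vh : Vi i h by exact: nice_lin nVi _ _ _ vs vt.
  have bs := hb i s s0 (le_trans st ti); have bt := hb i t t0 ti.
  have bh : bdd K' h by exact: bdd_sub.
  have := hB h Vh s t 0 C s0 st ti; rewrite normr0 !mulr0 !subr0 addr0 => hB'.
  have -> : Qf (lin (-1) (U i s) (U i t)) = Ic (U i t) h - Ic (U i s) h.
    by rewrite QfE -/h {1}/h (Ic_linl _ (W_L2c (bdd_W bs)) (W_L2c (bdd_W bt)) (W_L2c (bdd_W bh))) mulN1r addrC.
  apply: (le_trans (ler_norm _)); apply: hB' => r r0 /andP[_ rt]; rewrite subr0.
  by apply: Lam_le; [exact: bdd_le KK (hb i r r0 (le_trans rt ti))|exact: bdd_mi].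
have lip i s t : 0 <= s -> 0 <= t -> s <= i.2%:R -> t <= i.2%:R ->
    Qf (lin (-1) (U i s) (U i t)) <= C * (`|t - s| + i.2.+1%:R^-1).
  move=> s0 t0 si ti; have [st|/ltW ts] := leP s t; first by rewrite ger0_norm ?subr_ge0 //; exact: lip0.
  rewrite distrC ger0_norm ?subr_ge0 // Qf_linC; [exact: lip0|exact: bdd_W (hb i s s0 si)|exact: bdd_W (hb i t t0 ti)].
have C0 : 0 <= C.
  by rewrite /C !addr_ge0 // !mulr_ge0 ?sqr_ge0 // !addr_ge0 // !mulr_ge0 // addr_ge0 // mulr_ge0.
have equi (e : R) : 0 < e -> exists2 d : R, 0 < d & forall i s t, 0 <= s -> 0 <= t -> s <= i.2%:R -> t <= i.2%:R ->
    `|t - s| <= d -> i.2.+1%:R^-1 <= d -> forall x, cmod (U i t x - U i s x) <= e.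
  move=> e0; have [q qp hq] := cmod_small_of_Q K'0 e0; pose d := q / (2 * (C + 1)).
  have C1 : 0 < 2 * (C + 1) by rewrite mulr_gt0 // ltr_wpDl.
  exists d => [|i s t sp tp si ti h1 h2 x]; first by rewrite divr_gt0.
  have bs := hb i s sp si; have bt := hb i t tp ti; have bw := bdd_sub bs bt.
  have := hq _ (bdd_W bw); rewrite -/K' => hq'; have [_ _ dw _] := bw.
  have := hq' dw _ x; rewrite linE rmorphN1 mulN1r addrC; apply.
  apply: (le_trans (lip i s t sp tp si ti)); apply: (@le_trans _ _ (C * (d + d))).
    by rewrite ler_wpM2l // lerD.
  have aux (y : R) : 0 < y -> y * (2 * (C + 1)) = q -> C * (y + y) <= q by clear -C0; lra.
  by apply: aux; [rewrite divr_gt0|rewrite /d divfK // gt_eqF].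
have [u hu] : exists u : R -> fn, forall t, 0 <= t -> forall x,
    complex.Re (U i t x) @[i --> F] --> complex.Re (u t x) /\
    complex.Im (U i t x) @[i --> F] --> complex.Im (u t x).
  have H (p : R * R) : exists z : R[i], 0 <= p.1 ->
      complex.Re (U i p.1 p.2) @[i --> F] --> complex.Re z /\
      complex.Im (U i p.1 p.2) @[i --> F] --> complex.Im z.
    have [p0|p0] := leP 0 p.1; last by exists 0.
    have hM : \forall i \near F, cmod (U i p.1 p.2) <= 4 * K + 1.
      by apply: filterS (nT p.1) => i hi; exact: bdd_cmod (hb i p.1 p0 hi).
    have [a ha] : exists l : R, complex.Re (U i p.1 p.2) @[i --> F] --> l.
      by apply: (ultra_lim UF (M := 4 * K + 1)); apply: filterS hM => i; apply: le_trans; exact: Re_le.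
    have [b hb'] : exists l : R, complex.Im (U i p.1 p.2) @[i --> F] --> l.
      by apply: (ultra_lim UF (M := 4 * K + 1)); apply: filterS hM => i; apply: le_trans; exact: Im_le.
    by exists (a +i* b).
  have [u hu] := choice H; exists (fun t x => u (t, x)) => t t0 x; exact: (hu (t, x)).
have pt t x (e : R) : 0 <= t -> 0 < e -> \forall i \near F, cmod (U i t x - u t x) <= e.
  move=> t0 e0; have e2 : 0 < e / 2 by rewrite divr_gt0.
  have [/cvgEP h1 /cvgEP h2] := hu t t0 x; apply: filterS (filterI (h1 _ e2) (h2 _ e2)) => i [a b].
  by apply: (le_trans (cmod_le _)); rewrite ReB ImB (splitr e) lerD.
have wc t : 0 <= t -> wcv F K (fun i => U i t) (u t).
  move=> t0; split; first by apply: filterS (nT t) => i; exact: hb.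
  by move=> x e e0; exact: pt.
exists u, K; split.
- apply/funext => x; apply/eqP; rewrite -subr_eq0; apply/eqP; apply: cmod_eq0; apply/eqP.
  rewrite eq_le cmod_ge0 andbT; apply/ler_addgt0Pr => e e0; rewrite add0r.
  have [j hj] := filter_ex (pt 0 x e (lexx 0) e0); move: hj; have [_ -> _ _] := hU j.
  by rewrite cmodB.
- by move=> t t0; exact: (wcv_bdd FF (wc t t0)).
- move=> t t0 h wh e e0; set l := Lam gamma (u t) (mi h).
  (* A joint filter for the index along [F] and the time tending to [t]. Continuity of the operator
     along it gives one index set and one time window on which the Euler increments are close to the
     limit derivative. *)
  pose G : set_system ((seq fn * nat) * R) := [set B | exists2 A, F A & exists2 d : R, 0 < d &
    forall i r, A i -> 0 <= r -> `|r - t| <= d -> B (i, r)].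
  have GG : ProperFilter G.
    split.
      move=> [A FA [d d0 hd]]; have [i Ai] := filter_ex FA.
      by apply: (hd i t) => //; rewrite subrr normr0 ltW.
    split.
    - by exists setT; [exact: filterT|exists 1].
    - move=> P Q [A1 FA1 [d1 d10 h1]] [A2 FA2 [d2 d20 h2]]; exists (A1 `&` A2); first exact: filterI.
      exists (Num.min d1 d2) => [|i r [a1 a2] r0]; first by rewrite lt_min d10.
      by rewrite le_min => /andP[b1 b2]; split; [exact: h1|exact: h2].
    - by move=> P Q PQ [A FA [d d0 hd]]; exists A => //; exists d => // i r a b c; apply: PQ; exact: hd.
  (* Pointwise convergence along the joint filter combines convergence at the fixed time [t] with
     the equicontinuity in time. *)
  have wcG : wcv G K (fun p => U p.1 p.2) (u t).
    split.
      exists [set i | t + 1 <= i.2%:R]; first exact: nT.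
      exists 1 => // i r /= hi r0; rewrite ler_norml => /andP[_ hr]; apply: hb => //.
      by apply: le_trans hi; rewrite -lerBlDl.
    move=> x e' e'0; have e2 : 0 < e' / 2 by rewrite divr_gt0.
    have [d d0 hd] := equi _ e2.
    exists ([set i | t + 1 <= i.2%:R] `&` ([set i | i.2.+1%:R^-1 <= d] `&` [set i | cmod (U i t x - u t x) <= e' / 2])).
      by apply: filterI; [exact: nT|apply: filterI; [exact: nE|exact: pt]].
    exists (Num.min 1 d); first by rewrite lt_min ltr01.
    move=> i r /= [hi [hn hp]] r0; rewrite le_min => /andP[r1 rd].
    have rt : r <= i.2%:R.
      by move: r1; rewrite ler_norml => /andP[_ r1]; apply: le_trans hi; rewrite -lerBlDl.
    have tt : t <= i.2%:R by apply: le_trans hi; rewrite lerDl.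
    have := hd i t r t0 r0 tt rt rd hn x => h'.
    have -> : U i r x - u t x = (U i r x - U i t x) + (U i t x - u t x) by ring.
    by apply: (le_trans (cmodD_le _ _)); rewrite (splitr e') lerD.
  have hL := wcv_Lam GG (gamma := gamma) wcG (W_mi wh).
  have /cvgEP /(_ _ e0) [A FA [d d0 hA]] := hL; rewrite -/l in hA.
  pose d' := Num.min 1 d / 2; have d'0 : 0 < d' by rewrite divr_gt0 // lt_min ltr01.
  have d'd : d' + d' <= d by rewrite -splitr ge_min lexx orbT.
  have d'1 : d' + d' <= 1 by rewrite -splitr ge_min lexx.
  exists d' => // s sp sd; apply/ler_addgt0Pr => y y0.
  pose Y := y / (4 * (e + `|l| + 1)).
  have Z0 : 0 < 4 * (e + `|l| + 1) by rewrite mulr_gt0 // ltr_wpDl // addr_ge0 // ltW.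
  have Y0 : 0 < Y by rewrite divr_gt0.
  have Yy : (e + `|l|) * Y <= y / 4.
    have : Y * (4 * (e + `|l| + 1)) = y by rewrite /Y divfK // gt_eqF.
    by move: Y Y0 `|l| => a; clear => a0 b; lra.
  have y4 : 0 < y / 4 by rewrite divr_gt0.
  have /cvgEP /(_ _ y4) i1 := wcv_Ic FF (wc s sp) wh.
  have /cvgEP /(_ _ y4) i2 := wcv_Ic FF (wc t t0) wh.
  have [i [[Ai vi] [[ti ni] [[nd a1] a2]]]] :=
    filter_ex (filterI (filterI FA (nV h wh)) (filterI (filterI (nT (t + 1)) (nE _ Y0)) (filterI (filterI (nE _ d'0) i1) i2))).
  have [_ _ _ /(_ h vi) hB] := hU i.
  have tt : t <= i.2%:R by apply: le_trans ti; rewrite lerDl.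
  have s_t : s <= i.2%:R.
    apply: le_trans ti; rewrite -lerBlDl (le_trans (ler_norm _)) // (le_trans sd) //.
    by apply: le_trans d'1; rewrite lerDl ltW.
  have loc r : 0 <= r -> `|r - t| <= d -> `|Lam gamma (U i r) (mi h) - l| <= e by move=> r0 rd; exact: hA.
  set ni' := i.2.+1%:R^-1 in ni nd hB *.
  have key : `|Ic (U i s) h - Ic (U i t) h - sg * (s - t) * l| <= e * (`|s - t| + ni') + ni' * `|l|.
    have [st|ts] := leP t s.
      rewrite (ger0_norm (_ : 0 <= s - t)) ?subr_ge0 //; apply: hB => // r r0 /andP[r1 r2]; apply: loc => //.
      rewrite ler_norml; move: sd; rewrite ger0_norm ?subr_ge0 // => sd.
      by move: r1 r2 nd d'd d'0 sd; clear => *; apply/andP; split; lra.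
    rewrite (_ : _ - _ - _ = - (Ic (U i t) h - Ic (U i s) h - sg * (t - s) * l)); last first.
      by move: (Ic _ _) (Ic _ _) => a b; ring.
    rewrite normrN (distrC s t) (ger0_norm (_ : 0 <= t - s)) ?subr_ge0 ?(ltW ts) //.
    apply: hB => //; first exact: ltW.
    move=> r r0 /andP[r1 r2]; apply: loc => //.
    rewrite ler_norml; move: sd; rewrite (distrC s t) ger0_norm ?subr_ge0 ?(ltW ts) // => sd.
    by move: r1 r2 nd d'd d'0 sd; clear => *; apply/andP; split; lra.
  have ni0 : 0 <= ni' by rewrite invr_ge0.
  have kk : e * ni' + ni' * `|l| <= y / 4.
    by apply: le_trans Yy; rewrite (mulrC ni') -mulrDl ler_wpM2l // addr_ge0 // ltW.
  have -> : Ic (u s) h - Ic (u t) h - sg * (s - t) * l =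
     (Ic (U i s) h - Ic (U i t) h - sg * (s - t) * l) - (Ic (U i s) h - Ic (u s) h) + (Ic (U i t) h - Ic (u t) h).
    by move: (Ic (U i s) h) (Ic (U i t) h) (Ic (u s) h) (Ic (u t) h) => a b c f; ring.
  apply: (le_trans (ler_normD _ _)); apply: (le_trans (lerD (ler_normB _ _) (lexx _))).
  move: key kk a1 a2; rewrite [e * (_ + ni')]mulrDr; move: `|Ic (U i s) h - Ic (U i t) h - _| `|_ - Ic (u s) h| `|_ - Ic (u t) h| => a b c.
  by move: (e * ni') (ni' * _) (e * `|s - t|) => p q r; clear -y0; lra.
- move=> t t0 hQ; have hq (e : R) : 0 < e -> \forall i \near F, Qf (U i t) <= Qf (u t) + e.
    move=> e0; apply: filterS (filterI (nT t) (nE e e0)) => i [ti ni].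
    have [_ _ /(_ t) + _] := hU i; rewrite t0 ti => /(_ isT) [_ q _].
    by rewrite hQ (le_trans q) // lerD2l.
  have hw := wcv_Q0 FF (wc t t0) hq; apply/ler_addgt0Pr => e e0; have e2 : 0 < e / 2 by rewrite divr_gt0.
  have hE := wcv_En_lsc FF gamma (wc t t0) hw e2.
  have [i [[ti ni] hi]] := filter_ex (filterI (filterI (nT t) (nE _ e2)) hE).
  have [_ _ /(_ t) + _] := hU i; rewrite t0 ti => /(_ isT) [_ _ q].
  apply: (le_trans hi); apply: (le_trans (lerD q (lexx (e / 2)))).
  by rewrite -addrA lerD2l [leRHS](splitr e) lerD2r.
Qed.

(** Glue the forward limit with the limit for reversed time; at 0 the two one-sided expansions have
    the same derivative. The charge of the glued solution is conserved, and this releases both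
    energy inequalities. *)
Lemma wsol_exists u0 : W u0 -> exists u, [/\ wsol gamma u, u 0 = u0 & forall t, En gamma (u t) <= En gamma u0].
Proof.
move=> w0; have [u [K [u_0 bu du eu]]] := forward (normr1 R) w0.
have [v [K' [v_0 bv dv ev]]] := forward (normrN1 R) w0.
pose w t := if 0 <= t then u t else v (- t).
have w_0 : w 0 = u0 by rewrite /w lexx.
have wp t : 0 <= t -> w t = u t by move=> t0; rewrite /w t0.
have wn t : t <= 0 -> w t = v (- t).
  rewrite le_eqVlt => /predU1P[->|t0]; first by rewrite w_0 oppr0 v_0.
  by rewrite /w leNgt t0.
have bw t : bdd (Num.max K K') (w t).
  have [t0|/ltW t0] := leP 0 t.
    by rewrite wp //; apply: bdd_le (bu t t0); rewrite le_max lexx.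
  by rewrite wn //; apply: bdd_le (bv (- t) _); rewrite ?oppr_ge0 // le_max lexx orbT.
have hd t h : W h -> forall e : R, 0 < e -> \forall s \near t,
    `|Ic (w s) h - Ic (w t) h - (s - t) * Lam gamma (w t) (mi h)| <= e * `|s - t|.
  move=> wh e e0.
  have right : 0 <= t -> exists2 d : R, 0 < d & forall s, 0 <= s -> `|s - t| <= d ->
      `|Ic (w s) h - Ic (w t) h - (s - t) * Lam gamma (w t) (mi h)| <= e * `|s - t|.
    move=> t0; have [d d0 hd] := du t t0 h wh e e0; exists d => // s s0 sd.
    by have := hd s s0 sd; rewrite mul1r !wp.
  have left : t <= 0 -> exists2 d : R, 0 < d & forall s, s <= 0 -> `|s - t| <= d ->
      `|Ic (w s) h - Ic (w t) h - (s - t) * Lam gamma (w t) (mi h)| <= e * `|s - t|.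
    move=> t0; have nt : 0 <= - t by rewrite oppr_ge0.
    have [d d0 hd] := dv _ nt h wh e e0; exists d => // s s0; have ns : 0 <= - s by rewrite oppr_ge0.
    have E : `|- s - - t| = `|s - t| by rewrite -opprD normrN.
    move=> sd; have := hd _ ns; rewrite E => /(_ sd).
    by rewrite !wn // mulN1r opprB opprK (addrC (- t)).
  apply/nearEP; have [t0|t0|t0] := ltgtP t 0.
  - have [d d0 hd] := left (ltW t0); exists (Num.min d (- t)); first by rewrite lt_min d0 oppr_gt0.
    move=> s; rewrite le_min => /andP[sd st]; apply: hd => //.
    by move: st; rewrite ler_norml => /andP[_]; clear; lra.
  - have [d d0 hd] := right (ltW t0); exists (Num.min d t); first by rewrite lt_min d0.
    move=> s; rewrite le_min => /andP[sd st]; apply: hd => //.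
    by move: st; rewrite ler_norml => /andP[+ _]; clear; lra.
  - have tge : 0 <= t by rewrite t0.
    have tle : t <= 0 by rewrite t0.
    have [d1 d10 h1] := right tge; have [d2 d20 h2] := left tle.
    exists (Num.min d1 d2); first by rewrite lt_min d10.
    move=> s; rewrite le_min => /andP[s1 s2]; have [s0|/ltW s0] := leP 0 s; [exact: h1|exact: h2].
have hw : wsol gamma w.
  split=> //; first by move=> t; exact: bdd_W (bw t).
  by move=> t; exists (Num.max K K'); exact: filterE.
have hQ := wsol_Q hw; exists w; split=> // t; have := hQ t; rewrite w_0.
have [t0|/ltW t0] := leP 0 t; first by rewrite wp //; exact: eu.
by rewrite wn //; apply: ev; rewrite oppr_ge0.
Qed.

(** By uniqueness every solution obeys the energy inequality from its time 0. Applied to the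
    solution shifted by [t] and evaluated at [-t], it gives the reverse inequality. *)
Lemma wsol_En u : wsol gamma u -> forall t, En gamma (u t) = En gamma (u 0).
Proof.
move=> hu; have [uW _ _] := hu.
have main v : wsol gamma v -> forall t, En gamma (v t) <= En gamma (v 0).
  move=> hv t; have [vW _ _] := hv; have [w [hw w0 ew]] := wsol_exists (vW 0).
  by rewrite -(wsol_unique hw hv w0) w0.
move=> t; apply/eqP; rewrite eq_le main //=.
by have := main _ (wsol_shift t hu) (- t); rewrite addNr add0r.
Qed.

End forward_limit.

(** * Equivalence of weak solutions with solutions in the sense of [W] and its dual *)

Section well_posedness.
Context {R : realType} (gamma : R).
Local Notation fn := (R -> R[i]).
Implicit Types (u v : R -> fn) (w h k : fn) (t s : R).

Lemma wsol_wcv u t : wsol gamma u -> exists K : R, wcv (nbhs t) K u (u t).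
Proof.
move=> hu; have [_ hb _] := hu; have [K hK] := hb t; exists K; split=> // x e e0.
have bt : bdd K (u t) by move/nearEP: hK => [d d0]; apply; rewrite subrr normr0 ltW.
have K0 := bdd_ge0 bt; have K'0 : 0 <= 8 * (4 * K + K) by move: K0; clear; lra.
have [q q0 hq] := cmod_small_of_Q K'0 e0.
apply: filterS (filterI hK (wsol_Qcont hu t q0)) => s [bs hs].
have bw := bdd_sub bt bs; have [_ _ dw _] := bw.
by have := hq _ (bdd_W bw) dw hs x; rewrite linE rmorphN1 mulN1r addrC.
Qed.

Lemma wsol_Wcont u t : wsol gamma u -> Wnorm (lin (-1) (u t) (u s)) @[s --> t] --> 0.
Proof.
move=> hu; have [K wc] := wsol_wcv t hu; apply: (wcv_strong _ (gamma := gamma) wc) => e e0.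
  by apply: filterE => s; rewrite !(wsol_Q hu s) (wsol_Q hu t) lerDl ltW.
by apply: filterE => s; rewrite !(wsol_En hu s) (wsol_En hu t) lerDl ltW.
Qed.

(** The difference is rescaled by [kp], and its logarithm splits into [ln kp^2] and the logarithm of
    the rescaled difference. The first goes with Young's inequality in [L^2], the second with the
    Orlicz inequality at bound 5, whence [16 = 6 + 2 * 5]. *)
Lemma Flog_scaled (z z' x : R[i]) (M kp : R) : 0 < kp -> cmod z <= M -> cmod z' <= M ->
  cmod (kp^-1%:C * (z' - z)) <= 5 ->
  `|cdot (Flog z' - Flog z) x| <= (4 + 2 * M + `|ln (kp ^+ 2)|) * (kp^-1 * nsq (z' - z) + kp * nsq x) +
    kp * (16 * (Afun (cmod (kp^-1%:C * (z' - z))) + Afun (cmod x))).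
Proof.
move=> k0 hz hz' h5; have M0 : 0 <= M by exact: le_trans (cmod_ge0 z) hz.
have A0 : 0 <= kp * (16 * (Afun (cmod (kp^-1%:C * (z' - z))) + Afun (cmod x))).
  by rewrite !mulr_ge0 ?(ltW k0) // addr_ge0 // Afun_ge0 // cmod_ge0.
have C0 : 0 <= 4 + 2 * M + `|ln (kp ^+ 2)| by rewrite !addr_ge0 // mulr_ge0.
have y := @young_cdot R.
have hsr : cmod (z' - z) * cmod x <= kp^-1 * nsq (z' - z) + kp * nsq x.
  have := sqr_ge0 (kp^-1 * cmod (z' - z) - cmod x); rewrite -!cmod_sq.
  have -> : kp^-1 * cmod (z' - z) ^+ 2 = kp * (kp^-1 * cmod (z' - z)) ^+ 2.
    by field; rewrite gt_eqF.
  have e : cmod (z' - z) = kp * (kp^-1 * cmod (z' - z)) by rewrite mulrA divff ?mul1r // gt_eqF.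
  rewrite {2}e; move: (kp^-1 * cmod (z' - z)) (cmod x) => a b; rewrite sqrrB => h.
  rewrite -mulrA -mulrDr ler_wpM2l ?(ltW k0) //; have := sqr_ge0 a; have := sqr_ge0 b.
  by move: h; rewrite -mulr_natr; move: (a ^+ 2) (b ^+ 2) (a * b); clear => *; lra.
apply: (le_trans (cdot_le _ _)).
apply: (le_trans (ler_wpM2r (cmod_ge0 x) (Flog_mod hz' hz))).
set s := cmod (z' - z) in hsr *; set r := cmod x in hsr *.
have s0 : 0 <= s by exact: cmod_ge0.
have r0 : 0 <= r by exact: cmod_ge0.
have [sz|sn] := eqVneq s 0.
  rewrite sz !mul0r addr_ge0 // mulr_ge0 // addr_ge0 // mulr_ge0 ?nsq_ge0 // ?invr_ge0 ltW //.
have sp : 0 < s by rewrite lt_neqAle eq_sym sn.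
have cE : cmod (kp^-1%:C * (z' - z)) = kp^-1 * s by rewrite cmodZ gtr0_norm // invr_gt0.
rewrite cE in h5 *.
have ks0 : 0 < kp^-1 * s by rewrite mulr_gt0 // invr_gt0.
have or := orlicz (ltW ks0) h5 r0.
have lE : ln (s ^+ 2) = ln (kp ^+ 2) + ln ((kp^-1 * s) ^+ 2).
  rewrite -lnM ?posrE ?exprn_gt0 // -exprMn mulrA divff ?mul1r // gt_eqF //.
have h1 : `|ln (s ^+ 2)| <= `|ln (kp ^+ 2)| + `|ln ((kp^-1 * s) ^+ 2)| by rewrite lE ler_normD.
have h2 : s * r * `|ln ((kp^-1 * s) ^+ 2)| <= kp * (16 * (Afun (kp^-1 * s) + Afun r)).
  have -> : s * r * `|ln ((kp^-1 * s) ^+ 2)| = kp * (kp^-1 * s * `|ln ((kp^-1 * s) ^+ 2)| * r).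
    by field; rewrite gt_eqF.
  rewrite ler_wpM2l ?(ltW k0) // (le_trans or) // (_ : 6 + 2 * 5 = 16) //.
  by rewrite -natrM -natrD.
have h3 := ler_wpM2l C0 hsr; have h4 := ler_wpM2l (mulr_ge0 s0 r0) h1.
move: h3 h4 h2; move: (kp * (16 * _)) (ln _) (ln _) (ln _) => a b c d.
by move: (kp^-1 * nsq _ + _) => p; clear; lra.
Qed.

Lemma le5 : 4 * 1 + 1 <= 5 :> R. Proof. lra. Qed.

Lemma Nf_diff w1 w2 h (M kp : R) : W w1 -> W w2 -> 0 <= M -> (forall x, cmod (w1 x) <= M) ->
  (forall x, cmod (w2 x) <= M) -> bdd 4 h -> Wnorm (lin (-1) w1 w2) < kp -> kp <= 1 ->
  `|Nf w2 h - Nf w1 h| <= 5 * om M kp + 80 * kp.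
Proof.
move=> wa wb M0 ha hb bh hk k1; have ww := W_lin (-1) wa wb; have [k0 b1] := Wnorm_ball ww hk.
have [wh qh _ ah] := bh; have [Qw _ _] := Wnorm_lt_small ww hk k1.
pose w := lin (-1) w1 w2; have wk : W (scl kp^-1 w) by exact: bdd_W b1.
have [_ _ _ aw] := b1.
have iq := L2c_nsq (W_L2c ww); have ih := L2c_nsq (W_L2c wh); have iA := W_intg wk; have iAh := W_intg wh.
pose C := 4 + 2 * M + `|ln (kp ^+ 2)|; have C0 : 0 <= C by rewrite !addr_ge0 // mulr_ge0.
pose B x := C * (kp^-1 * nsq (w x) + kp * nsq (h x)) + kp * (16 * (Ax (scl kp^-1 w) x + Ax h x)).
have i1 : intg setT (fun x => kp^-1 * nsq (w x) + kp * nsq (h x)) by apply: intgD => //; exact: intgZ.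
have i2 : intg setT (fun x => 16 * (Ax (scl kp^-1 w) x + Ax h x)) by apply: intgZ => //; exact: intgD.
have iB : intg setT B by apply: intgD => //; exact: intgZ.
have hB : Int setT B <= 5 * om M kp + 80 * kp.
  rewrite /B IntD; [|by []|exact: intgZ|exact: intgZ].
  rewrite (IntZ C measurableT i1) (IntZ kp measurableT i2).
  rewrite IntD; [|by []|exact: intgZ|exact: intgZ].
  rewrite (IntZ 16 measurableT); last exact: intgD.
  rewrite (IntD measurableT iA iAh) !IntZ // -!Qf_nsq -!AuE.
  have h1 : kp^-1 * Qf w + kp * Qf h <= 5 * kp.
    have a1 : kp^-1 * Qf w <= kp by rewrite ler_pdivrMl // -expr2.
    have := ler_wpM2l (ltW k0) qh; move: (kp^-1 * _) (kp * Qf h) a1 => a b; clear; lra.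
  have h2 : Au (scl kp^-1 w) + Au h <= 5 by move: (Au _) (Au _) aw ah => a b; clear; lra.
  have := ler_wpM2l C0 h1; have := ler_wpM2l (ltW k0) h2; rewrite /om -/C.
  move: (kp^-1 * _ + _) (Au _ + Au _) => a b; clear; lra.
have iN1 := Nf_intg wa wh; have iN2 := Nf_intg wb wh.
rewrite !NfE -IntB //; apply: le_trans hB; apply: Int_norm_le => //.
  by apply: intg_meas; exact: intgB.
move=> x _; rewrite -cdotBl /B /C /Ax sclE.
have E : w x = w2 x - w1 x by rewrite /w linE rmorphN1 mulN1r addrC.
rewrite E; apply: Flog_scaled => //; rewrite -E -sclE.
exact: le_trans (bdd_cmod x b1) le5.
Qed.

Lemma Lam_diff K w1 w2 h (kp : R) : bdd K w1 -> bdd K w2 -> bdd 4 h ->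
  Wnorm (lin (-1) w1 w2) < kp -> kp <= 1 ->
  `|Lam gamma w2 h - Lam gamma w1 h| <= 2 * kp + `|gamma| * (5 * kp * 17) + (5 * om (4 * K + 1) kp + 80 * kp).
Proof.
move=> ba bb bh hk k1; have wa := bdd_W ba; have wb := bdd_W bb; have [wh _ dh _] := bh.
have K0 := bdd_ge0 ba; have ww := W_lin (-1) wa wb; have [k0 b1] := Wnorm_ball ww hk.
have [Qw Dw _] := Wnorm_lt_small ww hk k1.
have M0 : 0 <= 4 * K + 1 by move: K0; clear; lra.
have hN := Nf_diff wa wb M0 (fun x => bdd_cmod x ba) (fun x => bdd_cmod x bb) bh hk k1.
have hBd : `|Bf w2 h - Bf w1 h| <= 2 * kp.
  have := Bf_linl (-1) (W_H1 wa) (W_H1 wb) (W_H1 wh); rewrite mulN1r addrC => <-.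
  rewrite mulrC; apply: Bf_abs_le => //; [exact: W_H1|exact: W_H1| |exact: ltW].
  by apply: (le_trans dh); rewrite -natrX ler_nat.
have h0 : `|cdot (w2 0) (h 0) - cdot (w1 0) (h 0)| <= 5 * kp * 17.
  rewrite -cdotBl; apply: (le_trans (cdot_le _ _)); apply: ler_pM; rewrite ?cmod_ge0 //.
    have := bdd_cmod 0 b1; rewrite cmod_scl normfV (gtr0_norm k0) linE rmorphN1 mulN1r addrC.
    rewrite ler_pdivrMl // => h0; apply: (le_trans h0).
    by rewrite mulrC ler_wpM2r ?(ltW k0) // le5.
  by have := bdd_cmod 0 bh; rewrite -natrM natr1.
have h0' : `|gamma * cdot (w2 0) (h 0) - gamma * cdot (w1 0) (h 0)| <= `|gamma| * (5 * kp * 17).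
  by rewrite -mulrBr normrM ler_wpM2l.
rewrite /Lam; move: hBd h0' hN; move: (Bf _ _) (Bf _ _) (gamma * cdot _ _) (gamma * cdot _ _) (Nf _ _) (Nf _ _).
move=> a b c d f g h1 h2 h3.
have -> : - b + d + g - (- a + c + f) = - (b - a) + (d - c) + (g - f) by ring.
by apply: (le_trans (ler_normD _ _)); apply: lerD => //; apply: (le_trans (ler_normD _ _)); rewrite normrN lerD.
Qed.

(** Continuity of the derivative in the dual norm, that is uniformly over the unit ball. The
    pointwise continuity of [Lam] is not enough, hence the quantitative estimate of [Lam_diff]. *)
Lemma wsol_Lam_cont u t (e : R) : wsol gamma u -> 0 < e -> \forall s \near t,
  forall h, W h -> Wnorm h <= 1 -> `|Lam gamma (u s) (mi h) - Lam gamma (u t) (mi h)| <= e.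
Proof.
move=> hu e0; have [_ hb _] := hu; have [K hK] := hb t.
have bt : bdd K (u t) by move/nearEP: hK => [d d0]; apply; rewrite subrr normr0 ltW.
have K0 := bdd_ge0 bt; have M0 : 0 <= 4 * K + 1 by move: K0; clear; lra.
have e2 : 0 < e / 10 by rewrite divr_gt0.
have [d d0 hd] := om_small M0 e2.
pose C := 82 + `|gamma| * 85; have C0 : 0 < C by rewrite ltr_wpDr // mulr_ge0.
pose kp := Num.min (Num.min 1 d) (e / 2 / C).
have k0 : 0 < kp by rewrite !lt_min ltr01 d0 !divr_gt0.
have k1 : kp <= 1 by rewrite !ge_min lexx.
have kd : kp <= d by rewrite !ge_min lexx !orbT.
have kC : kp * C <= e / 2 by rewrite -ler_pdivlMr // !ge_min lexx !orbT.
have k2 : 0 < kp / 2 by rewrite divr_gt0.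
have /cvgEP /(_ _ k2) hw := wsol_Wcont t hu.
apply: filterS (filterI hK hw) => s [bs]; rewrite subr0 (ger0_norm (Wnorm_ge0 _)) => hs h wh h1.
have hk : Wnorm (lin (-1) (u t) (u s)) < kp.
  by apply: (le_lt_trans hs); rewrite ltr_pdivrMr // ltr_pMr // ltr1n.
apply: (le_trans (Lam_diff bt bs (bdd_mi (bdd_ball wh h1)) hk k1)).
have := hd kp (ltW k0) kd; move: (om _ _) kC; rewrite /C; move: `|gamma| => g o; clear; lra.
Qed.

Lemma mean_value (f df : R -> R) (t s L e : R) :
  (forall r, `|r - t| <= `|s - t| -> forall e : R, 0 < e ->
     \forall q \near r, `|f q - f r - (q - r) * df r| <= e * `|q - r|) ->
  (forall r, `|r - t| <= `|s - t| -> `|df r - L| <= e) ->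
  `|f s - f t - (s - t) * L| <= e * `|s - t|.
Proof.
move=> hf hL.
have in1 (a b r : R) : a <= r <= b -> `|a - t| <= `|s - t| -> `|b - t| <= `|s - t| -> `|r - t| <= `|s - t|.
  by move=> /andP[? ?]; rewrite !ler_norml => /andP[? ?] /andP[? ?]; apply/andP; split; lra.
have main (a b : R) : a <= b -> `|a - t| <= `|s - t| -> `|b - t| <= `|s - t| -> f b - f a <= (L + e) * (b - a) /\ (L - e) * (b - a) <= f b - f a.
  move=> ab ha hb; split.
    apply: (deriv_le (df := df)) => // r /in1 /(_ ha hb) hr; first exact: hf.
    by have := hL r hr; rewrite ler_norml => /andP[_]; clear; lra.
  have := @deriv_le _ (fun r => - f r) (fun r => - df r) a b (e - L) ab _ _.
  move=> h; have {}h : - f b - - f a <= (e - L) * (b - a).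
    apply: h => r /in1 /(_ ha hb) hr; last by have := hL r hr; rewrite ler_norml => /andP[+ _]; clear; lra.
    move=> e' e'0; apply: filterS (hf r hr e' e'0) => q.
    by rewrite (_ : - f q - - f r - _ = - (f q - f r - (q - r) * df r)) ?normrN //; ring.
  by move: h; clear; lra.
have z : `|t - t| <= `|s - t| by rewrite subrr normr0.
have [ts|/ltW st] := leP t s.
  have [h1 h2] := main _ _ ts z (lexx _); rewrite (ger0_norm (_ : 0 <= s - t)) ?subr_ge0 // ler_norml.
  by apply/andP; split; move: h1 h2; clear; lra.
have [h1 h2] := main _ _ st (lexx _) z; rewrite (distrC s t) (ger0_norm (_ : 0 <= t - s)) ?subr_ge0 // ler_norml.
by apply/andP; split; move: h1 h2; clear; lra.
Qed.

(** The mean value inequality upgrades differentiability against each fixed [h] to differentiability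
    in the dual norm, because the derivative is continuous there. *)
Lemma wsol_deriv_unif u t (e : R) : wsol gamma u -> 0 < e -> \forall s \near t,
  forall h, W h -> Wnorm h <= 1 ->
    `|Ic (u s) h - Ic (u t) h - (s - t) * Lam gamma (u t) (mi h)| <= e * `|s - t|.
Proof.
move=> hu e0; have [_ _ hd] := hu; have /nearEP [d d0 hL] := wsol_Lam_cont t hu e0.
apply/nearEP; exists d => // s sd h wh h1.
apply: (mean_value (f := fun q => Ic (u q) h) (df := fun q => Lam gamma (u q) (mi h))) => r hr; first exact: hd.
by apply: hL => //; exact: le_trans sd.
Qed.

Lemma cvge0 (I : Type) (F : set_system I) (FF : Filter F) (f : I -> \bar R) : (forall i, 0 <= f i)%E ->
  (forall e : R, 0 < e -> \forall i \near F, (f i <= e%:E)%E) -> f i @[i --> F] --> 0%E.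
Proof.
move=> f0 hf.
have fin i (e : R) : (f i <= e%:E)%E -> f i \is a fin_num.
  by move=> h; rewrite ge0_fin_numE // (le_lt_trans h) // ltry.
apply/fine_cvgP; split; first by apply: filterS (hf 1 ltr01) => i; exact: fin.
apply/cvgrPdist_le => e e0; apply: filterS (hf e e0) => i hi /=.
rewrite sub0r normrN ger0_norm ?fine_ge0 // -lee_fin fineK //; exact: fin hi.
Qed.

Lemma dual_ofE h k : dual_of h k = Ic h k.
Proof. by rewrite /dual_of IntE IcE. Qed.

Lemma wsol_global u : wsol gamma u -> global_solution gamma u.
Proof.
move=> hu; have [uW _ _] := hu; split.
  split=> // t; rewrite (_ : (fun s => _) = fun s => Wnorm (lin (-1) (u t) (u s))); first exact: wsol_Wcont.
  by apply/funext => s; rewrite fun_subE.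
exists (fun t h => Lam gamma (u t) (mi h)); split; last first.
  move=> t h wh; rewrite LamE /dual_muli fun_miE.
  rewrite (_ : mi (mi h) = scl (-1) h); last first.
    by apply/funext => x; rewrite mi_mi sclE rmorphN1 mulN1r.
  rewrite /scl (Lam_linr _ _ (uW t) wh W0).
  have -> : Lam gamma (u t) zf = 0.
    by apply: Wlinear0 => a h' k' wh' wk'; exact: Lam_linr.
  by rewrite addr0 mulN1r addNr.
split.
- move=> t; split; first by move=> a h k wh wk; rewrite fun_linE; exact: (Lam_mi_linear gamma (uW t)).
  have [K K4 bt] := bdd_W_ex (uW t); pose C := K + `|gamma| * (4 * K + 1) ^+ 2 + (6 + 2 * (4 * K + 1)) * (K + K).
  have b1 h : bdd 1 h -> `|Lam gamma (u t) (mi h)| <= C.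
    move=> bh; apply: Lam_le => //; apply: bdd_mi; apply: bdd_le bh; apply: le_trans K4; rewrite ler1n //.
  have C0 : 0 <= C by apply: le_trans (normr_ge0 _) (b1 zf _); split; [exact: W0|..];
    rewrite ?QfE ?Ic0l ?DfE ?(Bf0l W0) ?AuE ?(@Int_ext _ _ _ (fun=> 0)) ?Int0 // => x _; rewrite /Ax cmod0 Afun0.
  by exists C; exact: (Wlinear_le (Lam_mi_linear gamma (uW t)) C0 b1).
- move=> t; apply: cvge0 => [s|e e0]; first exact: Wdual_norm_ge0.
  have := wsol_deriv_unif t hu e0 => hn; have {}hn : \forall s \near t^', forall h, W h -> Wnorm h <= 1 ->
    `|Ic (u s) h - Ic (u t) h - (s - t) * Lam gamma (u t) (mi h)| <= e * `|s - t| by exact: cvg_within hn.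
  have hne : \forall s \near t^', s != t by exact: nbhs_dnbhs_neq.
  apply: filterS (filterI hn hne) => s [hs st]; apply: Wdual_norm_le => h wh h1; have := hs h wh h1.
  have st0 : s - t != 0 by rewrite subr_eq0.
  rewrite !dual_ofE; move: (Ic _ _) (Ic _ _) (Lam _ _ _) => a b l hh.
  have -> : (s - t)^-1 * (b - a) - l = (s - t)^-1 * (b - a - (s - t) * l) by field.
  by rewrite normrM normfV mulrC ler_pdivrMr ?normr_gt0.
- move=> t; apply: cvge0 => [s|e e0]; first exact: Wdual_norm_ge0.
  apply: filterS (wsol_Lam_cont t hu e0) => s hs; exact: Wdual_norm_le.
Qed.

(** Norm continuity provides local bounds in [W]. Each test function is scaled into the unit ball in
    order to read the dual norm limit off as an expansion against it. *)
Lemma global_wsol u : global_solution gamma u -> wsol gamma u.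
Proof.
move=> [[uW hc] [du [[hlin hder _] heq]]].
have duL t : Wlinear (du t).
  by move=> a h k wh wk; have [+ _] := hlin t; move=> /(_ a h k wh wk); rewrite fun_linE.
have duE t h : W h -> du t h = Lam gamma (u t) (mi h).
  move=> wh; have := heq t (mi h) (W_mi wh); rewrite LamE /dual_muli fun_miE.
  rewrite (_ : mi (mi h) = scl (-1) h); last first.
    by apply/funext => x; rewrite mi_mi sclE rmorphN1 mulN1r.
  rewrite (Wlinear_scl _ (duL t) wh); move: (du t h) (Lam _ _ _) => a b; lra.
split=> // t.
  have h : Wnorm (lin (-1) (u t) (u s)) @[s --> t] --> 0.
    rewrite (_ : (fun s => _) = fun s => Wnorm (fun x => u s x - u t x)); first exact: hc.
    by apply/funext => s; rewrite fun_subE.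
  have hW : \forall s \near t, W (u s) by exact: filterE.
  have [[K [hK _]] _ _] := Wnorm_cvg _ gamma (uW t) hW h.
  by exists K.
move=> h wh e e0; pose k := Wnorm h + 1.
have k0 : 0 < k by rewrite ltr_wpDl // Wnorm_ge0.
have hk : Wnorm (scl k^-1 h) <= 1 by apply: Wnorm_scl_le1 => //; rewrite ltrDl.
have wk : W (scl k^-1 h) by exact: W_scl.
have ek : 0 < e / k by rewrite divr_gt0.
have /fine_cvgP [hfin /cvgrPdist_le /(_ _ ek) hd] := hder t.
have hn : \forall s \near t^', `|Ic (u s) h - Ic (u t) h - (s - t) * Lam gamma (u t) (mi h)| <= e * `|s - t|.
  have hne : \forall s \near t^', s != t by exact: nbhs_dnbhs_neq.
  apply: filterS (filterI (filterI hfin hd) hne) => s [[fs ds] st].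
  have st0 : s - t != 0 by rewrite subr_eq0.
  set D := Wdual_norm _ in fs ds.
  have D0 : (0 <= D)%E by exact: Wdual_norm_ge0.
  move: ds; rewrite /= sub0r normrN ger0_norm ?fine_ge0 // -lee_fin fineK // => ds.
  have := le_trans (Wdual_norm_ge (fun h => (s - t)^-1 * (dual_of (u s) h - dual_of (u t) h) - du t h) wk hk) ds.
  rewrite lee_fin !dual_ofE (Wlinear_scl _ (duL t) wh) duE //.
  have E q : Ic (u q) (scl k^-1 h) = k^-1 * Ic (u q) h.
    by rewrite /scl (Ic_linr _ (W_L2c wh) (W_L2c W0) (W_L2c (uW q))) Ic0r addr0.
  rewrite !E; move: (Ic _ _) (Ic _ _) (Lam _ _ _) => a b l.
  have -> : (s - t)^-1 * (k^-1 * b - k^-1 * a) - k^-1 * l = k^-1 * ((s - t)^-1 * (b - a - (s - t) * l)).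
    by field; rewrite st0 gt_eqF.
  rewrite normrM gtr0_norm ?invr_gt0 // mulrC ler_pdivrMr // divfK ?gt_eqF //.
  by rewrite normrM normfV mulrC ler_pdivrMr ?normr_gt0.
have := hn; rewrite /dnbhs near_withinE => hn'; near=> s.
have [->|st] := eqVneq s t; first by rewrite !subrr mul0r subrr normr0 mulr0.
by move: st; near: s.
Unshelve. all: by end_near. Qed.

Lemma wellposed (u0 : fn) : W u0 -> exists u, [/\ global_solution gamma u, u 0 = u0,
  (forall v, global_solution gamma v -> v 0 = u0 -> v = u) &
  forall t, [/\ W (u t), Qf (u t) = Qf u0 & En gamma (u t) = En gamma u0]].
Proof.
move=> w0; have [u [hu u_0 _]] := wsol_exists gamma w0; exists u; split=> //.
- exact: wsol_global.
- by move=> v hv v0; apply: (wsol_unique (global_wsol hv) hu); rewrite v0.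
- by move=> t; rewrite (wsol_Q hu) (wsol_En hu) u_0; split=> //; case: hu.
Qed.

End well_posedness.

(** * The Bogomolny bound *)

Section signed_integrals.
Context {R : realType}.
Local Notation mu := (@lebesgue_measure R).
Implicit Types (f g : R -> R) (a b x : R).

(** The sign of [x - x0], with the value 1 at [x0], so that only the right end point needs care in
    the integrals. *)
Definition sg (x0 x : R) : R := if x < x0 then -1 else 1.

Lemma sg_sqr x0 x : sg x0 x ^+ 2 = 1.
Proof. by rewrite /sg; case: ifP; rewrite ?sqrrN expr1n. Qed.

Lemma sg_norm x0 x : `|sg x0 x| = 1.
Proof. by rewrite /sg; case: ifP; rewrite ?normrN1 ?normr1. Qed.

Lemma sg_meas x0 (D : set R) : measurable D -> measurable_fun D (sg x0).
Proof.
move=> mD; apply: (measurable_funS measurableT) => //.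
apply: measurable_fun_ifT; [exact: measurable_fun_ltr|exact: measurable_cst|exact: measurable_cst].
Qed.

Lemma intg_sg x0 (D : set R) f : measurable D -> intg D f -> intg D (fun x => sg x0 x * f x).
Proof.
move=> mD hf; apply: (intg_dom mD _ _ (intg_abs mD hf)).
  by apply: measurable_funM; [exact: sg_meas|exact: intg_meas hf].
by move=> x _; rewrite normrM sg_norm mul1r.
Qed.

Lemma Int_ext_co a b f g : a <= b -> intg `[a, b] f -> intg `[a, b] g ->
  (forall x, a <= x < b -> f x = g x) -> Int `[a, b] f = Int `[a, b] g.
Proof.
move=> ab hf hg h; rewrite -(Int_co_itv ab hf) -(Int_co_itv ab hg); apply: Int_ext => x /=.
by rewrite in_itv /=; exact: h.
Qed.

Lemma Int_sgl x0 a b f : a <= b -> b <= x0 -> intg `[a, b] f ->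
  Int `[a, b] (fun x => sg x0 x * f x) = - Int `[a, b] f.
Proof.
move=> ab bx hf; rewrite -IntN //; apply: Int_ext_co => //; [exact: intg_sg|exact: intgN|].
by move=> x /andP[_ xb]; rewrite /sg (lt_le_trans xb bx) mulN1r.
Qed.

Lemma Int_sgr x0 a b f : x0 <= a -> Int `[a, b] (fun x => sg x0 x * f x) = Int `[a, b] f.
Proof.
move=> xa; apply: Int_ext => x /=; rewrite in_itv /= => /andP[ax _].
by rewrite /sg ltNge (le_trans xa ax) mul1r.
Qed.

Lemma Int_sg x0 a b f : a <= x0 -> x0 <= b -> intg `[a, b] f ->
  Int `[a, b] (fun x => sg x0 x * f x) = Int `[x0, b] f - Int `[a, x0] f.
Proof.
move=> ax xb hf; rewrite (Int_itv_split ax xb); last exact: intg_sg.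
have hl : intg `[a, x0] f.
  by apply: (intgS _ _ _ hf) => // x /=; rewrite !in_itv /= => /andP[-> h] /=; exact: le_trans xb.
by rewrite (Int_sgl ax (lexx _) hl) (Int_sgr _ _ (lexx x0)) addrC.
Qed.

Lemma ac_even f f' : (forall x, is_derive x 1 f (f' x)) -> continuous f' ->
  ac (fun x => f `|x|) (fun x => sg 0 x * f' `|x|).
Proof.
move=> df cf'.
have d1 x : derive1 f x = f' x by rewrite derive1E; exact: derive_val.
have af : ac f f'.
  have := @ac_C1 _ f; rewrite (_ : derive1 f = f'); last by apply/funext.
  by apply=> // x; have [] := df x.
have dn (x : R) : is_derive x 1 (fun x => f (- x)) (- f' (- x)).
  have h := affine_derive (-1) 0 x df.
  have E : (fun y : R => f (- y)) = (fun y : R => f (-1 * y + 0)) by apply/funext => y; rewrite mulN1r addr0.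
  by rewrite E; apply: (is_derive_eq h); rewrite !mulN1r addr0.
have cn : continuous (fun x => - f' (- x)).
  by move=> x; apply: continuousN; apply: continuous_comp; [exact: opp_continuous|exact: cf'].
have an : ac (fun x => f (- x)) (fun x => - f' (- x)).
  have := @ac_C1 _ (fun x => f (- x)); rewrite (_ : derive1 _ = fun x => - f' (- x)).
    by apply=> // x; have [] := dn x.
  by apply/funext => x; rewrite derive1E; have h := dn x; exact: derive_val.
have ca : continuous (fun x => f' `|x|).
  by move=> x; apply: continuous_comp; [exact: norm_continuous|exact: cf'].
have ic a b : intg `[a, b] (fun x => f' `|x|) by exact: continuous_intg.
have pos a b : 0 <= a -> a <= b -> Int `[a, b] (fun x => f' `|x|) = f b - f a.
  move=> a0 ab; rewrite (af _ _ ab).2; apply: Int_ext => x /=; rewrite in_itv /= => /andP[ax _].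
  by rewrite ger0_norm // (le_trans a0).
have neg a b : a <= b -> b <= 0 -> Int `[a, b] (fun x => f' `|x|) = f (- a) - f (- b).
  move=> ab b0; rewrite -[RHS]opprB (an _ _ ab).2 -IntN //; last exact: continuous_intg.
  apply: Int_ext => x /=; rewrite in_itv /= => /andP[_ xb].
  by rewrite ler0_norm ?opprK // (le_trans xb).
move=> a b ab; split; first exact: intg_sg.
have [a0|a0] := leP 0 a.
  by rewrite Int_sgr // pos // !ger0_norm // (le_trans a0).
have [b0|/ltW b0] := leP b 0.
  by rewrite Int_sgl // neg // opprB !ler0_norm // ltW.
rewrite (Int_sg (ltW a0) b0) // pos // neg // ?(ltW a0) // oppr0 (ger0_norm b0) (ltr0_norm a0).
by ring.
Qed.

End signed_integrals.

Section bogomolny.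
Context {R : realType} (omega : R).
Local Notation mu := (@lebesgue_measure R).
Local Notation fn := (R -> R[i]).
Implicit Types (u w g h : fn) (d x y : R).

Local Notation Re u := (fun x => complex.Re (u x)).
Local Notation Im u := (fun x => complex.Im (u x)).

Lemma H1_vanish w (e : R) : H1 w -> 0 < e -> exists N : R, forall x, N <= `|x| -> nsq (w x) <= e.
Proof.
move=> hw e0; have iw := L2c_nsq (H1_L2c hw); pose d := e / (4 * (Df w + 1)).
have D1 : 0 < 4 * (Df w + 1) by rewrite mulr_gt0 // ltr_wpDl // Df_ge0.
have d0 : 0 < d by rewrite divr_gt0.
have dD : d * Df w <= e / 4.
  have : d * (4 * (Df w + 1)) = e by rewrite /d divfK // gt_eqF.
  by move: (Df w) d d0 => a b; clear; lra.
have ed : 0 < e * d / 4 by rewrite divr_gt0 // mulr_gt0.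
have [n hn] := Int_tail iw (fun x => nsq_ge0 (w x)) ed.
have key x a b : a <= x <= b -> b - a = d -> `[a, b]%classic `<=` co n%:R -> nsq (w x) <= e.
  move=> /andP[ax xb] bad hco; have ab := le_trans ax xb.
  have pt y : `[a, b]%classic y -> nsq (w x) - 2 * (d * Df w) <= 2 * nsq (w y).
    rewrite /= in_itv /= => /andP[ay yb].
    have h : nsq (w y - w x) <= d * Df w.
      apply: (le_trans (H1_holder x y hw)); rewrite ler_wpM2r ?Df_ge0 // ler_norml.
      by move: bad ax xb ay yb; clear => *; apply/andP; split; lra.
    by have := nsq_le_add h; move: (nsq _) (nsq _) (d * Df w) => p q r; clear; lra.
  have i1 : intg `[a, b] (fun y => nsq (w y)) by exact: intg_sub.
  have h1 : Int `[a, b] (fun=> nsq (w x) - 2 * (d * Df w)) <= Int `[a, b] (fun y => 2 * nsq (w y)).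
    by apply: Int_le => //; [exact: cst_intg|exact: intgZ].
  have mc := @measurable_co R n%:R.
  have h2 : Int `[a, b] (fun y => nsq (w y)) <= Int (co n%:R) (fun y => nsq (w y)).
    by apply: Int_subset => //; [exact: intg_sub|move=> y _; exact: nsq_ge0].
  move: h1; rewrite Int_cst // bad IntZ // => h1.
  have h3 : (nsq (w x) - 2 * (d * Df w)) * d <= e / 2 * d.
    by move: (Int _ _) (Int _ _) h1 h2 hn => p q; move: (nsq _ - _) => r; clear; lra.
  move: h3; rewrite ler_pM2r //; move: (nsq _) (d * Df w) dD => p q; clear; lra.
exists (n%:R + 1) => x hx; have [x0|/ltW x0] := leP 0 x.
  apply: (key x x (x + d)); first by rewrite lexx lerDl ltW.
    by rewrite addrC addKr.
  move=> y /=; rewrite in_itv /= => /andP[xy _]; rewrite /co /= in_itv /= => /andP[_].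
  rewrite leNgt => /negP; apply; apply: lt_le_trans xy; move: hx; rewrite ger0_norm // => hx.
  by apply: lt_le_trans hx; rewrite ltrDl.
apply: (key x (x - d) x); first by rewrite lexx gerBl ltW.
  by rewrite opprB addrC subrK.
move=> y /=; rewrite in_itv /= => /andP[_ yx]; rewrite /co /= in_itv /= => /andP[+ _].
rewrite leNgt => /negP; apply; apply: le_lt_trans yx _; move: hx; rewrite ler0_norm // lerNr => hx.
by apply: (le_lt_trans hx); rewrite opprD gtrDl oppr_lt0.
Qed.

(* The profile satisfies [|phi'| = sqrt (omega + 1 - ln phi^2) phi]; truncating at [d]
   keeps this slope bounded and continuous down to [y = 0]. *)
Definition sdel (d y : R) : R := Num.sqrt (Num.max 0 (omega + 1 - ln (Num.max y d))).

Lemma sdel_ge0 d y : 0 <= sdel d y. Proof. exact: sqrtr_ge0. Qed.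

Lemma maxr_lip (c y x : R) : `|Num.max y c - Num.max x c| <= `|y - x|.
Proof.
have a : - `|y - x| <= y - x by rewrite lerNl -normrN ler_norm.
have b := ler_norm (y - x).
by move: `|y - x| (normr_ge0 (y - x)) a b => q *; case: (leP y c) => h1; case: (leP x c) => h2;
  rewrite ler_norml; apply/andP; split; lra.
Qed.

Lemma sdel_cont d : 0 < d -> continuous (sdel d).
Proof.
move=> d0; have cm : continuous (fun y : R => Num.max y d).
  by apply: continuousEI => x e e0; exists e => // y; apply: le_trans; exact: maxr_lip.
have cl : continuous (fun y : R => omega + 1 - ln (Num.max y d)).
  move=> x; apply: cvgB; first exact: cvg_cst.
  apply: (@continuous_comp _ _ _ (fun y : R => Num.max y d) (@ln R)); first exact: cm.
  by apply: continuous_ln; rewrite lt_max d0 orbT.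
move=> x; apply: continuous_comp; last exact: sqrt_continuous.
have cM : continuous (fun y : R => Num.max 0 y).
  apply: continuousEI => x' e e0; exists e => // y; apply: le_trans.
  by rewrite !(maxC 0); exact: maxr_lip.
by apply: continuous_comp; [exact: cl|exact: cM].
Qed.

Lemma sdel_sqr d y : sdel d y ^+ 2 = Num.max 0 (omega + 1 - ln (Num.max y d)).
Proof. by rewrite sqr_sqrtr // le_max lexx. Qed.

Lemma sdel_mono d x y : 0 < d -> x <= y -> sdel d y <= sdel d x.
Proof.
move=> d0 xy; rewrite /sdel ler_wsqrtr // ge_max le_max lexx /= le_max; apply/orP; right.
rewrite lerD2l lerN2 ln_le //; first by rewrite lt_max d0 orbT.
by rewrite ge_max !le_max xy lexx orbT.
Qed.

Lemma sdel_le d y : 0 < d -> sdel d y <= sdel d 0.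
Proof.
move=> d0; have [y0|/ltW y0] := leP 0 y; first exact: sdel_mono.
rewrite le_eqVlt; apply/orP; left; apply/eqP; rewrite /sdel.
by rewrite (max_r (ltW d0)) (max_r (le_trans y0 (ltW d0))).
Qed.

Lemma sdel_sqr_le d y : 0 < d -> d <= expR (omega + 1) -> 0 <= y -> y <= expR (omega + 1) ->
  sdel d y ^+ 2 * y <= (omega + 1) * y - y * ln y.
Proof.
move=> d0 dE; rewrite le_eqVlt => /predU1P[<- _|y0 yE]; first by rewrite !mulr0 mul0r subr0.
rewrite [y * _]mulrC -mulrBl ler_pM2r // sdel_sqr ge_max.
have ly : ln y <= omega + 1 by rewrite -(expRK (omega + 1)) ln_le.
have lm : ln y <= ln (Num.max y d) by rewrite ln_le // le_max lexx.
by apply/andP; split; move: ly lm; clear; lra.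
Qed.

(** The superpotential of the square to be completed: along [w], the cross term is half the signed
    derivative of [Gam d (|w|^2)]. *)
Definition Gam (d y : R) : R := Int `[0, y] (sdel d).

Lemma Gam_diff d x y : 0 < d -> 0 <= x -> x <= y -> Gam d y - Gam d x = Int `[x, y] (sdel d).
Proof.
move=> d0 x0 xy; rewrite /Gam (Int_itv_split x0 xy); first by rewrite addrC addKr.
by apply: continuous_intg; exact: sdel_cont.
Qed.

Lemma Gam0 d : Gam d 0 = 0. Proof. exact: Int_itv1. Qed.

Lemma Gam_mono d x y : 0 < d -> 0 <= x -> x <= y -> Gam d x <= Gam d y.
Proof.
move=> d0 x0 xy; rewrite -subr_ge0 Gam_diff //; apply: Int_ge0 => z _; exact: sdel_ge0.
Qed.

Lemma Gam_incr d x y : 0 < d -> 0 <= x -> x <= y -> sdel d y * (y - x) <= Gam d y - Gam d x.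
Proof.
move=> d0 x0 xy; rewrite Gam_diff // -Int_cst //; apply: Int_le => //.
- exact: cst_intg.
- by apply: continuous_intg; exact: sdel_cont.
- by move=> z /=; rewrite in_itv /= => /andP[_ zy]; exact: sdel_mono.
Qed.

Lemma Gam_le d y : 0 < d -> 0 <= y -> Gam d y <= sdel d 0 * y.
Proof.
move=> d0 y0; rewrite -[X in _ * X]subr0 -Int_cst //; apply: Int_le => //.
- by apply: continuous_intg; exact: sdel_cont.
- exact: cst_intg.
- by move=> z _; exact: sdel_le.
Qed.

Lemma Gam_taylor d (Y e : R) : 0 < d -> 0 < e -> exists2 r : R, 0 < r & forall x y,
  0 <= x <= Y -> 0 <= y <= Y -> `|y - x| <= r -> `|Gam d y - Gam d x - sdel d x * (y - x)| <= e * `|y - x|.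
Proof.
move=> d0 e0; have [r r0 hr] := continuous_unif 0 Y (sdel_cont d0) e0; exists r => // x y hx hy hxy.
have cs := sdel_cont d0.
have main a b : 0 <= a -> a <= b -> (forall z, a <= z <= b -> `|sdel d z - sdel d x| <= e) ->
    `|Int `[a, b] (sdel d) - sdel d x * (b - a)| <= e * (b - a).
  move=> a0 ab h; rewrite -!Int_cst // -IntB //; [|exact: continuous_intg|exact: cst_intg].
  apply: Int_norm_le; [by []| |exact: cst_intg|].
    by apply: measurable_funB; [exact: continuous_measD|exact: measurable_cst].
  by move=> z /=; rewrite in_itv /=; exact: h.
have [xy|/ltW yx] := leP x y.
  case/andP: hx => x0 xY; case/andP: hy => y0 yY; rewrite Gam_diff // (ger0_norm (_ : 0 <= y - x)) ?subr_ge0 //.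
  apply: main => // z /andP[xz zy]; apply: hr; first by rewrite x0.
  by move: hxy; rewrite !ger0_norm ?subr_ge0 //; apply: le_trans; rewrite lerD2r.
have hxy' := hxy; case/andP: hx => x0 xY; case/andP: hy => y0 yY.
rewrite (_ : _ - _ - _ = - (Gam d x - Gam d y - sdel d x * (x - y))); last by ring.
rewrite normrN (distrC y) (ger0_norm (_ : 0 <= x - y)) ?subr_ge0 // Gam_diff //.
apply: main => // z /andP[yz zx]; apply: hr; first by rewrite x0.
rewrite (distrC z) ger0_norm ?subr_ge0 //; move: hxy; rewrite (distrC y) ger0_norm ?subr_ge0 //.
by apply: le_trans; rewrite lerD2l lerN2.
Qed.

(** Chain rule for a merely continuous [sdel]: the increment of [Gam] is linear up to a small
    multiple of the increment of [|w|^2], and the quadratic part of the latter is absorbed by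
    uniform continuity of [w]. *)
Lemma Gam_chain d w g (a b : R) : 0 < d -> continuous (Re w) -> continuous (Im w) -> hasd w g -> a <= b ->
  Gam d (nsq (w b)) - Gam d (nsq (w a)) =
  Int `[a, b] (fun x => 2 * (sdel d (nsq (w x)) * cdot (w x) (g x))).
Proof.
move=> d0 c1 c2 [_ a1 a2] ab; have cn : continuous (fun x => nsq (w x)) := ucb_cont ucb_nsq c1 c2.
have cs : continuous (fun x => sdel d (nsq (w x))).
  by move=> x; apply: continuous_comp; [exact: cn|exact: sdel_cont].
have cp1 : continuous (fun x => 2 * (sdel d (nsq (w x)) * complex.Re (w x))).
  by move=> x; apply: cvgM; [exact: cvg_cst|apply: cvgM; [exact: cs|exact: c1]].
have cp2 : continuous (fun x => 2 * (sdel d (nsq (w x)) * complex.Im (w x))).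
  by move=> x; apply: cvgM; [exact: cvg_cst|apply: cvgM; [exact: cs|exact: c2]].
have [Y Y0 hY] := continuous_bounded a b cn.
have [M M0 hM] := continuous_bounded a b (cmod_cont c1 c2).
have S0 := sdel_ge0 d 0; have S1 : 0 < sdel d 0 + 1 by rewrite ltr_wpDl.
rewrite (ac_chain (h := fun x => Gam d (nsq (w x))) ab a1 a2 cp1 cp2); last first.
  move=> e e0.
  have e1 : 0 < e / (4 * (M + 1)) by rewrite divr_gt0 // mulr_gt0 // ltr_wpDl // ltW.
  have e2 : 0 < e / (2 * (sdel d 0 + 1)) by rewrite divr_gt0 // mulr_gt0.
  have [r r0 hr] := Gam_taylor Y d0 e1.
  have [q1 q10 hq1] := continuous_unif a b cn r0.
  have e3 : 0 < e / (2 * (sdel d 0 + 1)) / 2 by rewrite divr_gt0.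
  have [q2 q20 hq2] := continuous_unif a b c1 e3; have [q3 q30 hq3] := continuous_unif a b c2 e3.
  exists (Num.min q1 (Num.min q2 q3)); first by rewrite !lt_min q10 q20.
  move=> x y xab yab; rewrite !le_min => /andP[xy1 /andP[xy2 xy3]].
  have nx : 0 <= nsq (w x) <= Y by rewrite nsq_ge0 /= (le_trans (ler_norm _)) // hY.
  have ny : 0 <= nsq (w y) <= Y by rewrite nsq_ge0 /= (le_trans (ler_norm _)) // hY.
  have h1 := hr _ _ nx ny (hq1 _ _ xab xy1).
  have h2 := nsq_sub_le (w y) (w x).
  have mx : cmod (w x) <= M by rewrite (le_trans (ler_norm _)) // hM.
  have my : cmod (w y) <= M by rewrite (le_trans (ler_norm _)) // hM.
  have h3 := cmod_le (w y - w x); rewrite ReB ImB in h3.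
  set D1 := complex.Re (w y) - complex.Re (w x) in h3 *; set D2 := complex.Im (w y) - complex.Im (w x) in h3 *.
  have h4 : `|D1| <= e / (2 * (sdel d 0 + 1)) / 2 by exact: hq2.
  have h5 : `|D2| <= e / (2 * (sdel d 0 + 1)) / 2 by exact: hq3.
  have E : nsq (w y) - nsq (w x) = 2 * (complex.Re (w x) * D1 + complex.Im (w x) * D2) + (D1 ^+ 2 + D2 ^+ 2).
    by rewrite /nsq /D1 /D2; ring.
  set N := `|D1| + `|D2| in h3 *; have N0 : 0 <= N by rewrite addr_ge0.
  have k1 : e / (4 * (M + 1)) * `|nsq (w y) - nsq (w x)| <= e / 2 * N.
    have h6 : `|nsq (w y) - nsq (w x)| <= N * (2 * (M + 1)).
      apply: (le_trans h2); apply: ler_pM; rewrite ?cmod_ge0 ?addr_ge0 ?cmod_ge0 //.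
      by move: (cmod _) (cmod _) mx my => p q; clear; lra.
    apply: (le_trans (ler_wpM2l (ltW e1) h6)); rewrite le_eqVlt; apply/orP; left; apply/eqP; field.
    by rewrite gt_eqF // ltr_wpDl // ltW.
  have k2 : `|sdel d (nsq (w x)) * (D1 ^+ 2 + D2 ^+ 2)| <= e / 2 * N.
    rewrite normrM (ger0_norm (sdel_ge0 _ _)) (ger0_norm (addr_ge0 (sqr_ge0 _) (sqr_ge0 _))).
    have : D1 ^+ 2 + D2 ^+ 2 <= e / (2 * (sdel d 0 + 1)) * N.
      have NN : N <= e / (2 * (sdel d 0 + 1)) by rewrite (splitr (e / _)) lerD.
      rewrite -[D1 ^+ 2]ger0_norm ?sqr_ge0 // -[D2 ^+ 2]ger0_norm ?sqr_ge0 // !normrX.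
      apply: le_trans (ler_wpM2r N0 NN); rewrite /N; move: `|D1| `|D2| (normr_ge0 D1) (normr_ge0 D2).
      by clear => p q *; rewrite !expr2; nra.
    move=> h; apply: (@le_trans _ _ ((sdel d 0 + 1) * (e / (2 * (sdel d 0 + 1)) * N))).
      apply: ler_pM => //; rewrite ?sdel_ge0 ?addr_ge0 ?sqr_ge0 //.
      by rewrite (le_trans (sdel_le _ d0)) // lerDl.
    by rewrite le_eqVlt; apply/orP; left; apply/eqP; field; rewrite gt_eqF.
  have -> : Gam d (nsq (w y)) - Gam d (nsq (w x)) - 2 * (sdel d (nsq (w x)) * complex.Re (w x)) * D1
      - 2 * (sdel d (nsq (w x)) * complex.Im (w x)) * D2 =
      (Gam d (nsq (w y)) - Gam d (nsq (w x)) - sdel d (nsq (w x)) * (nsq (w y) - nsq (w x))) +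
      sdel d (nsq (w x)) * (D1 ^+ 2 + D2 ^+ 2).
    by rewrite E; ring.
  apply: (le_trans (ler_normD _ _)); apply: (@le_trans _ _ (e / 2 * N + e / 2 * N)).
    by rewrite lerD // (le_trans h1).
  by rewrite -mulrDl -splitr.
by apply: Int_ext => x _; rewrite cdotE; ring.
Qed.

Definition Sdel (d : R) (z : R[i]) : R[i] := (sdel d (nsq z))%:C * z.

(* The square completed in the energy, for a profile centred at [x0]. *)
Definition Bog (d x0 : R) w : R :=
  Int setT (fun x => nsq (dx w x + (sg x0 x)%:C * Sdel d (w x))).

Lemma L2r_bounded (f c : R -> R) (C : R) : L2r f -> measurable_fun setT c -> (forall x, `|c x| <= C) ->
  L2r (fun x => c x * f x).
Proof.
move=> [mf hf] mc hc; split; first exact: measurable_funM.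
apply: (@intg_dom _ _ _ (fun x => C ^+ 2 * f x ^+ 2)) => //.
- by apply: measurable_funX; exact: measurable_funM.
- move=> x _; rewrite (ger0_norm (sqr_ge0 _)) exprMn ler_wpM2r ?sqr_ge0 //.
  rewrite -[c x ^+ 2]ger0_norm ?sqr_ge0 // normrX ler_pXn2r ?nnegrE //.
  exact: le_trans (hc x).
- exact: intgZ.
Qed.

Lemma Bog_L2c d x0 w : 0 < d -> H1 w ->
  L2c (fun x => (sg x0 x)%:C * Sdel d (w x)) /\ L2c (fun x => dx w x + (sg x0 x)%:C * Sdel d (w x)).
Proof.
move=> d0 hw; have [c1 c2] := H1_cont hw; have [l1 l2] := H1_L2c hw; have [[k1 k2] _ _] := dx_hasd hw.
have cs : continuous (fun x => sdel d (nsq (w x))).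
  move=> x; apply: continuous_comp; last exact: sdel_cont.
  exact: (ucb_cont ucb_nsq c1 c2).
have ms : measurable_fun setT (fun x => sg x0 x * sdel d (nsq (w x))).
  by apply: measurable_funM; [exact: sg_meas|exact: continuous_meas].
have bs x : `|sg x0 x * sdel d (nsq (w x))| <= sdel d 0.
  by rewrite normrM sg_norm mul1r ger0_norm ?sdel_ge0 // sdel_le.
have m1 := L2r_bounded l1 ms bs; have m2 := L2r_bounded l2 ms bs.
have E1 : (fun x => complex.Re ((sg x0 x)%:C * Sdel d (w x))) =
    fun x => sg x0 x * sdel d (nsq (w x)) * complex.Re (w x).
  by apply/funext => x; rewrite /Sdel !ReZ mulrA.
have E2 : (fun x => complex.Im ((sg x0 x)%:C * Sdel d (w x))) =
    fun x => sg x0 x * sdel d (nsq (w x)) * complex.Im (w x).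
  by apply/funext => x; rewrite /Sdel !ImZ mulrA.
have m : L2c (fun x => (sg x0 x)%:C * Sdel d (w x)) by split; rewrite ?E1 ?E2.
split=> //; case: m => m1' m2'; split.
  rewrite (_ : (fun x => _) = fun x => complex.Re (dx w x) + complex.Re ((sg x0 x)%:C * Sdel d (w x))).
    exact: L2rD.
  by apply/funext => x; rewrite ReD.
rewrite (_ : (fun x => _) = fun x => complex.Im (dx w x) + complex.Im ((sg x0 x)%:C * Sdel d (w x))).
  exact: L2rD.
by apply/funext => x; rewrite ImD.
Qed.

(** Each half-line integrates an exact derivative. The sign change at [x0] makes the two
    contributions add up to [- Gam d (|w(x0)|^2)], and the terms at infinity vanish because [w]
    does. *)
Lemma Bog_cross d x0 w : 0 < d -> H1 w ->
  Int setT (fun x => cdot (dx w x) ((sg x0 x)%:C * Sdel d (w x))) <= - Gam d (nsq (w x0)).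
Proof.
move=> d0 hw; have [c1 c2] := H1_cont hw; have hg := dx_hasd hw; have [lg _ _] := hg.
have [ls _] := Bog_L2c x0 d0 hw; have ii := intg_Ic lg ls.
set f := fun x => cdot (dx w x) ((sg x0 x)%:C * Sdel d (w x)) in ii *.
have fE x : f x = sg x0 x * (sdel d (nsq (w x)) * cdot (w x) (dx w x)).
  by rewrite /f /Sdel !cdotZr cdotC.
pose F x := 2 * (sdel d (nsq (w x)) * cdot (w x) (dx w x)).
have FE x : F x = 2 * (sg x0 x * f x) by rewrite /F fE [sg x0 x * (_ * _)]mulrA -expr2 sg_sqr mul1r.
have iF : intg setT F.
  by apply: (intg_ext (f := fun x => 2 * (sg x0 x * f x))) => //; apply: intgZ => //; exact: intg_sg.
apply/ler_addgt0Pr => e e0; have e4 : 0 < e / 4 by rewrite divr_gt0.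
have [n hn] := Int_tail (intg_abs measurableT ii) (fun x => normr_ge0 _) e4.
have S1 : 0 < sdel d 0 + 1 by rewrite ltr_wpDl // sdel_ge0.
have [N hN] := H1_vanish hw (divr_gt0 e4 S1).
pose r := Num.max (Num.max n%:R `|N|) `|x0|.
have r0 : 0 <= r by rewrite !le_max ler0n.
have hG x : `|x| = r -> Gam d (nsq (w x)) <= e / 4.
  move=> xr; apply: (le_trans (Gam_le d0 (nsq_ge0 _))).
  have := hN x; rewrite xr => /(_ _) h.
  have {}h : nsq (w x) <= e / 4 / (sdel d 0 + 1).
    by apply: h; rewrite (le_trans (ler_norm N)) // !le_max lexx orbT.
  apply: (@le_trans _ _ ((sdel d 0 + 1) * (e / 4 / (sdel d 0 + 1)))).
    by apply: ler_pM; rewrite ?sdel_ge0 ?nsq_ge0 // lerDl.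
  by rewrite mulrCA divff ?mulr1 // gt_eqF.
have xr : `|x0| <= r by rewrite !le_max lexx !orbT.
move: (xr); rewrite ler_norml => /andP[xr1 xr2].
have hI : Int `[- r, r] f <= - Gam d (nsq (w x0)) + e / 4.
  have -> : Int `[- r, r] f = 2^-1 * Int `[- r, r] (fun x => sg x0 x * F x).
    rewrite -IntZ //; last by apply: intg_sg => //; exact: intg_sub.
    apply: Int_ext => x _; have s2 := sg_sqr x0 x.
    have E (p q : R) : 2^-1 * (p * (2 * (p * q))) = p ^+ 2 * q by field.
    by rewrite FE E s2 mul1r.
  rewrite (Int_sg xr1 xr2); last exact: intg_sub.
  rewrite -(Gam_chain d0 c1 c2 hg xr1) -(Gam_chain d0 c1 c2 hg xr2).
  have := hG r (ger0_norm r0); have := hG (- r); rewrite normrN (ger0_norm r0) => /(_ erefl).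
  by move: (Gam _ _) (Gam _ _) (Gam _ _) => a b c; clear; lra.
have hC : `|Int (co r) f| <= e / 4.
  have mc := @measurable_co R r; apply: (le_trans (Int_norm mc (intg_sub mc ii))).
  apply: le_trans (ltW hn); apply: Int_co_le => //; last exact: intg_abs.
  by rewrite !le_max lexx.
rewrite (Int_co r ii); move: hI hC (ler_norm (Int (co r) f)); move: (Int _ _) (Int _ _) (Gam _ _) => a b c.
by move: `|b| => q; clear -e0; lra.
Qed.

(** Expand the square. The ceiling on [|w|^2] gives [s^2 y <= (omega + 1) y - y ln y], where the
    truncation can only lower [s], and the cross term supplies the value at the centre [x0]. *)
Lemma bogomolny d x0 w : 0 < d -> d <= expR (omega + 1) -> W w ->
  (forall x, nsq (w x) <= expR (omega + 1)) ->
  Bog d x0 w + 2 * Gam d (nsq (w x0)) <= Df w + (omega + 1) * Qf w + Au w - Pu w.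
Proof.
move=> d0 dE ww hb; have hw := W_H1 ww; have [lg _ _] := dx_hasd hw.
have [ls lb] := Bog_L2c x0 d0 hw; have [ig eg] := Lg_intg ww.
have iq := L2c_nsq (W_L2c ww); have i1 := L2c_nsq lg; have i2 := L2c_nsq ls; have ic := intg_Ic lg ls.
have hX := Bog_cross x0 d0 hw.
have eB : Bog d x0 w = Df w + 2 * Int setT (fun x => cdot (dx w x) ((sg x0 x)%:C * Sdel d (w x))) +
    Int setT (fun x => nsq ((sg x0 x)%:C * Sdel d (w x))).
  rewrite DfE BfE Ic_nsq -IntZ // -IntD //; last exact: intgZ.
  rewrite -IntD //; last by apply: intgD => //; exact: intgZ.
  by apply: Int_ext => x _; rewrite nsqD.
have hs : Int setT (fun x => nsq ((sg x0 x)%:C * Sdel d (w x))) <=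
    Int setT (fun x => omega * nsq (w x) - Glog (nsq (w x))).
  apply: Int_le => //; first by apply: intgB => //; exact: intgZ.
  move=> x _; rewrite nsqZ sg_sqr mul1r /Sdel nsqZ.
  have := sdel_sqr_le d0 dE (nsq_ge0 (w x)) (hb x); rewrite /Glog.
  move: (ln (nsq (w x))) => l; move: (sdel d (nsq (w x))) (nsq (w x)) => p q; clear; lra.
move: hs; rewrite IntB //; last exact: intgZ.
rewrite IntZ // -(Qf_nsq w) eg eB.
move: hX; move: (Int _ _) (Int _ _) (Gam _ _) (Df w) (Qf w) (Au w) (Pu w) => a b c p q r s; clear; lra.
Qed.

Lemma Bog_ge0 d x0 w : 0 <= Bog d x0 w.
Proof. by apply: Int_ge0 => x _; exact: nsq_ge0. Qed.

End bogomolny.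

Section scaling.
Context {R : realType} (gamma : R).
Local Notation fn := (R -> R[i]).
Implicit Types (u w : fn).

Lemma Lg_scl u (m : R) : W u -> m != 0 ->
  Int setT (fun x => Glog (nsq (scl m u x))) =
  m ^+ 2 * (Int setT (fun x => Glog (nsq (u x))) + ln (m ^+ 2) * Qf u).
Proof.
move=> wu m0; have [ig eg] := Lg_intg wu; have iq := L2c_nsq (W_L2c wu).
rewrite Qf_nsq -IntZ // -IntD //; last exact: intgZ.
rewrite -IntZ //; last by apply: intgD => //; exact: intgZ.
apply: Int_ext => x _; rewrite sclE nsqZ /Glog.
have [->|zn] := eqVneq (nsq (u x)) 0; first by rewrite !mulr0 !mul0r; ring.
rewrite lnM ?posrE ?exprn_even_gt0 // ?lt_neqAle 1?eq_sym ?zn ?nsq_ge0 //; ring.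
Qed.

(** The energy is quadratic up to the logarithm of the scale, which couples to the charge alone.
    This is what makes the rescaled lower bound computable. *)
Lemma En_scl u (m : R) : W u -> m != 0 ->
  En gamma (scl m u) = m ^+ 2 * (En gamma u - ln (m ^+ 2) * Qf u).
Proof.
move=> wu m0; have [_ e1] := Lg_intg wu; have [_ e2] := Lg_intg (W_scl m wu).
have := Lg_scl wu m0; rewrite e1 e2 (Qf_scl m wu) /En (Df_scl m wu) sclE nsqZ => h.
have -> : m ^+ 2 * Df u - gamma * (m ^+ 2 * nsq (u 0)) + Au (scl m u) - Pu (scl m u) =
  m ^+ 2 * Df u - gamma * (m ^+ 2 * nsq (u 0)) - (Pu (scl m u) - Au (scl m u) - m ^+ 2 * Qf u) - m ^+ 2 * Qf u.
  by move: (Au _) (Pu _) (m ^+ 2 * Qf u) => a b c; ring.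
rewrite h; move: (ln (m ^+ 2)) => f; move: (Df u) (nsq _) (Au u) (Pu u) (Qf u) (m ^+ 2) => a b c d e g; ring.
Qed.

End scaling.

(** * The peak *)

Section peak.
Context {R : realType} (omega gamma : R) (gamma_gt0 : 0 < gamma).
Local Notation mu := (@lebesgue_measure R).
Local Notation fn := (R -> R[i]).
Local Notation phi := (phi_peak omega gamma).
Implicit Types (x t r : R).

(** The powers of the squared profile on the half-line: [c = 1 / 2] is the peak, [c = 1] its square
    and [c = - 1 / 2] its inverse. *)
Definition gss (c t : R) : R := expR (c * (omega + 1 - (t + gamma / 2) ^+ 2)).
Local Notation pk := (gss (1 / 2)).
Local Notation q := (gss 1).
Local Notation pa x := (`|x| + gamma / 2).

Lemma gss_gt0 c t : 0 < gss c t. Proof. exact: expR_gt0. Qed.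

Lemma gss_derive c x : is_derive x 1 (gss c) (- (2 * c) * (x + gamma / 2) * gss c x).
Proof.
have d : is_derive x (1 : R) (fun t : R => c * (omega + 1 - (t + gamma / 2) ^+ 2)) (- (2 * c) * (x + gamma / 2)).
  by apply: is_derive_eq; rewrite /GRing.scale /=; ring.
have := @is_derive1_comp _ (@expR R) _ _ _ _ (is_derive_expR _) d.
by move=> h; apply: (is_derive_eq h); rewrite mulrC.
Qed.

Lemma gss_cont c : continuous (gss c). Proof. exact: is_derive_cont (gss_derive c). Qed.

Lemma pa_ge x : gamma / 2 <= pa x. Proof. by rewrite lerDr. Qed.

Lemma pk_sqr t : pk t ^+ 2 = q t.
Proof. by rewrite /gss -expRM_natl -mulrA; congr expR; rewrite mulr_natl; field. Qed.

Lemma ln_q t : ln (q t) = omega + 1 - (t + gamma / 2) ^+ 2.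
Proof. by rewrite /gss expRK mul1r. Qed.

Lemma phiE x : phi x = (pk `|x|)%:C.
Proof. by rewrite /phi_peak /gss -expRD; congr ((expR _)%:C); field. Qed.

Lemma nsq_phi x : nsq (phi x) = q `|x|.
Proof. by rewrite phiE /nsq /= expr0n addr0 pk_sqr. Qed.

Lemma Int_even f f' r : (forall x, is_derive x 1 f (f' x)) -> continuous f' -> 0 <= r ->
  Int `[- r, r] (fun x => f' `|x|) = 2 * (f r - f 0) :> R.
Proof.
move=> df cf r0; have a := ac_even df cf; have nr : - r <= 0 by rewrite oppr_le0.
have ca : continuous (fun x => f' `|x|).
  by move=> x; apply: continuous_comp; [exact: norm_continuous|exact: cf].
have [_] := a _ _ nr; have [_] := a _ _ r0; rewrite normrN normr0 (ger0_norm r0).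
rewrite Int_sgr // Int_sgl //; last exact: continuous_intg.
rewrite (Int_itv_split nr r0); last exact: continuous_intg.
by move: (Int _ _) (Int _ _) => p s h1 h2; lra.
Qed.

Lemma paq_derive x : is_derive x 1 (fun t => (t + gamma / 2) * q t)
  (q x - 2 * (x + gamma / 2) ^+ 2 * q x).
Proof.
have d1 : is_derive x (1 : R) (fun t : R => t + gamma / 2) 1 by apply: is_derive_eq; rewrite addr0.
have := is_deriveM d1 (gss_derive 1 x); move=> h; apply: (is_derive_eq h).
by rewrite /GRing.scale /=; ring.
Qed.

Lemma qpoly_cont (p : R -> R) : continuous p -> continuous (fun t => p t * q t).
Proof. by move=> cp t; apply: cvgM; [exact: cp|exact: gss_cont]. Qed.

Lemma pa_cont : continuous (fun t : R => t + gamma / 2).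
Proof. by move=> t; apply: cvgD; [exact: cvg_id|exact: cvg_cst]. Qed.

Lemma pa2_cont : continuous (fun t : R => (t + gamma / 2) ^+ 2).
Proof. by move=> t; rewrite /continuous_at expr2; apply: cvgM; exact: pa_cont. Qed.

Lemma abs_cont (p : R -> R) : continuous p -> continuous (fun x => p `|x|).
Proof. by move=> cp x; apply: continuous_comp; [exact: norm_continuous|exact: cp]. Qed.

Lemma Int_pa_q r : 0 <= r -> Int `[- r, r] (fun x => 2 * pa x * q `|x|) = 2 * (q 0 - q r).
Proof.
move=> r0; have c1 : continuous (fun t : R => - (2 * 1) * (t + gamma / 2) * q t).
  by apply: qpoly_cont => t; apply: cvgM; [exact: cvg_cst|exact: pa_cont].
rewrite (_ : 2 * (q 0 - q r) = - (2 * (q r - q 0))); last by ring.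
rewrite -(Int_even (gss_derive 1) c1 r0) -IntN //; last by apply: continuous_intg; exact: (abs_cont c1).
by apply: Int_ext => x _; ring.
Qed.

Lemma Int_pa2_q r : 0 <= r ->
  Int `[- r, r] (fun x => q `|x| - 2 * pa x ^+ 2 * q `|x|) = 2 * ((r + gamma / 2) * q r - gamma / 2 * q 0).
Proof.
move=> r0; have c1 : continuous (fun t : R => q t - 2 * (t + gamma / 2) ^+ 2 * q t).
  move=> t; apply: cvgB; first exact: gss_cont.
  by apply: (qpoly_cont (p := fun t => 2 * (t + gamma / 2) ^+ 2)) => s; apply: cvgM; [exact: cvg_cst|exact: pa2_cont].
by have := Int_even paq_derive c1 r0; rewrite add0r.
Qed.

Lemma q_abs_cont : continuous (fun x => q `|x|). Proof. exact: (abs_cont (p := q) (gss_cont (c := 1))). Qed.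

Lemma pa2q_cont : continuous (fun x => pa x ^+ 2 * q `|x|).
Proof. by apply: (abs_cont (p := fun t => (t + gamma / 2) ^+ 2 * q t)); apply: qpoly_cont; exact: pa2_cont. Qed.

Lemma paq_cont : continuous (fun x => 2 * pa x * q `|x|).
Proof.
apply: (abs_cont (p := fun t => 2 * (t + gamma / 2) * q t)); apply: qpoly_cont => t.
by apply: cvgM; [exact: cvg_cst|exact: pa_cont].
Qed.

Lemma q_intg : intg setT (fun x => q `|x|).
Proof.
suff h (n : nat) : Int `[- n%:R, n%:R] (fun x => q `|x|) <= 2 * q 0 / gamma.
  by have [] := ge0_intg_sup (fun x => ltW (gss_gt0 1 `|x|)) (continuous_meas q_abs_cont) h
    (fun n => continuous_intg _ _ q_abs_cont).
rewrite ler_pdivlMr // mulrC -IntZ //; last by apply: continuous_intg; exact: q_abs_cont.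
apply: (@le_trans _ _ (Int `[- n%:R, n%:R] (fun x => 2 * pa x * q `|x|))).
  apply: Int_le => //.
  - by apply: intgZ => //; apply: continuous_intg; exact: q_abs_cont.
  - by apply: continuous_intg; exact: paq_cont.
  - by move=> x _; rewrite ler_wpM2r ?(ltW (gss_gt0 _ _)) // -ler_pdivrMl // mulrC pa_ge.
by rewrite Int_pa_q // ler_pM2l // gerBl ltW // gss_gt0.
Qed.

Lemma pa2q_ge0 x : 0 <= pa x ^+ 2 * q `|x|.
Proof. by rewrite mulr_ge0 ?sqr_ge0 // ltW // gss_gt0. Qed.

Lemma Int_pa2_q' r : 0 <= r -> 2 * Int `[- r, r] (fun x => pa x ^+ 2 * q `|x|) =
  Int `[- r, r] (fun x => q `|x|) + gamma * q 0 - 2 * ((r + gamma / 2) * q r).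
Proof.
move=> r0; have i1 := @continuous_intg _ (- r) r _ q_abs_cont.
have i2 := @continuous_intg _ (- r) r _ pa2q_cont.
have := Int_pa2_q r0; rewrite (@Int_ext _ _ _ (fun x => q `|x| - 2 * (pa x ^+ 2 * q `|x|))); last first.
  by move=> x _; rewrite mulrA.
rewrite IntB // ?IntZ //; last exact: intgZ.
by move: (Int _ _) (Int _ _) (_ * q r) (q 0) => a b c d; lra.
Qed.

Lemma pa2q_intg : intg setT (fun x => pa x ^+ 2 * q `|x|).
Proof.
have iq := q_intg.
suff h (n : nat) : Int `[- n%:R, n%:R] (fun x => pa x ^+ 2 * q `|x|) <= Int setT (fun x => q `|x|) + gamma * q 0.
  by have [] := ge0_intg_sup pa2q_ge0 (continuous_meas pa2q_cont) h (fun n => continuous_intg _ _ pa2q_cont).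
have := Int_pa2_q' (ler0n _ n).
have : Int `[- n%:R, n%:R] (fun x => q `|x|) <= Int setT (fun x => q `|x|).
  by apply: Int_subset => // x _; exact: ltW (gss_gt0 _ _).
have : 0 <= (n%:R + gamma / 2) * q n%:R.
  by rewrite mulr_ge0 ?(ltW (gss_gt0 _ _)) // addr_ge0 // divr_ge0 // ltW.
have : 0 <= Int `[- n%:R, n%:R] (fun x => pa x ^+ 2 * q `|x|) by apply: Int_ge0 => x _; exact: pa2q_ge0.
have : 0 <= gamma * q 0 by rewrite mulr_ge0 ?(ltW (gss_gt0 _ _)) // ltW.
move: (Int _ _) (Int _ _) (Int _ _) ((n%:R + gamma / 2) * q n%:R) (gamma * q 0) => a b c d f.
by clear; lra.
Qed.

Definition dphi : fn := fun x => (sg 0 x * (- pa x * pk `|x|))%:C.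

Lemma nsq_dphi x : nsq (dphi x) = pa x ^+ 2 * q `|x|.
Proof.
rewrite /dphi /nsq [complex.Re _]/= [complex.Im _]/= expr0n addr0 exprMn sg_sqr exprMn sqrrN.
by rewrite pk_sqr mul1r.
Qed.

Lemma L2c_real (f : R -> R) : measurable_fun setT f -> intg setT (fun x => f x ^+ 2) ->
  L2c (fun x => (f x)%:C).
Proof. by move=> mf hf; split=> //=; exact: L2r0. Qed.

Lemma pk_abs_cont : continuous (fun x => pk `|x|). Proof. exact: (abs_cont (p := pk) (gss_cont (c := 1 / 2))). Qed.

Lemma phi_fun : phi = fun x => (pk `|x|)%:C. Proof. by apply/funext => x; rewrite phiE. Qed.

Lemma hasd_phi : hasd phi dphi.
Proof.
have c1 : continuous (fun t : R => - (2 * (1 / 2)) * (t + gamma / 2) * pk t).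
  move=> t; apply: cvgM; last exact: gss_cont.
  by apply: cvgM; [exact: cvg_cst|exact: pa_cont].
have a := ac_even (gss_derive (1 / 2)) c1.
split.
- apply: L2c_real.
    apply: measurable_funM; first exact: sg_meas.
    apply: continuous_meas; have := abs_cont c1; rewrite (_ : (fun x => _) = fun x : R => - pa x * pk `|x|) //.
    by apply/funext => x; field.
  apply: intg_ext pa2q_intg => x; rewrite -nsq_dphi /dphi /nsq /= expr0n addr0 //.
- apply: ac_ext a => x; first by rewrite phiE.
  by rewrite /dphi [RHS]/=; congr (_ * _); field.
- by apply: ac_ext (@ac0 R) => x; rewrite ?phiE.
Qed.

Lemma H1_phi : H1 phi.
Proof.
apply/H1P; split; last by exists dphi; exact: hasd_phi.
- by rewrite phi_fun; exact: pk_abs_cont.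
- by rewrite phi_fun /=; move=> x; exact: cvg_cst.
- rewrite phi_fun; apply: L2c_real; first exact: continuous_meas pk_abs_cont.
  by apply: intg_ext q_intg => x; rewrite pk_sqr.
Qed.

Lemma Qf_phi : Qf phi = Int setT (fun x => q `|x|).
Proof. by rewrite Qf_nsq; apply: Int_ext => x _; rewrite nsq_phi. Qed.

Lemma Df_phi : Df phi = Int setT (fun x => pa x ^+ 2 * q `|x|).
Proof.
rewrite DfE (Bf_hasd H1_phi H1_phi hasd_phi hasd_phi) Ic_nsq.
by apply: Int_ext => x _; rewrite nsq_dphi.
Qed.

Lemma W_phi : W phi.
Proof.
apply/WP; split; first exact: H1_phi.
have i1 := q_intg; have i2 := pa2q_intg.
apply: (@intg_dom _ _ _ (fun x => (6 + `|omega + 1|) * q `|x| + pa x ^+ 2 * q `|x|)) => //.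
- exact: continuous_meas (Ax_cont H1_phi).
- move=> x _; rewrite (ger0_norm (Ax_ge0 _ _)); apply: (le_trans (Afun_le (cmod_ge0 _))).
  have h := ler_normB (omega + 1) (pa x ^+ 2); rewrite (ger0_norm (sqr_ge0 (pa x))) in h.
  have := ler_wpM2l (ltW (gss_gt0 1 `|x|)) h; rewrite cmod_sq nsq_phi ln_q.
  by move: (q _) (pa x ^+ 2) `|_ - _| `|omega + 1| => s t p o; clear; lra.
- by apply: intgD => //; exact: intgZ.
Qed.

Lemma q_small (e : R) : 0 < e -> exists N : nat, forall n : nat, (N <= n)%N ->
  (n%:R + gamma / 2) * q n%:R <= e /\ q n%:R <= e.
Proof.
move=> e0; pose C := expR (omega + 1); have C0 : 0 < C by exact: expR_gt0.
exists (Num.truncn (C / e) + 1)%N => n hn.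
have n1 : 1 <= (n%:R : R) by rewrite ler1n (leq_trans _ hn) // addn1.
have nC : C / e <= n%:R.
  apply: ltW; apply: (lt_le_trans (truncnS_gt _)); rewrite ler_nat; by rewrite addn1 in hn.
have g2 : 0 < gamma / 2 by rewrite divr_gt0.
set a := n%:R + gamma / 2; have a1 : 1 <= a by rewrite /a; move: n1 g2; clear; lra.
have a0 : 0 < a by exact: lt_le_trans ltr01 a1.
have hq : q n%:R <= C / a ^+ 2.
  rewrite /gss mul1r expRD -/C ler_wpM2l ?(ltW C0) // expRN lef_pV2 ?posrE ?expR_gt0 ?exprn_gt0 //.
  by rewrite -/a (le_trans _ (expR_ge1Dx _)) // lerDr.
have h1 : a * q n%:R <= e.
  apply: (le_trans (ler_wpM2l (ltW a0) hq)).
  have -> : a * (C / a ^+ 2) = C / a by field; rewrite gt_eqF.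
  by rewrite ler_pdivrMr // mulrC -ler_pdivrMr // (le_trans nC) // /a lerDl ltW.
by split=> //; apply: le_trans h1; rewrite ler_peMl // ltW // gss_gt0.
Qed.

(** Integrate the derivative of [(t + gamma / 2) q t] over both half-lines; the boundary term at 0
    produces [gamma * q 0], and those at infinity vanish. *)
Lemma Df_phi_eq : 2 * Df phi = Qf phi + gamma * q 0.
Proof.
have i1 := q_intg; have i2 := pa2q_intg; apply/eqP; rewrite -subr_eq0 -normr_le0.
apply/ler_addgt0Pr => e e0; rewrite add0r; have e8 : 0 < e / 8 by rewrite divr_gt0.
have p0 x : 0 <= q `|x| by exact: ltW (gss_gt0 _ _).
have [n1 h1] := Int_tail i1 p0 e8; have [n2 h2] := Int_tail i2 pa2q_ge0 e8; have [n3 h3] := q_small e8.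
pose n := maxn n1 (maxn n2 n3).
have {}h1 : Int (co n%:R) (fun x => q `|x|) <= e / 8.
  by apply: le_trans (ltW h1); apply: Int_co_le => //; rewrite ler_nat leq_maxl.
have {}h2 : Int (co n%:R) (fun x => pa x ^+ 2 * q `|x|) <= e / 8.
  apply: le_trans (ltW h2); apply: Int_co_le => //; [|exact: pa2q_ge0].
  by rewrite ler_nat (leq_trans (leq_maxl n2 n3)) // leq_maxr.
have [h4 _] := h3 n (leq_trans (leq_maxr n2 n3) (leq_maxr n1 _)).
have h5 := Int_pa2_q' (ler0n _ n).
have g1 : 0 <= Int (co n%:R) (fun x => q `|x|) by exact: Int_ge0.
have g2 : 0 <= Int (co n%:R) (fun x => pa x ^+ 2 * q `|x|) by apply: Int_ge0 => x _; exact: pa2q_ge0.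
have g3 : 0 <= (n%:R + gamma / 2) * q n%:R.
  by rewrite mulr_ge0 ?(ltW (gss_gt0 _ _)) // addr_ge0 // divr_ge0 // ltW.
rewrite Df_phi Qf_phi (Int_co n%:R i1) (Int_co n%:R i2).
move: h5 h1 h2 h4 g1 g2 g3; move: (Int _ _) (Int _ _) (Int _ _) (Int _ _) (_ * q n%:R) (gamma * q 0) => a b c d f g.
by rewrite ler_norml; clear -e0 => *; apply/andP; split; lra.
Qed.

(** By the explicit logarithm of the profile the energy is [2 Df phi - gamma q(0) - (omega + 1) Qf
    phi], which the preceding identity simplifies. Thus [En + omega Qf] vanishes at the peak. *)
Lemma En_phi : En gamma phi = - omega * Qf phi.
Proof.
have [_ e1] := Lg_intg W_phi; have i1 := q_intg; have i2 := pa2q_intg.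
have e2 : Int setT (fun x => Glog (nsq (phi x))) = omega * Qf phi - Df phi.
  rewrite Qf_phi Df_phi -IntZ // -IntB //; last exact: intgZ.
  by apply: Int_ext => x _; rewrite nsq_phi /Glog ln_q; ring.
rewrite /En nsq_phi normr0; move: e1 (Df_phi_eq); rewrite e2.
move: (Df phi) (Qf phi) (Pu phi) (Au phi) (q 0) => a b c d f; nra.
Qed.

Lemma sdel_q t (d : R) : 0 <= t -> d <= q t -> sdel omega d (q t) = t + gamma / 2.
Proof.
move=> t0 dq; rewrite /sdel (max_l dq) ln_q opprB addrC subrK max_r ?sqr_ge0 //.
by rewrite sqrtr_sqr ger0_norm // addr_ge0 // divr_ge0 // ltW.
Qed.

Lemma q_mono s t : 0 <= s -> s <= t -> q t <= q s.
Proof.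
move=> s0 st; have g2 : 0 <= gamma / 2 by rewrite divr_ge0 // ltW.
by rewrite /gss ler_expR !mul1r lerD2l lerN2 ler_pXn2r ?nnegrE ?addr_ge0 ?lerD2r // (le_trans s0).
Qed.

(** The peak is the equality case. With [d = q n] the truncation is inactive on [[-n, n]], where [s]
    takes the value [|x| + gamma / 2], so the integral equals the drop of [Gam] from the centre to
    the two ends. *)
Lemma Gam_peak (n : nat) : 2 * Int `[- n%:R, n%:R] (fun x => pa x ^+ 2 * q `|x|) <= 2 * Gam omega (q n%:R) (q 0).
Proof.
set d := q n%:R; have d0 : 0 < d by exact: gss_gt0.
have n0 : (0 : R) <= n%:R by []. have nn : - (n%:R : R) <= 0 by rewrite oppr_le0.
have [c1 c2] := H1_cont H1_phi.
have k1 := Gam_chain omega d0 c1 c2 hasd_phi n0; have k2 := Gam_chain omega d0 c1 c2 hasd_phi nn.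
have sE x : `|x| <= n%:R -> 2 * (sdel omega d (nsq (phi x)) * cdot (phi x) (dphi x)) =
    sg 0 x * (- 2 * (pa x ^+ 2 * q `|x|)).
  move=> xn; rewrite nsq_phi sdel_q //; last by apply: q_mono.
  by rewrite phiE /dphi cdotE /= mulr0 addr0 -pk_sqr; ring.
have ci a b : intg `[a, b] (fun x => - 2 * (pa x ^+ 2 * q `|x|)).
  by apply: intgZ => //; apply: continuous_intg; exact: pa2q_cont.
have cj a b : intg `[a, b] (fun x => pa x ^+ 2 * q `|x|) by apply: continuous_intg; exact: pa2q_cont.
move: k1; rewrite !nsq_phi normr0 ger0_norm // (@Int_ext _ _ _ (fun x => sg 0 x * (- 2 * (pa x ^+ 2 * q `|x|)))); last first.
  by move=> x /=; rewrite in_itv /= => /andP[x0 xn]; apply: sE; rewrite ger0_norm.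
rewrite Int_sgr // IntZ // => k1.
move: k2; rewrite !nsq_phi normr0 normrN ger0_norm // (@Int_ext _ _ _ (fun x => sg 0 x * (- 2 * (pa x ^+ 2 * q `|x|)))); last first.
  by move=> x /=; rewrite in_itv /= => /andP[x0 xn]; apply: sE; rewrite ler0_norm // lerNl.
rewrite Int_sgl // IntZ // => k2.
rewrite (Int_itv_split nn n0) //; have := Gam_mono omega d0 (lexx 0) (ltW d0); rewrite Gam0 -/d in k1 k2 *.
by move: (Int _ _) (Int _ _) (Gam _ _ _) (Gam _ _ _) k1 k2 => a b c f; clear; lra.
Qed.

(** In the limit [d -> 0], twice [Gam] at the peak height is [2 Df phi = Qf phi + gamma q(0)]. Only
    the lower bound, for some arbitrarily small [d], is needed. *)
Lemma peak_J (e d0 : R) : 0 < e -> 0 < d0 -> exists d : R, [/\ 0 < d, d <= d0 &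
  Qf phi - e <= 2 * Gam omega d (q 0) - gamma * q 0].
Proof.
move=> e0 d00; have i2 := pa2q_intg; have e2 : 0 < e / 2 by rewrite divr_gt0.
have [n1 h1] := Int_tail i2 pa2q_ge0 e2; have [n2 h2] := q_small d00.
pose n := maxn n1 n2; have [_ h3] := h2 n (leq_maxr _ _).
have {}h1 : Int (co n%:R) (fun x => pa x ^+ 2 * q `|x|) <= e / 2.
  by apply: le_trans (ltW h1); apply: Int_co_le => //; [rewrite ler_nat leq_maxl|exact: pa2q_ge0].
exists (q n%:R); split=> //; first exact: gss_gt0.
have := Gam_peak n; have := Df_phi_eq; rewrite Df_phi (Int_co n%:R i2).
by move: (Int _ _) (Int _ _) h1 (Gam _ _ _) (Qf phi) (gamma * q 0) => a b h c f g; clear -h; lra.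
Qed.

End peak.

(** * Minimizing families *)

Section rescaled_bogomolny.
Context {R : realType} (omega gamma : R) (gamma_gt0 : 0 < gamma).
Local Notation fn := (R -> R[i]).
Implicit Types (u w : fn) (d p : R).

Local Notation ys := (gss omega gamma 1 0).

(** The height at which [s] equals [gamma / 4], half of its value at the peak. Between the two
    heights [s] is at least [gamma / 4], which is the source of the gain [egap]. *)
Definition ygap : R := expR (omega + 1 - (gamma / 4) ^+ 2).
Definition egap : R := gamma / 2 * (ygap - ys).

Lemma ysE : ys = expR (omega + 1 - (gamma / 2) ^+ 2).
Proof. by rewrite /gss mul1r add0r. Qed.

Lemma ys_gt0 : 0 < ys. Proof. exact: gss_gt0. Qed.

Lemma ys_gap : ys < ygap.
Proof.
rewrite ysE ltr_expR ltrD2l ltrN2 ltr_pXn2r ?nnegrE ?divr_ge0 ?(ltW gamma_gt0) //.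
by rewrite ltr_pM2l // ltf_pV2 ?posrE // ltr_nat.
Qed.

Lemma egap_gt0 : 0 < egap.
Proof. by rewrite /egap mulr_gt0 ?divr_gt0 // subr_gt0 ys_gap. Qed.

Lemma ygap_lt : ygap < expR (omega + 1).
Proof. by rewrite ltr_expR gtrDl oppr_lt0 exprn_gt0 // divr_gt0. Qed.

Lemma Gam_gap d : 0 < d -> d <= ygap -> 2 * Gam omega d ys + egap <= 2 * Gam omega d ygap.
Proof.
move=> d0 dy; have := Gam_incr omega d0 (ltW ys_gt0) (ltW ys_gap).
have -> : sdel omega d ygap = gamma / 4.
  rewrite /sdel (max_l dy) /ygap expRK opprB addrC subrK max_r ?sqr_ge0 //.
  by rewrite sqrtr_sqr ger0_norm // divr_ge0 // ltW.
by rewrite /egap; move: (Gam omega d ygap) (Gam omega d ys) ygap ys => a b y z; lra.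
Qed.

Lemma Qf_pos_ex u : W u -> 0 < Qf u -> exists x, 0 < nsq (u x).
Proof.
move=> wu q0; apply/not_existsP => H.
have z : u = zf.
  apply/funext => x; apply: nsq_eq0; apply/eqP; rewrite eq_le nsq_ge0 andbT leNgt; apply/negP; exact: H.
by move: q0; rewrite z QfE Ic0l ltxx.
Qed.

(** The Bogomolny bound for [u / sqrt p], multiplied back by [p]. The logarithm of the scale is what
    appears as [Qf u * ln p]. *)
Lemma bog_scaled u x0 p d : W u -> 0 < p -> 0 < d -> d <= ygap ->
  (forall x, nsq (u x) <= p * expR (omega + 1)) ->
  p * (Bog omega d x0 (scl (Num.sqrt p)^-1 u) + 2 * Gam omega d (p^-1 * nsq (u x0))) - Qf u - Qf u * ln p <=
  En gamma u + omega * Qf u + gamma * nsq (u 0).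
Proof.
move=> wu p0 d0 dy hb; pose m := (Num.sqrt p)^-1.
have sp0 : 0 < Num.sqrt p by rewrite sqrtr_gt0.
have m0 : m != 0 by rewrite invr_eq0 gt_eqF.
have m2 : m ^+ 2 = p^-1 by rewrite exprVn sqr_sqrtr // ltW.
have nE x : nsq (scl m u x) = p^-1 * nsq (u x) by rewrite sclE nsqZ m2.
have dE : d <= expR (omega + 1) by rewrite (le_trans dy) // ltW // ygap_lt.
have hb' x : nsq (scl m u x) <= expR (omega + 1) by rewrite nE ler_pdivrMl.
have := bogomolny x0 d0 dE (W_scl m wu) hb'; rewrite nE (Qf_scl m wu) m2 => h.
have eE := En_scl gamma wu m0; rewrite m2 lnV ?posrE // in eE.
have eE' : Df (scl m u) + Au (scl m u) - Pu (scl m u) =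
    p^-1 * (En gamma u + ln p * Qf u) + gamma * (p^-1 * nsq (u 0)).
  rewrite -nE; move: eE; rewrite /En; move: (Df _) (Au _) (Pu _) (nsq _) (Qf u) => a b c n k.
  by rewrite mulNr opprK => <-; ring.
have {}h : Bog omega d x0 (scl m u) + 2 * Gam omega d (p^-1 * nsq (u x0)) <=
    p^-1 * (En gamma u + ln p * Qf u + gamma * nsq (u 0) + (omega + 1) * Qf u).
  apply: (le_trans h); move: eE'; move: (Df _) (Au _) (Pu _) => a b c e.
  rewrite (_ : a + (omega + 1) * (p^-1 * Qf u) + b - c = (a + b - c) + (omega + 1) * (p^-1 * Qf u)); last by ring.
  by rewrite e le_eqVlt; apply/orP; left; apply/eqP; ring.
have := ler_wpM2l (ltW p0) h; rewrite mulrA divff ?gt_eqF // mul1r.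
move: (p * _) (En _ _) (ln p) (Qf u) (gamma * _) => a b c e f; clear; lra.
Qed.

(* [p] is the least scale for which [u / sqrt p] respects both the ceiling [expR (omega + 1)]
   and the height of the peak at 0; when the ceiling binds, the excess [egap] is gained. *)
Lemma bog_scale u : W u -> 0 < Qf u -> exists2 p : R, 0 < p &
  (nsq (u 0) = p * ys /\ forall d, 0 < d -> d <= ygap ->
     p * (2 * Gam omega d ys - gamma * ys + Bog omega d 0 (scl (Num.sqrt p)^-1 u)) - Qf u - Qf u * ln p <=
       En gamma u + omega * Qf u) \/
  (forall d, 0 < d -> d <= ygap ->
     p * (2 * Gam omega d ys - gamma * ys + egap) - Qf u - Qf u * ln p <= En gamma u + omega * Qf u).
Proof.
move=> wu q0; have [M M0 hM] := H1_bounded (W_H1 wu); have [x1 hx1] := Qf_pos_ex wu q0.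
pose S := range (fun x => nsq (u x)).
have hS : has_sup S.
  split; first by exists (nsq (u x1)); exists x1.
  by exists (M ^+ 2) => _ [x _ <-]; rewrite -cmod_sq ler_pXn2r ?nnegrE ?cmod_ge0 ?(ltW M0).
pose Z := sup S; have ZS x : nsq (u x) <= Z by apply: sup_upper_bound => //; exists x.
have Z0 : 0 < Z by apply: lt_le_trans (ZS x1).
have Y0 : 0 < expR (omega + 1) by exact: expR_gt0.
have yp := ys_gt0.
(* The larger of the two ratios decides: on the left the height at 0 determines the scale, on the
   right the ceiling does. *)
have [hp|hp] := leP (Z / expR (omega + 1)) (nsq (u 0) / ys).
  exists (nsq (u 0) / ys); first by apply: lt_le_trans hp; rewrite divr_gt0.
  set p := nsq (u 0) / ys in hp *.
  have p0 : 0 < p by apply: lt_le_trans hp; rewrite divr_gt0.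
  have pE : nsq (u 0) = p * ys by rewrite /p divfK // gt_eqF.
  left; split=> // d d0 dy.
  have hb x : nsq (u x) <= p * expR (omega + 1) by rewrite (le_trans (ZS x)) // -ler_pdivrMr.
  have := bog_scaled 0 wu p0 d0 dy hb; rewrite pE mulKf ?gt_eqF //.
  by move: (Bog _ _ _ _) (Gam _ _ _) (En _ _) (Qf u) (ln p) => a b c e f; clear; lra.
set p := Z / expR (omega + 1) in hp *; exists p; first by rewrite divr_gt0.
have p0 : 0 < p by rewrite divr_gt0.
right=> d d0 dy.
have pZ : p * expR (omega + 1) = Z by rewrite /p divfK // gt_eqF.
have hb x : nsq (u x) <= p * expR (omega + 1) by rewrite pZ.
(* After scaling the supremum sits at the ceiling, above [ygap]. Some [x0] therefore reaches [ygap],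
   and the square is completed around that point instead of 0. *)
have gz : 0 < Z - p * ygap by rewrite subr_gt0 -pZ ltr_pM2l // ygap_lt.
have [_ [x0 _ <-] hx0] := sup_adherent gz hS.
have hx : ygap <= p^-1 * nsq (u x0).
  rewrite ler_pdivlMl //; move: hx0; rewrite -/Z opprB addrC subrK => /ltW; exact.
have := bog_scaled x0 wu p0 d0 dy hb.
have g1 := Gam_mono omega d0 (ltW (lt_trans yp ys_gap)) hx; have g2 := Gam_gap d0 dy.
have b0 := Bog_ge0 omega d x0 (scl (Num.sqrt p)^-1 u).
have n0 : gamma * nsq (u 0) <= p * (gamma * ys).
  by rewrite mulrCA ler_pM2l // ltW // -ltr_pdivrMr.
have key : p * (2 * Gam omega d ys + egap) <=
    p * (Bog omega d x0 (scl (Num.sqrt p)^-1 u) + 2 * Gam omega d (p^-1 * nsq (u x0))).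
  by rewrite ler_pM2l //; move: (Bog _ _ _ _) (Gam _ _ _) (Gam _ _ _) (Gam _ _ _) b0 g1 g2 => a b c e; clear; lra.
move: key n0; move: (p * (Bog _ _ _ _ + _)) (Gam omega d ys) egap (En _ _) (Qf u) (ln p) (gamma * nsq _) => X a b c e f h.
by clear; lra.
Qed.

End rescaled_bogomolny.

(** * Passing to the limit in the completed square *)

Section profile_equation.
Context {R : realType} (omega gamma : R) (gamma_gt0 : 0 < gamma).
Local Notation mu := (@lebesgue_measure R).
Local Notation fn := (R -> R[i]).
Implicit Types (u w g : fn) (c z : R[i]) (d e : R).

Local Notation Re u := (fun x => complex.Re (u x)).
Local Notation Im u := (fun x => complex.Im (u x)).

Definition sful (y : R) : R := Num.sqrt (Num.max 0 (omega + 1 - ln y)).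
Definition Sful z : R[i] := (sful (nsq z))%:C * z.

Lemma sful_cmod z : cmod (Sful z) ^+ 2 = Num.max 0 ((omega + 1) * nsq z - nsq z * ln (nsq z)).
Proof.
rewrite cmod_sq /Sful nsqZ /sful sqr_sqrtr ?le_max ?lexx // [nsq z * ln _]mulrC -mulrBl.
have [z0|zn] := eqVneq (nsq z) 0; first by rewrite z0 !mulr0 maxxx.
by rewrite -[0 in RHS](mul0r (nsq z)) maxr_pMl ?nsq_ge0.
Qed.

(** Uniform in [z]: truncation matters only for [|z|^2 < d], where [s^2 |z|^2] is small by
    continuity of [y ln y] at 0. *)
Lemma Sdel_close e : 0 < e -> exists2 d0 : R, 0 < d0 & forall d z, 0 < d -> d <= d0 ->
  cmod (Sdel omega d z - Sful z) <= e.
Proof.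
move=> e0; have e2 : 0 < e ^+ 2 by rewrite exprn_gt0.
have c : continuous (fun y : R => (omega + 1) * y - y * ln y).
  move=> y; apply: cvgB; last exact: xlnx_cont.
  by apply: cvgM; [exact: cvg_cst|exact: cvg_id].
have [d0 d00 hd] := continuousEP c 0 e2; exists d0 => // d z dp dd.
have [h|h] := leP d (nsq z).
  by rewrite /Sdel /Sful /sdel (max_l h) -/(sful _) subrr cmod0 ltW.
have s1 : sdel omega d (nsq z) <= sful (nsq z) \/ nsq z = 0.
  have [->|zn] := eqVneq (nsq z) 0; [by right|left].
  rewrite /sdel /sful ler_wsqrtr // ge_max le_max lexx /= le_max; apply/orP; right.
  by rewrite lerD2l lerN2 ln_le // ?le_max ?lexx // lt_neqAle eq_sym zn nsq_ge0.
case: s1 => [s1|/nsq_eq0 ->]; last by rewrite /Sdel /Sful !mulr0 subrr cmod0 ltW.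
apply: (@le_trans _ _ (cmod (Sful z))).
  rewrite /Sdel /Sful -mulrBl -rmorphB !cmodZ ler_wpM2r ?cmod_ge0 //.
  have a := sdel_ge0 omega d (nsq z); rewrite (@ger0_norm _ (sful _)) ?sqrtr_ge0 //.
  by rewrite ler_norml; move: s1 a; move: (sdel _ _ _) (sful _); clear => *; apply/andP; split; lra.
rewrite -(@ler_pXn2r _ 2) ?nnegrE ?cmod_ge0 ?(ltW e0) // sful_cmod ge_max (ltW e2) /=.
have := hd (nsq z); rewrite subr0 (ger0_norm (nsq_ge0 _)) mulr0 mul0r !subr0 => h'.
by apply: (le_trans (ler_norm _)); apply: h'; rewrite (le_trans (ltW h)).
Qed.

Lemma cdot_cmod1 z c : cmod c = 1 -> `|cdot z c| <= cmod z.
Proof. by move=> c1; apply: (le_trans (cdot_le _ _)); rewrite c1 mulr1. Qed.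

Lemma ucb_Sdel d c : 0 < d -> cmod c = 1 -> ucb (fun z => cdot (Sdel omega d z) c).
Proof.
move=> d0 c1 M e e0; pose N := `|M| + 1; have N0 : 0 < N by rewrite ltr_wpDl.
have S0 := sdel_ge0 omega d 0; have S1 : 0 < sdel omega d 0 + 1 by rewrite ltr_wpDl.
have e1 : 0 < e / 2 / N by rewrite !divr_gt0.
have [r r0 hr] := continuous_unif 0 (N ^+ 2) (sdel_cont (omega := omega) d0) e1.
have [q q0 hq] := ucb_nsq M r0.
exists (Num.min q (e / 2 / (sdel omega d 0 + 1))); first by rewrite lt_min q0 !divr_gt0.
move=> z w hz; rewrite le_min => /andP[h1 h2]; rewrite -cdotBl; apply: (le_trans (cdot_cmod1 _ c1)).
have -> : Sdel omega d z - Sdel omega d w =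
    (sdel omega d (nsq z) - sdel omega d (nsq w))%:C * z + (sdel omega d (nsq w))%:C * (z - w).
  by rewrite /Sdel rmorphB; ring.
have hzN : cmod z <= N by rewrite (le_trans hz) // (le_trans (ler_norm M)) // lerDl.
apply: (le_trans (cmodD_le _ _)); rewrite (splitr e) !cmodZ; apply: lerD.
  have : `|sdel omega d (nsq z) - sdel omega d (nsq w)| <= e / 2 / N.
    rewrite distrC; apply: hr; last by rewrite distrC; exact: hq.
    by rewrite nsq_ge0 -cmod_sq ler_pXn2r ?nnegrE ?cmod_ge0 ?(ltW N0).
  move=> h; rewrite -[leRHS](divfK (lt0r_neq0 N0)); apply: ler_pM => //; exact: cmod_ge0.
rewrite (ger0_norm (sdel_ge0 _ _ _)); apply: (@le_trans _ _ ((sdel omega d 0 + 1) * (e / 2 / (sdel omega d 0 + 1)))).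
  apply: ler_pM => //; rewrite ?sdel_ge0 ?cmod_ge0 //.
  by rewrite (le_trans (sdel_le omega _ d0)) // lerDl.
by rewrite mulrCA divff ?mulr1 // gt_eqF.
Qed.

Lemma ac_cdot u g c : hasd u g -> ac (fun x => cdot (u x) c) (fun x => cdot (g x) c).
Proof.
case=> _ a1 a2; have a := ac_lin (complex.Re c) a1 (ac_lin (complex.Im c) a2 (@ac0 R)).
by apply: ac_ext a => x; rewrite cdotE; ring.
Qed.

Lemma L2r_cdot g c : L2c g -> L2r (fun x => cdot (g x) c).
Proof.
case=> l1 l2; have := L2r_lin (complex.Re c) l1 (L2rZ (complex.Im c) l2).
by rewrite (_ : (fun x => _) = fun x => cdot (g x) c) //; apply/funext => x; rewrite cdotE; ring.
Qed.

(** Cauchy-Schwarz on [[a, b]] turns a small completed square into an approximate integral equation,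
    read in the direction of a unit vector [c] to stay with real functions. *)
Lemma Bog_local d w c (a b : R) : 0 < d -> H1 w -> cmod c = 1 -> a <= b ->
  (cdot (w b) c - cdot (w a) c + Int `[a, b] (fun x => sg 0 x * cdot (Sdel omega d (w x)) c)) ^+ 2 <=
  (b - a) * Bog omega d 0 w.
Proof.
move=> d0 hw c1 ab; have [ls lb] := Bog_L2c omega 0 d0 hw.
have [i1 ->] := ac_cdot c (dx_hasd hw) ab.
have l1 := L2r_cdot c ls; have l2 := L2r_cdot c lb.
have i2 : intg `[a, b] (fun x => sg 0 x * cdot (Sdel omega d (w x)) c).
  by apply: intg_ext (L2r_intg a b l1) => x; rewrite cdotZl.
rewrite -IntD // (@Int_ext _ _ _ (fun x => cdot (dx w x + (sg 0 x)%:C * Sdel omega d (w x)) c)); last first.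
  by move=> x _; rewrite cdotDl cdotZl.
apply: (le_trans (L2r_Int_le ab l2)); rewrite ler_wpM2l ?subr_ge0 //.
apply: Int_le => //; [by case: l2|exact: L2c_nsq|].
move=> x _; apply: (le_trans (cdot_sq_le _ _)); rewrite -(cmod_sq c) c1 expr1n mulr1 //.
Qed.

(** The integral equation involves only values on a bounded interval, so it survives locally uniform
    convergence although the derivatives converge only weakly. The scale factors [k i] are harmless
    as they tend to 1. *)
Lemma Bog_limit (I : Type) (F : set_system I) (FF : ProperFilter F) (K : R) (v : I -> fn) u (k : I -> R) d (B : R) c (a b : R) :
  wcv F K v u -> k i @[i --> F] --> (1 : R) -> 0 < d -> cmod c = 1 -> a <= b ->
  (\forall i \near F, Bog omega d 0 (scl (k i) (v i)) <= B) ->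
  (cdot (u b) c - cdot (u a) c + Int `[a, b] (fun x => sg 0 x * cdot (Sdel omega d (u x)) c)) ^+ 2 <= (b - a) * B.
Proof.
move=> wc hk d0 c1 ab hB; have [hb _] := wc; have K0 := wcv_ge0 FF wc.
have uS := ucb_Sdel d0 c1; have [cu1 cu2] := wcv_cont FF wc.
pose r := `|a| + `|b|; pose M := 4 * K + 1; have M0 : 0 < M by rewrite ltr_wpDl ?mulr_ge0.
have cS (w : fn) : continuous (Re w) -> continuous (Im w) -> forall p q : R, intg `[p, q] (fun x => sg 0 x * cdot (Sdel omega d (w x)) c).
  by move=> h1 h2 p q; apply: intg_sg => //; apply: continuous_intg; apply: (ucb_cont uS).
pose T (w : fn) := cdot (w b) c - cdot (w a) c + Int `[a, b] (fun x => sg 0 x * cdot (Sdel omega d (w x)) c).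
have BB : 0 <= (b - a) * B.
  have [j hj] := filter_ex hB; rewrite mulr_ge0 ?subr_ge0 // (le_trans (Bog_ge0 _ _ _ _) hj) //.
suff h : `|T u| <= Num.sqrt ((b - a) * B).
  rewrite -[leRHS](sqr_sqrtr BB) -[leLHS](ger0_norm (sqr_ge0 _)) normrX ler_pXn2r ?nnegrE ?sqrtr_ge0 //.
apply/ler_addgt0Pr => e e0; have e4 : 0 < e / 4 by rewrite divr_gt0.
have e5 : 0 < e / 4 / (b - a + 1) by rewrite divr_gt0 // ltr_wpDl // subr_ge0.
have [q q0 hq] := uS (M + 1) _ e5.
pose q1 := Num.min 1 (Num.min q (e / 4)); have q10 : 0 < q1 by rewrite !lt_min ltr01 q0 divr_gt0.
have q2 : 0 < q1 / 2 by rewrite divr_gt0.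
have q3 : 0 < q1 / 2 / M by rewrite divr_gt0.
have /cvgEP /(_ _ q3) hk' := hk.
have [i [[bi ki] [ui Bi]]] := filter_ex (filterI (filterI hb hk') (filterI (wcv_unif FF r wc q2) hB)).
pose w := scl (k i) (v i); have ww : W w by apply: W_scl; exact: bdd_W bi.
have close x : `|x| <= r -> cmod (w x - u x) <= q1.
  move=> xr; rewrite /w sclE.
  have -> : (k i)%:C * v i x - u x = (k i - 1)%:C * v i x + (v i x - u x) by rewrite rmorphB rmorph1; ring.
  apply: (le_trans (cmodD_le _ _)); rewrite (splitr q1) cmodZ lerD ?ui //.
  by rewrite -[leRHS](divfK (lt0r_neq0 M0)); apply: ler_pM => //; [exact: cmod_ge0|exact: bdd_cmod].
have [w1 w2] := H1_cont (W_H1 ww).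
have ra : `|a| <= r by rewrite lerDl. have rb : `|b| <= r by rewrite lerDr.
have dT : `|T w - T u| <= e.
  have -> : T w - T u = (cdot (w b - u b) c - cdot (w a - u a) c) +
      Int `[a, b] (fun x => sg 0 x * cdot (Sdel omega d (w x)) c - sg 0 x * cdot (Sdel omega d (u x)) c).
    rewrite IntB //; [|exact: cS|exact: cS].
    by rewrite /T !cdotBl; move: (Int _ _) (Int _ _) (cdot _ _) (cdot _ _) (cdot _ _) (cdot _ _) => *; ring.
  have t1 : `|cdot (w b - u b) c| <= e / 4.
    by apply: (le_trans (cdot_cmod1 _ c1)); apply: (le_trans (close _ rb)); rewrite !ge_min lexx !orbT.
  have t2 : `|cdot (w a - u a) c| <= e / 4.
    by apply: (le_trans (cdot_cmod1 _ c1)); apply: (le_trans (close _ ra)); rewrite !ge_min lexx !orbT.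
  have t3 : `|Int `[a, b] (fun x => sg 0 x * cdot (Sdel omega d (w x)) c - sg 0 x * cdot (Sdel omega d (u x)) c)| <= e / 4.
    apply: (@le_trans _ _ (e / 4 / (b - a + 1) * (b - a))); last first.
      rewrite mulrAC ler_pdivrMr ?ltr_wpDl ?subr_ge0 // ler_wpM2l ?(ltW e4) // lerDl //.
    rewrite -Int_cst //; apply: Int_norm_le => //.
    - by apply: intg_meas; apply: intgB => //; apply: cS.
    - exact: cst_intg.
    - move=> x /=; rewrite in_itv /= => /andP[ax xb]; rewrite -mulrBr normrM sg_norm mul1r.
      have xr : `|x| <= r.
        rewrite /r; have := ler_norm a; have := ler_norm b; have := ler_norm (- a); have := ler_norm (- b).
        rewrite !normrN ler_norml; move: `|a| `|b| (normr_ge0 a) (normr_ge0 b) ax xb; clear => *; apply/andP; split; lra.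
      have cx := close x xr; rewrite distrC; apply: hq.
        by rewrite (le_trans (wcv_cmod FF x wc)) // lerDl.
      by rewrite cmodB (le_trans cx) // !ge_min lexx !orbT.
  apply: (le_trans (ler_normD _ _)); apply: (le_trans (lerD (ler_normB _ _) (lexx _))).
  apply: (le_trans (lerD (lerD t1 t2) t3)); clear -e0; lra.
have Tw : `|T w| <= Num.sqrt ((b - a) * B).
  rewrite -sqrtr_sqr ler_sqrt //; apply: (le_trans (Bog_local d0 (W_H1 ww) c1 ab)).
  by rewrite ler_wpM2l // subr_ge0.
have -> : T u = T w - (T w - T u) by rewrite opprB addrC subrK.
by apply: (le_trans (ler_normB _ _)); rewrite lerD.
Qed.

End profile_equation.

(** * Uniqueness for the profile equation *)

Section peak_profile.
Context {R : realType} (omega gamma : R) (gamma_gt0 : 0 < gamma).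
Local Notation fn := (R -> R[i]).
Local Notation phi := (phi_peak omega gamma).
Local Notation gs := (gss omega gamma).
Local Notation pa x := (`|x| + gamma / 2).
Implicit Types (u : fn) (x t : R).

Local Notation Re u := (fun x => complex.Re (u x)).
Local Notation Im u := (fun x => complex.Im (u x)).

Lemma ac_gronwall (f g c : R -> R) : continuous f -> ac f g -> (forall x, 0 <= f x) -> continuous c ->
  (forall x, `|g x| <= c x * f x) -> f 0 = 0 -> forall x, f x = 0.
Proof.
move=> cf af f0 cc hg f00 x; pose r := `|x|; have [M M0 hM] := continuous_bounded (- r) r cc.
have r0 : 0 <= r by exact: normr_ge0.
(* Clamping of [t] to [[-r, r]], which makes the rate [c] bounded by [M] and the Gronwall lemma on
   the whole line applicable. *)
pose k (t : R) := - Num.max (- Num.max t (- r)) (- r).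
have kr t : - r <= k t <= r.
  rewrite /k lerN2 lerNl le_max lexx orbT andbT ge_max lerNl le_max lexx orbT /=.
  by rewrite (@le_trans _ _ 0) // oppr_le0.
have kid t : - r <= t <= r -> k t = t.
  by move=> /andP[h1 h2]; rewrite /k (max_l h1) max_l ?opprK // lerN2.
have klip s t : `|k s - k t| <= `|s - t|.
  rewrite /k opprK addrC; apply: (le_trans (maxr_lip _ _ _)).
  by rewrite opprK addrC; exact: maxr_lip.
have bnd a b (B : R) : - r <= a -> a <= b -> b <= r -> (forall y, a <= y <= b -> f y <= B) ->
    `|f b - f a| <= M * B * (b - a).
  move=> ra ab br hB; have [ig ->] := af _ _ ab; rewrite -Int_cst //; apply: Int_norm_le => //.
  - exact: intg_meas.
  - exact: cst_intg.
  move=> y /=; rewrite in_itv /= => /andP[ay yb]; apply: (le_trans (hg y)).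
  have yr : - r <= y <= r by rewrite (le_trans ra ay) (le_trans yb br).
  apply: (@le_trans _ _ (M * f y)).
    by rewrite ler_wpM2r //; apply: (le_trans (ler_norm _)); exact: hM.
  by apply: ler_wpM2l; [exact: ltW|apply: hB; rewrite ay].
have near_k t (e : R) : 0 < e -> \forall s \near t, forall y, `|y - k t| <= `|s - t| -> `|f y - f (k t)| <= e.
  move=> e0; have [d d0 hd] := continuousEP cf (k t) e0; apply/nearEP; exists d => // s hs y hy.
  by apply: hd; exact: le_trans hy hs.
have : f (k x) <= 0.
  apply: (@dini_gronwall_abs _ (fun t => f (k t)) M (ltW M0)) => //.
  - move=> t e e0; apply: filterS (near_k t (e / M) (divr_gt0 e0 M0)) => s hs.
    have [/andP[s1 s2] /andP[t1 t2]] := (kr s, kr t); have kl := klip s t.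
    have st : `|f (k t) - f (k s)| <= M * (f (k t) + e / M) * `|k s - k t|.
      have up y : `|y - k t| <= `|k s - k t| -> f y <= f (k t) + e / M.
        move=> hy; have := hs y (le_trans hy kl); rewrite ler_norml => /andP[_]; clear; lra.
      have [h|h] := leP (k s) (k t).
        have n1 : `|k s - k t| = k t - k s by rewrite ler0_norm ?subr_le0 // opprB.
        rewrite n1; apply: bnd => // y /andP[y1 y2]; apply: up.
        by rewrite n1 ler0_norm ?subr_le0 // opprB lerD2l lerN2.
      have n1 : `|k s - k t| = k s - k t by rewrite ger0_norm ?subr_ge0 ?(ltW h).
      rewrite distrC n1; apply: bnd => //; first exact: ltW.
      by move=> y /andP[y1 y2]; apply: up; rewrite n1 ger0_norm ?subr_ge0 // lerD2r.
    apply: (le_trans (ler_norm _)); apply: (le_trans st).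
    rewrite mulrDr [M * (e / M)]mulrCA divff ?gt_eqF // mulr1 ler_wpM2l //.
    by rewrite addr_ge0 ?mulr_ge0 ?(ltW M0) ?(ltW e0).
  - move=> t e e0; apply: filterS (near_k t e e0) => s hs; apply: (le_trans (ler_norm _)); exact: hs.
  - by rewrite kid ?f00 // oppr_le0 r0.
rewrite kid; first by move=> h; apply/eqP; rewrite eq_le h f0.
by rewrite /r -ler_norml.
Qed.

(** With [s] the root, [a - s] is at most [|ln k| / (a + s)], and [a + s >= g]. The lower bound on
    [a], which is [gamma / 2] in the application, keeps the square root Lipschitz near [k = 1]; the
    factor [k] handles the logarithm near 0. *)
Lemma root_gap_bound (g a k : R) : 0 < g -> g <= a -> 0 <= k ->
  `|k * (a - Num.sqrt (Num.max 0 (a ^+ 2 - ln k)))| <= g^-1 * ((1 + k) * `|k - 1|).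
Proof.
move=> g0 ga; rewrite le_eqVlt => /predU1P[<-|k0].
  by rewrite mul0r normr0 !mulr_ge0 // invr_ge0 ltW.
set s := Num.sqrt _; have s0 : 0 <= s by exact: sqrtr_ge0.
have s2 : s ^+ 2 = Num.max 0 (a ^+ 2 - ln k) by rewrite sqr_sqrtr // le_max lexx.
have l1 : `|(a - s) * (a + s)| <= `|ln k|.
  rewrite -subr_sqr s2; have [h|h] := leP (a ^+ 2 - ln k) 0.
    rewrite subr0 ger0_norm ?sqr_ge0 // (le_trans _ (ler_norm _)) //; move: h; clear; lra.
  by rewrite opprB addrC subrK.
have l2 : `|a - s| * g <= `|ln k|.
  apply: le_trans l1; rewrite normrM ler_wpM2l // (le_trans _ (ler_norm _)) //.
  by move: ga s0; clear; lra.
have l3 : k * `|ln k| <= (1 + k) * `|k - 1|.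
  have [h|h] := leP 1 k.
    rewrite (ger0_norm (ln_ge0 h)) ger0_norm ?subr_ge0 //; have := ln_le_sub1 k0; nra.
  have h' : `|ln k| <= k^-1 - 1.
    rewrite ler0_norm; last by rewrite -ln1 ler_ln ?posrE // ltW.
    by rewrite -lnV ?posrE //; apply: ln_le_sub1; rewrite invr_gt0.
  apply: (@le_trans _ _ (k * (k^-1 - 1))); first by rewrite ler_wpM2l // ltW.
  by rewrite mulrBr divff ?gt_eqF // mulr1 ltr0_norm ?subr_lt0 //; nra.
rewrite normrM (gtr0_norm k0) ler_pdivlMl // [g * _]mulrC -mulrA; apply: le_trans l3.
by rewrite ler_pM2l.
Qed.

Lemma circle_angle (a b : R) : a ^+ 2 + b ^+ 2 = 1 -> exists t, cos t = a /\ sin t = b.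
Proof.
move=> h; have ha : -1 <= a <= 1.
  by rewrite -ler_norml -(@ler_pXn2r _ 2) ?nnegrE // expr1n real_normK ?num_real // -h lerDl sqr_ge0.
have [_ c] := acos_def ha; have s := sin_acos ha.
have e : Num.sqrt (1 - a ^+ 2) = `|b| by rewrite -h addrC addKr sqrtr_sqr.
have [b0|b0] := leP 0 b; first by exists (acos a); rewrite c s e ger0_norm.
by exists (- acos a); rewrite cosN sinN c s e ltr0_norm // opprK.
Qed.

Lemma ac_gauss : ac (fun x => gs (- (1 / 2)) `|x|) (fun x => sg 0 x * (pa x * gs (- (1 / 2)) `|x|)).
Proof.
have := @ac_even _ (gs (- (1 / 2))) (fun x => (x + gamma / 2) * gs (- (1 / 2)) x).
apply; first by move=> x; apply: is_derive_eq (gss_derive _ _ _ _) _; rewrite (_ : - (2 * _) = 1 :> R) ?mul1r //; field.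
by move=> x; apply: cvgM; [exact: (@pa_cont _ gamma)|exact: gss_cont].
Qed.

(** Divide by the profile: [E] is its inverse. The squared modulus [k] of the quotient solves an
    equation for which [k = 1] is stationary, and Gronwall for [(k - 1)^2] keeps it there from its
    value at 0. The coefficient [b] then vanishes, the quotient is constant, and it lies on the unit
    circle. *)
Lemma ode_peak u : continuous (Re u) -> continuous (Im u) -> nsq (u 0) = gs 1 0 ->
  ac (Re u) (fun x => - (sg 0 x * (sful omega (nsq (u x)) * complex.Re (u x)))) ->
  ac (Im u) (fun x => - (sg 0 x * (sful omega (nsq (u x)) * complex.Im (u x)))) ->
  exists t, u = fun x => cexp_i t * phi x.
Proof.
move=> c1 c2 u0 a1 a2; pose E x := gs (- (1 / 2)) `|x|.
have cE : continuous E by apply: (abs_cont (p := gs (- (1 / 2)))); exact: gss_cont.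
pose b x := pa x - sful omega (nsq (u x)).
have part (f : R -> R) : continuous f -> ac f (fun x => - (sg 0 x * (sful omega (nsq (u x)) * f x))) ->
    continuous (fun x => f x * E x) /\ ac (fun x => f x * E x) (fun x => sg 0 x * b x * (f x * E x)).
  move=> cf af; split; first by move=> x; apply: cvgM; [exact: cf|exact: cE].
  by apply: ac_ext (ac_mul cf cE af ac_gauss) => // x; rewrite /b /E; ring.
have [cX aX] := part _ c1 a1; have [cY aY] := part _ c2 a2.
set X := (fun x => complex.Re (u x) * E x) in cX aX; set Y := (fun x => complex.Im (u x) * E x) in cY aY.
pose k x := X x ^+ 2 + Y x ^+ 2.
have EE x : E x ^+ 2 * gs 1 `|x| = 1.
  by rewrite /E /gss expr2 -!expRD -[RHS]expR0; congr expR; field.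
have Ep x : 0 < E x by exact: gss_gt0.
have kE x : nsq (u x) = k x * gs 1 `|x|.
  by rewrite /k /X /Y !exprMn -mulrDl -mulrA EE mulr1.
have k0 x : 0 <= k x by rewrite addr_ge0 ?sqr_ge0.
have kb x : `|k x * b x| <= (gamma / 2)^-1 * ((1 + k x) * `|k x - 1|).
  have [kz|kn] := eqVneq (k x) 0.
    by rewrite kz mul0r normr0 !mulr_ge0 ?addr_ge0 // invr_ge0 divr_ge0 // ltW.
  have kp : 0 < k x by rewrite lt_neqAle eq_sym kn k0.
  have g2 : 0 < gamma / 2 by rewrite divr_gt0.
  have := root_gap_bound g2 (pa_ge gamma x) (k0 x).
  rewrite /b /sful kE lnM ?posrE ?gss_gt0 // ln_q.
  by rewrite (_ : omega + 1 - (ln (k x) + (omega + 1 - pa x ^+ 2)) = pa x ^+ 2 - ln (k x)) //; ring.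
have ck : continuous k by move=> x; apply: cvgD; (under eq_fun do rewrite expr2); rewrite expr2; apply: cvgM; (exact: cX || exact: cY).
have ak : ac k (fun x => 2 * (sg 0 x * (k x * b x))).
  have := ac_lin 1 (ac_mul cX cX aX aX) (ac_mul cY cY aY aY).
  by apply: ac_ext => x; rewrite /k /X /Y /=; ring.
have k1 x : k x = 1.
  pose f x := (k x - 1) ^+ 2.
  suff /eqP : f x = 0 by rewrite sqrf_eq0 subr_eq0 => /eqP.
  have ck1 : continuous (fun x => k x - 1) by move=> y; apply: cvgB; [exact: ck|exact: cvg_cst].
  have ak1 : ac (fun x => k x - 1) (fun x => 2 * (sg 0 x * (k x * b x))).
    by move=> p q pq; have [i1 i2] := ak p q pq; split=> //; rewrite -i2; ring.
  have af := ac_mul ck1 ck1 ak1 ak1.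
  have cf : continuous (fun x => (k x - 1) * (k x - 1)) by move=> y; apply: cvgM; exact: ck1.
  apply: (@ac_gronwall f _ (fun x => 4 * (gamma / 2)^-1 * (1 + k x)) _ _ (fun x => sqr_ge0 _)).
  - by rewrite (_ : f = fun x => (k x - 1) * (k x - 1)) //; apply/funext => y; rewrite /f expr2.
  - by apply: ac_ext af => // y; rewrite /f expr2.
  - move=> y; apply: cvgM; [exact: cvg_cst|apply: cvgD; [exact: cvg_cst|exact: ck]].
  - move=> y /=; rewrite (_ : _ + _ = 4 * (sg 0 y * ((k y * b y) * (k y - 1)))); last by ring.
    rewrite normrM normrM sg_norm mul1r (ger0_norm (_ : 0 <= 4 :> R)) // -!mulrA ler_pM2l //.
    rewrite mulrA normrM /f -(real_normK (num_real (k y - 1))) expr2.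
    rewrite [X in _ <= X](_ : _ = (gamma / 2)^-1 * ((1 + k y) * `|k y - 1|) * `|k y - 1|) ?ler_wpM2r //.
    by rewrite !mulrA.
  - rewrite /f /k -(_ : nsq (u 0) * E 0 ^+ 2 = X 0 ^+ 2 + Y 0 ^+ 2); last by rewrite /X /Y /nsq; ring.
    by have := EE 0; rewrite normr0 u0 mulrC => ->; rewrite subrr expr0n.
have b0 x : b x = 0.
  by have := kb x; rewrite k1 mul1r subrr normr0 !mulr0 normr_le0 => /eqP.
have cst (f : R -> R) : ac f (fun x => sg 0 x * b x * f x) -> forall x, f x = f 0.
  move=> af x; have z (p q : R) : p <= q -> f q = f p.
    by move=> pq; apply/eqP; rewrite -subr_eq0; have [_ ->] := af p q pq; rewrite -(Int0 `[p, q]); apply/eqP/Int_ext => y _; rewrite b0 mulr0 mul0r.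
  by have [h|h] := leP 0 x; [rewrite (z 0 x)|rewrite (z x 0) ?(ltW h)].
have [t [ct st]] : exists t, cos t = X 0 /\ sin t = Y 0 by apply: circle_angle; exact: k1.
exists t; apply/funext => x; rewrite (phiE omega gamma) /cexp_i ct st -(cst _ aX x) -(cst _ aY x).
have e : E x * gs (1 / 2) `|x| = 1.
  by rewrite /E /gss -expRD -[RHS]expR0; congr expR; field.
rewrite /X /Y; case: (u x) => p q /=; apply/eqP; rewrite eq_complex /=.
by rewrite !mulr0 subr0 add0r -!mulrA e !mulr1 !eqxx.
Qed.

End peak_profile.

(** * Compactness of families with the charge and energy of the peak *)

Section compactness.
Context {R : realType} (omega gamma : R) (gamma_gt0 : 0 < gamma).
Local Notation fn := (R -> R[i]).
Local Notation phi := (phi_peak omega gamma).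
Local Notation ys := (gss omega gamma 1 0).
Implicit Types (u : fn) (c z : R[i]).

Local Notation Re u := (fun x => complex.Re (u x)).
Local Notation Im u := (fun x => complex.Im (u x)).

Lemma ucb_Sful c : cmod c = 1 -> ucb (fun z => cdot (Sful omega z) c).
Proof.
move=> c1 M e e0; have e3 : 0 < e / 3 by rewrite divr_gt0.
have [d d0 hd] := Sdel_close omega e3; have [r r0 hr] := ucb_Sdel omega d0 c1 M e3.
exists r => // z w hz hzw; have h1 := hr z w hz hzw; have h2 := hd d z d0 (lexx d); have h3 := hd d w d0 (lexx d).
have {}h2 := le_trans (cdot_cmod1 _ c1) h2; have {}h3 := le_trans (cdot_cmod1 _ c1) h3.
move: h1 h2 h3; rewrite !cdotBl; move: (cdot _ _) (cdot _ _) (cdot (Sful omega z) c) (cdot (Sful omega w) c) => a b x y.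
by rewrite !ler_norml => /andP[? ?] /andP[? ?] /andP[? ?]; apply/andP; split; lra.
Qed.

(** Removes the truncation: the completed square is small for suitable small [d], and the truncated
    field is uniformly close to the full one. *)
Lemma limit_ode u c : continuous (Re u) -> continuous (Im u) -> cmod c = 1 ->
  (forall e d0 : R, 0 < e -> 0 < d0 -> exists d : R, [/\ 0 < d, d <= d0 & forall a b : R, a <= b ->
     (cdot (u b) c - cdot (u a) c + Int `[a, b] (fun x => sg 0 x * cdot (Sdel omega d (u x)) c)) ^+ 2 <= (b - a) * e]) ->
  ac (fun x => cdot (u x) c) (fun x => - (sg 0 x * cdot (Sful omega (u x)) c)).
Proof.
move=> c1 c2 cc H a b ab; have mi : measurable (`[a, b] : set R) by exact: measurable_itv.
have ig Phi : ucb Phi -> intg `[a, b] (fun x => sg 0 x * Phi (u x)).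
  by move=> hP; apply: intg_sg => //; apply: continuous_intg; apply: (ucb_cont hP).
have i1 := ig _ (ucb_Sful cc); split; first exact: intgN.
rewrite IntN //; apply/eqP; rewrite -addr_eq0 -normr_le0; apply/ler_addgt0Pr => e e0; rewrite add0r.
pose L := b - a + 1; have L0 : 0 < L by rewrite ltr_wpDl // subr_ge0.
have e2 : 0 < e / 2 / L by rewrite !divr_gt0.
have e3 : 0 < (e / 2) ^+ 2 / L by rewrite divr_gt0 // exprn_gt0 // divr_gt0.
have [d0 d00 hd] := Sdel_close omega e2; have [d [dp dd h]] := H _ _ e3 d00.
have i2 := ig _ (ucb_Sdel omega dp cc).
have hL (k : R) : 0 <= k -> (b - a) * (k / L) <= k.
  move=> k0; rewrite mulrCA ler_piMr // ler_pdivrMr // mul1r lerDl //.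
have {}h : `|cdot (u b) c - cdot (u a) c + Int `[a, b] (fun x => sg 0 x * cdot (Sdel omega d (u x)) c)| <= e / 2.
  rewrite -(@ler_pXn2r _ 2) ?nnegrE ?normr_ge0 ?divr_ge0 ?(ltW e0) // real_normK ?num_real //.
  by apply: (le_trans (h a b ab)); apply: hL; exact: sqr_ge0.
have h' : `|Int `[a, b] (fun x => sg 0 x * cdot (Sful omega (u x)) c - sg 0 x * cdot (Sdel omega d (u x)) c)| <= e / 2.
  apply: (@le_trans _ _ (e / 2 / L * (b - a))); last by rewrite mulrC hL // divr_ge0 // ltW.
  rewrite -Int_cst //; apply: Int_norm_le => //.
  - by apply: intg_meas; exact: intgB.
  - exact: cst_intg.
  move=> x _; rewrite -mulrBr normrM sg_norm mul1r -cdotBl; apply: (le_trans (cdot_cmod1 _ cc)).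
  by rewrite cmodB; exact: hd.
move: h'; rewrite IntB //; move: h; move: (Int _ _) (Int _ _) (cdot _ _) (cdot _ _) => p q x y.
by rewrite !ler_norml => /andP[? ?] /andP[? ?]; apply/andP; split; lra.
Qed.

(** As a function of [p] the right side is least at [p = Q / a], where it equals [Q ln (a / Q)];
    both steps are tangent inequalities of the logarithm. *)
Lemma log_gap (p a Q : R) : 0 < p -> 0 < a -> 0 < Q -> Q * (1 - Q / a) <= p * a - Q - Q * ln p.
Proof.
move=> p0 a0 Q0; have h1 := ln_diff_le (mulr_gt0 p0 a0) Q0; have h2 := ln_diff_le Q0 a0.
rewrite lnM ?posrE // in h1.
have {}h1 : Q * (ln p + ln a - ln Q) <= p * a - Q.
  by rewrite (le_trans (ler_wpM2l (ltW Q0) h1)) // mulrCA divff ?gt_eqF // mulr1.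
have {}h2 := ler_wpM2l (ltW Q0) h2; rewrite mulrBl divff ?gt_eqF // in h2.
move: h1 h2; move: (Q / a) (p * a) (ln p) (ln a) (ln Q) => x y z s t; clear; nra.
Qed.

(** Tangent to the logarithm at 1, with a right side that stays continuous at [p = 0], a limit not
    yet excluded when the bound is used. *)
Lemma ln_le_sqrt (p : R) : 0 < p -> ln p <= 2 * (Num.sqrt p - 1).
Proof.
move=> p0; have s0 : 0 < Num.sqrt p by rewrite sqrtr_gt0.
rewrite -{1}(sqr_sqrtr (ltW p0)) expr2 lnM ?posrE //; have := ln_le_sub1 s0.
by move=> h; lra.
Qed.

Lemma Qf_phi_gt0 : 0 < Qf phi.
Proof.
rewrite lt_neqAle eq_sym Qf_ge0 andbT; apply/eqP => /(Qf_eq0 (W_phi omega gamma_gt0)) h.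
have := nsq_phi omega gamma 0; rewrite h /zf nsq0 => /esym/eqP.
by rewrite gt_eqF // gss_gt0.
Qed.

Lemma cmod_cexp (t : R) : cmod (cexp_i t) = 1.
Proof. by rewrite cmod_sqrt /nsq /= cos2Dsin2 sqrtr1. Qed.

Lemma rot_invariant u (c : R[i]) : W u -> cmod c = 1 ->
  [/\ W (fun x => c * u x), Qf (fun x => c * u x) = Qf u & En gamma (fun x => c * u x) = En gamma u].
Proof.
move=> wu c1; have E : (fun x => c * u x) = lcc c u zf by apply/funext => x; rewrite lccE addr0.
have n1 z : nsq (c * z) = nsq z by rewrite nsqM -(cmod_sq c) c1 expr1n mul1r.
have m1 z : cmod (c * z) = cmod z by rewrite cmodM c1 mul1r.
have wc : W (fun x => c * u x) by rewrite E; exact: W_lcc wu W0.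
split=> //; first by rewrite !Qf_nsq; apply: Int_ext => x _; rewrite n1.
have D : Df (fun x => c * u x) = Df u.
  have du := dx_hasd (W_H1 wu).
  have hz : hasd (@zf R) zf by split; [split; exact: L2r0|exact: ac0|exact: ac0].
  have dc := hasd_lcc c du hz.
  rewrite E !DfE (Bf_hasd (W_H1 (W_lcc c wu W0)) (W_H1 (W_lcc c wu W0)) dc dc) (Bf_hasd (W_H1 wu) (W_H1 wu) du du) !Ic_nsq.
  by apply: Int_ext => x _; rewrite lccE addr0 n1.
by rewrite /En D n1; congr (_ - _ + _ - _); apply: Int_ext => x _; rewrite /Ax m1.
Qed.

Lemma ultra_wcv (I : Type) (F : set_system I) (UF : UltraFilter F) (K : R) (v : I -> fn) :
  (\forall i \near F, bdd K (v i)) -> exists u, wcv F K v u.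
Proof.
move=> hb; have FF : ProperFilter F by case: UF.
have H x : exists z, complex.Re (v i x) @[i --> F] --> complex.Re z /\ complex.Im (v i x) @[i --> F] --> complex.Im z.
  have hM : \forall i \near F, cmod (v i x) <= 4 * K + 1 by apply: filterS hb => i hi; exact: bdd_cmod.
  have [a ha] : exists l : R, complex.Re (v i x) @[i --> F] --> l.
    by apply: (ultra_lim UF (M := 4 * K + 1)); apply: filterS hM => i; apply: le_trans; exact: Re_le.
  have [b hb'] : exists l : R, complex.Im (v i x) @[i --> F] --> l.
    by apply: (ultra_lim UF (M := 4 * K + 1)); apply: filterS hM => i; apply: le_trans; exact: Im_le.
  by exists (a +i* b).
have [u hu] := choice H; exists u; split=> // x e e0; have e2 : 0 < e / 2 by rewrite divr_gt0.
have [/cvgEP h1 /cvgEP h2] := hu x; apply: filterS (filterI (h1 _ e2) (h2 _ e2)) => i [a b].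
by apply: (le_trans (cmod_le _)); rewrite ReB ImB (splitr e) lerD.
Qed.

Lemma cvg_sqrt (I : Type) (F : set_system I) (FF : ProperFilter F) (f : I -> R) (l : R) :
  f i @[i --> F] --> l -> Num.sqrt (f i) @[i --> F] --> Num.sqrt l.
Proof. by move=> h; apply: (cvg_comp f Num.sqrt h); exact: sqrt_continuous. Qed.

Lemma bound_half (B p e : R) : 0 <= B -> - (1 / 2) <= p - 1 -> p * B <= e / 2 -> B <= e.
Proof. by move=> h1 h2 h3; nra. Qed.

Section minimizing.
Context (I : Type) (F : set_system I) (UF : UltraFilter F) (v : I -> fn).
Context (vQ : Qf (v i) @[i --> F] --> Qf phi) (vE : En gamma (v i) @[i --> F] --> En gamma phi).

Let FF : ProperFilter F := @ultra_proper _ _ UF.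

Let Iv i := En gamma (v i) + omega * Qf (v i).

Lemma min_action_cvg : Iv i @[i --> F] --> (0 : R).
Proof.
have -> : 0 = En gamma phi + omega * Qf phi by rewrite (En_phi omega gamma_gt0) mulNr addNr.
by apply: cvgD => //; apply: cvgM => //; exact: cvg_cst.
Qed.

Lemma min_Q_gt0 : \forall i \near F, 0 < Qf (v i).
Proof.
have q0 := Qf_phi_gt0; have q2 : 0 < Qf phi / 2 by rewrite divr_gt0.
have /cvgEP /(_ _ q2) := vQ; apply: filterS => i; rewrite ler_norml => /andP[+ _].
by move: (Qf phi) (Qf (v i)) q0 => a b h1 h2; lra.
Qed.

Lemma min_not_far (p : I -> R) : (\forall i \near F, 0 < p i) ->
  ~ (\forall i \near F, forall d : R, 0 < d -> d <= ygap omega gamma ->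
      p i * (2 * Gam omega d ys - gamma * ys + egap omega gamma) - Qf (v i) - Qf (v i) * ln (p i) <= Iv i).
Proof.
move=> p0 h; have e0 := egap_gt0 omega gamma_gt0; have m0 := Qf_phi_gt0.
have e2 : 0 < egap omega gamma / 2 by rewrite divr_gt0.
have [d [d0 dy hd]] := peak_J omega gamma_gt0 e2 (expR_gt0 _ : 0 < ygap omega gamma).
pose a := Qf phi + egap omega gamma / 2; have a0 : 0 < a by rewrite addr_gt0.
have H : \forall i \near F, Qf (v i) * (1 - Qf (v i) / a) - Iv i <= 0.
  apply: filterS (filterI (filterI min_Q_gt0 p0) h) => i [[qi pi] /(_ d d0 dy) hi].
  have := log_gap pi a0 qi; have : p i * a <= p i * (2 * Gam omega d ys - gamma * ys + egap omega gamma).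
    by rewrite ler_pM2l // /a; move: hd; move: (Qf phi) (Gam _ _ _) (gamma * ys) (egap _ _) => x y z w h'; lra.
  move: hi; move: (Iv i) (Qf (v i)) (Qf (v i) * ln (p i)) (Qf (v i) * (1 - _)) (p i * _) (p i * _) => s t x y z w h1 h2 h3.
  by lra.
have : Qf (v i) * (1 - Qf (v i) / a) - Iv i @[i --> F] --> Qf phi * (1 - Qf phi / a) - 0.
  apply: cvgB min_action_cvg; apply: cvgM => //; apply: cvgB; first exact: cvg_cst.
  by apply: cvgM => //; exact: cvg_cst.
move=> /(@cvg_le_near _ _ _ FF _ _ _) /(_ H); rewrite subr0 leNgt mulr_gt0 // subr_gt0 ltr_pdivrMr // mul1r.
by rewrite /a ltrDl.
Qed.

Context (gap_scale : \forall i \near F, 0 < nsq (v i 0) /\ forall d : R, 0 < d -> d <= ygap omega gamma ->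
  nsq (v i 0) / ys * (2 * Gam omega d ys - gamma * ys + Bog omega d 0 (scl (Num.sqrt (nsq (v i 0) / ys))^-1 (v i)))
    - Qf (v i) - Qf (v i) * ln (nsq (v i 0) / ys) <= Iv i).

Let p i := nsq (v i 0) / ys.

(** Isolates the completed square; the replacement of [ln p] by a square root lets every other term
    pass to the limit. *)
Lemma min_Bog_le (J d : R) : 0 < d -> d <= ygap omega gamma -> J = 2 * Gam omega d ys - gamma * ys ->
  \forall i \near F, 0 < p i /\
    p i * Bog omega d 0 (scl (Num.sqrt (p i))^-1 (v i)) <=
    Iv i + Qf (v i) + Qf (v i) * (2 * (Num.sqrt (p i) - 1)) - p i * J.
Proof.
move=> d0 dy ->; apply: filterS (filterI min_Q_gt0 gap_scale) => i [qi [ni /(_ d d0 dy)]].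
have pi : 0 < p i by rewrite divr_gt0 // gss_gt0.
rewrite -/(p i) => h; split=> //; have := ler_wpM2l (ltW qi) (ln_le_sqrt pi).
move: h; rewrite mulrDr; move: (Iv i) (Qf (v i)) (Qf _ * (2 * _)) (Qf _ * ln (p i)) (p i * (2 * _ - _)) (p i * Bog _ _ _ _).
by move=> a b c e f g h1 h2; lra.
Qed.

Context (K : R) (u : fn) (wc : wcv F K v u).

Let pu := nsq (u 0) / ys.

Lemma min_p_cvg : p i @[i --> F] --> pu.
Proof. by apply: cvgM; [exact: (@wcv_nsq _ _ _ FF _ _ _ 0 wc)|exact: cvg_cst]. Qed.

Lemma min_rhs_cvg (J : R) :
  Iv i + Qf (v i) + Qf (v i) * (2 * (Num.sqrt (p i) - 1)) - p i * J @[i --> F] -->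
  0 + Qf phi + Qf phi * (2 * (Num.sqrt pu - 1)) - pu * J.
Proof.
have pc := min_p_cvg; apply: cvgB; last by apply: cvgM => //; exact: cvg_cst.
apply: cvgD; first by apply: cvgD => //; exact: min_action_cvg.
apply: cvgM => //; apply: cvgM; first exact: cvg_cst.
by apply: cvgB; [exact: (cvg_sqrt FF pc)|exact: cvg_cst].
Qed.

(* As [ln p <= 2 (sqrt p - 1)], the limit gives [Qf phi * (sqrt pu - 1) ^+ 2 <= 0]. *)
Lemma min_height : pu = 1.
Proof.
have pu0 : 0 <= pu by rewrite divr_ge0 ?nsq_ge0 // ltW // gss_gt0.
have m0 := Qf_phi_gt0; have s0 := sqrtr_ge0 pu.
suff h : Qf phi * (Num.sqrt pu - 1) ^+ 2 <= 0.
  have : (Num.sqrt pu - 1) ^+ 2 <= 0 by rewrite -(pmulr_rle0 _ m0).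
  rewrite real_exprn_even_le0 ?num_real //= subr_eq0 => /eqP s1.
  by rewrite -(sqr_sqrtr pu0) s1 expr1n.
apply/ler_addgt0Pr => e e0; rewrite add0r; have P0 : 0 < pu + 1 by rewrite ltr_wpDl.
have [d [d0 dy hd]] := peak_J omega gamma_gt0 (divr_gt0 e0 P0) (expR_gt0 _ : 0 < ygap omega gamma).
set J := 2 * _ - _ in hd.
have : 0 <= 0 + Qf phi + Qf phi * (2 * (Num.sqrt pu - 1)) - pu * J.
  rewrite -oppr_le0; apply: (@cvg_le_near _ _ _ FF (fun i => - (Iv i + Qf (v i) + Qf (v i) * (2 * (Num.sqrt (p i) - 1)) - p i * J))).
    by apply: cvgN; exact: min_rhs_cvg.
  apply: filterS (min_Bog_le d0 dy (erefl J)) => i [pi h]; rewrite oppr_le0; apply: le_trans h.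
  by rewrite mulr_ge0 ?Bog_ge0 // ltW.
have h1 : pu * (Qf phi - J) <= e.
  apply: (@le_trans _ _ (pu * (e / (pu + 1)))); first by rewrite ler_wpM2l // lerBlDr addrC -lerBlDr.
  by rewrite mulrCA ler_piMr ?(ltW e0) // ler_pdivrMr // mul1r lerDl.
have h2 := sqr_sqrtr pu0; clear hd; move: h1; move: (Num.sqrt pu) h2 (Qf phi) J => s <- m J'.
rewrite add0r => h1 h3; have -> : m * (s - 1) ^+ 2 = s ^+ 2 * (m - J') - (m + m * (2 * (s - 1)) - s ^+ 2 * J') by ring.
by rewrite lerBlDr (le_trans h1) // lerDl.
Qed.

(** With the height known, the right side of [min_Bog_le] tends to [Qf phi - J], which [peak_J]
    makes arbitrarily small. So the completed square vanishes in the limit, and its directions [1]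
    and [i] give the real and imaginary parts of the profile equation. *)
Lemma min_profile : exists t, u = fun x => cexp_i t * phi x.
Proof.
have ph := min_height; have pc : p i @[i --> F] --> (1 : R) by rewrite -ph; exact: min_p_cvg.
have kc : (Num.sqrt (p i))^-1 @[i --> F] --> (1 : R).
  have -> : 1 = (Num.sqrt 1)^-1 :> R by rewrite sqrtr1 invr1.
  by apply: cvgV; [rewrite sqrtr1 oner_neq0|exact: cvg_sqrt].
have [c1 c2] := wcv_cont FF wc.
have H (c : R[i]) : cmod c = 1 -> ac (fun x => cdot (u x) c) (fun x => - (sg 0 x * cdot (Sful omega (u x)) c)).
  move=> cc; apply: limit_ode => // e d0 e0 d00; have e4 : 0 < e / 4 by rewrite divr_gt0.
  have m0 : 0 < Num.min d0 (ygap omega gamma) by rewrite lt_min d00 expR_gt0.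
  have [d [dp]] := peak_J omega gamma_gt0 e4 m0; rewrite le_min => /andP[dd dy] hd.
  exists d; split=> // a b ab; apply: (Bog_limit FF wc kc dp cc ab).
  set J := 2 * _ - _ in hd; have /cvgEP /(_ _ e4) h := @min_rhs_cvg J.
  have /cvgEP /(_ (1 / 2)) h2 := pc.
  have {}h2 : \forall i \near F, `|p i - 1| <= 1 / 2 by apply: h2; rewrite divr_gt0.
  apply: filterS (filterI (filterI h h2) (min_Bog_le dp dy (erefl J))) => i [[+ +] [pi +]].
  rewrite ph sqrtr1 subrr !mulr0 addr0 add0r mul1r; have B0 := Bog_ge0 omega d 0 (scl (Num.sqrt (p i))^-1 (v i)).
  rewrite !ler_norml => /andP[_ h3] /andP[h4 _] h5.
  by apply: (bound_half B0 h4 (le_trans h5 _)); move: h3 hd; move: (Iv i + _ + _ - _) (Qf phi) => x y h3 hd; lra.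
have u0 : nsq (u 0) = ys by rewrite -[LHS](divfK (lt0r_neq0 (gss_gt0 omega gamma 1 0))) -/pu ph mul1r.
apply: (ode_peak gamma_gt0 c1 c2 u0).
  have c1' : cmod (1 : R[i]) = 1 by rewrite cmod_sqrt /nsq /= expr1n expr0n addr0 sqrtr1.
  by apply: ac_ext (H 1 c1') => x; rewrite cdotE /= ?ReZ ?ImZ; ring.
have c1' : cmod ('i : R[i]) = 1 by rewrite cmod_sqrt /nsq /= expr1n expr0n add0r sqrtr1.
by apply: ac_ext (H 'i c1') => x; rewrite cdotE /= ?ReZ ?ImZ; ring.
Qed.

End minimizing.

Lemma minimizing_compact (I : Type) (F : set_system I) (UF : UltraFilter F) (v : I -> fn) :
  (\forall i \near F, W (v i)) -> Qf (v i) @[i --> F] --> Qf phi -> En gamma (v i) @[i --> F] --> En gamma phi ->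
  exists t, Wnorm (lin (-1) (fun x => cexp_i t * phi x) (v i)) @[i --> F] --> (0 : R).
Proof.
move=> vW vQ vE; have FF : ProperFilter F by case: UF.
have q1 : 0 <= Qf phi + 1 by rewrite addr_ge0 // Qf_ge0.
have up (f : I -> R) (l e : R) : f i @[i --> F] --> l -> 0 < e -> \forall i \near F, f i <= l + e.
  move=> /cvgEP h e0; apply: filterS (h _ e0) => i; rewrite ler_norml => /andP[_]; clear; lra.
have [K hK] := En_coercive gamma (En gamma phi + 1) q1.
have hb : \forall i \near F, bdd K (v i).
  by apply: filterS (filterI vW (filterI (up _ _ _ vQ ltr01) (up _ _ _ vE ltr01))) => i [wi [h1 h2]]; exact: hK.
have [u wc] := ultra_wcv UF hb.
have [t ut] : exists t, u = fun x => cexp_i t * phi x.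
  have H i : exists p : R, W (v i) -> 0 < Qf (v i) -> 0 < p /\
      ((nsq (v i 0) = p * ys /\ forall d : R, 0 < d -> d <= ygap omega gamma ->
         p * (2 * Gam omega d ys - gamma * ys + Bog omega d 0 (scl (Num.sqrt p)^-1 (v i))) - Qf (v i) - Qf (v i) * ln p <=
         En gamma (v i) + omega * Qf (v i)) \/
      (forall d : R, 0 < d -> d <= ygap omega gamma ->
         p * (2 * Gam omega d ys - gamma * ys + egap omega gamma) - Qf (v i) - Qf (v i) * ln p <=
         En gamma (v i) + omega * Qf (v i))).
    have [wi|wi] := pselect (W (v i)); last by exists 0.
    have [qi|qi] := pselect (0 < Qf (v i)); last by exists 0.
    by have [p p0 h] := bog_scale omega gamma_gt0 wi qi; exists p.
  have [p hp] := choice H; have qp := min_Q_gt0 UF vQ.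
  have p0 : \forall i \near F, 0 < p i by apply: filterS (filterI vW qp) => i [wi qi]; have [] := hp i wi qi.
  (* An ultrafilter selects one of the two alternatives of [bog_scale] for the whole family; the far
     one is impossible. *)
  have [hA|hA] := in_ultra_setVsetC [set i | nsq (v i 0) = p i * ys /\ forall d : R, 0 < d -> d <= ygap omega gamma ->
         p i * (2 * Gam omega d ys - gamma * ys + Bog omega d 0 (scl (Num.sqrt (p i))^-1 (v i))) - Qf (v i) - Qf (v i) * ln (p i) <=
         En gamma (v i) + omega * Qf (v i)] UF; last first.
    exfalso; apply: (min_not_far UF vQ vE p0).
    by apply: filterS (filterI (filterI vW qp) hA) => i [[wi qi] nA]; have [_ [//|]] := hp i wi qi.
  apply: (min_profile UF vQ vE _ wc); have yp := gss_gt0 omega gamma 1 0.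
  apply: filterS (filterI p0 hA) => i [pi [e h]]; rewrite e mulfK ?gt_eqF //; split=> //; exact: mulr_gt0.
(* The rotated peak has the charge and the energy of the peak, so the limits of the family are
   exactly what [wcv_strong] asks for. *)
exists t; rewrite -ut; have [_ Qt Et] := rot_invariant (W_phi omega gamma_gt0) (cmod_cexp t).
apply: (wcv_strong FF (gamma := gamma) wc) => e e0; rewrite ut ?Qt ?Et; exact: up.
Qed.

End compactness.

Theorem theorem1p3 (R : realType) (omega gamma : R) (gamma_gt0 : 0 < gamma) :
  orbitally_stable gamma (phi_peak omega gamma).
Proof.
move=> eps eps0; apply: contrapT => H; pose phi := phi_peak omega gamma.
have wp : W phi := W_phi omega gamma_gt0.
(* Instability yields, for each [n], a datum within [1 / (n + 1)] of the peak and a value of its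
   solution at some time that is at least [eps / 2] away from the whole orbit. *)
have seq n : exists uv : (R -> R[i]) * (R -> R[i]), [/\ W uv.1, Wnorm (lin (-1) phi uv.1) < n.+1%:R^-1,
    W uv.2, Qf uv.2 = Qf uv.1 /\ En gamma uv.2 = En gamma uv.1 &
    forall t, eps / 2 <= Wnorm (lin (-1) (fun x => cexp_i t * phi x) uv.2)].
  apply: contrapT => N; apply: H; exists n.+1%:R^-1; split; first by rewrite invr_gt0.
  move=> u0 w0 hu0; have [u [h1 h2 h3 h4]] := wellposed gamma w0; exists u; split=> //.
  (* The supremum over time must be strictly below [eps], so each orbit distance is compared with
     [eps / 2]. *)
  apply: (@le_lt_trans _ _ (eps / 2)%:E); last by rewrite lte_fin ltr_pdivrMr // mulr_natr mulr2n ltrDl.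
  apply: ge_ereal_sup => _ [s _ <-]; apply: contrapT => /negP; rewrite -ltNge => hs; apply: N.
  exists (u0, u s) => /=; have [ws Qs Es] := h4 s; split; [exact: w0|by rewrite -fun_subE|exact: ws|by split|].
  move=> t; rewrite -fun_subE -lee_fin; apply: (le_trans (ltW hs)); apply: ereal_inf_lbound; by exists t.
have [uv huv] := choice seq.
(* An ultrafilter finer than [\oo] replaces the extraction of a subsequence. *)
have [G [UG sG]] := ultraFilterLemma (eventually_filter : ProperFilter \oo).
have GG : ProperFilter G by case: UG.
have hW : \forall n \near G, W (uv n).1 by apply: filterE => n; have [] := huv n.
have c0 : Wnorm (lin (-1) phi (uv n).1) @[n --> G] --> (0 : R).
  apply/cvgEP => e e0; apply: sG; near=> n; rewrite subr0 ger0_norm ?Wnorm_ge0 //; have [_ h _ _ _] := huv n.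
  by apply: (le_trans (ltW h)); near: n; have [N hN] := natSinv_le e0; exists N.
have [_ cQ cE] := Wnorm_cvg GG gamma wp hW c0.
have [t ht] : exists t, Wnorm (lin (-1) (fun x => cexp_i t * phi x) (uv n).2) @[n --> G] --> (0 : R).
  apply: (minimizing_compact gamma_gt0 UG).
  - by apply: filterE => n; have [] := huv n.
  - by rewrite (_ : (fun n => Qf (uv n).2) = fun n => Qf (uv n).1) //; apply/funext => n; have [_ _ _ []] := huv n.
  - by rewrite (_ : (fun n => En gamma (uv n).2) = fun n => En gamma (uv n).1) //; apply/funext => n; have [_ _ _ []] := huv n.
have /cvgEP /(_ (eps / 4)) h := ht; have e4 : 0 < eps / 4 by rewrite divr_gt0.
have [n] := filter_ex (h e4); rewrite subr0 ger0_norm ?Wnorm_ge0 // => h'.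
by have [_ _ _ _ /(_ t)] := huv n; move: h'; move: (Wnorm _) => x; lra.
Unshelve. all: by end_near. Qed.
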